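(* Let $h:[0,+\infty)\to\mathbb{R}$ be a non-decreasing convex function and let $f:\mathbb{R}^2\to(0,+\infty)$, $f(x)=e^{h(|x|)}$. Let $v>0$ and let $B$ be a centred ball in $\mathbb{R}^2$ (a ball with centre at the origin) with $V_f(B)=v$. Then $B$ is a minimiser for the weighted isoperimetric problem $$I_f(v):=\inf\{P_f(E): E\text{ is a set of finite perimeter in }\mathbb{R}^2\text{ and }V_f(E)=v\},$$ that is, $P_f(B)=I_f(v)$.
   Context: $\mathscr{L}^2$ is Lebesgue measure on $\mathbb{R}^2$ and $V_f:=f\mathscr{L}^2$, i.e. $V_f(E)=\int_E f\,dx$. An $\mathscr{L}^2$-measurable set $E\subset\mathbb{R}^2$ has finite perimeter if $\chi_E\in\mathrm{BV}_{\mathrm{loc}}(\mathbb{R}^2)$; $|D\chi_E|$ is the total variation measure of its distributional derivative $D\chi_E$. The weighted perimeter is $P_f(E):=\int_{\mathbb{R}^2}f\,d|D\chi_E|\in[0,+\infty]$. *)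

(* Defs.v *)
From HB Require Import structures.
From mathcomp Require Import all_boot all_order all_algebra.
From mathcomp Require Import all_classical all_reals all_analysis.
From mathcomp Require Import ring lra.

Set Implicit Arguments.
Unset Strict Implicit.
Unset Printing Implicit Defensive.

Import Order.TTheory GRing.Theory Num.Theory.
Import numFieldNormedType.Exports.

Local Open Scope classical_set_scope.
Local Open Scope ring_scope.

Notation plane R := (measurableTypeR R * measurableTypeR R)%type.

Section Plane.
Context {R : realType}.
Implicit Types (x : R * R) (A E : set (R * R)).

(* The norm of the normed module [R * R] is the max norm. *)
Definition enorm x : R := Num.sqrt (x.1 ^+ 2 + x.2 ^+ 2).

Definition centred_ball (r : R) : set (R * R) := [set x | enorm x < r].

(* Lebesgue measure restricted to the Borel sets. *)
Definition leb2_borel : {measure set (plane R) -> \bar R} :=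
  (@lebesgue_measure R \x @lebesgue_measure R)%E.

Definition leb2 := @completed_measure_extension _ _ R leb2_borel.

(* The Caratheodory measurable sets, that is, the domain of [leb2]. *)
Definition leb2_measurable E : Prop := (leb2_borel^*)%mu.-cara.-measurable E.

Definition partial1 (u : R * R -> R) x : R := 'D_((1, 0) : R * R) u x.
Definition partial2 (u : R * R -> R) x : R := 'D_((0, 1) : R * R) u x.

(* u is of class C^k. *)
Fixpoint Ck (k : nat) (u : R * R -> R) : Prop :=
  continuous u /\
  if k is k'.+1 then
    [/\ forall x, derivable u x (1, 0), forall x, derivable u x (0, 1),
        Ck k' (partial1 u) & Ck k' (partial2 u)]
  else True.

Definition test_function (u : R * R -> R) : Prop :=
  (forall k, Ck k u) /\ compact (closure [set x | u x != 0]).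

(* A real Radon measure on the plane, given as a difference of two positive
   ones (the product sigma-algebra of [plane R] is the Borel one). The two parts
   may both be infinite, hence [radon_val] is meaningful on bounded sets only. *)
Record signed_radon := SignedRadon {
  radon_pos : {measure set (plane R) -> \bar R};
  radon_neg : {measure set (plane R) -> \bar R};
  radon_pos_fin : forall K, compact (K : set (R * R)) -> (radon_pos K < +oo)%E;
  radon_neg_fin : forall K, compact (K : set (R * R)) -> (radon_neg K < +oo)%E
}.

Definition signed_radon0 : signed_radon :=
  @SignedRadon mzero mzero (fun _ _ => ltry 0) (fun _ _ => ltry 0).

HB.instance Definition _ := gen_eqMixin signed_radon.
HB.instance Definition _ := gen_choiceMixin signed_radon.

Definition radon_val (s : signed_radon) A : R :=
  fine (radon_pos s A) - fine (radon_neg s A).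

Definition radon_int (s : signed_radon) (u : R * R -> R) : R :=
  \int[radon_pos s]_x u x - \int[radon_neg s]_x u x.

Definition vradon_norm (D : signed_radon * signed_radon) A : R :=
  enorm (radon_val D.1 A, radon_val D.2 A).

(* The total variation measure |D|(A) of an R^2-valued Radon measure D: the
   supremum of the sums of |D (F k)| over countable Borel partitions F of A. As D
   lives on bounded sets, the F k are bounded; they need not exhaust A, since
   adding bounded pieces of the remainder can only increase the sum. *)
Definition radon_variation (D : signed_radon * signed_radon)
    (A : set (plane R)) : \bar R :=
  ereal_sup [set (\sum_(0 <= k <oo) (vradon_norm D (F k))%:E)%E |
    F in [set F : (set (plane R))^nat |
      [/\ forall k, measurable (F k), forall k, bounded_set (F k : set (R * R)),
          trivIset setT F & \bigcup_k F k `<=` A]]].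

End Plane.

Section radon_variation_measure.
Context {R : realType}.
Implicit Types (D : @signed_radon R * @signed_radon R) (A : set (plane R)).

Lemma radon_bounded_fin (mu : {measure set (plane R) -> \bar R}) A :
  (forall K, compact (K : set (R * R)) -> (mu K < +oo)%E) ->
  measurable A -> bounded_set (A : set (R * R)) -> mu A \is a fin_num.
Proof.
move=> muK mA [M [_ bA]].
pose I : set R := `[- (M + 1), M + 1]%classic.
have AI : A `<=` I `*` I.
  have M1 : M < M + 1 by rewrite ltrDl.
  move=> x /(bA _ M1) /=; rewrite prod_normE ge_max => /andP[x1 x2].
  by split; rewrite /I /= in_itv/= -ler_norml.
have cI : compact (I `*` I : set (R * R)).
  by apply: compact_setX; exact: segment_compact.
have mI : measurable (I `*` I : set (plane R)).
  by apply: measurableX; exact: measurable_itv.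
rewrite ge0_fin_numE//; apply: le_lt_trans (muK _ cI).
by apply: le_measure => //; rewrite inE.
Qed.

Lemma radon_val_cvg (s : @signed_radon R) (F : (set (plane R))^nat) :
  (forall k, measurable (F k)) -> trivIset setT F ->
  bounded_set (\bigcup_k F k : set (R * R)) ->
  (fun n => \sum_(0 <= k < n) radon_val s (F k)) @ \oo
    --> (radon_val s (\bigcup_k F k) : R).
Proof.
move=> mF tF bF.
have bFk k : bounded_set (F k : set (R * R)).
  by case: bF => M [rM bM]; exists M; split => // x xM y Fy; apply: (bM x xM); exists k.
have mU : measurable (\bigcup_k F k) by exact: bigcup_measurable.
have aux (mu : {measure set (plane R) -> \bar R}) :
    (forall K, compact (K : set (R * R)) -> (mu K < +oo)%E) ->
    (fun n => \sum_(0 <= k < n) fine (mu (F k))) @ \oo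
      --> (fine (mu (\bigcup_k F k)) : R).
  move=> muK.
  have := @measure_semi_sigma_additive _ _ _ mu F mF tF mU.
  rewrite -(fineK (radon_bounded_fin muK mU bF)) => /fine_cvg; apply: cvg_trans.
  apply: near_eq_cvg; apply: nearW => n /=; rewrite sum_fine// => i _.
  exact: radon_bounded_fin.
rewrite /radon_val.
under eq_fun do rewrite sumrB.
by apply: cvgB; apply: aux; [exact: radon_pos_fin|exact: radon_neg_fin].
Qed.

Lemma enormD (x y : R * R) : enorm (x.1 + y.1, x.2 + y.2) <= enorm x + enorm y.
Proof.
case: x y => [a b] [c d]; rewrite /enorm/=.
set p := Num.sqrt (a ^+ 2 + b ^+ 2); set q := Num.sqrt (c ^+ 2 + d ^+ 2).
have p0 : 0 <= p by exact: sqrtr_ge0.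
have q0 : 0 <= q by exact: sqrtr_ge0.
have pE : p ^+ 2 = a ^+ 2 + b ^+ 2 by rewrite sqr_sqrtr// addr_ge0// sqr_ge0.
have qE : q ^+ 2 = c ^+ 2 + d ^+ 2 by rewrite sqr_sqrtr// addr_ge0// sqr_ge0.
have pq0 : 0 <= p * q by exact: mulr_ge0.
have cs : a * c + b * d <= p * q.
  rewrite (le_trans (ler_norm _))// -(ger0_norm pq0) -ler_sqr ?nnegrE ?normr_ge0//.
  rewrite !real_normK ?num_real// exprMn pE qE.
  have := sqr_ge0 (a * d - b * c); nra.
rewrite -(ger0_norm (addr_ge0 p0 q0)) -sqrtr_sqr ler_wsqrtr//.
have -> : (p + q) ^+ 2 = p ^+ 2 + q ^+ 2 + 2 * (p * q) by ring.
rewrite pE qE; nra.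
Qed.

Lemma vradon_norm_ge0 D A : 0 <= vradon_norm D A.
Proof. exact: sqrtr_ge0. Qed.

Lemma enorm_sum (a b : R^nat) n :
  enorm (\sum_(0 <= k < n) a k, \sum_(0 <= k < n) b k)
    <= \sum_(0 <= k < n) enorm (a k, b k).
Proof.
elim: n => [|n IH]; first by rewrite !big_nil /enorm/= expr0n addr0 sqrtr0.
rewrite !big_nat_recr//=.
apply: (le_trans (enormD (_, _) (_, _))).
by rewrite lerD2r.
Qed.

Lemma vradon_norm_sub D (F : (set (plane R))^nat) :
  (forall k, measurable (F k)) -> trivIset setT F ->
  bounded_set (\bigcup_k F k : set (R * R)) ->
  ((vradon_norm D (\bigcup_k F k))%:E
    <= \sum_(0 <= k <oo) (vradon_norm D (F k))%:E)%E.
Proof.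
move=> mF tF bF.
have c1 := radon_val_cvg (s := D.1) mF tF bF.
have c2 := radon_val_cvg (s := D.2) mF tF bF.
have c : (fun n => enorm (\sum_(0 <= k < n) radon_val D.1 (F k),
                          \sum_(0 <= k < n) radon_val D.2 (F k))) @ \oo
    --> vradon_norm D (\bigcup_k F k).
  have h : (fun n => (\sum_(0 <= k < n) radon_val D.1 (F k)) ^+ 2 +
      (\sum_(0 <= k < n) radon_val D.2 (F k)) ^+ 2) @ \oo -->
      (radon_val D.1 (\bigcup_k F k) ^+ 2 + radon_val D.2 (\bigcup_k F k) ^+ 2).
    by apply: cvgD; rewrite expr2; under eq_fun do rewrite expr2; apply: cvgM.
  exact: (continuous_cvg _ (@sqrt_continuous _ _) h).
have cE : (fun n => (enorm (\sum_(0 <= k < n) radon_val D.1 (F k),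
                          \sum_(0 <= k < n) radon_val D.2 (F k)))%:E) @ \oo
    --> (vradon_norm D (\bigcup_k F k))%:E.
  by apply: cvg_EFin; [exact: nearW | exact: c].
rewrite -(cvg_lim _ cE)//; apply: lime_le; first by apply/cvg_ex; eexists; exact: cE.
apply: nearW => n.
apply: (@le_trans _ _ (\sum_(0 <= k < n) (vradon_norm D (F k))%:E)%E).
  by rewrite sumEFin lee_fin enorm_sum.
by apply: nneseries_lim_ge => k _; rewrite lee_fin vradon_norm_ge0.
Qed.

Let bounded0 : bounded_set (set0 : set (R * R)).
Proof. exact/compact_bounded/compact0. Qed.

Let boundedS (A B : set (R * R)) : A `<=` B -> bounded_set B -> bounded_set A.
Proof.
by move=> AB [M [rM bM]]; exists M; split => // x xM y /AB By; exact: (bM x xM).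
Qed.

Let vnorm0 D : vradon_norm D set0 = 0.
Proof. by rewrite /vradon_norm /radon_val !measure0 /enorm/= subrr expr0n addr0 sqrtr0. Qed.

Let pieces A (F : (set (plane R))^nat) :=
  [/\ forall k, measurable (F k), forall k, bounded_set (F k : set (R * R)),
      trivIset setT F & \bigcup_k F k `<=` A].

Let vsum D (F : (set (plane R))^nat) :=
  (\sum_(0 <= k <oo) (vradon_norm D (F k))%:E)%E.

Let vsum_ge0 D F : (0 <= vsum D F)%E.
Proof. by apply: nneseries_ge0 => k _ _; rewrite lee_fin vradon_norm_ge0. Qed.

Let pieces0 A : pieces A (fun=> set0).
Proof.
split => //; first by move=> i j _ _ [x []].
by move=> x [].
Qed.

Let vsum_le D A F : pieces A F -> (vsum D F <= radon_variation D A)%E.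
Proof. by move=> AF; apply: ereal_sup_ubound; exists F. Qed.

Let rv_le D A x : (forall F, pieces A F -> (vsum D F <= x)%E) ->
  (radon_variation D A <= x)%E.
Proof. by move=> h; apply: ub_ereal_sup => _ [F AF <-]; exact: h. Qed.

Let rv_ge0 D A : (0 <= radon_variation D A)%E.
Proof. by rewrite (le_trans (vsum_ge0 D (fun=> set0)))// vsum_le. Qed.

Let rv_mono D A B : A `<=` B -> (radon_variation D A <= radon_variation D B)%E.
Proof.
move=> AB; apply: rv_le => F [mF bF tF FA]; apply: vsum_le; split => //.
exact: subset_trans AB.
Qed.

Let rv0 D : radon_variation D set0 = 0%E.
Proof.
apply/eqP; rewrite eq_le rv_ge0 andbT; apply: rv_le => F [mF bF tF F0].
rewrite /vsum eseries0// => k _ _.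
have -> : F k = set0 by rewrite -subset0 => x Fx; apply: F0; exists k.
by rewrite vnorm0.
Qed.

Let vsum_add D A C F G : A `&` C = set0 -> pieces A F -> pieces C G ->
  (vsum D F + vsum D G <= radon_variation D (A `|` C))%E.
Proof.
move=> AC [mF bF tF FA] [mG bG tG GC].
pose H k := if odd k then G k./2 else F k./2.
have pH : pieces (A `|` C) H.
  split.
  - by move=> k; rewrite /H; case: ifP.
  - by move=> k; rewrite /H; case: ifP.
  - have no i j x : F i x -> G j x -> False.
      move=> Fx Gx; suff : set0 x by [].
      by rewrite -AC; split; [apply: FA; exists i|apply: GC; exists j].
    move=> i j _ _ [x []]; rewrite /H; case: ifPn => oi; case: ifPn => oj Hi Hj.
    + have : i./2 = j./2 by apply: (tG _ _ I I); exists x.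
      by rewrite -{2}(odd_double_half i) -{2}(odd_double_half j) oi oj => ->.
    + by case: (no _ _ _ Hj Hi).
    + by case: (no _ _ _ Hi Hj).
    + have : i./2 = j./2 by apply: (tF _ _ I I); exists x.
      rewrite -{2}(odd_double_half i) -{2}(odd_double_half j).
      by rewrite (negbTE oi) (negbTE oj) => ->.
  - move=> x [k _]; rewrite /H; case: ifP => _ Hx.
    + by right; apply: GC; exists k./2.
    + by left; apply: FA; exists k./2.
apply: (le_trans _ (vsum_le D pH)).
rewrite /vsum -nneseriesD; [|by move=> i _ _; rewrite lee_fin vradon_norm_ge0..].
apply: lime_le.
  by apply: is_cvg_nneseries => n _ _; rewrite adde_ge0// lee_fin vradon_norm_ge0.
apply: nearW => n.
rewrite [leLHS](_ : _ = \sum_(0 <= k < n.*2) (vradon_norm D (H k))%:E)%E.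
  by apply: nneseries_lim_ge => k _ _; rewrite lee_fin vradon_norm_ge0.
elim: n => [|n IH]; first by rewrite !big_nil.
rewrite doubleS !big_nat_recr//= IH /H /= odd_double /= -addeA.
by rewrite uphalf_double doubleK.
Qed.

Let rv_add D A C : A `&` C = set0 ->
  (radon_variation D A + radon_variation D C <= radon_variation D (A `|` C))%E.
Proof.
move=> AC; set X := radon_variation D (A `|` C).
have [->|Xoo] := eqVneq X +oo%E; first by rewrite leey.
have Xfin : X \is a fin_num by rewrite ge0_fin_numE ?ltey// rv_ge0.
have fin y : (0 <= y)%E -> (y <= X)%E -> y \is a fin_num.
  by move=> y0 yX; rewrite ge0_fin_numE// (le_lt_trans yX)// ltey.
have fA : radon_variation D A \is a fin_num.
  by apply: fin => //; apply: rv_mono => x; left.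
rewrite addeC -leeBrDr//; apply: rv_le => G pG.
have fG : vsum D G \is a fin_num.
  by apply: fin => //; apply: (le_trans (vsum_le D pG)); apply: rv_mono => x; right.
rewrite leeBrDr// addeC -leeBrDr//; apply: rv_le => F pF.
by rewrite leeBrDr//; exact: vsum_add.
Qed.

Let rv_sigma_additive D : semi_sigma_additive (radon_variation D).
Proof.
move=> B mB tB mU.
have bnd n : (\sum_(0 <= i < n) radon_variation D (B i)
    <= radon_variation D (\bigcup_i B i))%E.
  apply: (@le_trans _ _ (radon_variation D (\big[setU/set0]_(0 <= i < n) B i))).
    elim: n => [|n IH]; first by rewrite !big_nil rv0.
    rewrite !big_nat_recr//=; apply: (le_trans _ (rv_add _ _)).
      by rewrite leeD2r.
    rewrite -subset0 => x [].
    rewrite big_mkord -bigcup_mkord => -[i /= im Bi] Bn.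
    by have /eqP := tB _ _ I I (ex_intro _ x (conj Bi Bn)); rewrite ltn_eqF.
  by apply: rv_mono; rewrite big_mkord; exact: bigsetU_bigcup.
have cv : cvgn (fun n => \sum_(0 <= i < n) radon_variation D (B i))%E.
  by apply: is_cvg_nneseries => n _ _.
suff <- : (\sum_(0 <= i <oo) radon_variation D (B i))%E =
  radon_variation D (\bigcup_i B i) by exact: cv.
apply/eqP; rewrite eq_le; apply/andP; split.
  by apply: lime_le => //; exact: nearW.
apply: rv_le => F [mF bF tF FU].
apply: (@le_trans _ _ (\sum_(0 <= k <oo) \sum_(0 <= i <oo)
    (vradon_norm D (F k `&` B i))%:E)%E).
  apply: lee_nneseries => k _; first by rewrite lee_fin vradon_norm_ge0.
  have FE : F k = \bigcup_i (F k `&` B i).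
    rewrite -setI_bigcupr; apply/esym/setIidPl => x Fx; apply: FU; by exists k.
  rewrite {1}FE; apply: vradon_norm_sub.
  - by move=> i; exact: measurableI.
  - exact: trivIset_setIl.
  - by rewrite -FE.
rewrite nneseries_interchange; last by move=> i j; rewrite lee_fin vradon_norm_ge0.
apply: lee_nneseries => i _; first by move=> _; exact: (vsum_ge0 D (fun k => F k `&` B i)).
apply: (vsum_le D (F := fun k => F k `&` B i)); split.
- by move=> k; exact: measurableI.
- by move=> k; apply: boundedS (bF k) => x [].
- exact: trivIset_setIr.
- by move=> x [k _ []].
Qed.

HB.instance Definition _ D := isMeasure.Build _ _ _ (radon_variation D)
  (rv0 D) (rv_ge0 D) (@rv_sigma_additive D).

End radon_variation_measure.

Section WeightedPerimeter.
Context {R : realType}.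
Implicit Types (u f : R * R -> R) (E : set (R * R)).

Definition distr_derivative u (D : @signed_radon R * @signed_radon R) : Prop :=
  forall phi : R * R -> R, test_function phi ->
    \int[leb2]_x (u x * partial1 phi x) = - radon_int D.1 phi /\
    \int[leb2]_x (u x * partial2 phi x) = - radon_int D.2 phi.

Definition BVloc u : Prop :=
  (forall K : set (R * R), compact K -> leb2.-integrable K (EFin \o u)) /\
  exists D, distr_derivative u D.

Definition finite_perimeter E : Prop := leb2_measurable E /\ BVloc \1_E.

(* D chi_E; it is unique as a set function when E has finite perimeter, and a
   default value otherwise. *)
Definition Dchi E : @signed_radon R * @signed_radon R :=
  xget (signed_radon0, signed_radon0) [set D | distr_derivative \1_E D].

Definition weighted_volume f E : \bar R := (\int[leb2]_(x in E) (f x)%:E)%E.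

Definition weighted_perimeter f E : \bar R :=
  (\int[radon_variation (Dchi E)]_x (f x)%:E)%E.

Definition competitor f (v : R) : set (set (R * R)) :=
  [set E | finite_perimeter E /\ weighted_volume f E = v%:E].

Definition isoperimetric_profile f (v : R) : \bar R :=
  ereal_inf [set weighted_perimeter f E | E in competitor f v].

End WeightedPerimeter.

(* Main.v *)
(* Calibration. Let m(t) be the angular measure of the competitor E on the circle
   of radius t, k(t) = t exp(h t), and let |l| <= k vanish at both ends. Integrating
   the divergence of the field with radial part l(t) / t and tangential part
   +- sqrt(exp(2 h) - (l / t)^2), the sign being chosen slice by slice, yields
     int l' m + 2 int_{0 < m < 2 pi} sqrt(exp(2 h) - (l / t)^2) <= P_f(E).
   Take l piecewise affine in the weighted area int k. The tangential term on a
   chord of k pays for the area missing from the slices, because by convexity of h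
   the extremal curves turn by at least pi. Hence 2 pi k(y) <= P_f(E) as soon as E
   contains more mass than the disc of radius y. *)

Require Import Defs.
From HB Require Import structures.
From mathcomp Require Import all_boot all_order all_algebra.
From mathcomp Require Import all_classical all_reals all_analysis.
From mathcomp Require Import measurable_realfun.
From mathcomp Require Import ring lra.

Set Implicit Arguments.
Unset Strict Implicit.
Unset Printing Implicit Defensive.

Import Order.TTheory GRing.Theory Num.Theory.
Import numFieldNormedType.Exports.

Local Open Scope classical_set_scope.
Local Open Scope ring_scope.

(** Why pi: if the chord [lam * w + l0] is lowered by a constant, its tangential integral grows at
    the rate given by the integral of m / (t sqrt(1 - m^2)), m = l / k. This is the polar angle
    swept by the curve that makes an angle of sine m with the rays. A lower bound pi for the angle,
    integrated over the heights below the top of [k - l], yields pi times the largest gap between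
    [k] and the chord. The obstacle is that the tangential term exists only on slices neither empty
    nor full, and these radii need not form intervals. Hence a fine grid of radii. Beyond the last
    cell with full slices, chords are used on runs of cells without empty slices; in a cell with
    empty slices [l] is dropped to [- k] for free; and such cells carry little mass, because letting
    [l] oscillate inside them would show too large a perimeter. A chord restarting from [- k] is the
    delicate case, settled by comparing level sets of two parallel chords. *)

Local Notation mfun := measurable_fun.
Local Notation cts_mfun := continuous_measurable_fun.
Local Notation wc_cts := continuous_subspaceT.

(** * One-variable calculus: derivatives, mean values, integrals *)

Section calculus.
Context {R : realType}.
Notation mu := (@lebesgue_measure R).
Implicit Types (f g : R -> R) (a b x : R).

(* An opaque alias: [is_derive] is a type class, whose resolution would
   otherwise run on every derivation goal. *)
Definition isd f x a : Prop := is_derive x 1 f a.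

Lemma der_eq f x a b : isd f x a -> a = b -> isd f x b.
Proof. by move=> + <-. Qed.

Lemma derC a x : isd (fun=> a : R) x 0.
Proof. exact:is_derive_cst. Qed.

Lemma derI x : isd (fun y : R => y) x 1.
Proof. exact:is_derive_id. Qed.

Lemma derD f g x a b : isd f x a -> isd g x b ->
  isd (fun y => f y + g y) x (a + b).
Proof. by move=> fa gb;have:=is_deriveD fa gb. Qed.

Lemma derN f x a : isd f x a -> isd (fun y => - f y) x (- a).
Proof. by move=> fa;have:=is_deriveN fa. Qed.

Lemma derB f g x a b : isd f x a -> isd g x b ->
  isd (fun y => f y - g y) x (a - b).
Proof. by move=> fa gb;have:=is_deriveB fa gb. Qed.

Lemma derM f g x a b : isd f x a -> isd g x b ->
  isd (fun y => f y * g y) x (a * g x + f x * b).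
Proof.
move=> fa gb;apply:(der_eq (is_deriveM fa gb)).
by rewrite /GRing.scale/=;ring.
Qed.

Lemma der_comp f g x a b : isd g x b -> isd f (g x) a ->
  isd (fun y => f (g y)) x (a * b).
Proof.
by move=> gb fa;have:=is_derive1_comp fa gb.
Qed.

Lemma derV f x a : f x != 0 -> isd f x a ->
  isd (fun y => (f y)^-1) x (- a / f x ^+ 2).
Proof.
move=> f0 fa;apply:(der_eq (is_deriveV f0 fa)).
by rewrite /GRing.scale/= mulNr mulrC mulNr.
Qed.

Lemma der_expR f x a : isd f x a ->
  isd (fun y => expR (f y)) x (expR (f x) * a).
Proof. by move=> fa;apply:der_comp fa _;exact:is_derive_expR. Qed.

Lemma der_sqrt f x a : 0 < f x -> isd f x a ->
  isd (fun y => Num.sqrt (f y)) x (a / (2 * Num.sqrt (f x))).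
Proof.
move=> f0 fa;have:=der_comp fa (is_derive1_sqrt f0).
by move=>/der_eq;apply;rewrite mulrC.
Qed.

Lemma der_atan f x a : isd f x a ->
  isd (fun y => atan (f y)) x (a / (1 + f x ^+ 2)).
Proof.
move=> fa;have:=der_comp fa (is_derive1_atan (f x)).
by move=>/der_eq;apply;rewrite mulrC.
Qed.

Lemma der_cts f x a : isd f x a -> {for x, continuous f}.
Proof. by move=>[fa _];exact/differentiable_continuous/derivable1_diffP. Qed.

Lemma within_der f (f' : R -> R) a b :
  (forall x, a <= x <= b -> isd f x (f' x)) ->
  {within `[a, b], continuous f}.
Proof.
move=> df;apply:continuous_in_subspaceT=> x.
by rewrite inE/= in_itv/= =>/df;exact:der_cts.
Qed.

Lemma der_le f (f' : R -> R) a b : a <= b -> {within `[a, b], continuous f} ->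
  (forall x, a < x < b -> isd f x (f' x)) ->
  (forall x, a < x < b -> 0 <= f' x) -> f a <= f b.
Proof.
rewrite le_eqVlt=>/predU1P[->//|ab] cf df f0.
have df' x : x \in `]a,b[%R -> isd f x (f' x) by rewrite in_itv/= =>/df.
have [c cab e]:=@MVT _ f f' a b ab df' cf.
rewrite -subr_ge0 e mulr_ge0// ?subr_ge0 ?(ltW ab)//.
by apply:f0;move: cab;rewrite in_itv.
Qed.

Lemma der_lt f (f' : R -> R) a b : a < b -> {within `[a, b], continuous f} ->
  (forall x, a < x < b -> isd f x (f' x)) ->
  (forall x, a < x < b -> 0 < f' x) -> f a < f b.
Proof.
move=> ab cf df f0.
have df' x : x \in `]a,b[%R -> isd f x (f' x) by rewrite in_itv/= =>/df.
have [c cab e]:=@MVT _ f f' a b ab df' cf.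
rewrite -subr_gt0 e mulr_gt0// ?subr_gt0//.
by apply:f0;move: cab;rewrite in_itv.
Qed.

Lemma der_ge f (f' : R -> R) a b : a <= b -> {within `[a, b], continuous f} ->
  (forall x, a < x < b -> isd f x (f' x)) ->
  (forall x, a < x < b -> f' x <= 0) -> f b <= f a.
Proof.
move=> ab cf df f0;rewrite -lerN2.
apply:(@der_le (fun x=> - f x) (fun x=> - f' x))=>//.
- by move=> x;exact/continuousN/cf.
- by move=> x /df ?;exact:derN.
- by move=> x /f0;rewrite oppr_ge0.
Qed.

Lemma ftc f (f' : R -> R) a b : a <= b ->
  (forall x, a <= x <= b -> isd f x (f' x)) ->
  {within `[a, b], continuous f'} ->
  (\int[mu]_(x in `[a, b]) (f' x)%:E = (f b - f a)%:E)%E.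
Proof.
rewrite le_eqVlt=>/predU1P[<- _ _|ab df cf'].
 by rewrite set_itv1 integral_set1 subrr.
rewrite (@continuous_FTC2 _ f' f)//.
- split.
 + move=> x;rewrite in_itv/= =>/andP[ax xb].
  by have [] : isd f x (f' x) by apply:df;rewrite !ltW.
 + apply:cvg_at_right_filter;apply:(@der_cts _ _ (f' a)).
  by apply:df;rewrite lexx ltW.
 + apply:cvg_at_left_filter;apply:(@der_cts _ _ (f' b)).
  by apply:df;rewrite lexx ltW.
- move=> x;rewrite in_itv/= =>/andP[ax xb];rewrite derive1E.
 by apply:derive_val;apply:df;rewrite !ltW.
Qed.

Lemma cts_int f a b : {within `[a, b], continuous f} ->
  mu.-integrable `[a, b] (EFin \o f).
Proof. by move=> cf;apply:continuous_compact_integrable=>//;exact:segment_compact. Qed.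

Lemma ftcR f (f' : R -> R) a b : a <= b ->
  (forall x, a <= x <= b -> isd f x (f' x)) ->
  {within `[a, b], continuous f'} ->
  \int[mu]_(x in `[a, b]) f' x = f b - f a.
Proof. by move=> ab df cf';rewrite /Rintegral (ftc ab df cf'). Qed.

Lemma exists_primitive f a : continuous f ->
  exists F : R -> R, forall x, a < x -> isd F x (f x).
Proof.
move=> cf;exists (fun x=> \int[mu]_(t in `[a,x]) f t)=> x ax.
have x1: x < x + 1 by rewrite ltrDl.
have fi: mu.-integrable `[a,x + 1] (EFin \o f).
 by apply:cts_int;exact:wc_cts.
have /= [dF eF]:=continuous_FTC1_closed x1 fi ax (cf x).
by apply:DeriveDef=>//;rewrite -derive1E.
Qed.

Lemma wcD (A : set R) f g : {within A, continuous f} -> {within A, continuous g} ->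
  {within A, continuous (fun x => f x + g x)}.
Proof. by move=> cf cg x;apply:cvgD;[exact:cf|exact:cg]. Qed.

Lemma wcB (A : set R) f g : {within A, continuous f} -> {within A, continuous g} ->
  {within A, continuous (fun x => f x - g x)}.
Proof. by move=> cf cg x;apply:cvgB;[exact:cf|exact:cg]. Qed.

Lemma wcM (A : set R) f g : {within A, continuous f} -> {within A, continuous g} ->
  {within A, continuous (fun x => f x * g x)}.
Proof. by move=> cf cg x;apply:cvgM;[exact:cf|exact:cg]. Qed.

Lemma wcC (A : set R) a : {within A, continuous (fun=> a)}.
Proof. by move=> x;exact:cvg_cst. Qed.

Lemma wcI (A : set R) : {within A, continuous (fun x : R => x)}.
Proof. by apply:wc_cts=> x;exact:cvg_id. Qed.

Lemma wcS (A B : set R) f : A `<=` B -> {within B, continuous f} ->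
  {within A, continuous f}.
Proof. exact:continuous_subspaceW. Qed.

Lemma wc_comp (A : set R) f g : {within A, continuous f} -> continuous g ->
  {within A, continuous (fun x => g (f x))}.
Proof. by move=> cf cg x;apply:continuous_comp;[exact:cf|exact:cg]. Qed.

Lemma wc_comp_at (A : set R) f g : {within A, continuous f} ->
  (forall x, A x -> {for f x, continuous g}) ->
  {within A, continuous (fun x => g (f x))}.
Proof.
move=>/subspace_continuousP cf cg;apply/subspace_continuousP=> x Ax.
by apply:cvg_comp;[exact:cf|exact:cg].
Qed.

Lemma wcV (A : set R) f : {within A, continuous f} -> (forall x, A x -> f x != 0) ->
  {within A, continuous (fun x => (f x)^-1)}.
Proof.
by move=> cf f0;apply:(wc_comp_at (g:=fun x=> x^-1))=>// x /f0;exact:inv_continuous.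
Qed.

Lemma wc_sqrt (A : set R) f : {within A, continuous f} ->
  {within A, continuous (fun x => Num.sqrt (f x))}.
Proof. by move=> cf;apply:wc_comp=>//;exact:sqrt_continuous. Qed.

(** The derivative [f'] is compared with the continuous [g] pointwise only: the primitive of [g]
    minus [f] is nondecreasing, so the integral of [f'] never enters. *)
Lemma ftc_ge f g (f' : R -> R) a b : a <= b ->
  {within `[a, b], continuous f} -> {within `[a, b], continuous g} ->
  (forall x, a < x < b -> isd f x (f' x)) -> (forall x, a < x < b -> f' x <= g x) ->
  f b - f a <= \int[mu]_(x in `[a, b]) g x.
Proof.
rewrite le_eqVlt=>/predU1P[<- _ _ _ _|ab cf cg df fg].
 by rewrite set_itv1 subrr Rintegral_set1.
have ig:=cts_int cg.
pose G x:=\int[mu]_(t in `[a,x]) g t.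
have cG: {within `[a,b],continuous G} by apply:parameterized_integral_continuous=>//;exact:ltW.
have dG x : a < x < b -> isd G x (g x).
 move=>/andP[ax xb];have cgx: {for x,continuous g}.
  by apply:(within_continuous_continuous ab cg);rewrite in_itv/= ax.
 have /= [dF eF]:=continuous_FTC1_closed xb ig ax cgx.
 by apply:DeriveDef=>//;rewrite -derive1E.
have : G a - f a <= G b - f b.
 apply:(der_le (f:=fun x=> G x - f x) (f':=fun x=> g x - f' x)) (ltW ab) _ _ _.
 - exact:wcB.
 - by move=> x xab;apply:derB;[exact:dG|exact:df].
 - by move=> x xab;rewrite subr_ge0 fg.
rewrite {1}/G set_itv1 Rintegral_set1 sub0r=> h.
by rewrite -[leRHS]/(G b);lra.
Qed.

Lemma ivt f a b v : a <= b -> {within `[a, b], continuous f} ->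
  f a <= v <= f b -> exists2 c, a <= c <= b & f c = v.
Proof.
move=> ab cf /andP[fav vfb].
have /(IVT ab cf)[c cab <-] : Num.min (f a) (f b) <= v <= Num.max (f a) (f b).
 by rewrite ge_min fav le_max vfb orbT.
by exists c=>//;move: cab;rewrite in_itv.
Qed.

End calculus.

(** * Primitives on the whole line *)

Section primitive.
Context {R : realType}.
Implicit Types (f F : R -> R) (a b x y : R).

Lemma der_const F a b : (forall x, a < x < b -> isd F x 0) -> forall x y, a < x -> x < b -> a < y -> y < b -> F x = F y.
Proof.
move=> dF.
have key x y : a < x -> x <= y -> y < b -> F x = F y.
 move=> ax xy yb.
 have c: {within `[x,y],continuous F}.
  by apply:(within_der (f':=fun=> 0))=> z /andP[xz zy];apply:dF;rewrite (lt_le_trans ax xz) (le_lt_trans zy).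
 have d z : x < z < y -> isd F z 0 by move=>/andP[xz zy];apply:dF;rewrite (lt_trans ax xz) (lt_trans zy).
 apply/eqP;rewrite eq_le;apply/andP;split.
  exact:(der_le (f':=fun=> 0) xy c d).
 exact:(der_ge (f':=fun=> 0) xy c d).
move=> x y ax xb ay yb;have [xy|/ltW yx]:=leP x y;first exact:key.
by apply/esym;exact:key.
Qed.

(** [exists_primitive] works to the right of a base point. A second primitive, of the reflected
    function, covers the left; on (-1, 1), where both are defined, they differ by the constant
    [c]. *)
Lemma primitive f : continuous f -> exists F, forall x, isd F x (f x).
Proof.
move=> cf;have [F1 d1]:=exists_primitive (-1) cf.
have cf': continuous (fun x=> f (- x)) by move=> x;apply:continuous_comp;[exact:opp_continuous|exact:cf].
have [F2 d2]:=exists_primitive (-1) cf'.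
pose G x:=- F2 (- x).
have dG x : x < 1 -> isd G x (f x).
 move=> x1;apply:der_eq.
  by apply:derN;apply:(@der_comp _ F2 (fun x=> - x));[apply:derN;exact:derI|apply:d2;rewrite ltrN2].
 by rewrite /= opprK;ring.
pose c:=F1 0 - G 0;pose F x:=if x < 0 then G x + c else F1 x.
have FG x : -1 < x -> x < 1 -> F1 x = G x + c.
 move=> x0 x1;suff : F1 x - G x = F1 0 - G 0 by rewrite /c=> <-;ring.
 apply:(@der_const (fun x=> F1 x - G x) (-1) 1)=>//.
 move=> z /andP[z0 z1];apply:der_eq;first by apply:derB;[exact:d1|exact:dG].
 by rewrite subrr.
exists F=> x;have [x0|x0]:=ltP x 0.
 apply:(near_eq_is_derive (f:=fun x=> G x + c)).
  near=> u;rewrite /F ifT//;near: u;exact:lt_nbhsl.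
 by apply:der_eq;[apply:derD;[apply:dG;rewrite (lt_trans x0)|exact:derC]|rewrite addr0].
apply:(near_eq_is_derive (f:=F1));last by apply:d1;rewrite (lt_le_trans _ x0)// oppr_lt0.
near=> u;have u1: -1 < u by near: u;apply:lt_nbhsr;rewrite (lt_le_trans _ x0)// oppr_lt0.
by rewrite /F;case:ltP=>// u0;rewrite FG// (lt_trans u0).
Unshelve. all: by end_near. Qed.

End primitive.

(** * Angle swept by an extremal curve when the log density is affine *)

Section theta.
Context {R : realType}.
Notation mu := (@lebesgue_measure R).
Variables (c p h0 : R) (n : R -> R) (a b : R).
Let E0 (t : R) : R := expR (h0 + c * (t - p)).
Let k (t : R) : R := t * E0 t.
Hypotheses (c0 : 0 <= c) (a0 : 0 < a) (ap : a < p) (pb : p < b).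
(** This makes [n] the difference of [k] and a chord of slope [lam = p^-1 + c] in the weighted area:
    [k' = E0 * (1 + c * t)], the chord has derivative [lam * k], and subtraction gives the
    right-hand side. *)
Hypothesis dn : forall t, a <= t <= b -> isd n t (E0 t * (1 - t / p)).
Hypotheses (na : n a = 0) (nb : n b = 0).
(** Ratio of the chord to [k]: the sine of the angle between the extremal curve and the ray, so that
    the polar angle along the curve has derivative [m / (t * r)]. *)
Let m (t : R) : R := 1 - n t / k t.
Let lam : R := p^-1 + c.
(** [y] is [t * m'], in a closed form that can be differentiated again. *)
Let y (t : R) : R := lam * t - (1 + c * t) * m t.

Let p0 : 0 < p. Proof. exact:lt_trans ap. Qed.
Let E0p (t : R) : 0 < E0 t. Proof. exact:expR_gt0. Qed.
Let kp (t : R) : 0 < t -> 0 < k t. Proof. by move=> t0;rewrite mulr_gt0. Qed.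

Let dE0 (t : R) : isd E0 t (c * E0 t).
Proof.
apply:der_eq;first apply:der_expR.
 apply:derD;first exact:derC.
 by apply:derM;[exact:derC|apply:derB;[exact:derI|exact:derC]].
by rewrite /= /E0;ring.
Qed.

Let dk (t : R) : isd k t (E0 t * (1 + c * t)).
Proof.
apply:der_eq;first by apply:derM;[exact:derI|exact:dE0].
by rewrite/=;ring.
Qed.

Let dm (t : R) : a <= t <= b -> isd m t (y t / t).
Proof.
move=>/[dup] tab /andP[ta tb];have t0: 0 < t by exact:lt_le_trans ta.
apply:der_eq;first apply:derB;first exact:derC.
 apply:derM;first exact:dn.
 by apply:derV (dk t);rewrite gt_eqF// kp.
have:=E0p t=> E0t;rewrite /= /y /m /k /lam;field.
by rewrite !gt_eqF.
Qed.

Let dy (t : R) : a <= t <= b -> isd y t ((m t - c * t * y t) / t).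
Proof.
move=>/[dup] tab /andP[ta tb];have t0: 0 < t by exact:lt_le_trans ta.
apply:der_eq;first apply:derB.
 by apply:derM;[exact:derC|exact:derI].
 apply:derM;last exact:dm.
 by apply:derD;[exact:derC|apply:derM;[exact:derC|exact:derI]].
rewrite /= /y;field;by rewrite !gt_eqF.
Qed.

Let npos (t : R) : a < t < b -> 0 < n t.
Proof.
move=>/andP[ta tb];have cn: {within `[a,b],continuous n}.
 exact:within_der dn.
have [tp|pt]:=leP t p.
 rewrite -na;apply:(der_lt (f':=fun t=> E0 t * (1 - t / p))) ta _ _ _.
 - apply:continuous_subspaceW cn;apply:subset_itvl;rewrite bnd_simp;exact:ltW.
 - by move=> x /andP[ax xt];apply:dn;rewrite !ltW// (lt_trans xt).
 - move=> x /andP[ax xt];rewrite mulr_gt0// subr_gt0 ltr_pdivrMr// mul1r.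
  exact:lt_le_trans tp.
rewrite -nb -ltrN2;apply:(der_lt (f:=fun t=> - n t) (f':=fun t=> - (E0 t * (1 - t / p)))) tb _ _ _.
- move=> x;apply:continuousN;move: x;apply:continuous_subspaceW cn;apply:subset_itvr;rewrite bnd_simp;exact:ltW.
- move=> x /andP[ax xt];by apply:derN;apply:dn;rewrite (ltW (lt_trans ta ax)) ltW.
- move=> x /andP[ax xt];rewrite -mulrN mulr_gt0// oppr_gt0 subr_lt0 ltr_pdivlMr// mul1r.
 exact:lt_trans ax.
Qed.

Let ma : m a = 1. Proof. by rewrite /m na mul0r subr0. Qed.
Let mb : m b = 1. Proof. by rewrite /m nb mul0r subr0. Qed.

Let mlt1 (t : R) : a < t < b -> m t < 1.
Proof.
move=> tab;rewrite /m ltrBlDr ltrDl divr_gt0 ?npos// kp//.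
by case/andP: tab=>/(lt_trans a0).
Qed.

(** [k - n] equals [k a] at the left end and has derivative [lam * k > 0]: the chord stays
    positive. *)
Let kn (t : R) : a <= t <= b -> n t < k t.
Proof.
move=>/andP[at_ tb];rewrite -subr_gt0.
apply:lt_le_trans (_ : k a - n a <= _).
 by rewrite na subr0 kp.
apply:(der_le (f:=fun t=> k t - n t) (f':=fun t=> lam * k t)) at_ _ _ _.
- apply:(within_der (f':=fun t=> lam * k t))=> x /andP[ax xt].
 apply:der_eq;first by apply:derB;[exact:dk|apply:dn;rewrite ax (le_trans xt)].
 by rewrite /lam /k/=;ring.
- move=> x /andP[ax xt].
 apply:der_eq;first by apply:derB;[exact:dk|apply:dn;rewrite !ltW// (lt_le_trans xt)].
 by rewrite /lam /k/=;ring.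
- move=> x /andP[ax xt];rewrite mulr_ge0// ?addr_ge0// ?invr_ge0 ?ltW// kp//.
 exact:lt_trans ax.
Qed.

Let mpos (t : R) : a <= t <= b -> 0 < m t.
Proof.
move=>/[dup] tab /andP[ta _];rewrite /m subr_gt0 ltr_pdivrMr ?mul1r ?kn// kp//.
exact:lt_le_trans ta.
Qed.

(** A first integral when [c = 0]; in general [Q' = - 2 c y^2]. It is also the denominator in the
    derivative of [atan (y / r)], since [Q = r^2 + y^2]. *)
Let Q (t : R) : R := 1 - m t ^+ 2 + y t ^+ 2.
Let r (t : R) : R := Num.sqrt (1 - m t ^+ 2).

Let m1 (t : R) : a < t < b -> 0 < 1 - m t ^+ 2.
Proof.
move=>/[dup] tab /andP[ta tb].
have:=mlt1 tab;have:=mpos (_ : a <= t <= b);rewrite !ltW// =>/(_ isT).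
by move=> *;rewrite subr_gt0 expr_lt1// ltW.
Qed.

Let ya : y a < 0.
Proof.
rewrite /y ma /lam mulr1 mulrDl opprD addrACA subrr addr0 subr_lt0.
by rewrite mulrC ltr_pdivrMr// mul1r.
Qed.

Let yb : 0 < y b.
Proof.
rewrite /y mb /lam mulr1 mulrDl opprD addrACA subrr addr0 subr_gt0.
by rewrite mulrC ltr_pdivlMr// mul1r.
Qed.

Let Qp (t : R) : a <= t <= b -> 0 < Q t.
Proof.
move=>/andP[];rewrite le_eqVlt=>/predU1P[<- _|ta].
 by rewrite /Q ma expr1n subrr add0r exprn_even_gt0//= lt_eqF.
rewrite le_eqVlt=>/predU1P[->|tb].
 by rewrite /Q mb expr1n subrr add0r exprn_even_gt0//= gt_eqF.
by rewrite /Q ltr_wpDr ?sqr_ge0// m1// ta.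
Qed.

Let cy : {within `[a, b], continuous y}. Proof. exact:within_der dy. Qed.
Let cm : {within `[a, b], continuous m}. Proof. exact:within_der dm. Qed.

(** [y] solves [y' = m / t - c y]. The integrating factor turns it into an increasing function,
    whence the single sign change. *)
Let z (t : R) : R := expR (c * t) * y t.
Let dz (t : R) : a <= t <= b -> isd z t (expR (c * t) * (m t / t)).
Proof.
move=>/[dup] tab /andP[ta tb];have t0: 0 < t by exact:lt_le_trans ta.
apply:der_eq;first apply:derM (dy tab).
 by apply:der_expR;apply:derM;[exact:derC|exact:derI].
by rewrite/=;field;rewrite !gt_eqF.
Qed.

Let z_lt (s t : R) : a <= s -> s < t -> t <= b -> z s < z t.
Proof.
move=> as_ st tb;apply:(der_lt (f':=fun t=> expR (c * t) * (m t / t))) st _ _ _.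
- apply:(@within_der _ _ (fun t=> expR (c * t) * (m t / t)))=> x /andP[sx xt].
 by apply:dz;rewrite (le_trans as_) ?(le_trans xt).
- move=> x /andP[sx xt].
 by apply:dz;rewrite (le_trans as_) ?(le_trans (ltW xt))// ltW.
- move=> x /andP[sx xt];rewrite mulr_gt0 ?expR_gt0// divr_gt0//.
  by apply:mpos;rewrite (le_trans as_) ?(le_trans (ltW xt))// ltW.
 by rewrite (lt_trans a0)// (le_lt_trans as_).
Qed.

Let ysgn : exists2 q, a < q < b & forall t, a <= t <= b ->
  (t <= q -> y t <= 0) /\ (q <= t -> 0 <= y t).
Proof.
have ab: a <= b by rewrite ltW// (lt_trans ap).
have /(ivt ab cy)[q /andP[aq qb] yq] : y a <= 0 <= y b by rewrite !ltW.
have {}aq : a < q.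
 by rewrite lt_neqAle aq andbT;apply/eqP=> aq';move: ya;rewrite aq' yq ltxx.
have {}qb : q < b.
 by rewrite lt_neqAle qb andbT;apply/eqP=> qb';move: yb;rewrite -qb' yq ltxx.
have zq: z q = 0 by rewrite /z yq mulr0.
exists q;first by rewrite aq.
move=> t /andP[ta tb];split;rewrite le_eqVlt=>/predU1P[|tq].
- by move=> ->;rewrite yq.
- by have:=z_lt ta tq (ltW qb);rewrite zq /z pmulr_rlt0 ?expR_gt0// =>/ltW.
- by move=> <-;rewrite yq.
- by have:=z_lt (ltW aq) tq tb;rewrite zq /z pmulr_rgt0 ?expR_gt0// =>/ltW.
Qed.

Let dQ (t : R) : a <= t <= b -> isd Q t (- (2 * c * y t ^+ 2)).
Proof.
move=>/[dup] tab /andP[ta tb];have t0: 0 < t by exact:lt_le_trans ta.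
have e: Q = fun t : R=> 1 - m t * m t + y t * y t by apply/funext=> u;rewrite /Q !expr2.
rewrite e;apply:der_eq;first apply:derD;first apply:derB;first exact:derC.
 by apply:derM (dm tab);exact:dm.
 by apply:derM (dy tab);exact:dy.
by rewrite/=;field;rewrite gt_eqF.
Qed.

Let Q_ge (s t : R) : a <= s -> s <= t -> t <= b -> Q t <= Q s.
Proof.
move=> as_ st tb;apply:(der_ge (f':=fun t=> - (2 * c * y t ^+ 2))) st _ _ _.
- apply:(@within_der _ _ (fun t=> - (2 * c * y t ^+ 2)))=> x /andP[sx xt].
 by apply:dQ;rewrite (le_trans as_) ?(le_trans xt).
- move=> x /andP[sx xt].
 by apply:dQ;rewrite (le_trans as_) ?(le_trans (ltW xt))// ltW.
- by move=> x _;rewrite oppr_le0 mulr_ge0 ?sqr_ge0// mulr_ge0.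
Qed.

Let tQ (s t : R) : a <= s -> s <= t -> t <= b -> s / Q s <= t / Q t.
Proof.
move=> as_ st tb;have Qs: 0 < Q s by apply:Qp;rewrite as_ (le_trans st).
have Qt: 0 < Q t by apply:Qp;rewrite (le_trans as_).
apply:ler_pM=>//;first by rewrite ltW// (lt_le_trans a0).
 by rewrite invr_ge0 ltW.
by rewrite lef_pV2 ?posrE//;exact:Q_ge.
Qed.

(* The curve t |-> (y / r) is the slope of the extremal curve in logarithmic
   polar coordinates; its angle increases by pi, up to a term which is
   controlled since t / Q is nondecreasing and y changes sign only once. *)
Lemma total_angle (e : R) : 0 < e -> exists a1 b1 : R, [/\ a < a1, a1 < b1, b1 < b,
  {within `[a1, b1], continuous (fun t => m t / (t * r t))} &
  pi - e <= \int[mu]_(t in `[a1, b1]) (m t / (t * r t))].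
Proof.
move=> e0;have [q /andP[aq qb] yq]:=ysgn.
(* A primitive of the half circle: [S (m t)] has derivative [r * y / t], and [m = 1] at both ends,
   so a multiple of it does not change the total increment. *)
have [S dS] : exists S : R -> R,forall s : R,-2 < s -> isd S s (Num.sqrt (1 - s * s)).
 apply:(@exists_primitive _ (fun s : R=> Num.sqrt (1 - s * s)) (-2))=> s.
 apply:(@continuous_comp _ _ _ (fun s : R=> 1 - s * s) (@Num.sqrt R));last exact:sqrt_continuous.
 by apply:(@der_cts _ _ _ (0 - (1 * s + s * 1)));apply:derB;[exact:derC|apply:derM;exact:derI].
(* With this constant the error term becomes a positive multiple of [y t * (t / Q t - q / Q q)],
   whose two factors change sign together at [q]. *)
pose C0:=c * (q / Q q).
pose w (t : R) : R:=atan (y t / r t) + C0 * S (m t).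
have dr (t : R) : a < t < b -> isd r t (- (m t * y t) / (t * r t)).
 move=>/[dup] tab /andP[ta tb];have t0: 0 < t by exact:lt_trans ta.
 have tab': a <= t <= b by rewrite !ltW.
 have e1: (fun t : R=> 1 - m t ^+ 2) = fun t : R=> 1 - m t * m t by apply/funext=> u;rewrite !expr2.
 apply:der_eq;first apply:der_sqrt;first exact:m1.
  by rewrite e1;apply:derB;[exact:derC|apply:derM;exact:dm].
 have r0: Num.sqrt (1 - m t ^+ 2) != 0 by rewrite gt_eqF// sqrtr_gt0 m1.
 by rewrite /= /r;field;rewrite r0 gt_eqF.
have rp t : a < t < b -> 0 < r t by move=> tab;rewrite sqrtr_gt0 m1.
have r2 t : a < t < b -> r t ^+ 2 = 1 - m t ^+ 2 by move=> tab;rewrite sqr_sqrtr// ltW// m1.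
pose w' (t : R) : R:=m t / (t * r t) - c * y t * r t / Q t + C0 * (r t * (y t / t)).
have dw (t : R) : a < t < b -> isd w t (w' t).
 move=>/[dup] tab /andP[ta tb];have t0: 0 < t by exact:lt_trans ta.
 have tab': a <= t <= b by rewrite !ltW.
 apply:der_eq;first apply:derD.
  apply:der_atan;apply:derM;first exact:dy.
  by apply:derV (dr _ tab);rewrite gt_eqF// rp.
  apply:derM;first exact:derC.
  by apply:der_comp (dm tab') (dS _ _);apply:lt_trans (mpos tab');rewrite oppr_lt0.
 rewrite /= -/(r t) /w'.
 have e1: 1 + (y t / r t) ^+ 2 = Q t / r t ^+ 2.
  by rewrite /Q -r2// expr_div_n;field;rewrite gt_eqF// rp.
 rewrite e1;have:=rp _ tab;have:=Qp tab';rewrite /Q -r2//;move=> Q0 r0.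
 by rewrite/=;field;rewrite !gt_eqF.
have w'le t : a < t < b -> w' t <= m t / (t * r t).
 move=>/[dup] tab /andP[ta tb];have t0: 0 < t by exact:lt_trans ta.
 have tab': a <= t <= b by rewrite !ltW.
 suff : 0 <= y t * (t / Q t - q / Q q).
  move=> h;rewrite -subr_ge0 /w' /C0.
  rewrite [leRHS](_ : _ = c * r t / t * (y t * (t / Q t - q / Q q))).
   by rewrite mulr_ge0// !mulr_ge0// ?invr_ge0 ?ltW// rp.
  have:=Qp tab';have:=Qp (_ : a <= q <= b);rewrite !ltW// =>/(_ isT) ? ?.
  by have:=rp _ tab=> r0;field;rewrite !gt_eqF.
 have [tq|qt]:=leP t q.
  rewrite mulr_le0//;first exact:(yq t tab').1.
  by rewrite subr_le0 tQ// ltW.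
 rewrite mulr_ge0//;first by apply:(yq t tab').2;exact:ltW.
 by rewrite subr_ge0 tQ// ltW.
have cr: {within `[a,b],continuous r}.
 by apply:wc_sqrt;apply:wcB;[exact:wcC|exact:(wcM cm cm)].
have ab: a < b by exact:lt_trans pb.
have cSm: {within `[a,b],continuous (fun t=> C0 * S (m t))}.
 apply:wcM;first exact:wcC.
 apply:wc_comp_at=>// t;rewrite /= in_itv/= => tab;apply:der_cts (dS _ _).
 by apply:lt_trans (mpos tab);rewrite oppr_lt0.
have [M M0 hM] : exists2 M : R,0 < M & forall x,M < x -> pi / 2 - e / 4 < atan x.
 have /cvgr_gt : (@atan R) x @[x --> +oo] --> pi / 2 by exact:cvgy_atan.
 move=>/(_ (pi / 2 - e / 4));rewrite ltrBlDr ltrDl divr_gt0// =>/(_ isT)[M [_ hM]].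
 exists (Num.max M 1);first by rewrite lt_max ltr01 orbT.
 by move=> x;rewrite gt_max=>/andP[/hM].
have ra: r a = 0 by rewrite /r ma expr1n subrr sqrtr0.
have rb: r b = 0 by rewrite /r mb expr1n subrr sqrtr0.
have [_ SA SB]:=(continuous_within_itvP _ ab).1 cSm.
have c1: {within `[a,b],continuous (fun t=> y t - M * r t)}.
 by apply:wcB=>//;apply:wcM=>//;exact:wcC.
have c2: {within `[a,b],continuous (fun t=> y t + M * r t)}.
 by apply:wcD=>//;apply:wcM=>//;exact:wcC.
have [_ _ yB]:=(continuous_within_itvP _ ab).1 c1.
have [_ yA _]:=(continuous_within_itvP _ ab).1 c2.
have e4: 0 < e / 4 by rewrite divr_gt0.
(* The integrand is singular where [r = 0], so the ends are moved inwards. Each of the two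
   arctangents and each of the two values of [S] loses at most [e / 4]. *)
have [b1 [qb1 b1b yb1 Sb1]] : exists b1 : R,[/\ q < b1,b1 < b,0 < y b1 - M * r b1 &
  C0 * S 1 - e / 4 < C0 * S (m b1)].
 near (b^'-)=> b1;exists b1;split;near: b1.
 - exact:nbhs_left_gt.
 - exact:nbhs_left_lt.
 - by apply:(cvgr_gt _ yB);rewrite rb mulr0 subr0.
 - by apply:(cvgr_gt _ SB);rewrite mb ltrBlDr ltrDl.
have [a1 [aa1 a1q ya1 Sa1]] : exists a1 : R,[/\ a < a1,a1 < q,y a1 + M * r a1 < 0 &
  C0 * S (m a1) < C0 * S 1 + e / 4].
 near (a^'+)=> a1;exists a1;split;near: a1.
 - exact:nbhs_right_gt.
 - exact:nbhs_right_lt.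
 - by apply:(cvgr_lt _ yA);rewrite ra mulr0 addr0.
 - by apply:(cvgr_lt _ SA);rewrite ma ltrDl.
have a1b1: a1 < b1 by exact:lt_trans qb1.
have in1 t : a1 <= t <= b1 -> a < t < b.
 by move=>/andP[at_ tb];rewrite (lt_le_trans aa1)//= (le_lt_trans tb).
have sab: `[a1,b1] `<=` `[a,b].
 by apply:subset_itv;rewrite bnd_simp ltW.
have cg: {within `[a1,b1],continuous (fun t=> m t / (t * r t))}.
 apply:wcM;first exact:wcS cm.
 apply:wcV;last first.
  move=> t;rewrite /= in_itv/= =>/in1 tab;rewrite mulf_neq0// gt_eqF ?rp//.
  by case/andP: tab=>/(lt_trans a0).
 apply:wcM;last exact:wcS cr.
 exact:wcI.
exists a1,b1;split=>//.
apply:(@le_trans _ _ (w b1 - w a1));last first.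
 apply:(ftc_ge (f':=w')) (ltW a1b1) _ cg _ _.
 - by apply:within_der=> t /in1;exact:dw.
 - by move=> t /andP[at_ tb];apply:dw;apply:in1;rewrite !ltW.
 - by move=> t /andP[at_ tb];apply:w'le;apply:in1;rewrite !ltW.
have rb1: 0 < r b1 by apply:rp;apply:in1;rewrite lexx ltW.
have ra1: 0 < r a1 by apply:rp;apply:in1;rewrite lexx ltW.
have : pi / 2 - e / 4 < atan (y b1 / r b1).
 by apply:hM;rewrite ltr_pdivlMr//;rewrite subr_gt0 in yb1.
have : pi / 2 - e / 4 < atan (- (y a1 / r a1)).
 apply:hM;rewrite -mulNr ltr_pdivlMr//;move: ya1;lra.
rewrite atanN /w;lra.
Unshelve. all: by end_near. Qed.

End theta.

(** * A slope lemma and the concavity of the circle *)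

Section calculus2.
Context {R : realType}.
Notation mu := (@lebesgue_measure R).

Lemma le_Rint (f g : R -> R) (a b : R) : {within `[a, b], continuous f} ->
  {within `[a, b], continuous g} -> (forall x, a <= x <= b -> f x <= g x) ->
  \int[mu]_(x in `[a, b]) f x <= \int[mu]_(x in `[a, b]) g x.
Proof.
move=> cf cg fg;apply:le_Rintegral;[by []|exact:cts_int|exact:cts_int|].
by move=> x;rewrite /= in_itv/=;exact:fg.
Qed.

Lemma Rint_sub (f : R -> R) (a b c d : R) : a <= c -> d <= b ->
  {within `[a, b], continuous f} -> (forall x, a <= x <= b -> 0 <= f x) ->
  \int[mu]_(x in `[c, d]) f x <= \int[mu]_(x in `[a, b]) f x.
Proof.
move=> ac db cf f0;have sub: `[c,d] `<=` `[a,b].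
 by apply:subset_itv;rewrite bnd_simp.
have ifab:=cts_int cf;have ifcd: mu.-integrable `[c,d] (EFin \o f).
 by apply:cts_int;exact:wcS cf.
apply:fine_le;[exact:integrable_fin_num..|].
apply:ge0_subset_integral=>//;first by case/integrableP : ifab.
Qed.

(** Continuous induction downwards from [v], on the set of [s] beyond which [G t - q * t] never
    exceeds its value at [v]. Monotonicity of [G], in place of continuity, carries the bound to the
    infimum. *)
Lemma left_slope (G : R -> R) (v q : R) : 0 <= v -> 0 <= q ->
  (forall s t : R, 0 <= s -> s <= t -> t <= v -> G s <= G t) ->
  (forall t : R, 0 < t -> t <= v -> exists2 d : R, 0 < d &
     forall s : R, 0 <= s -> t - d <= s -> s <= t -> q * (t - s) <= G t - G s) ->
  q * v <= G v - G 0.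
Proof.
move=> v0 q0 Gm Gs;pose f (s : R) : R:=G s - q * s.
pose A : set R:=[set s : R|0 <= s <= v /\ forall t : R,s <= t <= v -> f t <= f v].
have Av: A v.
 split;first by rewrite v0 lexx.
 by move=> t /andP[vt tv];have ->: t = v by apply/eqP;rewrite eq_le tv.
have hA: has_inf A by split;[exists v|exists 0=> s [/andP[]]].
set i:=inf A.
have i0: 0 <= i by apply:lb_le_inf;[exists v|move=> s [/andP[]]].
have iv: i <= v by apply:ge_inf=>//;case:hA.
have gt_i (t : R) : i < t -> t <= v -> f t <= f v.
 move=> it tv;have [s [/andP[s0 sv] As] st]:=inf_lt hA.1 it.
 by apply:As;rewrite (ltW st).
have fi: f i <= f v.
 have [->//|iv']:=eqVneq i v.
 have {}iv' : i < v by rewrite lt_neqAle iv'.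
 apply/ler_addgt0Pr=> e e0.
 pose t:=Num.min v (i + e / (q + 1)).
 have q1: 0 < q + 1 by rewrite ltr_wpDl.
 have it: i < t by rewrite lt_min iv'/= ltrDl divr_gt0.
 have tv: t <= v by rewrite ge_min lexx.
 have:=Gm _ _ i0 (ltW it) tv;have:=gt_i _ it tv.
 have : q * (t - i) <= e.
  apply:(@le_trans _ _ (q * (e / (q + 1)))).
   by rewrite ler_wpM2l// lerBlDl ge_min lexx orbT.
  by rewrite mulrA ler_pdivrMr// mulrDr mulr1 mulrC lerDl ltW.
 rewrite /f;nra.
have Ai: A i.
 split;first by rewrite i0.
 move=> t /andP[];rewrite le_eqVlt=>/predU1P[<- //|it tv];exact:gt_i.
suff i_eq0: i = 0 by move: fi;rewrite /f i_eq0;lra.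
apply/eqP;rewrite eq_le i0 andbT leNgt;apply/negP=> ip.
have [d d0 hd]:=Gs _ ip iv.
pose s:=Num.max 0 (i - d).
have si: s < i by rewrite gt_max ip/= ltrBlDr ltrDl.
have s0: 0 <= s by rewrite le_max lexx.
suff : A s by move=>/(ge_inf hA.2);rewrite leNgt si.
split;first by rewrite s0/= (le_trans (ltW si)).
move=> t /andP[st tv];have [ti|/gt_i->//]:=leP t i.
have t0: 0 <= t by exact:le_trans st.
have:=hd t t0 (le_trans _ st) ti;rewrite le_max lexx orbT=>/(_ isT).
move: fi;rewrite /f;lra.
Qed.

(** The arc lies below its tangent at [m2]. Without denominators this is [r1 * r2 + m1 * m2 <= 1],
    Cauchy-Schwarz for two unit vectors. *)
Lemma concave_circle (m1 m2 : R) : 0 <= m2 -> m2 <= m1 -> m1 <= 1 -> m2 < 1 ->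
  (m1 - m2) * (m2 / Num.sqrt (1 - m2 ^+ 2)) <=
  Num.sqrt (1 - m2 ^+ 2) - Num.sqrt (1 - m1 ^+ 2).
Proof.
move=> m20 m21 m11 m2lt.
have h2: 0 < 1 - m2 ^+ 2 by rewrite subr_gt0 expr_lt1.
have h1: 0 <= 1 - m1 ^+ 2 by rewrite subr_ge0 expr_le1// (le_trans m20).
set r1:=Num.sqrt (1 - m1 ^+ 2);set r2:=Num.sqrt (1 - m2 ^+ 2).
have r20: 0 < r2 by rewrite sqrtr_gt0.
have r10: 0 <= r1 by exact:sqrtr_ge0.
have e1: r1 ^+ 2 = 1 - m1 ^+ 2 by rewrite sqr_sqrtr.
have e2: r2 ^+ 2 = 1 - m2 ^+ 2 by rewrite sqr_sqrtr// ltW.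
rewrite mulrA ler_pdivrMr//.
suff : r1 * r2 <= 1 - m1 * m2 by move: e2;lra.
rewrite -(@ler_pXn2r _ 2)// ?nnegrE ?mulr_ge0 ?(ltW r20)//;last first.
 by rewrite subr_ge0;nra.
rewrite exprMn e1 e2;have:=sqr_ge0 (m1 - m2);lra.
Qed.

End calculus2.

(** * Tangential gain of a chord when the log density is affine *)

Section linear_gain.
Context {R : realType}.
Notation mu := (@lebesgue_measure R).
Variables (c p h0 : R) (n : R -> R) (a b : R).
Let E0 (t : R) : R := expR (h0 + c * (t - p)).
Let k (t : R) : R := t * E0 t.
Hypotheses (c0 : 0 <= c) (a0 : 0 < a) (ap : a < p) (pb : p < b).
Hypothesis dn : forall t, a <= t <= b -> isd n t (E0 t * (1 - t / p)).
Hypotheses (na : n a = 0) (nb : n b = 0).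
Hypothesis nk : forall t, a <= t <= b -> n t <= k t.

Let v := n p.
(** The chord [k - n] is raised by [v - s], with [v] the height of [n] at [p]. [nu s] is the
    relative gap left below [k], cut off at 0 where the raised chord exceeds [k]; as [s] goes from 0
    to [v] the gap grows from nothing to the full one. *)
Let nu (s t : R) : R := Num.max 0 (n t - v + s) / k t.
Let g (s t : R) : R := E0 t * Num.sqrt (1 - (1 - nu s t) ^+ 2).
Let G (s : R) : R := \int[mu]_(t in `[a, b]) g s t.

Let cn : {within `[a, b], continuous n}. Proof. exact:within_der dn. Qed.
Let cE (A : set R) : {within A, continuous E0}.
Proof.
apply:wc_cts=> t;apply:(@der_cts _ _ _ (E0 t * (0 + (0 * (t - p) + c * (1 - 0))))).
apply:der_expR;apply:derD;first exact:derC.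
by apply:derM;[exact:derC|apply:derB;[exact:derI|exact:derC]].
Qed.
Let kp (t : R) : a <= t <= b -> 0 < k t.
Proof. by move=>/andP[at_ _];rewrite mulr_gt0 ?expR_gt0// (lt_le_trans a0). Qed.

Let cg s : {within `[a, b], continuous (g s)}.
Proof.
apply:wcM=>//;apply:wc_sqrt;apply:wcB;first exact:wcC.
have c1: {within `[a,b],continuous (fun t=> 1 - nu s t)}.
 apply:wcB;first exact:wcC.
 apply:wcM.
  apply:(wc_comp (g:=fun x=> Num.max 0 x));last by move=> x;apply:(@continuous_max _ _ (fun=> 0 : R) (fun y : R=> y));[exact:cvg_cst|exact:cvg_id].
  by apply:wcD;[apply:wcB=>//;exact:wcC|exact:wcC].
 apply:wcV;first by apply:wcM=>//;exact:wcI.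
 by move=> t;rewrite /= in_itv/= =>/kp /gt_eqF ->.
exact:(wcM c1 c1).
Qed.

Let n_incr (s t : R) : a <= s -> s <= t -> t <= p -> n s <= n t.
Proof.
move=> as_ st tp;apply:(der_le (f':=fun t=> E0 t * (1 - t / p))) st _ _ _.
- by apply:wcS cn;apply:subset_itv;rewrite bnd_simp// (le_trans tp)// ltW.
- by move=> x /andP[sx xt];apply:dn;rewrite !ltW ?(le_lt_trans as_)// (lt_le_trans xt) ?(le_trans tp)// ltW.
- move=> x /andP[sx xt];rewrite mulr_ge0 ?expR_ge0// subr_ge0 ler_pdivrMr ?(lt_trans a0)// mul1r.
 by rewrite ltW// (lt_le_trans xt).
Qed.

Let n_decr (s t : R) : p <= s -> s <= t -> t <= b -> n t <= n s.
Proof.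
move=> as_ st tp;apply:(der_ge (f':=fun t=> E0 t * (1 - t / p))) st _ _ _.
- by apply:wcS cn;apply:subset_itv;rewrite bnd_simp// (le_trans _ as_)// ltW.
- move=> x /andP[sx xt];apply:dn.
 by rewrite !ltW ?(lt_le_trans xt)// (lt_le_trans ap)// (le_trans as_)// ltW.
- move=> x /andP[sx xt];rewrite mulr_ge0_le0 ?expR_ge0// subr_le0 ler_pdivlMr ?(lt_trans a0)// mul1r.
 by rewrite ltW// (le_lt_trans as_).
Qed.

Let v0 : 0 <= v.
Proof. by rewrite -na;apply:n_incr=>//;exact:ltW. Qed.

Let nu01 (s t : R) : a <= t <= b -> s <= v -> 0 <= nu s t <= 1.
Proof.
move=> tab sv;have k0:=kp tab.
rewrite divr_ge0 ?le_max ?lexx ?(ltW k0)//= ler_pdivrMr// mul1r ge_max (ltW k0)/=.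
by apply:le_trans (nk tab);rewrite -addrA gerDl addrC subr_le0.
Qed.

Let g_le (s s' t : R) : a <= t <= b -> s <= s' -> s' <= v -> g s t <= g s' t.
Proof.
move=> tab ss sv;have k0:=kp tab.
have /andP[h1 h2]:=nu01 tab sv.
have /andP[h3 h4]:=nu01 tab (le_trans ss sv).
rewrite ler_wpM2l ?expR_ge0// ler_wsqrtr// lerD2l lerN2.
rewrite ler_pXn2r ?nnegrE ?subr_ge0// lerD2l lerN2.
rewrite ler_wpM2r ?invr_ge0 ?(ltW k0)// ge_max le_max lexx/=.
by rewrite le_max lerD2l ss orbT.
Qed.

(** Formally the derivative of [g s t] in [s] is [m / (t * r)] for the raised chord. So [G] grows at
    a rate equal to the angle swept by the corresponding extremal curve, which [total_angle] bounds
    below by almost pi. *)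
Let slope (e : R) : 0 < e -> forall t : R, 0 < t -> t <= v -> exists2 d : R, 0 < d &
     forall s : R, 0 <= s -> t - d <= s -> s <= t -> (pi - e) * (t - s) <= G t - G s.
Proof.
move=> e0 s2 s20 s2v.
have [a' /andP[aa' a'p] na'] : exists2 a' : R,a <= a' <= p & n a' = v - s2.
 apply:ivt;[exact:ltW|by apply:wcS cn;apply:subset_itv;rewrite bnd_simp// ltW |].
 by rewrite na subr_ge0 s2v lerBlDr lerDl ltW.
have [b' /andP[pb' b'b] nb'] : exists2 b' : R,p <= b' <= b & - n b' = - (v - s2).
 apply:(@ivt _ (fun t=> - n t))=>//;first exact:ltW.
  move=> x;apply:continuousN;move: x.
  by apply:wcS cn;apply:subset_itv;rewrite bnd_simp// ltW.
 by rewrite nb oppr0 oppr_le0 subr_ge0 s2v lerN2 lerBlDr lerDl ltW.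
move/oppr_inj in nb'.
have {}a'p : a' < p.
 rewrite lt_neqAle a'p andbT;apply/eqP=> e1;move: na';rewrite e1 -/v=>/eqP.
 by rewrite -subr_eq0 opprB addrC addrNK gt_eqF.
have {}pb' : p < b'.
 rewrite lt_neqAle pb' andbT;apply/eqP=> e1;move: nb';rewrite -e1 -/v=>/eqP.
 by rewrite -subr_eq0 opprB addrC addrNK gt_eqF.
pose n' (t : R) : R:=n t - (v - s2).
have dn' (t : R) : a' <= t <= b' -> isd n' t (E0 t * (1 - t / p)).
 move=>/andP[a't tb'];apply:der_eq;first apply:derB (derC _ _).
  by apply:dn;rewrite (le_trans aa')// (le_trans tb').
 by rewrite subr0.
have [||a1 [b1 [a'a1 a1b1 b1b' cm hpi]]] :=
  @total_angle R c p h0 n' a' b' c0 (lt_le_trans a0 aa') a'p pb' dn' _ _ e e0.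
- by rewrite /n' na' subrr.
- by rewrite /n' nb' subrr.
have in' (t : R) : a1 <= t <= b1 -> a' < t < b'.
 by move=>/andP[h1 h2];rewrite (lt_le_trans a'a1)//= (le_lt_trans h2).
have inb (t : R) : a1 <= t <= b1 -> a <= t <= b.
 by move=>/in' /andP[h1 h2];rewrite (le_trans aa' (ltW h1)) (le_trans (ltW h2)).
have sab: `[a1,b1] `<=` `[a,b].
 by move=> t;rewrite /= !in_itv/=;exact:inb.
have cn': {within `[a1,b1],continuous n'}.
 by apply:wcB;[exact:wcS cn|exact:wcC].
(* On the compact interval the gap has a positive minimum: this is how far [s] may decrease before
   the cut-off in [nu] becomes active there. *)
have [q qin qmin]:=EVT_min (ltW a1b1) cn'.
have n'q: 0 < n' q.
 move: qin;rewrite in_itv/= =>/in' /andP[a'q qb'].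
 have aq: a <= q by rewrite (le_trans aa')// ltW.
 have qb: q <= b by rewrite (le_trans (ltW qb')).
 rewrite /n' subr_gt0;have [qp|pq]:=leP q p.
  rewrite -na';apply:(der_lt (f':=fun t=> E0 t * (1 - t / p))) a'q _ _ _.
  + by apply:wcS cn;apply:subset_itv;rewrite bnd_simp.
  + move=> x /andP[sx xt];apply:dn.
   by rewrite (le_trans aa' (ltW sx)) (le_trans (ltW xt)).
  + move=> x /andP[sx xt];rewrite mulr_gt0 ?expR_gt0// subr_gt0 ltr_pdivrMr ?(lt_trans a0)// mul1r.
   by rewrite (lt_le_trans xt).
 rewrite -nb' -ltrN2;apply:(der_lt (f:=fun t=> - n t) (f':=fun t=> - (E0 t * (1 - t / p)))) qb' _ _ _.
 + move=> x;apply:continuousN;move: x.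
  by apply:wcS cn;apply:subset_itv;rewrite bnd_simp.
 + move=> x /andP[sx xt];apply:derN;apply:dn.
  by rewrite (le_trans aq (ltW sx)) (le_trans (ltW xt)).
 + move=> x /andP[sx xt];rewrite -mulrN mulr_gt0 ?expR_gt0// oppr_gt0 subr_lt0 ltr_pdivlMr ?(lt_trans a0)// mul1r.
  exact:lt_trans sx.
exists (n' q)=>// s s0 hs ss2.
have Ge: G s2 - G s = \int[mu]_(t in `[a,b]) (g s2 t - g s t).
 by rewrite RintegralB//;exact:cts_int.
rewrite Ge;apply:(@le_trans _ _ (\int[mu]_(t in `[a1,b1]) (g s2 t - g s t)));last first.
 apply:Rint_sub.
 - by have /inb/andP[] : a1 <= a1 <= b1 by rewrite lexx ltW.
 - by have /inb/andP[] : a1 <= b1 <= b1 by rewrite lexx ltW.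
 - by apply:wcB;exact:cg.
 - by move=> x xab;rewrite subr_ge0 g_le.
rewrite mulrC;apply:(@le_trans _ _ ((s2 - s) *
 \int[mu]_(t in `[a1,b1]) ((1 - n' t / k t) / (t * Num.sqrt (1 - (1 - n' t / k t) ^+ 2))))).
 by rewrite ler_wpM2l// subr_ge0.
have cgB: {within `[a1,b1],continuous (fun x : R=> g s2 x - g s x)}.
 by apply:wcB;[exact:(wcS sab (@cg s2))|exact:(wcS sab (@cg s))].
rewrite -RintegralZl//;last exact:cts_int.
apply:le_Rint.
- by apply:wcM;[exact:wcC|exact:cm].
- exact:cgB.
move=> t tab1;have tab:=inb _ tab1;have k0:=kp tab.
have t0: 0 < t by case/andP: tab=>/(lt_le_trans a0).
have n't: n' q <= n' t by apply:qmin;rewrite in_itv.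
have nu2: nu s2 t = n' t / k t.
 rewrite /nu /n' opprB addrA addrAC;congr (_ / _);apply/max_idPr.
 by apply:le_trans (ltW (lt_le_trans n'q n't)) _;rewrite /n' opprB addrA addrAC.
have nu1: nu s t = (n' t - (s2 - s)) / k t.
 rewrite /nu;congr (_ / _).
 have ->: n t - v + s = n' t - (s2 - s) by rewrite /n';ring.
 apply/max_idPr;move: n't hs;lra.
have /andP[h1 h2]:=nu01 tab s2v.
have /andP[h3 h4]:=nu01 tab (le_trans ss2 s2v).
have nupos: 0 < nu s2 t by rewrite nu2 divr_gt0// (lt_le_trans n'q).
rewrite /g -mulrBr -nu2.
apply:(@le_trans _ _ (E0 t * ((1 - nu s t - (1 - nu s2 t)) * ((1 - nu s2 t) / Num.sqrt (1 - (1 - nu s2 t) ^+ 2)))));last first.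
 rewrite ler_wpM2l ?expR_ge0//;apply:concave_circle.
 - by rewrite subr_ge0.
 - rewrite lerD2l lerN2 nu1 nu2 ler_wpM2r ?invr_ge0 ?(ltW k0)//.
  by rewrite gerDl oppr_le0 subr_ge0.
 - by rewrite gerDl oppr_le0.
 - by rewrite gtrDl oppr_lt0.
have ->: 1 - nu s t - (1 - nu s2 t) = (s2 - s) / k t.
 by rewrite nu1 nu2;field;rewrite gt_eqF.
have E1: E0 t != 0 by rewrite gt_eqF ?expR_gt0.
have sq: 0 < Num.sqrt (1 - (1 - nu s2 t) ^+ 2).
 rewrite sqrtr_gt0 subr_gt0 expr_lt1// ?subr_ge0//.
 by rewrite gtrDl oppr_lt0.
rewrite le_eqVlt;apply/orP;left;apply/eqP.
by rewrite /k;field;rewrite E1 !gt_eqF.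
Qed.

Lemma linear_gain :
  pi * n p <= \int[mu]_(t in `[a, b]) (E0 t * Num.sqrt (1 - (1 - n t / k t) ^+ 2)).
Proof.
have Gv: \int[mu]_(t in `[a,b]) (E0 t * Num.sqrt (1 - (1 - n t / k t) ^+ 2)) = G v.
 apply:eq_Rintegral=> t;rewrite inE/= in_itv/= => tab.
 rewrite /g /nu addrNK;congr (_ * Num.sqrt (1 - (1 - _ / _) ^+ 2)).
 apply/esym/max_idPr;move: tab=>/andP[at_ tb].
 have [tp|/ltW pt]:=leP t p;first by rewrite -na n_incr.
 by rewrite -nb n_decr.
rewrite Gv;apply/ler_addgt0Pr=> e e0.
have G0: 0 <= G 0.
 by apply:Rintegral_ge0=> t _;rewrite mulr_ge0 ?expR_ge0 ?sqrtr_ge0.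
pose e':=Num.min 1 (e / (v + 1)).
have v1: 0 < v + 1 by rewrite ltr_wpDl.
have e'0: 0 < e' by rewrite lt_min ltr01 divr_gt0.
have : (pi - e') * v <= G v - G 0.
 apply:left_slope=>//;last exact:slope.
 - rewrite subr_ge0 ge_min (le_trans _ (pi_ge2 R))//;by rewrite ler1n.
 - move=> s t s0 st tv;apply:le_Rint;[exact:cg..|].
  by move=> x xab;exact:g_le.
have : e' * v <= e.
 apply:(@le_trans _ _ (e / (v + 1) * v)).
  by rewrite ler_wpM2r// ge_min lexx orbT.
 by rewrite mulrAC ler_pdivrMr// mulrDr mulr1 lerDl ltW.
rewrite -/v;lra.
Qed.

End linear_gain.

(** * Integrals over subsets of the line *)

Section measure_aux.
Context {R : realType}.
Implicit Types (s t x y c d : R).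
Notation mu := (@lebesgue_measure R).

Lemma Rint_subset (A B : set R) (f : R -> R) : measurable A -> measurable B ->
  A `<=` B -> mu.-integrable B (EFin \o f) -> (forall x, B x -> 0 <= f x) ->
  \int[mu]_(x in A) f x <= \int[mu]_(x in B) f x.
Proof.
move=> mA mB AB ifB f0;have ifA: mu.-integrable A (EFin \o f) by exact:integrableS ifB.
apply:fine_le;[exact:integrable_fin_num..|].
by apply:ge0_subset_integral=>//;case/integrableP : ifB.
Qed.

Lemma bounded_int (A : set R) (f : R -> R) (M : R) : measurable A -> (mu A < +oo)%E ->
  mfun A f -> (forall x, A x -> `|f x| <= M) -> mu.-integrable A (EFin \o f).
Proof.
move=> mA Aoo mf fM;apply:measurable_bounded_integrable=>//.
exists M;split;first exact:num_real.
by move=> r Mr x Ax;apply:le_trans (fM _ Ax) (ltW Mr).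
Qed.

Lemma mu_itv_fin (a b : R) (x y : bool) : (mu [set` Interval (BSide x a) (BSide y b)] < +oo)%E.
Proof. by rewrite lebesgue_measure_itv/=;case:ifP=>// _;rewrite -EFinD ltry. Qed.

Lemma meas_itv_pos (f : R -> R) (a b : R) : 0 <= a ->
  (forall x, 0 < x -> {for x, continuous f}) -> mfun `[a, b] f.
Proof.
move=> a0 cf;have cf' (c : R) : {within `]0,c],continuous f}.
 by apply:continuous_in_subspaceT=> x;rewrite inE/= in_itv/= =>/andP[/cf].
have mf c : mfun `[0,c] f.
 apply:(@measurable_fun_itv_cc _ 0 c false false).
 exact:subspace_continuous_measurable_fun.
by apply:measurable_funS (mf b)=>//;apply:subset_itvr;rewrite bnd_simp.
Qed.
End measure_aux.

(** * Radial log-convex densities *)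

Section radial.
Context {R : realType}.
Implicit Types (s t x y c d : R).
Variables (h h' w : R -> R).
Definition circ (t : R) : R := t * expR (h t).
(* The standing assumptions on a smooth log-convex radial density [exp h]:
   2 pi [circ t] is the weighted length of the circle of radius t, and 2 pi [w]
   a primitive of it, that is, the weighted area of the disc. *)
Definition radial_profile : Prop := [/\ forall t, isd h t (h' t),
  {homo h' : s t / s <= t}, forall t, 0 <= h' t & forall t, 0 <= t -> isd w t (circ t)].
(** For [t > 0] this is the square root of exp(2h) - (l / t)^2, the tangential component left to a
    field of length exp(h) with radial component [l / t]. It is 0 where [|l|] exceeds [circ], by the
    convention on roots of negative numbers. *)
Definition lateral (l t : R) : R := expR (h t) * Num.sqrt (1 - (l / circ t) ^+ 2).
End radial.

(** * Chords for a log-convex density *)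

Section chord.
Context {R : realType}.
Implicit Types (s t x y c d : R).
Notation mu := (@lebesgue_measure R).
Variables (h h' w : R -> R).
Notation k := (circ h).
Hypothesis Hr : radial_profile h h' w.
Let dh : forall t, isd h t (h' t). Proof. by case:Hr. Qed.
Let h'm : {homo h' : s t / s <= t}. Proof. by case:Hr. Qed.
Let h'0 : forall t, 0 <= h' t. Proof. by case:Hr. Qed.
Let dw : forall t, 0 <= t -> isd w t (k t). Proof. by case:Hr. Qed.

Lemma circ_gt0 t : 0 < t -> 0 < k t. Proof. by move=> t0;rewrite mulr_gt0 ?expR_gt0. Qed.
Lemma circ_ge0 t : 0 <= t -> 0 <= k t. Proof. by move=> t0;rewrite mulr_ge0 ?expR_ge0. Qed.
Lemma der_circ t : isd k t (expR (h t) * (1 + t * h' t)).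
Proof.
apply:der_eq;first by apply:derM;[exact:derI|apply:der_expR].
by rewrite/=;ring.
Qed.

Lemma circ_lt s t : 0 <= s -> s < t -> k s < k t.
Proof.
move=> s0 st;apply:(der_lt (f':=fun t=> expR (h t) * (1 + t * h' t))) st _ _ _.
- by apply:within_der=> x _;exact:der_circ.
- by move=> x _;exact:der_circ.
- move=> x /andP[sx _];rewrite mulr_gt0 ?expR_gt0// ltr_wpDr// mulr_ge0//.
 by rewrite (le_trans s0)// ltW.
Qed.

Lemma circ_le s t : 0 <= s -> s <= t -> k s <= k t.
Proof. by move=> s0;rewrite le_eqVlt=>/predU1P[->//|/(circ_lt s0)/ltW]. Qed.

Lemma w_lt s t : 0 <= s -> s < t -> w s < w t.
Proof.
move=> s0 st;apply:(der_lt (f':=k)) st _ _ _.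
- by apply:within_der=> x /andP[sx _];apply:dw;exact:le_trans sx.
- by move=> x /andP[sx _];apply:dw;rewrite (le_trans s0)// ltW.
- by move=> x /andP[sx _];apply:circ_gt0;exact:le_lt_trans sx.
Qed.

Lemma w_le s t : 0 <= s -> s <= t -> w s <= w t.
Proof. by move=> s0;rewrite le_eqVlt=>/predU1P[->//|/(w_lt s0)/ltW]. Qed.

Lemma w_leE s t : 0 <= s -> 0 <= t -> (w s <= w t) = (s <= t).
Proof.
move=> s0 t0;have [st|ts]:=leP s t;first exact:w_le.
by apply/negbTE;rewrite -ltNge w_lt.
Qed.

Lemma wc_w (a b : R) : 0 <= a -> {within `[a, b], continuous w}.
Proof. by move=> a0;apply:within_der=> x /andP[/(le_trans a0) x0 _];exact:dw. Qed.

Lemma wc_circ (A : set R) : {within A, continuous k}.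
Proof. by apply:wc_cts=> x;apply:der_cts (der_circ x). Qed.

Lemma wc_h (A : set R) : {within A, continuous h}.
Proof. by apply:wc_cts=> x;apply:der_cts (dh x). Qed.

Lemma wc_exph (A : set R) : {within A, continuous (fun t => expR (h t))}.
Proof. by apply:wc_cts=> x;apply:der_cts (der_expR (dh x)). Qed.

Lemma cts_lateral (l : R -> R) x : 0 < x -> {for x, continuous l} ->
  {for x, continuous (fun t => lateral h (l t) t)}.
Proof.
move=> x0 cl;have ck:=der_cts (der_circ x).
apply:cvgM;first exact:der_cts (der_expR (dh x)).
apply:continuous_comp;last exact:sqrt_continuous.
have cm: {for x,continuous (fun t=> l t / k t)}.
 apply:cvgM=>//;apply:(@cvgV _ _ _ _ k)=>//.
 by rewrite gt_eqF// circ_gt0.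
by apply:cvgB;[exact:cvg_cst|exact:(cvgM cm cm)].
Qed.

Lemma lateral_ge0 l t : 0 <= lateral h l t.
Proof. by rewrite mulr_ge0 ?expR_ge0 ?sqrtr_ge0. Qed.

Lemma lateral_le l t : lateral h l t <= expR (h t).
Proof.
rewrite ler_piMr ?expR_ge0// -[leRHS]sqrtr1 ler_wsqrtr//.
by rewrite gerDl oppr_le0 sqr_ge0.
Qed.

Lemma le_lateral l1 l2 t : 0 < t -> `|l2| <= `|l1| -> lateral h l1 t <= lateral h l2 t.
Proof.
move=> t0 l12;rewrite ler_wpM2l ?expR_ge0// ler_wsqrtr// lerD2l lerN2.
rewrite -[leLHS]real_normK ?num_real// -[leRHS]real_normK ?num_real//.
rewrite ler_pXn2r ?nnegrE// !normrM ler_wpM2r//.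
Qed.

Lemma h_le s t : s <= t -> h s <= h t.
Proof.
move=> st;apply:(der_le (f':=h')) st _ _ _=>//.
exact:wc_h.
Qed.

Lemma lateral_int (l : R -> R) (a b : R) : 0 <= a ->
  (forall x, 0 < x -> {for x, continuous l}) ->
  mu.-integrable `[a, b] (EFin \o (fun t => lateral h (l t) t)).
Proof.
move=> a0 cl;apply:(@bounded_int _ _ _ (expR (h b)))=>//.
- exact:mu_itv_fin.
- by apply:meas_itv_pos=>// x x0;apply:cts_lateral=>//;exact:cl.
- move=> x;rewrite /= in_itv/= =>/andP[_ xb].
 rewrite ger0_norm ?lateral_ge0// (le_trans (lateral_le _ _))// ler_expR.
 exact:h_le.
Qed.

Lemma tangent_h p t : h p + h' p * (t - p) <= h t.
Proof.
pose f (t : R) : R:=h t - (h p + h' p * (t - p)).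
have df s : isd f s (h' s - h' p).
 apply:der_eq;first apply:derB;first exact:dh.
  apply:derD;first exact:derC.
  by apply:derM;[exact:derC|apply:derB;[exact:derI|exact:derC]].
 by rewrite/=;ring.
have fp: f p = 0 by rewrite /f subrr mulr0 addr0 subrr.
rewrite -subr_ge0 -/(f t) -fp;have [pt|/ltW tp]:=leP p t.
 apply:(der_le (f':=fun s=> h' s - h' p)) pt _ _ _.
 - by apply:within_der=> x _;exact:df.
 - by move=> x _;exact:df.
 - by move=> x /andP[/ltW px _];rewrite subr_ge0 h'm.
apply:(der_ge (f':=fun s=> h' s - h' p)) tp _ _ _.
- by apply:within_der=> x _;exact:df.
- by move=> x _;exact:df.
- by move=> x /andP[_ /ltW px];rewrite subr_le0 h'm.
Qed.

(* Comparison with the density whose logarithm is the tangent of [h] at p. *)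
Lemma chord_gain (a b p lam l0 : R) : 0 <= a -> a < p -> p < b ->
  lam = p^-1 + h' p -> k a <= lam * w a + l0 -> k b <= lam * w b + l0 ->
  pi * (k p - (lam * w p + l0)) <=
  \int[mu]_(t in `[a, b]) lateral h (lam * w t + l0) t.
Proof.
move=> a0 ap pb elam La Lb;pose L (t : R) : R:=lam * w t + l0.
rewrite -!/(L _) in La Lb *.
have p0: 0 < p by exact:le_lt_trans ap.
have lam0: 0 < lam by rewrite elam ltr_wpDr ?invr_gt0.
have Lint: mu.-integrable `[a,b] (EFin \o (fun t=> lateral h (L t) t)).
 apply:lateral_int=>// x x0;apply:(@der_cts _ _ _ (0 * w x + lam * k x + 0)).
 by apply:derD;[apply:derM;[exact:derC|apply:dw;exact:ltW]|exact:derC].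
set v:=k p - L p.
have [v0|v0]:=leP v 0.
 apply:(@le_trans _ _ 0);first by rewrite mulr_ge0_le0// pi_ge0.
 by apply:Rintegral_ge0=> t _;exact:lateral_ge0.
pose c:=h' p;pose lin (t : R) : R:=h p + c * (t - p).
pose E0 (t : R) : R:=expR (lin t).
pose kl (t : R) : R:=t * E0 t.
have dlin t : isd lin t c.
 apply:der_eq;first (apply:derD;first exact:derC).
  by apply:derM;[exact:derC|apply:derB;[exact:derI|exact:derC]].
 by rewrite/=;ring.
have dkl t : isd kl t (E0 t * (1 + c * t)).
 apply:der_eq;first by apply:derM;[exact:derI|apply:der_expR].
 by rewrite /= /E0;ring.
(* The model has the affine log density [lin] and the area [wl]; its chord [ll] has the same slope
   as [L] and the same value at [p]. *)
have [wl dwl]:=@exists_primitive _ kl (-1) (fun x=> der_cts (dkl x)).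
pose ll (t : R) : R:=lam * (wl t - wl p) + L p.
pose n (t : R) : R:=kl t - ll t.
have dll t : 0 <= t -> isd ll t (lam * kl t).
 move=> t0;apply:der_eq;first apply:derD (derC _ _).
  apply:derM;first exact:derC.
  by apply:derB (derC _ _);apply:dwl;rewrite (lt_le_trans _ t0)// oppr_lt0.
 by rewrite/=;ring.
have dn t : 0 <= t -> isd n t (E0 t * (1 - t / p)).
 move=> t0;apply:der_eq;first by apply:derB;[exact:dkl|exact:dll].
 by rewrite elam /kl /c;ring.
have klp : kl p = k p by rewrite /kl /E0 /lin subrr mulr0 addr0.
have np: n p = v by rewrite /n /ll subrr mulr0 add0r klp.
have ll_le s t : 0 <= s -> s <= t -> ll s <= ll t.
 move=> s0 st;apply:(der_le (f':=fun t=> lam * kl t)) st _ _ _.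
 - by apply:within_der=> x /andP[sx _];apply:dll;exact:le_trans sx.
 - by move=> x /andP[sx _];apply:dll;rewrite (le_trans s0)// ltW.
 - move=> x /andP[sx _];rewrite mulr_ge0 ?(ltW lam0)// mulr_ge0 ?expR_ge0//.
  by rewrite (le_trans s0)// ltW.
have L_lt s t : 0 <= s -> s < t -> L s < L t.
 by move=> s0 st;rewrite ltrD2r ltr_pM2l// w_lt.
have Lpos: 0 <= L a by exact:le_trans (circ_ge0 a0) La.
pose eH (t : R) : R:=expR (h t - lin t).
have keH t : k t = eH t * kl t.
 by rewrite /circ /kl /eH /E0 mulrCA -expRD addrNK.
(* [Z >= 0] means [L / k <= ll / kl]: the model has the larger chord ratio, hence the smaller
   tangential term. [Z] vanishes at [p], and while [ll >= 0] its derivative has the sign of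
   [h' t - h' p]. *)
pose Z (t : R) : R:=eH t * ll t - L t.
have dZ t : 0 <= t -> isd Z t (eH t * (h' t - c) * ll t).
 move=> t0;apply:der_eq;first apply:derB.
  by apply:derM;[apply:der_expR;apply:derB;[exact:dh|exact:dlin]|exact:dll].
  apply:derD (derC _ _);apply:derM;[exact:derC|exact:dw].
 by rewrite /= -/(eH t) keH;ring.
have Zp: Z p = 0 by rewrite /Z /eH /lin subrr mulr0 addr0 subrr expR0 mul1r /ll subrr mulr0 add0r subrr.
have wcZ s t : 0 <= s -> {within `[s,t],continuous Z}.
 move=> s0;apply:(within_der (f':=fun t=> eH t * (h' t - c) * ll t))=> x /andP[sx _].
 by apply:dZ;exact:le_trans sx.
have Zl s : 0 <= s -> s <= p -> 0 <= ll s -> 0 <= Z s.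
 move=> s0 sp lls;rewrite -Zp.
 apply:(der_ge (f':=fun t=> eH t * (h' t - c) * ll t)) sp _ _ _;first exact:wcZ.
 - by move=> x /andP[sx _];apply:dZ;rewrite (le_trans s0)// ltW.
 - move=> x /andP[sx xp];rewrite mulr_le0_ge0//;last first.
   by rewrite (le_trans lls)// ll_le// ltW.
  by rewrite mulr_ge0_le0 ?expR_ge0// subr_le0 h'm// ltW.
(* Were [ll] negative at [a], it would vanish at some [s] between [a] and [p], where
   [Z s = - L s < 0]. *)
have lla: 0 <= ll a.
 rewrite leNgt;apply/negP=> lla.
 have [s /andP[as_ sp] lls] : exists2 s,a <= s <= p & ll s = 0.
  apply:ivt;first exact:ltW.
   by apply:(within_der (f':=fun t=> lam * kl t))=> x /andP[ax _];apply:dll;exact:le_trans ax.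
  by rewrite (ltW lla) /ll subrr mulr0 add0r (le_trans Lpos)// ltW// L_lt.
 have : 0 <= Z s by apply:Zl;[exact:le_trans as_|by []|rewrite lls].
 rewrite /Z lls mulr0 sub0r oppr_ge0 leNgt=>/negP;apply.
 rewrite (le_lt_trans Lpos)// L_lt// lt_neqAle as_ andbT.
 by apply/eqP=> e;move: lla;rewrite e lls ltxx.
have ll0 t : a <= t -> 0 <= ll t by move=> at_;rewrite (le_trans lla)// ll_le.
have Z0 t : a <= t -> 0 <= Z t.
 move=> at_;have [tp|/ltW pt]:=leP t p.
  by apply:Zl=>//;[exact:le_trans at_|exact:ll0].
 rewrite -Zp;apply:(der_le (f':=fun t=> eH t * (h' t - c) * ll t)) pt _ _ _.
 - by apply:wcZ;exact:ltW.
 - by move=> x /andP[px _];apply:dZ;rewrite !ltW ?(lt_trans p0).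
 - move=> x /andP[px _];rewrite mulr_ge0//;last first.
   by apply:ll0;rewrite ltW// (lt_trans ap).
  by rewrite mulr_ge0 ?expR_ge0// subr_ge0 h'm// ltW.
have nle t : a <= t -> k t <= L t -> n t <= 0.
 move=> at_ kL;rewrite subr_le0 -(ler_pM2l (expR_gt0 (h t - lin t))) -/(eH t) -keH.
 by rewrite (le_trans kL)// -subr_ge0 -/(Z t) Z0.
have na: n a <= 0 by exact:nle.
have nb: n b <= 0 by apply:nle=>//;rewrite ltW// (lt_trans ap).
have cn: {within `[a,b],continuous n}.
 by apply:(within_der (f':=fun t=> E0 t * (1 - t / p)))=> x /andP[ax _];apply:dn;exact:le_trans ax.
(* The level [d] puts the ends [a1] and [b1] strictly inside [a, b]; in particular [a1 > 0] even
   when [a = 0], as [linear_gain] requires. *)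
suff main d : 0 < d -> d < v -> pi * (v - d) <= \int[mu]_(t in `[a,b]) lateral h (L t) t.
 apply/ler_addgt0Pr=> e e0.
 pose d:=Num.min (v / 2) (e / pi).
 have d0: 0 < d by rewrite lt_min !divr_gt0 ?pi_gt0.
 have dv: d < v by rewrite gt_min ltr_pdivrMr// ltr_pMr// ltr1n.
 have : pi * d <= e by rewrite mulrC -ler_pdivlMr ?pi_gt0// ge_min lexx orbT.
 by have:=main d d0 dv;rewrite mulrBr lerBlDr=>/le_trans h1 h2;apply:h1;rewrite lerD2l.
move=> d0 dv.
have [a1 /andP[aa1 a1p] na1] : exists2 x,a <= x <= p & n x = d.
 apply:ivt;[exact:ltW|by apply:wcS cn;apply:subset_itv;rewrite bnd_simp// ltW |].
 by rewrite np (le_trans na) ltW.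
have [b1 /andP[pb1 b1b] nb1] : exists2 x,p <= x <= b & - n x = - d.
 apply:(@ivt _ (fun t=> - n t));first exact:ltW.
  move=> x;apply:continuousN;move: x.
  by apply:wcS cn;apply:subset_itv;rewrite bnd_simp// ltW.
 by rewrite np !lerN2 (le_trans nb) !ltW.
move/oppr_inj in nb1.
have {}aa1 : a < a1.
 by rewrite lt_neqAle aa1 andbT;apply/eqP=> e;move: na;rewrite e na1 leNgt d0.
have {}a1p : a1 < p.
 by rewrite lt_neqAle a1p andbT;apply/eqP=> e;move: dv;rewrite -np -e na1 ltxx.
have {}pb1 : p < b1.
 by rewrite lt_neqAle pb1 andbT;apply/eqP=> e;move: dv;rewrite -np e nb1 ltxx.
have a10: 0 < a1 by exact:le_lt_trans aa1.
have kl0 t : a1 <= t -> 0 < kl t.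
 by move=> a1t;rewrite mulr_gt0 ?expR_gt0// (lt_le_trans a10).
have n0k t : a1 <= t <= b1 -> n t - d <= kl t.
 move=>/andP[a1t _];rewrite lerBlDr ler_wpDr ?(ltW d0)// lerBlDr lerDl ll0//.
 by rewrite (le_trans (ltW aa1)).
have:=@linear_gain R c p (h p) (fun t=> n t - d) a1 b1 (h'0 p) a10 a1p pb1 _ _ _ n0k.
rewrite -/(n p) np na1 nb1 subrr=>/(_ _ erefl erefl)h1.
apply:le_trans (h1 _) _.
 move=> t /andP[a1t _];apply:der_eq;first apply:derB (derC _ _).
  by apply:dn;rewrite ltW// (lt_le_trans a10).
 by rewrite subr0.
have sub: `[a1,b1] `<=` `[a,b] by apply:subset_itv;rewrite bnd_simp// ltW.
apply:(@le_trans _ _ (\int[mu]_(t in `[a1,b1]) lateral h (L t) t));last first.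
 by apply:Rint_subset=>// t _;exact:lateral_ge0.
apply:le_Rintegral=>//;last 2 first.
- exact:integrableS Lint.
- move=> t;rewrite /= in_itv/= =>/[dup] tab /andP[a1t tb1].
 have t0: 0 < t by exact:lt_le_trans a1t.
 have at_: a <= t by rewrite (le_trans (ltW aa1)).
 apply:ler_pM;rewrite ?expR_ge0 ?sqrtr_ge0//.
  by rewrite ler_expR tangent_h.
 rewrite ler_wsqrtr// lerD2l lerN2.
 have Lt: 0 <= L t.
  by rewrite (le_trans Lpos)//;move: at_;rewrite le_eqVlt=>/predU1P[->//|/(L_lt _ _ a0)/ltW].
 have h2: L t / k t <= ll t / kl t.
  rewrite ler_pdivrMr ?circ_gt0// mulrAC ler_pdivlMr ?kl0//.
  have ->: ll t * k t = (eH t * ll t) * kl t by rewrite keH mulrA [ll t * _]mulrC.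
  by rewrite ler_pM2r ?kl0// -subr_ge0 Z0.
 have h3: ll t / kl t <= 1 - (n t - d) / kl t.
  rewrite -[X in X - _](@divff _ (kl t)) ?gt_eqF ?kl0// -mulrBl.
  rewrite ler_wpM2r ?invr_ge0 ?(ltW (kl0 _ _))// /n;move: d0;lra.
 rewrite ler_pXn2r ?nnegrE//;first exact:le_trans h3.
  by rewrite divr_ge0// ltW// circ_gt0.
 by rewrite (le_trans _ (le_trans h2 h3))// divr_ge0// ltW// circ_gt0.
apply:cts_int;apply:wcM.
 by apply:wc_cts=> x;apply:der_cts (der_expR (dlin x)).
apply:wc_sqrt;apply:wcB;first exact:wcC.
have c1: {within `[a1,b1],continuous (fun t=> 1 - (n t - d) / kl t)}.
 apply:wcB;first exact:wcC.
 apply:wcM;first by apply:wcB;[exact:wcS cn|exact:wcC].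
 apply:wcV;first by apply:wc_cts=> x;apply:der_cts (dkl x).
 by move=> t;rewrite /= in_itv/= =>/andP[a1t _];rewrite gt_eqF// kl0.
exact:(wcM c1 c1).
Qed.

End chord.

(** * Smooth functions of one variable *)

Section smooth1.
Context {R : realType}.
Notation mu := (@lebesgue_measure R).
Implicit Types (f g : R -> R) (a b c x y s t : R) (k n m : nat).

Fixpoint S1 k g : Prop := continuous g /\
  if k is k'.+1 then (forall x, derivable g x 1) /\ S1 k' (derive1 g) else True.

Definition smooth1 g : Prop := forall k, S1 k g.

Lemma isd_derive1 g (g' : R -> R) : (forall x, isd g x (g' x)) -> (derive1 g) = g'.
Proof.
by move=> dg;apply/funext=> x;rewrite derive1E;apply:derive_val;exact:dg.
Qed.

Lemma S1_cts k g : S1 k g -> continuous g.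
Proof. by case:k=>[|k] []. Qed.

Lemma S1_intro k g (g' : R -> R) : (forall x, isd g x (g' x)) -> S1 k g' -> S1 k.+1 g.
Proof.
move=> dg cg';split;first by move=> x;exact:der_cts (dg x).
by split;[move=> x;have []:=dg x|rewrite (isd_derive1 dg)].
Qed.

Lemma S1_isd k g x : S1 k.+1 g -> isd g x ((derive1 g) x).
Proof. by move=>[_ [dg _]];apply:DeriveDef=>//;rewrite derive1E. Qed.

Lemma S1_der k g : S1 k.+1 g -> S1 k (derive1 g).
Proof. by case=> _ []. Qed.

Lemma S1S k g : S1 k.+1 g -> S1 k g.
Proof.
elim:k g=>[|k IH] g [cg [dg kg]];first by split.
by split=>//;split=>//;exact:IH.
Qed.

Lemma smooth1_isd g x : smooth1 g -> isd g x ((derive1 g) x).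
Proof. by move=>/(_ 1%N);exact:S1_isd. Qed.

Lemma smooth1_der g : smooth1 g -> smooth1 (derive1 g).
Proof. by move=> sg k;exact:S1_der (sg k.+1). Qed.

Lemma smooth1_cts g : smooth1 g -> continuous g.
Proof. by move=>/(_ 0%N) []. Qed.

Lemma S1_cst k c : S1 k (fun=> c).
Proof.
elim:k c=>[|k IH] c;first by split=>// x;exact:cvg_cst.
by apply:(@S1_intro _ _ (fun=> 0));[move=> x;exact:derC|exact:IH].
Qed.

Lemma S1_id k : S1 k (fun x => x).
Proof.
case:k=>[|k];first by split=>// x;exact:cvg_id.
by apply:(@S1_intro _ _ (fun=> 1));[move=> x;exact:derI|exact:S1_cst].
Qed.

Lemma S1D k f g : S1 k f -> S1 k g -> S1 k (fun x => f x + g x).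
Proof.
elim:k f g=>[|k IH] f g kf kg.
 by split=>// x;apply:cvgD;[exact:(S1_cts kf)|exact:(S1_cts kg)].
apply:(S1_intro (g':=fun x=>(derive1 f) x + (derive1 g) x)).
 by move=> x;apply:derD;apply:S1_isd;eassumption.
by apply:IH;exact:S1_der.
Qed.

Lemma S1M k f g : S1 k f -> S1 k g -> S1 k (fun x => f x * g x).
Proof.
elim:k f g=>[|k IH] f g kf kg.
 by split=>// x;apply:cvgM;[exact:(S1_cts kf)|exact:(S1_cts kg)].
apply:(S1_intro (g':=fun x=>(derive1 f) x * g x + f x * (derive1 g) x)).
 by move=> x;apply:derM;apply:S1_isd;eassumption.
by apply:S1D;apply:IH=>//;[exact:S1_der|exact:S1S|exact:S1S|exact:S1_der].
Qed.

Lemma S1N k f : S1 k f -> S1 k (fun x => - f x).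
Proof.
move=> kf;rewrite (_ : (fun x=> _) = (fun x=> -1 * f x)).
 by apply:S1M=>//;exact:S1_cst.
by apply/funext=> x;rewrite mulN1r.
Qed.

Lemma S1B k f g : S1 k f -> S1 k g -> S1 k (fun x => f x - g x).
Proof. by move=> kf kg;apply:S1D=>//;exact:S1N. Qed.

Lemma S1V k f : (forall x, f x != 0) -> S1 k f -> S1 k (fun x => (f x)^-1).
Proof.
move=> f0;elim:k=>[|k IH] kf.
 by split=>// x;apply:cvgV=>//;exact:(S1_cts kf).
apply:(S1_intro (g':=fun x=> - (derive1 f) x * ((f x)^-1 * (f x)^-1))).
 move=> x;apply:der_eq;first by apply:derV;[exact:f0|exact:S1_isd kf].
 by rewrite expr2 invfM.
apply:S1M;first by apply:S1N;exact:S1_der.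
by apply:S1M;exact/IH/S1S.
Qed.

Lemma S1_affine k f a b : S1 k f -> S1 k (fun x => f (a * x + b)).
Proof.
elim:k f=>[|k IH] f kf.
 split=>// x;apply:continuous_comp;last exact:(S1_cts kf).
 by apply:cvgD;[apply:cvgM;[exact:cvg_cst|exact:cvg_id]|exact:cvg_cst].
apply:(S1_intro (g':=fun x=>(derive1 f) (a * x + b) * a)).
 move=> x;apply:der_comp;last exact:S1_isd kf.
 apply:der_eq;first apply:derD (derC _ _).
  by apply:derM;[exact:derC|exact:derI].
 by rewrite/=;ring.
by apply:S1M;[apply:IH;exact:S1_der|exact:S1_cst].
Qed.

Lemma pow_le_exp n y : 0 <= y -> y ^+ n.+1 <= n.+1%:R ^+ n.+1 * expR y.
Proof.
move=> y0;have n0: (0 : R) < n.+1%:R by rewrite ltr0n.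
have ->: expR y = expR (y / n.+1%:R) ^+ n.+1.
 by rewrite -expRM_natl mulrC divfK// gt_eqF.
rewrite -exprMn ler_pXn2r ?nnegrE ?mulr_ge0 ?expR_ge0 ?(ltW n0)//.
rewrite mulrC -ler_pdivrMr//.
by apply:le_trans (expR_ge1Dx _);rewrite lerDr.
Qed.

Lemma isd_sqr f C : f 0 = 0 -> (forall x, `|f x| <= C * x ^+ 2) -> isd f 0 0.
Proof.
move=> f0 fC.
have cv: h^-1 *: (f (h *: (1 : R) + 0) - f 0) @[h --> 0^'] --> (0 : R).
 apply/cvgrPdist_le=> e e0;near=> h.
 have h0: h != 0 by near: h;exact:nbhs_dnbhs_neq.
 rewrite sub0r normrN f0 subr0 addr0 /GRing.scale/= mulr1 normrM normfV.
 rewrite ler_pdivrMl ?normr_gt0//.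
 apply:le_trans (fC _) _;rewrite -real_normK ?num_real// expr2 mulrA mulrC.
 rewrite ler_wpM2l//.
 have hl: `|h| <= e / (`|C| + 1).
  near: h;apply:dnbhs0_le;rewrite divr_gt0// ltr_wpDl//.
 apply:(@le_trans _ _ ((`|C| + 1) * `|h|)).
  by rewrite ler_wpM2r// (le_trans (ler_norm _))// lerDl.
 by rewrite mulrC -ler_pdivlMr// ltr_wpDl.
apply:DeriveDef;first by apply/cvg_ex;exists 0.
exact:cvg_lim cv.
Unshelve. all: by end_near. Qed.

(** The power of [x^-1] closes the family under differentiation: [flat n] has derivative
    [flat n.+2 - n * flat n.+1], so one induction proves all members smooth. *)
Definition flat n x : R := if 0 < x then x^-1 ^+ n * expR (- x^-1) else 0.

Lemma flat_ge0 n x : 0 <= flat n x.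
Proof.
by rewrite /flat;case:ifP=>// x0;rewrite mulr_ge0 ?expR_ge0// exprn_ge0// invr_ge0 ltW.
Qed.

Lemma flat_gt0 n x : 0 < x -> 0 < flat n x.
Proof. by move=> x0;rewrite /flat x0 mulr_gt0 ?expR_gt0// exprn_gt0// invr_gt0. Qed.

Lemma flat_le0 n x : x <= 0 -> flat n x = 0.
Proof. by rewrite /flat leNgt=>/negbTE ->. Qed.

Lemma der_flat n x : isd (flat n) x (flat n.+2 x - n%:R * flat n.+1 x).
Proof.
have [x0|x0|->]:=ltgtP x 0.
- rewrite !flat_le0 ?(ltW x0)// mulr0 subrr.
 apply:(near_eq_is_derive _ (derC 0 x)).
 near=> y;rewrite flat_le0//;apply:ltW;near: y;exact:lt_nbhsl.
- rewrite /flat x0.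
 apply:(near_eq_is_derive (f:=fun y=> y^-1 ^+ n * expR (- y^-1))).
  by near=> y;rewrite ifT//;near: y;exact:lt_nbhsr.
 have dV: isd (fun y : R=> y^-1) x (- 1 / x ^+ 2).
  by apply:(@derV _ (fun y=> y));[rewrite gt_eqF|exact:derI].
 apply:der_eq;first apply:derM.
 + have /(_ n) : forall m,isd (fun y : R=> y^-1 ^+ m) x (- m%:R * x^-1 ^+ m.+1).
   elim=>[|m IH].
    rewrite mulr0n oppr0 mul0r.
    by rewrite (_ : (fun y=> _) = (fun=> 1));[exact:derC|apply/funext=> y;rewrite expr0].
   rewrite (_ : (fun y=> _) = (fun y=> y^-1 * y^-1 ^+ m));last by apply/funext=> y;rewrite exprS.
   apply:der_eq;first exact:derM dV IH.
   by rewrite -natr1 /= expr2 invfM !exprS;ring.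
  by apply.
 + by apply:der_expR;apply:derN;exact:dV.
 by rewrite /= expr2 invfM !exprS;ring.
- rewrite !flat_le0// mulr0 subrr.
 apply:(@isd_sqr _ ((n.+2)%:R ^+ n.+2));first by rewrite flat_le0.
 move=> y;rewrite ger0_norm ?flat_ge0//.
 have [y0|y0]:=leP y 0;first by rewrite flat_le0// mulr_ge0 ?sqr_ge0 ?exprn_ge0.
 rewrite /flat y0 expRN.
 have:=@pow_le_exp n.+1 y^-1;rewrite invr_ge0 ltW// =>/(_ isT) h.
 rewrite ler_pdivrMr ?expR_gt0// mulrAC.
 rewrite -ler_pdivrMr ?exprn_gt0//;apply:le_trans h.
 by rewrite -[X in _ * X]exprVn -exprD addn2.
Unshelve. all: by end_near. Qed.

Lemma flat_smooth n : smooth1 (flat n).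
Proof.
move=> k;elim:k n=>[|k IH] n;first by split=>// x;exact:der_cts (der_flat n x).
apply:(S1_intro (der_flat n));apply:S1B;first exact:IH.
by apply:S1M;[exact:S1_cst|exact:IH].
Qed.

Definition step x : R := flat 0 x / (flat 0 x + flat 0 (1 - x)).

(** [x] and [1 - x] are never both nonpositive. *)
Let step_den x : 0 < flat 0 x + flat 0 (1 - x).
Proof.
have [x0|x0]:=leP x 0.
 by rewrite ltr_wpDl ?flat_ge0// flat_gt0// subr_gt0 (le_lt_trans x0).
by rewrite ltr_pwDl ?flat_ge0// flat_gt0.
Qed.

Lemma step_smooth : smooth1 step.
Proof.
move=> k;apply:S1M;first exact:flat_smooth.
apply:S1V=>[x|];first by rewrite gt_eqF.
apply:S1D;first exact:flat_smooth.
rewrite (_ : (fun x=> _) = (fun x=> flat 0 (-1 * x + 1))).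
 by apply:S1_affine;exact:flat_smooth.
by apply/funext=> x;rewrite mulN1r addrC.
Qed.

Lemma step_ge0 x : 0 <= step x.
Proof. by rewrite divr_ge0 ?flat_ge0// ltW. Qed.

Lemma step_le1 x : step x <= 1.
Proof. by rewrite ler_pdivrMr// mul1r lerDl flat_ge0. Qed.

Lemma step0 x : x <= 0 -> step x = 0.
Proof. by move=> x0;rewrite /step flat_le0// mul0r. Qed.

Lemma step1 x : 1 <= x -> step x = 1.
Proof.
move=> x1;have e: flat 0 (1 - x) = 0 by rewrite flat_le0// subr_le0.
by have:=step_den x;rewrite /step e addr0=> h;rewrite divff// gt_eqF.
Qed.

End smooth1.

(** * Smooth approximation that respects upper and lower bounds *)

Section smooth_approximation.
Context {R : realType}.
Notation mu := (@lebesgue_measure R).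
Implicit Types (f g : R -> R) (a b c x y s t e lo hi : R).

Lemma convex_between lo hi u v c : 0 <= c -> c <= 1 -> lo <= u <= hi -> lo <= v <= hi ->
  lo <= u + (v - u) * c <= hi.
Proof.
move=> c0 c1 /andP[lu uh] /andP[lv vh];apply/andP;split.
 have:=mulr_ge0 c0 (_ : 0 <= v - lo);have:=mulr_ge0 (_ : 0 <= 1 - c) (_ : 0 <= u - lo).
 by rewrite !subr_ge0=>/(_ c1 lu) ? /(_ lv) ?;nra.
have:=mulr_ge0 c0 (_ : 0 <= hi - v);have:=mulr_ge0 (_ : 0 <= 1 - c) (_ : 0 <= hi - u).
by rewrite !subr_ge0=>/(_ c1 uh) ? /(_ vh) ?;nra.
Qed.

(** Sampled values of [f] are joined by smooth steps, so only convex combinations of values of [f]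
    occur and the bounds survive. The right end [c] advances by continuous induction; the
    approximant is constant beyond [c], ready for the next step. *)
Lemma smooth_uniform f a b lo hi e : a <= b -> 0 < e -> continuous f ->
  (forall x, a <= x <= b -> lo <= f x <= hi) ->
  exists g, [/\ smooth1 g, forall x, lo <= g x <= hi &
    forall x, a <= x <= b -> `|g x - f x| <= e].
Proof.
move=> ab e0 cf fb.
pose P c:=a <= c <= b /\ exists g,[/\ smooth1 g,forall x,lo <= g x <= hi,
 forall x,a <= x <= c -> `|g x - f x| <= e & forall x,c <= x -> g x = f c].
suff [_ [g [sg gb gf _]]] : P b by exists g.
have Pa: P a.
 split;first by rewrite lexx.
 exists (fun=> f a);split=>//.
 - by move=> k;exact:S1_cst.
 - by move=> _;apply:fb;rewrite lexx.
 - move=> x /andP[ax xa];have ->: x = a by apply/eqP;rewrite eq_le xa.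
  by rewrite subrr normr0 ltW.
have ext c c' : P c -> c < c' -> c' <= b ->
  (forall x y,c <= x <= c' -> c <= y <= c' -> `|f x - f y| <= e) -> P c'.
 move=>[/andP[ac cb] [g [sg gb gf gc]]] cc' c'b osc.
 have d0: 0 < c' - c by rewrite subr_gt0.
 split;first by rewrite c'b (le_trans ac) ?ltW.
 exists (fun x=> g x + (f c' - f c) * step ((c' - c)^-1 * x + - (c' - c)^-1 * c)).
 have stE x : (c' - c)^-1 * x + - (c' - c)^-1 * c = (x - c) / (c' - c).
  by rewrite mulNr -mulrBr mulrC.
 have st0 x : x <= c -> step ((c' - c)^-1 * x + - (c' - c)^-1 * c) = 0.
  by move=> xc;rewrite stE step0// pmulr_lle0 ?invr_gt0// subr_le0.
 have fcb: lo <= f c <= hi by apply:fb;rewrite ac.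
 have fc'b: lo <= f c' <= hi by apply:fb;rewrite c'b (le_trans ac)// ltW.
 split.
 - move=> k;apply:S1D;first exact:sg.
  by apply:S1M;[exact:S1_cst|apply:S1_affine;exact:step_smooth].
 - move=> x;have [xc|cx]:=leP x c;first by rewrite st0// mulr0 addr0.
  rewrite gc;last exact:ltW.
  by apply:convex_between;rewrite ?step_ge0 ?step_le1.
 - move=> x /andP[ax xc'];have [xc|cx]:=leP x c.
   by rewrite st0// mulr0 addr0 gf// ax.
  have xI: c <= x <= c' by rewrite ltW.
  have:=osc c x;rewrite lexx xI (ltW cc')=>/(_ isT isT);rewrite ler_norml=> h1.
  have:=osc c' x;rewrite lexx xI (ltW cc')=>/(_ isT isT);rewrite ler_norml=> h2.
  rewrite gc ?(ltW cx)//.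
  have ->: f c + (f c' - f c) * step ((c' - c)^-1 * x + - (c' - c)^-1 * c) - f x =
   (f c - f x) + ((f c' - f x) - (f c - f x)) * step ((c' - c)^-1 * x + - (c' - c)^-1 * c).
   by ring.
  by rewrite ler_norml;apply:convex_between;rewrite ?step_ge0 ?step_le1.
 - move=> x c'x;rewrite gc ?(le_trans (ltW cc'))// stE step1;first by rewrite mulr1 addrC subrK.
  by rewrite ler_pdivlMr// mul1r lerD2r.
have hA: has_sup P by split;[exists a|exists b=> s [/andP[]]].
set s:=sup P.
have as_: a <= s by apply:ub_le_sup=>//;case:hA.
have sb: s <= b by apply:ge_sup;[exists a|move=> x [/andP[]]].
have /cvgrPdist_lt/(_ (e / 2))[|d /= d0 hd]:=cf s;first by rewrite divr_gt0.
have near_s x y : `|s - x| < d -> `|s - y| < d -> `|f x - f y| <= e.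
 move=>/hd h1 /hd h2;rewrite (_ : f x - f y = (f s - f y) - (f s - f x));last by ring.
 by rewrite (le_trans (ler_normB _ _))// (splitr e) lerD// ltW.
have sds: s - d < sup P by rewrite ltrBlDr ltrDl.
have [c [/andP[ac cb] Pc] sc]:=sup_gt hA.1 sds.
have cs: c <= s by apply:ub_le_sup;[case:hA|split=>//;rewrite ac].
pose c':=Num.min b (s + d / 2).
have c'b: c' <= b by rewrite ge_min lexx.
have c's: c' <= s + d / 2 by rewrite ge_min lexx orbT.
have sc': s <= c' by rewrite le_min sb/= lerDl divr_ge0// ltW.
have Pc': P c'.
 have [e1|ne]:=eqVneq c c';first by rewrite -e1;split=>//;rewrite ac.
 apply:(ext c)=>//;first by split=>//;rewrite ac.
  by rewrite lt_neqAle ne/= (le_trans cs).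
 have h x : c <= x <= c' -> `|s - x| < d.
  move=>/andP[cx xc'];rewrite ltr_norml;move: d0 sc;rewrite -/s;lra.
 by move=> x y /h hx /h hy;exact:near_s.
have c's': c' <= s by apply:ub_le_sup=>//;case:hA.
suff -> : b = c' by [].
apply/eqP;rewrite eq_le c'b andbT leNgt;apply/negP=> c'b'.
move: c's';rewrite leNgt=>/negP;apply;rewrite lt_min ltrDl divr_gt0// andbT.
by rewrite (le_lt_trans sc').
Qed.

(** A continuous L1 approximation is clamped between [lo] and [hi], which cannot increase its
    distance to [f], and then smoothed uniformly. *)
Lemma smooth_L1 f a b lo hi e : a < b -> 0 < e -> mfun `[a, b] f ->
  (forall x, a <= x <= b -> lo <= f x <= hi) ->
  exists g, [/\ smooth1 g, forall x, lo <= g x <= hi &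
    (\int[mu]_(x in `[a, b]) `|f x - g x| <= e)%R].
Proof.
move=> ab e0 mf fb.
have muab: (mu `[a,b]%classic < +oo)%E by rewrite lebesgue_measure_itv/= lte_fin ab ltry.
have bdd (g : R -> R) M : mfun `[a,b] g -> (forall x,a <= x <= b -> `|g x| <= M) ->
  mu.-integrable `[a,b] (EFin \o g).
 move=> mg gM;apply:measurable_bounded_integrable=>//.
 exists M;split;first exact:num_real.
 by move=> y My x;rewrite /= in_itv/= =>/gM h;rewrite (le_trans h)// ltW.
have lohi: lo <= hi.
 have /fb/andP[h1 h2] : a <= a <= b by rewrite lexx ltW.
 exact:le_trans h2.
have fM x : a <= x <= b -> `|f x| <= `|lo| + `|hi|.
 move=>/fb /andP[h1 h2];have:=ler_norm hi;have:=ler_norm (- lo).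
 by rewrite normrN ler_norml=> ? ?;have:=normr_ge0 hi;have:=normr_ge0 lo;lra.
have If:=bdd _ _ mf fM.
have [g_ [cg Ig /fine_cvgP[_ /cvgrPdist_lt/(_ (e / 2))]]] :=
 approximation_continuous_integrable (measurable_itv _) muab If.
rewrite divr_gt0// =>/(_ isT)[N _ /(_ N (leqnn N))/=].
rewrite sub0r normrN=>/(le_lt_trans (ler_norm _)) hN.
pose g1 x:=Num.max lo (Num.min hi (g_ N x)).
have cg1: continuous g1.
 move=> x;apply:(@continuous_max _ _ (fun=> lo) (fun y=> Num.min hi (g_ N y)));first exact:cvg_cst.
 by apply:(@continuous_min _ _ (fun=> hi) (g_ N));[exact:cvg_cst|exact:cg].
have g1b x : lo <= g1 x <= hi by rewrite /g1 le_max lexx/= ge_max lohi ge_min lexx.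
have be0: 0 < e / 2 / (b - a) by rewrite !divr_gt0// subr_gt0.
have [g [sg gb gg1]]:=smooth_uniform (ltW ab) be0 cg1 (fun x _=> g1b x).
exists g;split=>//.
have cg': continuous g by exact:smooth1_cts.
have mg: mfun `[a,b] g by apply:measurable_funTS;exact:cts_mfun.
have mgN: mfun `[a,b] (g_ N) by apply:measurable_funTS;exact:cts_mfun.
have I1: mu.-integrable `[a,b] (EFin \o (fun x=> `|f x - g_ N x|)).
 have I0: mu.-integrable `[a,b] ((EFin \o f) \- (EFin \o g_ N))%E by apply:integrableB=>//;exact:Ig.
 exact:integrable_abse I0.
have I2: mu.-integrable `[a,b] (EFin \o (fun=> e / 2 / (b - a))).
 by apply:cts_int;exact:wcC.
apply:(@le_trans _ _ (\int[mu]_(x in `[a,b]) (`|f x - g_ N x| + e / 2 / (b - a)))%R).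
 apply:le_Rintegral=>//.
 - apply:(bdd _ ((`|lo| + `|hi|) + (`|lo| + `|hi|))).
   by apply:measurableT_comp=>//;exact:measurable_funB.
  move=> x xab;rewrite normr_id (le_trans (ler_normB _ _))// lerD ?fM//.
  have /andP[h1 h2]:=gb x;have:=ler_norm hi;have:=ler_norm (- lo).
  by rewrite normrN ler_norml=> ? ?;have:=normr_ge0 hi;have:=normr_ge0 lo;lra.
 - have I0: mu.-integrable `[a,b] ((EFin \o (fun x=> `|f x - g_ N x|%R)) \+ (EFin \o (fun=>(e / 2 / (b - a))%R)))%E by apply:integrableD.
  exact:I0.
 - move=> x;rewrite /= in_itv/= => xab.
  rewrite (_ : f x - g x = (f x - g1 x) + (g1 x - g x));last by ring.
  rewrite (le_trans (ler_normD _ _))// lerD//;last by rewrite distrC gg1.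
  have /andP[h1 h2]:=fb x xab;rewrite /g1.
  have:=ler_norm (f x - g_ N x);have:=ler_norm (- (f x - g_ N x));rewrite normrN.
  move: `|f x - g_ N x| => z hz1 hz2;rewrite ler_norml.
  case:(leP hi (g_ N x))=> h3;first by case:(leP lo hi)=> h4;apply/andP;split;lra.
  by case:(leP lo (g_ N x))=> h4;apply/andP;split;lra.
rewrite RintegralD// [leRHS]splitr lerD//.
 by rewrite ltW// (le_lt_trans _ hN)//.
rewrite Rintegral_cst//.
rewrite (_ : fine _ = b - a);first by rewrite divfK// subr_eq0 gt_eqF.
have e1: mu `[a,b]%classic = (b - a)%:E by rewrite lebesgue_measure_itv/= lte_fin ab.
exact:(congr1 fine e1).
Qed.

End smooth_approximation.

(** * Differentiability classes in the plane *)

Section plane_calculus.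
Context {R : realType}.
Implicit Types (u v : R * R -> R) (x y : R * R) (a b c s t : R) (k : nat).

(** Partial derivatives seen as one-variable derivatives, so that the rules for [isd] apply; [pd1P]
    and [pd2P] identify them with the directional ones. *)
Definition pd1 u x a : Prop := isd (fun s => u (s, x.2)) x.1 a.
Definition pd2 u x a : Prop := isd (fun s => u (x.1, s)) x.2 a.

Let quot1 u x : (fun h : R => h^-1 *: ((u \o shift x) (h *: (1, 0)) - u x)) =
  (fun h : R => h^-1 *: (((fun s => u (s, x.2)) \o shift x.1) (h *: 1) - u (x.1, x.2))).
Proof.
apply/funext=> h;case:x=> x1 x2/=.
rewrite (_ : h *: ((1,0) : R * R) + (x1,x2) = (h *: 1 + x1,x2))//.
by congr pair;rewrite /= scaler0 add0r.
Qed.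

Let quot2 u x : (fun h : R => h^-1 *: ((u \o shift x) (h *: (0, 1)) - u x)) =
  (fun h : R => h^-1 *: (((fun s => u (x.1, s)) \o shift x.2) (h *: 1) - u (x.1, x.2))).
Proof.
apply/funext=> h;case:x=> x1 x2/=.
rewrite (_ : h *: ((0,1) : R * R) + (x1,x2) = (x1,h *: 1 + x2))//.
by congr pair;rewrite /= scaler0 add0r.
Qed.

Lemma pd1P u x a : pd1 u x a <-> derivable u x (1, 0) /\ partial1 u x = a.
Proof.
rewrite /pd1 /partial1 /derivable /derive quot1;split=>[[du <-]|[du <-]];first by split.
exact:DeriveDef.
Qed.

Lemma pd2P u x a : pd2 u x a <-> derivable u x (0, 1) /\ partial2 u x = a.
Proof.
rewrite /pd2 /partial2 /derivable /derive quot2;split=>[[du <-]|[du <-]];first by split.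
exact:DeriveDef.
Qed.

Lemma Ck_intro k u (u1 u2 : R * R -> R) : continuous u ->
  (forall x, pd1 u x (u1 x)) -> (forall x, pd2 u x (u2 x)) ->
  Ck k u1 -> Ck k u2 -> Ck k.+1 u.
Proof.
move=> cu du1 du2 k1 k2;split=>//.
have ->: partial1 u = u1 by apply/funext=> x;have []:=(pd1P _ _ _).1 (du1 x).
have ->: partial2 u = u2 by apply/funext=> x;have []:=(pd2P _ _ _).1 (du2 x).
by split=>// x;[have []:=(pd1P _ _ _).1 (du1 x)|have []:=(pd2P _ _ _).1 (du2 x)].
Qed.

Lemma Ck_cts k u : Ck k u -> continuous u. Proof. by case:k=>[|k] []. Qed.

Lemma Ck_pd1 k u x : Ck k.+1 u -> pd1 u x (partial1 u x).
Proof. by case=> _ [d1 _ _ _];exact/pd1P. Qed.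

Lemma Ck_pd2 k u x : Ck k.+1 u -> pd2 u x (partial2 u x).
Proof. by case=> _ [_ d2 _ _];exact/pd2P. Qed.

Lemma CkS k u : Ck k.+1 u -> Ck k u.
Proof.
elim:k u=>[|k IH] u [cu [d1 d2 k1 k2]];first by split.
exact:(conj cu (And4 d1 d2 (IH _ k1) (IH _ k2))).
Qed.

Lemma Ck_cst k c : Ck k (fun=> c).
Proof.
elim:k c=>[|k IH] c;first by split=>// x;exact:cvg_cst.
apply:(@Ck_intro _ _ (fun=> 0) (fun=> 0));rewrite ?IH//.
- by move=> x;exact:cvg_cst.
- by move=> x;exact:derC.
- by move=> x;exact:derC.
Qed.

Lemma CkD k u v : Ck k u -> Ck k v -> Ck k (fun x => u x + v x).
Proof.
elim:k u v=>[|k IH] u v ku kv.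
 by split=>// x;apply:cvgD;[exact:(Ck_cts ku)|exact:(Ck_cts kv)].
apply:(Ck_intro (u1:=fun x=> partial1 u x + partial1 v x) (u2:=fun x=> partial2 u x + partial2 v x)).
- by move=> x;apply:cvgD;[exact:(Ck_cts ku)|exact:(Ck_cts kv)].
- by move=> x;apply:derD;[exact:Ck_pd1 ku|exact:Ck_pd1 kv].
- by move=> x;apply:derD;[exact:Ck_pd2 ku|exact:Ck_pd2 kv].
- by case:ku kv=> _ [_ _ ? _] [_ [_ _ ? _]];exact:IH.
- by case:ku kv=> _ [_ _ _ ?] [_ [_ _ _ ?]];exact:IH.
Qed.

Lemma CkM k u v : Ck k u -> Ck k v -> Ck k (fun x => u x * v x).
Proof.
elim:k u v=>[|k IH] u v ku kv.
 by split=>// x;apply:cvgM;[exact:(Ck_cts ku)|exact:(Ck_cts kv)].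
apply:(Ck_intro (u1:=fun x=> partial1 u x * v x + u x * partial1 v x) (u2:=fun x=> partial2 u x * v x + u x * partial2 v x)).
- by move=> x;apply:cvgM;[exact:(Ck_cts ku)|exact:(Ck_cts kv)].
- by case=> x1 x2;exact:(derM (Ck_pd1 (x1,x2) ku) (Ck_pd1 (x1,x2) kv)).
- by case=> x1 x2;exact:(derM (Ck_pd2 (x1,x2) ku) (Ck_pd2 (x1,x2) kv)).
- have [ku' kv']:=(CkS ku,CkS kv).
 by case:ku kv=> _ [_ _ ? _] [_ [_ _ ? _]];apply:CkD;exact:IH.
- have [ku' kv']:=(CkS ku,CkS kv).
 by case:ku kv=> _ [_ _ _ ?] [_ [_ _ _ ?]];apply:CkD;exact:IH.
Qed.

Lemma cts_fst : continuous (fst : R * R -> R). Proof. by move=> x;exact:cvg_fst. Qed.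
Lemma cts_snd : continuous (snd : R * R -> R). Proof. by move=> x;exact:cvg_snd. Qed.

Lemma Ck_fst k : Ck k (fst : R * R -> R).
Proof.
case:k=>[|k];first by split=>//;exact:cts_fst.
apply:(Ck_intro (u1:=fun=> 1) (u2:=fun=> 0));try exact:Ck_cst.
- exact:cts_fst.
- by move=> x;exact:derI.
- by move=> x;exact:derC.
Qed.

Lemma Ck_snd k : Ck k (snd : R * R -> R).
Proof.
case:k=>[|k];first by split=>//;exact:cts_snd.
apply:(Ck_intro (u1:=fun=> 0) (u2:=fun=> 1));try exact:Ck_cst.
- exact:cts_snd.
- by move=> x;exact:derC.
- by move=> x;exact:derI.
Qed.

Lemma CkB k u v : Ck k u -> Ck k v -> Ck k (fun x => u x - v x).
Proof.
move=> ku kv;rewrite (_ : (fun x=> _) = (fun x=> u x + -1 * v x)).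
 by apply:CkD=>//;apply:CkM=>//;exact:Ck_cst.
by apply/funext=> x;rewrite mulN1r.
Qed.

Lemma enorm_ge0 x : 0 <= enorm x. Proof. exact:sqrtr_ge0. Qed.

Lemma enorm_sqr x : enorm x ^+ 2 = x.1 ^+ 2 + x.2 ^+ 2.
Proof. by rewrite sqr_sqrtr// addr_ge0// sqr_ge0. Qed.

Lemma cts_enorm : continuous (@enorm R).
Proof.
move=> x;apply:continuous_comp;last exact:sqrt_continuous.
by apply:cvgD;apply:cvgM;solve [exact:cvg_fst|exact:cvg_snd].
Qed.

Lemma pd1_enorm x : 0 < enorm x -> pd1 (@enorm R) x (x.1 / enorm x).
Proof.
move=> x0;have x2: 0 < x.1 ^+ 2 + x.2 ^+ 2 by rewrite -sqrtr_gt0.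
apply:der_eq;first apply:(@der_sqrt _ (fun s=> s * s + x.2 * x.2) _ _ x2).
 by apply:derD;[apply:derM;exact:derI|exact:derC].
rewrite -[Num.sqrt _]/(enorm x);field;rewrite gt_eqF//.
Qed.

Lemma pd2_enorm x : 0 < enorm x -> pd2 (@enorm R) x (x.2 / enorm x).
Proof.
move=> x0;have x2: 0 < x.1 ^+ 2 + x.2 ^+ 2 by rewrite -sqrtr_gt0.
apply:der_eq;first apply:(@der_sqrt _ (fun s=> x.1 * x.1 + s * s) _ _ x2).
 by apply:derD;[exact:derC|apply:derM;exact:derI].
rewrite -[Num.sqrt _]/(enorm x);field;rewrite gt_eqF//.
Qed.

Lemma near_fst x (P : set (R * R)) : (\forall y \near x, P y) -> \forall s \near x.1, P (s, x.2).
Proof.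
move=>[[A B] [/= nA nB] AB];apply:filterS nA=> s As.
by apply:AB;split=>//=;exact:nbhs_singleton nB.
Qed.

Lemma near_snd x (P : set (R * R)) : (\forall y \near x, P y) -> \forall s \near x.2, P (x.1, s).
Proof.
move=>[[A B] [/= nA nB] AB];apply:filterS nB=> s As.
by apply:AB;split=>//=;exact:nbhs_singleton nA.
Qed.

Lemma near_lt u x c : {for x, continuous u} -> u x < c -> \forall y \near x, u y < c.
Proof. by move=> cu h;exact:(cu _ (lt_nbhsl h)). Qed.

Lemma near_gt u x c : {for x, continuous u} -> c < u x -> \forall y \near x, c < u y.
Proof. by move=> cu h;exact:(cu _ (lt_nbhsr h)). Qed.

Lemma pd1_near u v x a : (\forall y \near x, v y = u y) -> pd1 v x a -> pd1 u x a.
Proof. by move=>/near_fst uv;exact:near_eq_is_derive. Qed.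

Lemma pd2_near u v x a : (\forall y \near x, v y = u y) -> pd2 v x a -> pd2 u x a.
Proof. by move=>/near_snd uv;exact:near_eq_is_derive. Qed.

Lemma cts_near u v x : (\forall y \near x, v y = u y) -> {for x, continuous v} -> {for x, continuous u}.
Proof.
move=> uv cv;rewrite /prop_for /continuous_at -(nbhs_singleton uv).
by apply:cvg_trans cv;exact:near_eq_cvg.
Qed.

End plane_calculus.

(* Functions homogeneous of degree 0, in the slope chart: [g1] on the right half
   plane, [g2] on the left one, [cp] and [cm] on the positive and negative parts
   of the vertical axis, near which they are locally constant. *)
Section angular.
Context {R : realType}.
Implicit Types (x y : R * R) (a b c s t : R) (k : nat).

Record angular := Angular { ang1 : R -> R ; ang2 : R -> R ; angp : R ; angm : R }.

Definition ang_fun (A : angular) x : R :=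
  if 0 < x.1 then ang1 A (x.2 / x.1) else if x.1 < 0 then ang2 A (x.2 / x.1)
  else if 0 < x.2 then angp A else angm A.

(** In the left half plane a large positive slope is close to the negative vertical axis, hence the
    exchange of [angp] and [angm] in the conditions on [ang2]. *)
Definition ang_smooth (A : angular) : Prop :=
  [/\ smooth1 (ang1 A), smooth1 (ang2 A) & exists M : R, [/\ 0 < M,
    forall s, M <= s -> ang1 A s = angp A, forall s, s <= - M -> ang1 A s = angm A,
    forall s, M <= s -> ang2 A s = angm A & forall s, s <= - M -> ang2 A s = angp A]].

(** The derivative in the polar angle: the slope is its tangent, so d/dtheta is [1 + s^2] times
    d/ds. Near the vertical axis the function is locally constant. *)
Definition ang_der (A : angular) : angular :=
  Angular (fun s => (1 + s * s) * derive1 (ang1 A) s) (fun s => (1 + s * s) * derive1 (ang2 A) s) 0 0.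

Lemma isd_cst_near (g : R -> R) s c : isd g s (derive1 g s) -> (\forall t \near s, g t = c) -> derive1 g s = 0.
Proof.
move=> dg gc;have h: isd g s 0.
 by apply:near_eq_is_derive (derC c s);near=> t;apply/esym;near: t.
by rewrite derive1E;case:h.
Unshelve. all: by end_near. Qed.

Lemma ang_der_smooth A : ang_smooth A -> ang_smooth (ang_der A).
Proof.
move=>[s1 s2 [M [M0 h1 h2 h3 h4]]].
have sm g : smooth1 g -> smooth1 (fun s=>(1 + s * s) * derive1 g s).
 move=> sg k;apply:S1M;last exact:smooth1_der.
 by apply:S1D;[exact:S1_cst|apply:S1M;exact:S1_id].
split;[exact:sm|exact:sm|exists (M + 1)].
have up g c : smooth1 g -> (forall s,M <= s -> g s = c) -> forall s,M + 1 <= s -> (1 + s * s) * derive1 g s = 0.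
 move=> sg gc s Ms;rewrite (@isd_cst_near g s c) ?mulr0//;first exact:smooth1_isd.
 near=> t;apply:gc;apply:ltW;near: t;apply:lt_nbhsr.
 by rewrite (lt_le_trans _ Ms)// ltrDl.
have dn g c : smooth1 g -> (forall s,s <= - M -> g s = c) -> forall s,s <= - (M + 1) -> (1 + s * s) * derive1 g s = 0.
 move=> sg gc s Ms;rewrite (@isd_cst_near g s c) ?mulr0//;first exact:smooth1_isd.
 near=> t;apply:gc;apply:ltW;near: t;apply:lt_nbhsl.
 by rewrite (le_lt_trans Ms)// ltrN2 ltrDl.
by split;rewrite ?addr_gt0//;[exact:up h1|exact:dn h2|exact:up h3|exact:dn h4].
Unshelve. all: by end_near. Qed.

Lemma ang_local A x : ang_smooth A -> 0 < enorm x ->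
  (exists g, [/\ smooth1 g, x.1 != 0, \forall y \near x, g (y.2 / y.1) = ang_fun A y &
    ang_fun (ang_der A) x = (1 + (x.2 / x.1) * (x.2 / x.1)) * derive1 g (x.2 / x.1)]) \/
  (exists c, (\forall y \near x, c = ang_fun A y) /\ ang_fun (ang_der A) x = 0).
Proof.
move=>[s1 s2 [M [M0 h1 h2 h3 h4]]] x0.
have [x1|x1|x1]:=ltgtP x.1 0.
- left;exists (ang2 A);split=>//.
  have : \forall y \near x,y.1 < 0 by exact:(@near_lt _ fst _ _ (@cts_fst R x)).
  by apply:filterS=> y y1;rewrite /ang_fun ltNge ltW//= y1.
 by rewrite /ang_fun ltNge ltW//= x1.
- left;exists (ang1 A);split=>//.
  have : \forall y \near x,0 < y.1 by exact:(@near_gt _ fst _ _ (@cts_fst R x)).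
  by apply:filterS=> y y1;rewrite /ang_fun y1.
 by rewrite /ang_fun x1.
right.
have x2: x.2 != 0.
 by apply/eqP=> x2;move: x0;rewrite /enorm x1 x2 expr0n addr0 sqrtr0 ltxx.
exists (ang_fun A x);split;last by rewrite /ang_fun x1 ltxx/=;case:ifP.
have nM: \forall y \near x,M * `|y.1| < `|y.2|.
 have : \forall y \near x,0 < `|y.2| - M * `|y.1|.
  apply:(@near_gt _ (fun y : R * R=> `|y.2| - M * `|y.1|)).
   apply:cvgB;first by apply:cvg_norm;exact:cvg_snd.
   by apply:cvgM;[exact:cvg_cst|apply:cvg_norm;exact:cvg_fst].
  by rewrite x1 normr0 mulr0 subr0 normr_gt0.
 by apply:filterS=> y;rewrite subr_gt0.
have sg: \forall y \near x,(0 < y.2) = (0 < x.2) /\ y.2 != 0.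
 move: x2;case:(ltgtP x.2 0)=>// x2 _.
  have : \forall y \near x,y.2 < 0 by exact:(@near_lt _ snd _ _ (@cts_snd R x)).
  by apply:filterS=> y y2;rewrite [0 < _]ltNge ltW//= lt_eqF.
 have : \forall y \near x,0 < y.2 by exact:(@near_gt _ snd _ _ (@cts_snd R x)).
 by apply:filterS=> y y2;rewrite y2 gt_eqF.
apply:filterS2 nM sg=> y yM [ys y20].
rewrite /ang_fun x1 ltxx -ys;case:(ltgtP 0 y.1)=> y1//;move: yM.
- rewrite (gtr0_norm y1);have [y2|y2]:=ltP 0 y.2.
  by rewrite gtr0_norm// => yM;rewrite h1// ler_pdivlMr// ltW.
 by rewrite ler0_norm// => yM;rewrite h2// ler_pdivrMr// mulNr lerNr ltW.
- rewrite (ltr0_norm y1);have [y2|y2]:=ltP 0 y.2.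
  by rewrite gtr0_norm// mulrN=> yM;rewrite h4// ler_ndivrMr// mulNr ltW.
 by rewrite ler0_norm// mulrN ltrN2=> yM;rewrite h3// ler_ndivlMr// ltW.
Qed.

(* Smooth functions on the line vanishing on a neighbourhood of the half line [t <= 0]. *)
Definition radial a (F : R -> R) : Prop := smooth1 F /\ forall t, t <= a -> F t = 0.

(** [t^-1] is replaced by a smooth function equal to it for [t >= a], the inverse of a blend of [t]
    and 1. Below [a] the factor [F] vanishes. *)
Lemma radial_div a F : 0 < a -> radial a F -> radial a (fun t => F t / t).
Proof.
move=> a0 [sF F0];split;last by move=> t ta;rewrite F0// mul0r.
pose sg t:=step (2 / a * t + - 1).
have sg0 t : t <= 0 -> sg t = 0.
 move=> t0;rewrite /sg step0// subr_le0;apply:(@le_trans _ _ 0)=>//.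
 by apply:mulr_ge0_le0=>//;rewrite divr_ge0 ?(ltW a0).
have sg1 t : a <= t -> sg t = 1.
 move=> ta;rewrite /sg step1// lerBrDr mulrAC ler_pdivlMr//;lra.
pose r t:=(t * sg t + (1 - sg t))^-1.
have d0 t : t * sg t + (1 - sg t) != 0.
 have [t0|t0]:=leP t 0;first by rewrite sg0// mulr0 add0r subr0 oner_neq0.
 rewrite gt_eqF//;have:=step_ge0 (2 / a * t + - 1);have:=step_le1 (2 / a * t + - 1).
 rewrite -/(sg t)=> s1 s0;have [e|n0]:=eqVneq (sg t) 0;first by rewrite e mulr0 add0r subr0.
 by rewrite ltr_pwDl ?subr_ge0// mulr_gt0// lt_neqAle eq_sym n0.
rewrite (_ : (fun t=> _) = (fun t=> F t * r t)).
 move=> k;apply:S1M;first exact:sF.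
 apply:S1V=>//;have ssg: S1 k sg by apply:S1_affine;exact:step_smooth.
 apply:S1D;first by apply:S1M=>//;exact:S1_id.
 by apply:S1B=>//;exact:S1_cst.
apply/funext=> t;have [ta|/ltW ta]:=leP t a;first by rewrite F0// !mul0r.
by rewrite /r sg1// mulr1 subrr addr0.
Qed.

Lemma radial_der a F : radial a F -> radial a (derive1 F).
Proof.
move=>[sF F0];split;first exact:smooth1_der.
have h t : t < a -> derive1 F t = 0.
 move=> ta;apply:(@isd_cst_near _ _ 0);first exact:smooth1_isd.
 by near=> s;apply:F0;near: s;exact:lt_le_nbhsl.
move=> t;rewrite le_eqVlt=>/predU1P[->|/h//].
apply/eqP/negPn/negP=> ne.
have cF: {for a,continuous (fun s=> `|derive1 F s|)}.
 by apply:cvg_norm;apply:smooth1_cts;exact:smooth1_der.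
have : \forall s \near a,0 < `|derive1 F s| by apply:(cF _ (lt_nbhsr _));rewrite normr_gt0.
case/nbhs_ballP=> e /= e0 /(_ (a - e / 2));rewrite h ?normr0 ?ltxx.
 by rewrite -ball_normE/= opprB addrC subrK gtr0_norm ?divr_gt0// ltr_pdivrMr// ltr_pMr// ltr1n=>/(_ isT).
by rewrite ltrBlDr ltrDl divr_gt0.
Unshelve. all: by end_near. Qed.

Lemma radialM a F (c : R -> R) : smooth1 c -> radial a F -> radial a (fun t => F t * c t).
Proof.
move=> sc [sF F0];split;first by move=> k;exact:S1M.
by move=> t ta;rewrite F0// mul0r.
Qed.

Definition rad_ang (F : R -> R) A x : R := F (enorm x) * ang_fun A x.

Section rad_ang.
Variables (a : R) (F : R -> R) (A : angular).
Hypotheses (a0 : 0 < a) (rF : radial a F) (sA : ang_smooth A).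
Let G t := derive1 F t / t.
Let H t := F t / t / t.

(** The gradient in polar form: [F' / t] along x, and [F / t^2] times the angular derivative along x
    turned by a right angle. Both coefficients are again of the form [rad_ang], which feeds the
    induction on regularity. *)
Lemma rad_ang_local x :
  [/\ {for x, continuous (rad_ang F A)},
   pd1 (rad_ang F A) x (x.1 * rad_ang G A x - x.2 * rad_ang H (ang_der A) x) &
   pd2 (rad_ang F A) x (x.2 * rad_ang G A x + x.1 * rad_ang H (ang_der A) x)].
Proof.
have [xa|ax]:=ltP (enorm x) a.
 have n0: \forall y \near x,0 = rad_ang F A y.
  have : \forall y \near x,enorm y < a by exact:(@near_lt _ (@enorm R) _ _ (@cts_enorm R x)).
  by apply:filterS=> y ya;rewrite /rad_ang rF.2 ?mul0r// ltW.
 have F0: F (enorm x) = 0 by rewrite rF.2// ltW.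
 have D0: derive1 F (enorm x) = 0 by rewrite (radial_der rF).2// ltW.
 rewrite /rad_ang /G /H F0 D0 !mul0r !mulr0 subrr addr0.
 split;first by apply:cts_near n0 _;exact:cvg_cst.
 - by apply:pd1_near n0 _;exact:derC.
 - by apply:pd2_near n0 _;exact:derC.
have x0: 0 < enorm x by exact:lt_le_trans ax.
have sF:=rF.1.
have dF t:=smooth1_isd t sF.
have cF: {for x,continuous (fun y=> F (enorm y))}.
 by apply:continuous_comp;[exact:cts_enorm|exact:smooth1_cts].
have dF1: pd1 (fun y=> F (enorm y)) x (x.1 * G (enorm x)).
 apply:der_eq;first by apply:der_comp;[exact:pd1_enorm|case:(x)=> ? ?;exact:dF].
 by case:(x)=> ? ? /=;rewrite /G;ring.
have dF2: pd2 (fun y=> F (enorm y)) x (x.2 * G (enorm x)).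
 apply:der_eq;first by apply:der_comp;[exact:pd2_enorm|case:(x)=> ? ?;exact:dF].
 by case:(x)=> ? ? /=;rewrite /G;ring.
have [[g [sg x1 gA gd]]|[c [cA cd]]]:=ang_local sA x0.
- have nn: \forall y \near x,F (enorm y) * g (y.2 / y.1) = rad_ang F A y.
  by apply:filterS gA=> y e;rewrite /rad_ang e.
 have gx:=nbhs_singleton gA.
 split.
 + apply:cts_near nn _;apply:cvgM=>//;apply:continuous_comp;last exact:smooth1_cts.
  by apply:cvgM;[exact:cvg_snd|apply:cvgV=>//;exact:cvg_fst].
 + apply:pd1_near nn _;apply:der_eq.
   apply:(derM dF1);apply:der_comp;last by case:(x)=> ? ?;exact:smooth1_isd.
   by apply:derM (derC _ _) _;apply:derV;[exact:x1|exact:derI].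
  rewrite /rad_ang gd -gx /H.
  have e2: enorm x * enorm x = x.1 * x.1 + x.2 * x.2 by rewrite -expr2 enorm_sqr !expr2.
  have ->: F (enorm x) / enorm x / enorm x = F (enorm x) / (x.1 * x.1 + x.2 * x.2).
   by rewrite -e2 invfM mulrA.
  have e3: x.1 * x.1 + x.2 * x.2 != 0 by rewrite -e2 mulf_neq0 ?gt_eqF.
  case:(x) x1 e3=> p q /= p0 e3;field.
  by rewrite p0.
 + apply:pd2_near nn _;apply:der_eq.
   apply:(derM dF2);apply:der_comp;last by case:(x)=> ? ?;exact:smooth1_isd.
   have hq: isd (fun y : R=> y * x.1^-1) x.2 (1 * x.1^-1 + x.2 * 0) by apply:derM;[exact:derI|exact:derC].
   exact:hq.
  rewrite /rad_ang gd -gx /H.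
  have e2: enorm x * enorm x = x.1 * x.1 + x.2 * x.2 by rewrite -expr2 enorm_sqr !expr2.
  have ->: F (enorm x) / enorm x / enorm x = F (enorm x) / (x.1 * x.1 + x.2 * x.2).
   by rewrite -e2 invfM mulrA.
  have e3: x.1 * x.1 + x.2 * x.2 != 0 by rewrite -e2 mulf_neq0 ?gt_eqF.
  case:(x) x1 e3=> p q /= p0 e3;field.
  by rewrite p0.
- have nn: \forall y \near x,F (enorm y) * c = rad_ang F A y.
  by apply:filterS cA=> y e;rewrite /rad_ang e.
 have cx:=nbhs_singleton cA.
 rewrite /rad_ang cd -cx !mulr0 subr0 addr0;split.
 + by apply:cts_near nn _;apply:cvgM=>//;exact:cvg_cst.
 + apply:pd1_near nn _;apply:der_eq;first by apply:(derM dF1);exact:derC.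
  by case:(x)=> ? ? /=;ring.
 + apply:pd2_near nn _;apply:der_eq;first by apply:(derM dF2);exact:derC.
  by case:(x)=> ? ? /=;ring.
Qed.

End rad_ang.

Lemma rad_ang_Ck a F A k : 0 < a -> radial a F -> ang_smooth A -> Ck k (rad_ang F A).
Proof.
move=> a0;elim:k F A=>[|k IH] F A rF sA.
 by split=>// x;have []:=rad_ang_local a0 rF sA x.
have rG: radial a (fun t=> derive1 F t / t) by apply:radial_div=>//;exact:radial_der.
have rH: radial a (fun t=> F t / t / t) by do 2 apply:radial_div=>//.
have sD:=ang_der_smooth sA.
apply:Ck_intro.
- by move=> x;have []:=rad_ang_local a0 rF sA x.
- by move=> x;have [_ h _]:=rad_ang_local a0 rF sA x;exact:h.
- by move=> x;have [_ _ h]:=rad_ang_local a0 rF sA x;exact:h.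
- by apply:CkB;apply:CkM;solve [exact:Ck_fst|exact:Ck_snd|exact:IH].
- by apply:CkD;apply:CkM;solve [exact:Ck_fst|exact:Ck_snd|exact:IH].
Qed.

End angular.

(** * Polar coordinates in the slope chart *)

Section polar.
Context {R : realType}.
Notation T := (measurableTypeR R).
Notation mu := (@lebesgue_measure R).
Implicit Types (c s t : R).

Section scale.
Variables (c : R) (c0 : c != 0).
Let phi : T -> T := fun x => c * x.
Let mphi : mfun setT phi.
Proof. by apply:measurable_funM=>//;exact:measurable_cst. Qed.
Let m : {measure set T -> \bar R} := mscale (NngNum (normr_ge0 c))
  (measure_function_pushforward__canonical__measure_function_Measure mu mphi).

Lemma lebesgue_scale A : measurable A -> mu A = m A.
Proof.
apply:lebesgue_measure_unique=> X /ocitvP[->|[[a b] /= ab ->]];first by rewrite !measure0.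
rewrite /m /mscale/= /pushforward lebesgue_measure_itv/= lte_fin ab.
have [cn|cp]:=ltP c 0.
 have ->: phi @^-1` `]a,b] = `[b / c,a / c[%classic.
  apply/seteqP;split=> x/=;rewrite /phi !in_itv/= ler_ndivrMr// ltr_ndivlMr// ![_ * c]mulrC.
   by move=>/andP[-> ->].
  by move=>/andP[-> ->].
 rewrite lebesgue_measure_itv/= lte_fin ltr_nM2r ?invr_lt0// ab.
 by rewrite ltr0_norm// -EFinM -mulrBl mulrCA mulNr divff ?lt_eqF//;congr EFin;ring.
have {}cp : 0 < c by rewrite lt_neqAle eq_sym c0.
have ->: phi @^-1` `]a,b] = `]a / c,b / c]%classic.
 apply/seteqP;split=> x/=;rewrite /phi !in_itv/= ltr_pdivrMr// ler_pdivlMr// ![_ * c]mulrC.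
  by move=>/andP[-> ->].
 by move=>/andP[-> ->].
rewrite lebesgue_measure_itv/= lte_fin ltr_pM2r ?invr_gt0// ab.
by rewrite gtr0_norm// -EFinM -mulrBl mulrCA divff ?gt_eqF// mulr1.
Qed.

Lemma ge0_scale (g : T -> \bar R) : mfun setT g -> (forall x, 0 <= g x)%E ->
  (\int[mu]_x g x = \int[mu]_x (`|c|%:E * g (c * x)%R))%E.
Proof.
move=> mg g0.
rewrite (eq_measure_integral m);last by move=> A mA _;exact:lebesgue_scale.
rewrite /m ge0_integral_mscale//= (@ge0_integral_pushforward _ _ _ _ _ _ mphi)//=.
rewrite preimage_setT ge0_integralZl//.
by apply:measurableT_comp.
Qed.

End scale.

(** With [s] the tangent of the polar angle, [dang s] is the angle element and its square root the
    cosine. *)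
Definition dang s : R := (1 + s * s)^-1.
(** [t] takes both signs, the negative ones reaching the left half plane, so the real slopes cover
    the plane off the vertical axis. *)
Definition ray t s : R * R := (t * Num.sqrt (dang s), t * (s * Num.sqrt (dang s))).

Lemma dang_den s : 0 < 1 + s * s.
Proof. by rewrite ltr_pwDl// -expr2 sqr_ge0. Qed.

Lemma dang_gt0 s : 0 < dang s. Proof. by rewrite invr_gt0 dang_den. Qed.
Lemma cts_dang : continuous dang.
Proof.
move=> s;apply:(@cvgV _ _ _ _ (fun s=> 1 + s * s));first by rewrite gt_eqF// dang_den.
by apply:cvgD;[exact:cvg_cst|apply:cvgM;exact:cvg_id].
Qed.

Lemma cts_sqrt_dang : continuous (fun s => Num.sqrt (dang s)).
Proof. by move=> s;apply:continuous_comp;[exact:cts_dang|exact:sqrt_continuous]. Qed.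

Lemma sqrt_dang_gt0 s : 0 < Num.sqrt (dang s).
Proof. by rewrite sqrtr_gt0 dang_gt0. Qed.

Lemma enorm_ray t s : enorm (ray t s) = `|t|.
Proof.
rewrite /enorm /ray /= -sqrtr_sqr;congr Num.sqrt.
rewrite !exprMn sqr_sqrtr;last by rewrite ltW// dang_gt0.
have:=dang_den s;rewrite /dang=> h;field;rewrite -expr2 in h *.
by rewrite gt_eqF.
Qed.

Lemma measurable_ray : mfun setT (fun z : T * T => (ray z.1 z.2 : T * T)).
Proof.
have ms: mfun setT (fun z : T * T=> Num.sqrt (dang z.2)).
 apply:(measurableT_comp (f:=fun s : T=> Num.sqrt (dang s)))=>//.
 exact:cts_mfun cts_sqrt_dang.
apply:measurable_fun_pair;first exact:measurable_funM.
by apply:measurable_funM=>//;exact:measurable_funM.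
Qed.

(** Two linear substitutions under Tonelli, each in one variable: the ordinate is [x * s] for fixed
    [x], then the abscissa is [t * sqrt (dang s)] for fixed [s]. The axis [x = 0] is negligible. *)
Lemma polar (f : T * T -> \bar R) : mfun setT f -> (forall z, 0 <= f z)%E ->
  (\int[@leb2_borel R]_z f z = \int[mu]_t \int[mu]_s ((`|t| * dang s)%:E * f (ray t s)))%E.
Proof.
move=> mf f0.
have mrat: mfun setT (fun z : T * T=>(z.1,z.1 * z.2) : T * T).
 by apply:measurable_fun_pair=>//;exact:measurable_funM.
have m1: mfun setT (fun z : T * T=> `|z.1|%:E * f (z.1,(z.1 * z.2)%R))%E.
 apply:emeasurable_funM;last exact:(measurableT_comp mf mrat).
 by apply/measurable_EFinP;apply:measurableT_comp.
have m2: mfun setT (fun z : T * T=>(`|z.1| * dang z.2)%:E * f (ray z.1 z.2))%E.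
 apply:emeasurable_funM;last exact:(measurableT_comp mf measurable_ray).
 apply/measurable_EFinP;apply:measurable_funM;first exact:measurableT_comp.
 by apply:(measurableT_comp (f:=dang))=>//;exact:cts_mfun cts_dang.
have p1 z : (0 <= `|z.1|%:E * f (z.1,(z.1 * z.2)%R))%E by rewrite mule_ge0// lee_fin.
have p2 z : (0 <= (`|z.1| * dang z.2)%:E * f (ray z.1 z.2))%E.
 by rewrite mule_ge0// lee_fin mulr_ge0// ltW// dang_gt0.
rewrite /leb2_borel fubini_tonelli1// /fubini_F.
transitivity (\int[mu]_x \int[mu]_s (`|x|%:E * f (x,(x * s)%R)))%E.
 apply:ae_eq_integral=>//.
 - exact:(measurable_fun_fubini_tonelli_F _ mf f0).
 - exact:(measurable_fun_fubini_tonelli_F _ m1 p1).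
 - exists [set 0];split;[by []|exact:lebesgue_measure_set1|].
  move=> x /= /not_implyP[_ h];apply:contrapT=>/eqP x0;apply:h.
  apply:(@ge0_scale _ x0 (fun y=> f (x,y)))=>//.
  exact:(measurable_fun_pair2 x mf).
rewrite (fubini_tonelli _ m1 p1) [RHS](fubini_tonelli _ m2 p2).
apply:eq_integral=> s _.
have c0: Num.sqrt (dang s) != 0 by rewrite gt_eqF// sqrt_dang_gt0.
rewrite (@ge0_scale _ c0 (fun x=> `|x|%:E * f (x,(x * s)%R))%E)//;last 2 first.
- exact:(measurable_fun_pair1 s m1).
- by move=> x;exact:(p1 (x,s)).
apply:eq_integral=> t _;rewrite muleA -EFinM /ray;congr (_%:E * f _)%E.
 rewrite normrM mulrA -normrM -expr2 sqr_sqrtr ?(ltW (dang_gt0 _))//.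
 by rewrite ger0_norm ?(ltW (dang_gt0 _))// mulrC.
congr pair;first exact:mulrC.
by rewrite/=;ring.
Qed.

Lemma atan_cvgy : @atan R x @[x --> +oo] --> (pi / 2 : R).
Proof.
apply/cvgrPdist_le=> e e0.
pose y:=Num.max 0 (pi / 2 - e).
have ylt: y < pi / 2 by rewrite gt_max divr_gt0 ?pi_gt0//= ltrBlDr ltrDl.
exists (tan y);split;first exact:num_real.
move=> x yx;have h: y < atan x.
 rewrite ltNge;apply/negP=> axy.
 have : tan (atan x) <= tan y.
  have yI: y \in `](- (pi / 2)),(pi / 2)[.
   by rewrite in_itv/= ylt andbT (lt_le_trans (_ : _ < 0)) ?oppr_lt0 ?divr_gt0 ?pi_gt0// le_max lexx.
  move: axy;rewrite le_eqVlt=>/predU1P[->//|axy];apply/ltW.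
  by rewrite ltr_tan// in_itv/= atan_gtNpi2 atan_ltpi2.
 by rewrite atanK leNgt yx.
rewrite ger0_norm;last by rewrite subr_ge0 ltW// atan_ltpi2.
have : pi / 2 - e <= y by rewrite le_max lexx orbT.
by move: h;lra.
Qed.

Lemma integral_dang : (\int[mu]_s (dang s)%:E = pi%:E)%E.
Proof.
rewrite ge0_symfun_integralT;last 3 first.
- by move=> s;rewrite ltW// dang_gt0.
- exact:cts_dang.
- by move=> s;rewrite /dang /= mulrNN.
have ->: [set x : R|0 <= x] = `[0,+oo[%classic.
 by apply/seteqP;split=> x/=;rewrite in_itv/= andbT.
have dat x : isd (@atan R) x (dang x).
 by apply:der_eq (is_derive1_atan x) _;rewrite /dang expr2.
rewrite (@ge0_continuous_FTC2y _ dang (@atan R) 0 (pi / 2)).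
- by rewrite atan0 sube0 -EFinM mulrC divfK.
- by move=> s _;rewrite ltW// dang_gt0.
- by apply:wc_cts;exact:cts_dang.
- exact:atan_cvgy.
- by move=> x _;case:(dat x).
- by apply:cvg_at_right_filter;exact:der_cts (dat 0).
- by move=> x _;rewrite derive1E;case:(dat x).
Qed.

End polar.

(** * Pairing of a vector field with a vector measure *)

Section pairing.
Context {R : realType}.
Notation P := (plane R).
Implicit Types (X : R * R -> R) (C Q : set P) (m : {measure set P -> \bar R}) (a b c d e M : R).

Lemma measurable_ltr X a : mfun (setT : set P) X -> measurable ([set x | X x < a] : set P).
Proof.
move=> mX;have:=mX measurableT _ (measurable_itv `]-oo,a[%R).
by rewrite setTI;congr measurable;apply/seteqP;split=> x/=;rewrite in_itv.
Qed.

Lemma integrable_bounded m X C M : measurable C -> (m C < +oo)%E -> mfun C X ->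
  (forall x, C x -> `|X x| <= M) -> m.-integrable C (EFin \o X).
Proof.
move=> mC mCoo mX XM;apply:measurable_bounded_integrable=>//.
by exists M;split;[exact:num_real|move=> y My x /= Cx;apply:le_trans (XM x Cx) (ltW My)].
Qed.

Lemma Rint_near_cst m X C c e M : measurable C -> (m C < +oo)%E -> mfun C X ->
  (forall x, C x -> `|X x| <= M) -> (forall x, C x -> `|X x - c| <= e) ->
  `|\int[m]_(x in C) X x - c * fine (m C)| <= e * fine (m C).
Proof.
move=> mC mCoo mX XM Xe.
have IX:=integrable_bounded mC mCoo mX XM.
have Ic d : m.-integrable C (EFin \o cst d) by apply:(@integrable_bounded _ _ _ `|d|).
have IB: m.-integrable C (EFin \o (fun x=> X x - c)).
 by apply:(@integrable_bounded m (fun x=> X x - c) C e)=>//;exact:measurable_funB.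
rewrite -(Rintegral_cst m mC c) -RintegralB//;last exact:(Ic c).
apply:le_trans (le_normr_Rintegral _ IB) _=>//.
rewrite -(Rintegral_cst m mC e);apply:le_Rintegral=>//;last exact:(Ic e).
apply:(@integrable_bounded _ _ _ e)=>//.
 by apply:measurableT_comp=>//;exact:measurable_funB.
by move=> x /Xe;rewrite normr_id.
Qed.

Lemma vradon_norm_le (D : @signed_radon R * @signed_radon R) C :
  measurable C -> bounded_set (C : set (R * R)) -> ((vradon_norm D C)%:E <= radon_variation D C)%E.
Proof.
move=> mC bC;apply:ereal_sup_ge.
pose F (k : nat) : set P:=if k == 0%N then C else set0.
have b0: bounded_set (set0 : set (R * R)) by exact/compact_bounded/compact0.
exists (\sum_(0 <= k <oo) (vradon_norm D (F k))%:E)%E.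
 exists F=>//;split.
 - by move=> k;rewrite /F;case:ifP.
 - by move=> k;rewrite /F;case:ifP.
 - by move=> i j _ _;rewrite /F;case:eqP=>[->|_];case:eqP=>[->|_] // [x []].
 - by move=> x [k _];rewrite /F;case:ifP.
rewrite (nneseries_split 0 1);last by move=> k _;rewrite lee_fin vradon_norm_ge0.
by rewrite big_nat1 leeDl// nneseries_ge0// => k _ _;rewrite lee_fin vradon_norm_ge0.
Qed.

Lemma le_enorm1 (x : R * R) : enorm x <= `|x.1| + `|x.2|.
Proof.
rewrite -[leRHS]ger0_norm ?addr_ge0// -sqrtr_sqr ler_wsqrtr//.
rewrite sqrrD !real_normK ?num_real//.
have : 0 <= `|x.1| * `|x.2| *+ 2 by rewrite mulrn_wge0// mulr_ge0.
lra.
Qed.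

Lemma dot_le (a b c d : R) : a * c + b * d <= enorm (a, b) * enorm (c, d).
Proof.
have e1:=enorm_sqr (a,b);have e2:=enorm_sqr (c,d).
move: (enorm_ge0 (a,b)) (enorm_ge0 (c,d)) e1 e2=>/=.
move: (enorm (a,b)) (enorm (c,d))=> p q p0 q0 e1 e2.
rewrite (le_trans (ler_norm _))// -(ger0_norm (mulr_ge0 p0 q0)) -ler_sqr ?nnegrE ?normr_ge0//.
rewrite !real_normK ?num_real// exprMn e1 e2.
have:=sqr_ge0 (a * d - b * c);nra.
Qed.

Section tv.
Variables (D : @signed_radon R * @signed_radon R) (Q : set P).
Hypotheses (mQ : measurable Q) (bQ : bounded_set (Q : set (R * R))).

(** A finite and additive majorant of the variation on subsets of [Q], read off the four positive
    measures; it serves to weigh the error terms. *)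
Definition tv_bound C : R := fine (radon_pos D.1 C) + fine (radon_neg D.1 C) +
  (fine (radon_pos D.2 C) + fine (radon_neg D.2 C)).

Let bS C : C `<=` Q -> bounded_set (C : set (R * R)).
Proof.
by move=> CQ;case:bQ=> M [rM bM];exists M;split=>// x xM y /CQ Qy;exact:(bM x xM).
Qed.

Let fin1 m C : (forall K, compact (K : set (R * R)) -> (m K < +oo)%E) ->
  measurable C -> C `<=` Q -> m C \is a fin_num.
Proof. by move=> mK mC CQ;apply:(radon_bounded_fin mK mC);exact:bS. Qed.

Let pf1 := @radon_pos_fin R D.1.  Let nf1 := @radon_neg_fin R D.1.
Let pf2 := @radon_pos_fin R D.2.  Let nf2 := @radon_neg_fin R D.2.

Lemma tv_bound_ge0 C : 0 <= tv_bound C.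
Proof. by rewrite !addr_ge0// fine_ge0. Qed.

Lemma vradon_norm_tv C : vradon_norm D C <= tv_bound C.
Proof.
apply:le_trans (le_enorm1 _) _;rewrite /radon_val/=;apply:lerD;
by apply:le_trans (ler_normB _ _) _;rewrite !ger0_norm ?fine_ge0.
Qed.

Lemma tv_boundU C C' : measurable C -> measurable C' -> C `<=` Q -> C' `<=` Q ->
  [disjoint C & C'] -> tv_bound (C `|` C') = tv_bound C + tv_bound C'.
Proof.
move=> mC mC' CQ C'Q dCC'.
have h m : (forall K,compact (K : set (R * R)) -> (m K < +oo)%E) ->
  fine (m (C `|` C')) = fine (m C) + fine (m C').
 by move=> mK;rewrite measureU// ?fineD ?fin1//;exact/disj_set2P.
by rewrite /tv_bound !h//;ring.
Qed.

Lemma radon_variation_tv C : measurable C -> C `<=` Q ->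
  (radon_variation D C <= (tv_bound C)%:E)%E.
Proof.
move=> mC CQ;apply:ub_ereal_sup=> _ [F [mF bF tF FC] <-].
have mU: measurable (\bigcup_k F k) by exact:bigcup_measurable.
have UQ: \bigcup_k F k `<=` Q by exact:subset_trans CQ.
pose m4 A : \bar R:=(radon_pos D.1 A + radon_neg D.1 A + (radon_pos D.2 A + radon_neg D.2 A))%E.
have m4E A : measurable A -> A `<=` Q -> m4 A = (tv_bound A)%:E.
 by move=> mA AQ;rewrite /m4 /tv_bound !EFinD !fineK// fin1.
have m4S: m4 (\bigcup_k F k) = (\sum_(0 <= k <oo) m4 (F k))%E.
 rewrite /m4;under [RHS]eq_eseriesr do rewrite -/(_ + _)%E.
 rewrite !nneseriesD//;try by move=> *;rewrite ?adde_ge0.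
 have mb m : m (\bigcup_k F k) = (\sum_(0 <= k <oo) m (F k))%E.
  by apply/esym/cvg_lim=>//;exact:measure_semi_sigma_additive.
 by rewrite !mb.
rewrite -m4E//;apply:(@le_trans _ _ (m4 (\bigcup_k F k))).
 rewrite m4S;apply:lee_nneseries=> k _;first by rewrite lee_fin vradon_norm_ge0.
 rewrite m4E ?lee_fin ?vradon_norm_tv//.
 by move=> x Fx;apply:UQ;exists k.
by rewrite /m4;do ![apply:leeD];apply:le_measure;rewrite ?inE.
Qed.

Variables (X1 X2 f : R * R -> R) (M : R).
Hypotheses (mX1 : mfun (setT : set P) X1) (mX2 : mfun (setT : set P) X2)
  (mf : mfun (setT : set P) f).
Hypotheses (bX1 : forall x, `|X1 x| <= M) (bX2 : forall x, `|X2 x| <= M).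
Hypothesis Xf : forall x, enorm (X1 x, X2 x) <= f x.

Definition rint (s : @signed_radon R) X C : R :=
  \int[radon_pos s]_(x in C) X x - \int[radon_neg s]_(x in C) X x.

Let nu C := rint D.1 X1 C + rint D.2 X2 C.
Let f0 x : (0 <= (f x)%:E)%E.
Proof. by rewrite lee_fin (le_trans (enorm_ge0 _) (Xf x)). Qed.

Let lam C := (\int[radon_variation D]_(x in C) (f x)%:E)%E.

(** The field is frozen at a point x0 of [C], and Cauchy-Schwarz is applied against the vector
    [D C]. The weight [f] may oscillate on [C]: it enters through |X(x0)| <= f(x) + 2e, integrated
    in x. Freezing the field costs the third [e]. *)
Let local e C : 0 <= e -> measurable C -> C `<=` Q ->
  (forall x y, C x -> C y -> `|X1 x - X1 y| <= e) -> (forall x y, C x -> C y -> `|X2 x - X2 y| <= e) ->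
  ((nu C)%:E <= lam C + (3 * e * tv_bound C)%:E)%E.
Proof.
move=> e0 mC CQ o1 o2.
have [C0|/set0P[x0 Cx0]]:=eqVneq C set0.
 rewrite /nu /rint C0 !Rintegral_set0 !subrr addr0 adde_ge0//;first exact:integral_ge0.
 by rewrite lee_fin !mulr_ge0// tv_bound_ge0.
have fC m : (forall K,compact (K : set (R * R)) -> (m K < +oo)%E) -> (m C < +oo)%E.
 by move=> mK;rewrite -ge0_fin_numE// fin1.
have mX1C:=measurable_funTS (D:=C) mX1;have mX2C:=measurable_funTS (D:=C) mX2.
have n1 m mK:=@Rint_near_cst m X1 C (X1 x0) e M mC (fC m mK) mX1C (fun x _=> bX1 x) (fun x Cx=> o1 _ _ Cx Cx0).
have n2 m mK:=@Rint_near_cst m X2 C (X2 x0) e M mC (fC m mK) mX2C (fun x _=> bX2 x) (fun x Cx=> o2 _ _ Cx Cx0).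
have mfC: mfun C (fun x=>(f x)%:E).
 by apply/measurable_EFinP;exact:measurable_funTS mf.
have:=n1 _ pf1;have:=n1 _ nf1;have:=n2 _ pf2;have:=n2 _ nf2.
rewrite !ler_norml=>/andP[a1 a2] /andP[a3 a4] /andP[a5 a6] /andP[a7 a8].
have h1: nu C <= (X1 x0 * radon_val D.1 C + X2 x0 * radon_val D.2 C) + e * tv_bound C.
 rewrite /nu /rint /radon_val /tv_bound;lra.
have h2: X1 x0 * radon_val D.1 C + X2 x0 * radon_val D.2 C <= enorm (X1 x0,X2 x0) * vradon_norm D C.
 exact:dot_le.
have h3: ((enorm (X1 x0,X2 x0) * vradon_norm D C)%:E <= lam C + (2 * e * tv_bound C)%:E)%E.
 apply:(@le_trans _ _ ((enorm (X1 x0,X2 x0))%:E * radon_variation D C)%E).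
  rewrite EFinM lee_wpmul2l// ?lee_fin ?enorm_ge0//.
  by apply:vradon_norm_le=>//;exact:bS.
 apply:(@le_trans _ _ (\int[radon_variation D]_(x in C) ((f x)%:E + (2 * e)%:E))%E).
  rewrite -(integral_cst _ mC);apply:ge0_le_integral=>//.
  - by move=> x _;rewrite lee_fin enorm_ge0.
  - exact:(emeasurable_funD mfC (measurable_cst _)).
  - move=> x Cx;rewrite -EFinD lee_fin.
   have:=enormD (X1 x,X2 x) (X1 x0 - X1 x,X2 x0 - X2 x);rewrite /= ![_ + (_ - _)]addrC !subrK.
   move=>/le_trans;apply;apply:lerD=>//.
   apply:le_trans (le_enorm1 _) _;rewrite /= mulr_natl mulr2n.
   by apply:lerD;[exact:o1|exact:o2].
 rewrite ge0_integralD//;try exact:mfC;try by move=> x _;rewrite lee_fin mulr_ge0.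
 rewrite leeD2l// integral_cst// (EFinM (2 * e)) lee_wpmul2l ?lee_fin ?mulr_ge0//.
 exact:radon_variation_tv.
apply:(@le_trans _ _ ((enorm (X1 x0,X2 x0) * vradon_norm D C)%:E + (e * tv_bound C)%:E)%E).
 by rewrite -EFinD lee_fin;lra.
apply:(@le_trans _ _ ((lam C + (2 * e * tv_bound C)%:E) + (e * tv_bound C)%:E)%E);first by rewrite leeD2r.
by rewrite -addeA -EFinD leeD2l// lee_fin;lra.
Qed.

Let rintU s X C C' : mfun (setT : set P) X -> (forall x, `|X x| <= M) ->
  measurable C -> measurable C' -> C `<=` Q -> C' `<=` Q ->
  [disjoint C & C'] -> rint s X (C `|` C') = rint s X C + rint s X C'.
Proof.
move=> mX bX mC mC' CQ C'Q dCC'.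
have h m : (forall K,compact (K : set (R * R)) -> (m K < +oo)%E) ->
  \int[m]_(x in C `|` C') X x = \int[m]_(x in C) X x + \int[m]_(x in C') X x.
 move=> mK;apply:Rintegral_setU=>//.
 apply:(@integrable_bounded _ _ _ M)=>//;first exact:measurableU.
 - rewrite -ge0_fin_numE// fin1//;first exact:measurableU.
  by rewrite subUset.
 - exact:measurable_funTS.
by rewrite /rint (h _ (@radon_pos_fin R s)) (h _ (@radon_neg_fin R s));ring.
Qed.

Let split_step e C C' : 0 <= e -> measurable C -> measurable C' -> C `<=` Q -> C' `<=` Q ->
  [disjoint C & C'] ->
  ((nu C)%:E <= lam C + (3 * e * tv_bound C)%:E)%E ->
  ((nu C')%:E <= lam C' + (3 * e * tv_bound C')%:E)%E ->
  ((nu (C `|` C'))%:E <= lam (C `|` C') + (3 * e * tv_bound (C `|` C'))%:E)%E.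
Proof.
move=> e0 mC mC' CQ C'Q dCC' h h'.
rewrite /nu !rintU// addrACA -/(nu C) -/(nu C') /lam ge0_integral_setU//;last first.
 by apply/measurable_EFinP;exact:measurable_funTS mf.
rewrite tv_boundU// mulrDr (EFinD (nu C)) (EFinD (3 * e * tv_bound C)) addeACA.
exact:leeD h h'.
Qed.

(** Small oscillation is reached by cutting the range of [X2] into bands of height [e], one per
    induction step; [slab1] does the same for [X1]. *)
Let slab2 e n a C : 0 < e -> measurable C -> C `<=` Q ->
  (forall x y, C x -> C y -> `|X1 x - X1 y| <= e) -> (forall x, C x -> a <= X2 x < a + n%:R * e) ->
  ((nu C)%:E <= lam C + (3 * e * tv_bound C)%:E)%E.
Proof.
move=> e0;elim:n a C=>[|n IH] a C mC CQ o1 h2.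
 apply:local=>//;first exact:ltW.
 by move=> x y /h2;rewrite mul0r addr0=>/andP[/le_lt_trans h] /h;rewrite ltxx.
have mI:=measurable_ltr (a + e) mX2.
have m1: measurable (C `&` [set x|X2 x < a + e]) by exact:measurableI.
have m2: measurable (C `\` [set x|X2 x < a + e]) by exact:measurableD.
rewrite -(setUIDK C [set x|X2 x < a + e]).
apply:split_step=>//.
- exact:ltW.
- by move=> x [/CQ].
- by move=> x [/CQ].
- by apply/disj_set2P;apply/seteqP;split=>// x [[_ +] [_]].
- apply:local=>//;first exact:ltW.
 + by move=> x [/CQ].
 + by move=> x y [Cx _] [Cy _];exact:o1.
 + move=> x y [/h2/andP[ax _] /= xa] [/h2/andP[ay _] /= ya];rewrite ler_norml;move: ax xa ay ya;lra.
- apply:(IH (a + e))=>//.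
 + by move=> x [/CQ].
 + by move=> x y [Cx _] [Cy _];exact:o1.
 + move=> x [/h2/andP[ax xa] /= /negP];rewrite -leNgt=> ->/=.
  by move: xa;rewrite -natr1;lra.
Qed.

Let slab1 e n N a b C : 0 < e -> measurable C -> C `<=` Q ->
  (forall x, C x -> a <= X1 x < a + n%:R * e) -> (forall x, C x -> b <= X2 x < b + N%:R * e) ->
  ((nu C)%:E <= lam C + (3 * e * tv_bound C)%:E)%E.
Proof.
move=> e0;elim:n a C=>[|n IH] a C mC CQ h1 h2.
 apply:local=>//;first exact:ltW.
  by move=> x y /h1;rewrite mul0r addr0=>/andP[/le_lt_trans h] /h;rewrite ltxx.
 by move=> x y /h1;rewrite mul0r addr0=>/andP[/le_lt_trans h] /h;rewrite ltxx.
have mI:=measurable_ltr (a + e) mX1.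
have m1: measurable (C `&` [set x|X1 x < a + e]) by exact:measurableI.
have m2: measurable (C `\` [set x|X1 x < a + e]) by exact:measurableD.
rewrite -(setUIDK C [set x|X1 x < a + e]).
apply:split_step=>//.
- exact:ltW.
- by move=> x [/CQ].
- by move=> x [/CQ].
- by apply/disj_set2P;apply/seteqP;split=>// x [[_ +] [_]].
- apply:(@slab2 e N b)=>//.
 + by move=> x [/CQ].
 + move=> x y [/h1/andP[ax _] /= xa] [/h1/andP[ay _] /= ya];rewrite ler_norml;move: ax xa ay ya;lra.
 + by move=> x [/h2].
- apply:(IH (a + e))=>//.
 + by move=> x [/CQ].
 + move=> x [/h1/andP[ax xa] /= /negP];rewrite -leNgt=> ->/=.
  by move: xa;rewrite -natr1;lra.
 + by move=> x [/h2].
Qed.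

Lemma pairing_on : ((nu Q)%:E <= lam Q)%E.
Proof.
apply/lee_addgt0Pr=> d d0.
pose e:=d / (3 * (tv_bound Q + 1)).
have t1: 0 < tv_bound Q + 1 by rewrite ltr_wpDl// tv_bound_ge0.
have e0: 0 < e by rewrite divr_gt0// mulr_gt0.
have M0: 0 <= M by apply:le_trans (bX1 (0,0)).
(* Enough bands of height [e] to cover the range [-M, M] of each component. *)
pose n:=(Num.truncn (2 * M / e)).+1.
have ne: 2 * M < n%:R * e by rewrite -ltr_pdivrMr// truncnS_gt.
have hb (X : R * R -> R) x : `|X x| <= M -> - M <= X x < - M + n%:R * e.
 by rewrite ler_norml=>/andP[-> h]/=;move: h ne;lra.
apply:le_trans (@slab1 e n n (- M) (- M) Q e0 mQ _ _ _) _=>//.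
- by move=> x _;exact:hb.
- by move=> x _;exact:hb.
rewrite leeD2l// lee_fin.
have ->: 3 * e * tv_bound Q = d * (tv_bound Q / (tv_bound Q + 1)) by rewrite /e;field;rewrite gt_eqF.
by rewrite ler_piMr ?(ltW d0)// ler_pdivrMr// mul1r lerDl.
Qed.

End tv.

End pairing.

(** * Lebesgue and Borel measurability in the plane *)

Section plane_measure.
Context {R : realType}.
Notation P := (plane R).
Notation m := (@leb2_borel R).
Implicit Types (A E G N U : set P) (X : R * R -> R) (a b c e : R).

Let near_rat (u d : R) : 0 < d -> u - d < u + d. Proof. by move=> d0;lra. Qed.

Let near_sym (u v d : R) : u - d < v -> v < u + d -> v - d < u < v + d.
Proof. by move=> h1 h2;apply/andP;split;lra. Qed.

Let near_trans (u v y d e : R) : u - d < v -> v < u + d -> v - d < y -> y < v + d ->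
  2 * d < e -> `|u - y| < e.
Proof. by move=> *;rewrite ltr_norml;apply/andP;split;lra. Qed.

Lemma open_plane_measurable U : open (U : set (R * R)) -> measurable U.
Proof.
move=> oU;pose box (p q : rat) (n : nat) : set P :=
 `](ratr p - n.+1%:R^-1),(ratr p + n.+1%:R^-1)[ `*` `](ratr q - n.+1%:R^-1),(ratr q + n.+1%:R^-1)[.
have mbox p q n : measurable (box p q n) by apply:measurableX;exact:measurable_itv.
have ->: U = \bigcup_p \bigcup_q \bigcup_n (if pselect (box p q n `<=` U) then box p q n else set0).
 apply/seteqP;split=>[x Ux|x [p _ [q _ [n _]]]];last by case:pselect=>// h;exact:h.
 have /nbhs_ballP[e /= e0 eU] : nbhs (x : R * R) U by exact:open_nbhs_nbhs.
 have [n ne] : exists n : nat,2 * n.+1%:R^-1 < e.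
  exists (Num.truncn (2 / e));rewrite -[e]invrK ltr_pdivrMr// mulrC -ltr_pdivrMr ?invr_gt0// invrK.
  exact:truncnS_gt.
 have n0: 0 < n.+1%:R^-1 :> R by rewrite invr_gt0.
 have [p] : exists q : rat,ratr q \in `](x.1 - n.+1%:R^-1),(x.1 + n.+1%:R^-1)[.
  by apply:rat_in_itvoo;exact:near_rat.
 have [q] : exists q : rat,ratr q \in `](x.2 - n.+1%:R^-1),(x.2 + n.+1%:R^-1)[.
  by apply:rat_in_itvoo;exact:near_rat.
 rewrite !in_itv/= =>/andP[q1 q2] /andP[p1 p2].
 exists p=>//;exists q=>//;exists n=>//;case:pselect=>[h|h].
  by rewrite /box;split;rewrite /= in_itv/=;exact:near_sym.
 exfalso;apply:h=> y []/=;rewrite !in_itv/= =>/andP[y1 y2] /andP[y3 y4];apply:eU.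
 by split;[exact:(near_trans p1 p2 y1 y2 ne)|exact:(near_trans q1 q2 y3 y4 ne)].
apply:bigcupT_measurable_rat=> p;apply:bigcupT_measurable_rat=> q.
by apply:bigcup_measurable=> n _;case:ifP=> _;[exact:mbox|exact:measurable0].
Qed.

Lemma cts_plane_measurable X : continuous X -> mfun (setT : set P) X.
Proof.
move=>/continuousP cX;apply:(measurability _ (RGenOpens.measurableE R)).
move=> _ [_ [a [b ->]] <-];rewrite setTI;apply:open_plane_measurable.
by apply:cX;exact:interval_open.
Qed.

Lemma borel_leb2_measurable A : measurable A -> leb2_measurable A.
Proof. exact:caratheodory_measurable_mu_ext. Qed.

Lemma leb2E A : measurable A -> leb2 A = m A.
Proof. by move=> mA;rewrite /leb2 /completed_measure_extension measurable_mu_extE. Qed.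

Lemma integral_leb2 (g : P -> \bar R) : mfun setT g ->
  (\int[leb2]_x g x = \int[m]_x g x)%E.
Proof.
have mid: mfun (setT : set (caratheodory_type (m^*)%mu)) (fun x=> x : P).
 by move=> _ A mA;rewrite setTI;exact:borel_leb2_measurable.
suff h (g' : P -> \bar R) : mfun setT g' -> (forall x,0 <= g' x)%E ->
  (\int[leb2]_x g' x = \int[m]_x g' x)%E.
 move=> mg;rewrite integralE [RHS]integralE !h//.
 - exact:measurable_funeneg.
 - exact:measurable_funepos.
move=> mg g0.
have e: forall A,measurable A -> A `<=` setT ->
  m A = measure_function_pushforward__canonical__measure_function_Measure leb2 mid A.
 by move=> A mA _;rewrite -leb2E.
rewrite (eq_measure_integral _ e) ge0_integral_pushforward// preimage_setT.
Qed.

Lemma borel_hull E : ((m^*)%mu E < +oo)%E ->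
  exists G, [/\ measurable G, E `<=` G & (m G <= (m^*)%mu E)%E].
Proof.
move=> Eoo.
have cov (n : nat) : exists G,[/\ measurable G,E `<=` G & (m G <= (m^*)%mu E + (n.+1%:R^-1)%:E)%E].
 have fE: (m^*)%mu E \is a fin_num by rewrite ge0_fin_numE// mu_ext_ge0.
 have n0: (0 < n.+1%:R^-1 :> R)%R by rewrite invr_gt0.
 have [_ [F [mF EF] <-] /ltW hF]:=lb_ereal_inf_adherent n0 fE.
 exists (\bigcup_k F k);split=>//;first exact:bigcup_measurable.
 by apply:le_trans hF;apply:measure_sigma_subadditive=>//;exact:bigcup_measurable.
have [G hG]:=choice cov.
exists (\bigcap_n G n);split.
- by apply:bigcapT_measurable=> n;have []:=hG n.
- by move=> x Ex n _;have [_ h _]:=hG n;exact:h.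
apply/lee_addgt0Pr=> e e0;pose n:=Num.truncn e^-1.
have [mG _ h]:=hG n.
apply:(@le_trans _ _ (m (G n))).
 apply:le_measure;rewrite ?inE//;last by move=> x;exact.
 by apply:bigcapT_measurable=> k;have []:=hG k.
apply:(le_trans h);rewrite leeD2l// lee_fin -[leRHS]invrK lef_pV2 ?posrE ?invr_gt0//.
by rewrite ltW// truncnS_gt.
Qed.

(** Boxes make the outer measure finite. There a Borel hull [G] exceeds the set by an outer null
    set, by the Caratheodory condition tested on [G], and that difference has a null Borel hull of
    its own. *)
Lemma leb2_borel_repr (E : set (R * R)) : leb2_measurable E -> exists A N,
  [/\ measurable A, measurable N, m N = 0, A `<=` E `|` N & E `<=` A `|` N].
Proof.
move=> mE;pose Q (n : nat) : set P:=`[- n%:R,n%:R] `*` `[- n%:R,n%:R].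
have mQ n : measurable (Q n) by apply:measurableX;exact:measurable_itv.
have Qoo n : (m (Q n) < +oo)%E.
 have e: m (Q n) = (@lebesgue_measure R `[(- n%:R)%R,n%:R%R]%classic * @lebesgue_measure R `[(- n%:R)%R,n%:R%R]%classic)%E.
  by apply:product_measure1E;exact:measurable_itv.
 by rewrite e lebesgue_measure_itv/= lte_fin;case:ifP=> _;rewrite ?mule0 ?ltry.
have cE n : leb2_measurable (E `&` Q n).
 by apply:(@measurableI _ (caratheodory_type (m^*)%mu))=>//;exact:borel_leb2_measurable.
have hn n : exists GN : set P * set P,[/\ measurable GN.1,measurable GN.2,m GN.2 = 0,
  E `&` Q n `<=` GN.1 & GN.1 `\` (E `&` Q n) `<=` GN.2].
 have Eoo: ((m^*)%mu (E `&` Q n) < +oo)%E.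
  apply:le_lt_trans (Qoo n);rewrite -(leb2E (mQ n)).
  by apply:(@le_outer_measure _ _ (m^*)%mu);exact:subIsetr.
 have [G [mG EG leG]]:=borel_hull Eoo.
 have z: ((m^*)%mu (G `\` (E `&` Q n)) = 0)%E.
  have:=cE n G;rewrite setIidr// -setDE=> e.
  have mGE: ((m^*)%mu G = m G)%E by exact:leb2E.
  have eq1: ((m^*)%mu (E `&` Q n) = (m^*)%mu (E `&` Q n) + (m^*)%mu (G `\` (E `&` Q n)))%E.
   have e': ((m^*)%mu G = (m^*)%mu (E `&` Q n) + (m^*)%mu (G `\` (E `&` Q n)))%E:=e.
   apply/eqP;rewrite -e' eq_le mGE leG andbT -mGE.
   exact:(@le_outer_measure _ _ (m^*)%mu _ _ EG).
  have fE: (m^*)%mu (E `&` Q n) \is a fin_num by rewrite ge0_fin_numE// mu_ext_ge0.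
  move: eq1 fE;move: ((m^*)%mu (E `&` Q n)) ((m^*)%mu (G `\` (E `&` Q n)))=>[u| |] [v| |]//.
  by move=> -[euv] _;congr EFin;move: euv;lra.
 have zoo: ((m^*)%mu (G `\` (E `&` Q n)) < +oo)%E by rewrite z ltry.
 have [N [mN GN leN]]:=borel_hull zoo.
 exists (G,N);split=>//=;apply/eqP;rewrite eq_le measure_ge0 andbT.
 by rewrite z in leN.
have [GN hGN]:=choice hn.
exists (\bigcup_n (GN n).1),(\bigcup_n (GN n).2);split.
- by apply:bigcup_measurable=> n _;have []:=hGN n.
- by apply:bigcup_measurable=> n _;have []:=hGN n.
- apply/eqP;rewrite eq_le measure_ge0 andbT.
 apply:(@le_trans _ _ (\sum_(0 <= n <oo) m (GN n).2)%E).
  apply:measure_sigma_subadditive=>//;last by apply:bigcup_measurable=> n _;have []:=hGN n.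
  by move=> n;have []:=hGN n.
 by rewrite eseries0// => n _ _;have []:=hGN n.
- move=> x [n _ Gx];have [_ _ _ _ h]:=hGN n.
 by have [[]|nE]:=pselect ((E `&` Q n) x);[left|right;exists n=>//;apply:h].
- move=> x Ex;pose n:=Num.truncn (`|x.1| + `|x.2|).
 have [_ _ _ h _]:=hGN n.+1;left;exists n.+1=>//;apply:h;split=>//.
 have xn:=truncnS_gt (`|x.1| + `|x.2|);rewrite -/n in xn.
 by split;rewrite /= in_itv/= -ler_norml ltW// (le_lt_trans _ xn)// (lerDl,lerDr).
Qed.

End plane_measure.

(** * Divergence of test fields on a set of finite perimeter *)

Section divergence.
Context {R : realType}.
Notation P := (plane R).
Notation m := (@leb2_borel R).
Implicit Types (A E N Q : set P) (X u : R * R -> R) (a b c e : R).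

Definition plane_box (M : R) : set P := `[- M, M] `*` `[- M, M].

Lemma measurable_box M : measurable (plane_box M).
Proof. by apply:measurableX;exact:measurable_itv. Qed.

Lemma compact_box M : compact (plane_box M : set (R * R)).
Proof. by apply:compact_setX;exact:segment_compact. Qed.

Lemma plane_boxP M (x : R * R) : plane_box M x <-> `|x.1| <= M /\ `|x.2| <= M.
Proof. by rewrite !ler_norml /plane_box /= !in_itv. Qed.

Lemma bounded_box M : bounded_set (plane_box M : set (R * R)).
Proof. by apply/compact_bounded;exact:compact_box. Qed.

Lemma box_finite M : (m (plane_box M) < +oo)%E.
Proof.
have e: m (plane_box M) = (@lebesgue_measure R `[(- M)%R,M]%classic * @lebesgue_measure R `[(- M)%R,M]%classic)%E.
 by apply:product_measure1E;exact:measurable_itv.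
by rewrite e lebesgue_measure_itv/= lte_fin;case:ifP=> _;rewrite ?mule0 ?ltry.
Qed.

Lemma cts_bounded X M : continuous X -> (forall x, ~ plane_box M x -> X x = 0) ->
  exists B, forall x, `|X x| <= B.
Proof.
move=> cX X0;have : compact (X @` (plane_box M : set (R * R))).
 by apply:continuous_compact;[exact:wc_cts|exact:compact_box].
move=>/compact_bounded[B [rB hB]];exists (`|B| + 1)=> x.
have B1: B < `|B| + 1 by rewrite (le_lt_trans (ler_norm _))// ltrDl.
have [Mx|/X0->]:=pselect (plane_box M x);first by apply:(hB _ B1);exists x.
by rewrite normr0 addr_ge0.
Qed.

Lemma test_box u : test_function u -> exists M, forall x, ~ plane_box M x -> u x = 0.
Proof.
move=>[_ /compact_bounded[B [rB hB]]];exists (`|B| + 1)=> x;apply:contra_notP=>/eqP ux.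
have B1: B < `|B| + 1 by rewrite (le_lt_trans (ler_norm _))// ltrDl.
have ucl: closure [set y : R * R|u y != 0] x by exact:subset_closure.
have:=hB _ B1 x ucl;rewrite /= prod_normE ge_max=>/andP[h1 h2].
exact/plane_boxP.
Qed.

Lemma box_le M M' x : M <= M' -> plane_box M x -> plane_box M' x.
Proof. by move=> MM /plane_boxP[h1 h2];apply/plane_boxP;split;exact:le_trans MM. Qed.

Lemma radon_int_rint (s : @signed_radon R) X M : (forall x, ~ plane_box M x -> X x = 0) ->
  radon_int s X = rint s X (plane_box M).
Proof.
move=> X0;have h (mm : {measure set P -> \bar R}) : \int[mm]_x X x = \int[mm]_(x in plane_box M) X x.
 rewrite /Rintegral [in RHS]integral_mkcond;congr fine;apply:eq_integral=> x _.
 by rewrite patchE;case:ifPn=>// /negP;rewrite inE=>/X0 ->.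
by rewrite /radon_int /rint !h.
Qed.

Section repr.
Variables (E A N : set P).
Hypotheses (mE : leb2_measurable E) (mA : measurable A) (mN : measurable N) (N0 : m N = 0)
  (AE : A `<=` E `|` N) (EA : E `<=` A `|` N).

Let mpatch (g : P -> \bar R) (B : set P) : mfun setT g -> leb2_measurable B ->
  mfun (setT : set (caratheodory_type (m^*)%mu)) (g \_ B).
Proof.
move=> mg mB.
have gc: mfun (setT : set (caratheodory_type (m^*)%mu)) g.
 move=> _ Y mY;rewrite setTI;apply:borel_leb2_measurable.
 by rewrite -[X in measurable X]setTI;exact:mg.
exact:((measurable_restrictT (T1:=caratheodory_type (m^*)%mu) g mB).1 (measurable_funTS gc)).
Qed.

Lemma integral_repr (g : P -> \bar R) : mfun setT g ->
  (\int[leb2]_(x in E) g x = \int[m]_(x in A) g x)%E.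
Proof.
move=> mg;rewrite integral_mkcond [RHS]integral_mkcond -integral_leb2;last first.
 exact:((measurable_restrictT _ mA).1 (measurable_funTS mg)).
apply:ae_eq_integral=>//.
- exact:mpatch.
- by apply:mpatch=>//;exact:borel_leb2_measurable.
exists N;split.
- exact:borel_leb2_measurable.
- exact:etrans (leb2E mN) N0.
move=> x /= /not_implyP[_];apply:contra_notP=> nNx;rewrite !patchE.
suff -> : (x \in E) = (x \in A) by [].
by apply/idP/idP;rewrite !inE;[move=>/EA[]|move=>/AE[]].
Qed.

Lemma Rintegral_repr X : mfun setT X ->
  \int[leb2]_x (\1_E x * X x) = \int[m]_(x in A) X x.
Proof.
move=> mX;rewrite /Rintegral -(integral_repr (g:=fun x=>(X x)%:E));last exact/measurable_EFinP.
rewrite [in RHS]integral_mkcond;congr fine;apply:eq_integral=> x _.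
by rewrite patchE indicE;case:ifP=> _;rewrite ?mul1r ?mul0r.
Qed.

Lemma volume_repr f : mfun setT f -> weighted_volume f E = (\int[m]_(x in A) (f x)%:E)%E.
Proof. by move=> mf;apply:integral_repr;exact/measurable_EFinP. Qed.

(** Both components vanish outside one box. On it the pairing inequality applies to [Dchi E], and
    [f >= 0] lets the perimeter integral be enlarged to the whole plane. *)
Lemma divergence_le f X1 X2 : BVloc \1_E -> test_function X1 -> test_function X2 ->
  mfun setT f -> (forall x, enorm (X1 x, X2 x) <= f x) ->
  ((- (\int[m]_(x in A) partial1 X1 x + \int[m]_(x in A) partial2 X2 x))%:E
    <= weighted_perimeter f E)%E.
Proof.
move=>[_ [D0 hD0]] t1 t2 mf Xf.
(* The default of [xget] is excluded because some derivative exists. *)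
have hD: distr_derivative \1_E (Dchi E).
 by rewrite /Dchi;case:xgetP=>[D _ //|/(_ D0)].
have [k1 k2]:=(t1.1,t2.1).
have mp1: mfun setT (partial1 X1) by apply:cts_plane_measurable;case:(k1 1%N)=> _ [_ _ []].
have mp2: mfun setT (partial2 X2) by apply:cts_plane_measurable;case:(k2 1%N)=> _ [_ _ _ []].
have [h1 _]:=hD _ t1;have [_ h2]:=hD _ t2.
rewrite -(Rintegral_repr mp1) -(Rintegral_repr mp2) h1 h2 -opprD opprK.
have [M1 z1]:=test_box t1;have [M2 z2]:=test_box t2.
pose M:=Num.max M1 M2.
have z1' x : ~ plane_box M x -> X1 x = 0.
 by move=> h;apply:z1;apply:contra_not h;apply:box_le;rewrite le_max lexx.
have z2' x : ~ plane_box M x -> X2 x = 0.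
 by move=> h;apply:z2;apply:contra_not h;apply:box_le;rewrite le_max lexx orbT.
have c1:=Ck_cts (k1 0%N);have c2:=Ck_cts (k2 0%N).
have [B1 b1]:=cts_bounded c1 z1';have [B2 b2]:=cts_bounded c2 z2'.
rewrite (radon_int_rint _ z1') (radon_int_rint _ z2').
have b1' x : `|X1 x| <= Num.max B1 B2 by rewrite le_max b1.
have b2' x : `|X2 x| <= Num.max B1 B2 by rewrite le_max b2 orbT.
have hp:=pairing_on (Dchi E) (measurable_box M) (@bounded_box M) (cts_plane_measurable c1)
 (cts_plane_measurable c2) mf b1' b2' Xf.
apply:(le_trans hp).
apply:ge0_subset_integral=>//.
- exact:measurable_box.
- exact/measurable_EFinP.
- by move=> x _;rewrite lee_fin (le_trans (enorm_ge0 _) (Xf x)).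
Qed.

End repr.
End divergence.

(** * Integration over circles *)

Section circle_integral.
Context {R : realType}.
Notation T := (measurableTypeR R).
Notation P := (plane R).
Notation mu := (@lebesgue_measure R).
Notation m := (@leb2_borel R).
Implicit Types (a b c s t M : R) (W : P -> R).

Lemma ge0_integral_fold (G : T -> \bar R) : mfun setT G -> (forall t, 0 <= G t)%E ->
  (\int[mu]_t G t = \int[mu]_(t in `]0%R, +oo[) (G t + G (- t)%R))%E.
Proof.
move=> mG G0.
have mGN: mfun setT (fun t : T=> G (- t)) by apply:(measurableT_comp mG).
have ->: (\int[mu]_t G t = \int[mu]_(t in `]0%R,+oo[) G t + \int[mu]_(t in `]-oo,0%R]) G t)%E.
 rewrite -ge0_integral_setU//=.
 - by congr integral;apply/seteqP;split=>// x _/=;rewrite !in_itv/= andbT;case:(ltP 0 x)=> _;[left|right].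
 - exact:measurable_funTS.
 - by apply/disj_set2P;apply/seteqP;split=>// x /= [];rewrite !in_itv/= andbT ltNge=>/negP.
rewrite ge0_integralD//;try exact:measurable_funTS.
congr (_ + _)%E;rewrite [LHS]integral_mkcond.
rewrite [LHS](@ge0_scale _ (-1));[|by rewrite oppr_eq0 oner_neq0| |by move=> x;rewrite patchE;case:ifP].
2: by apply:(measurable_restrictT _ _).1;[exact:measurable_itv|exact:measurable_funTS].
rewrite (_ : (fun x=> _) = (fun t : T=> G (- t)) \_ `[0,+oo[);last first.
 apply/funext=> t;rewrite normrN1 mul1e mulN1r !patchE;congr (if _ then _ else _).
 by apply/idP/idP;rewrite !inE/= !in_itv/= andbT oppr_le0.
rewrite -integral_mkcond integral_itv_obnd_cbnd//.
exact:measurable_funTS.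
Qed.

Lemma polar_pos (f : P -> \bar R) : mfun setT f -> (forall z, 0 <= f z)%E ->
  (\int[m]_z f z = \int[mu]_(t in `]0%R, +oo[)
     \int[mu]_s ((t * dang s)%:E * (f (ray t s) + f (ray (- t) s))))%E.
Proof.
move=> mf f0;rewrite polar//.
have mZ: mfun setT (fun z : T * T=>(`|z.1| * dang z.2)%:E * f (ray z.1 z.2))%E.
 apply:emeasurable_funM;last exact:(measurableT_comp mf (@measurable_ray R)).
 apply/measurable_EFinP;apply:measurable_funM;first exact:measurableT_comp.
 by apply:(measurableT_comp (f:=dang))=>//;exact:cts_mfun (@cts_dang R).
have Z0 z : (0 <= (`|z.1| * dang z.2)%:E * f (ray z.1 z.2))%E.
 by rewrite mule_ge0// lee_fin mulr_ge0// ltW// dang_gt0.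
rewrite ge0_integral_fold;last 2 first.
- exact:(measurable_fun_fubini_tonelli_F _ mZ Z0).
- by move=> t;apply:integral_ge0=> s _;exact:(Z0 (t,s)).
apply:eq_integral=> t;rewrite inE/= in_itv/= andbT=> t0.
rewrite -ge0_integralD//=.
- apply:eq_integral=> s _;rewrite normrN gtr0_norm// ge0_muleDr//.
- by move=> s _;exact:(Z0 (t,s)).
- exact:(measurable_fun_pair2 t mZ).
- by move=> s _;exact:(Z0 (- t,s)).
- exact:(measurable_fun_pair2 (- t) mZ).
Qed.

(** Integral over the circle of radius [t] with respect to the angle: the rays with parameters [t]
    and [- t] trace the right and the left half circle. *)
Definition circ_int W t : R := \int[mu]_s (dang s * (W (ray t s) + W (ray (- t) s))).

Lemma dang_integrable c : mu.-integrable setT (EFin \o (fun s => c * dang s)).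
Proof.
have h: mu.-integrable setT (EFin \o (@dang R)).
 apply/integrableP;split;first by apply/measurable_EFinP;exact:cts_mfun (@cts_dang R).
 rewrite (_ : (fun x=> _) = (fun s=>(dang s)%:E));first by rewrite integral_dang ltry.
 by apply/funext=> s/=;rewrite ger0_norm// ltW// dang_gt0.
have h2: mu.-integrable setT (fun s=> c%:E * (EFin \o (@dang R)) s)%E by apply:integrableZl.
exact:h2.
Qed.

Lemma measurable_circ W t : mfun setT W ->
  mfun setT (fun s : T => dang s * (W (ray t s) + W (ray (- t) s))).
Proof.
move=> mW;apply:measurable_funM;first exact:cts_mfun (@cts_dang R).
have h u : mfun setT (fun s : T=> W (ray u s)).
 exact:(measurable_fun_pair2 u (measurableT_comp mW (@measurable_ray R))).
exact:measurable_funD.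
Qed.

Lemma circ_integrable W t M : mfun setT W -> (forall x, `|W x| <= M) ->
  mu.-integrable setT (EFin \o (fun s => dang s * (W (ray t s) + W (ray (- t) s)))).
Proof.
move=> mW WM;apply:(le_integrable measurableT _ _ (dang_integrable (M + M))).
 by apply/measurable_EFinP;exact:measurable_circ.
move=> s _/=;rewrite lee_fin normrM (ger0_norm (ltW (dang_gt0 s))) mulrC.
have M0: 0 <= M by exact:le_trans (WM (0,0)).
rewrite [leRHS]ger0_norm ?mulr_ge0 ?addr_ge0 ?(ltW (dang_gt0 s))//.
by rewrite ler_wpM2r ?(ltW (dang_gt0 s))// (le_trans (ler_normD _ _))// lerD.
Qed.

Lemma circ_int_bound W t M : mfun setT W -> (forall x, `|W x| <= M) ->
  `|circ_int W t| <= 2 * pi * M.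
Proof.
move=> mW WM;have I:=circ_integrable t mW WM.
apply:le_trans (le_normr_Rintegral _ I) _=>//.
have ->: 2 * pi * M = \int[mu]_s ((M + M) * dang s).
 rewrite RintegralZl//;first by rewrite /Rintegral integral_dang/=;ring.
 by have:=dang_integrable 1;under eq_fun do rewrite /= mul1r.
apply:le_Rintegral=>//;first exact:integrable_norm I.
 exact:dang_integrable.
move=> s _/=;rewrite normrM (ger0_norm (ltW (dang_gt0 s))) mulrC.
by rewrite ler_wpM2r ?(ltW (dang_gt0 s))// (le_trans (ler_normD _ _))// lerD.
Qed.

Lemma circ_intD W1 W2 t M : mfun setT W1 -> (forall x, `|W1 x| <= M) ->
  mfun setT W2 -> (forall x, `|W2 x| <= M) ->
  circ_int (fun x => W1 x + W2 x) t = circ_int W1 t + circ_int W2 t.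
Proof.
move=> m1 b1 m2 b2;have I1:=circ_integrable t m1 b1;have I2:=circ_integrable t m2 b2.
rewrite /circ_int -RintegralD//;apply:eq_Rintegral=> s _;ring.
Qed.

Lemma circ_intZ c W t M : mfun setT W -> (forall x, `|W x| <= M) ->
  circ_int (fun x => c * W x) t = c * circ_int W t.
Proof.
move=> m1 b1;have I1:=circ_integrable t m1 b1.
rewrite /circ_int -RintegralZl//;apply:eq_Rintegral=> s _;ring.
Qed.

Lemma measurable_circ_int W : mfun setT W -> mfun setT (circ_int W).
Proof.
move=> mW.
pose Z (z : T * T):=dang z.2 * (W (ray z.1 z.2) + W (ray (- z.1) z.2)).
have mZ: mfun setT Z.
 apply:measurable_funM.
  by apply:(measurableT_comp (f:=dang))=>//;exact:cts_mfun (@cts_dang R).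
 apply:measurable_funD;first exact:(measurableT_comp mW (@measurable_ray R)).
 have mN: mfun setT (fun z : T * T=>(- z.1,z.2) : T * T).
  by apply:measurable_fun_pair=>//;exact:measurableT_comp.
 exact:(measurableT_comp (measurableT_comp mW (@measurable_ray R)) mN).
have hp (Z' : T * T -> \bar R) : mfun setT Z' -> (forall z,0 <= Z' z)%E ->
 mfun setT (fun t=> \int[mu]_s Z' (t,s))%E.
 by move=> mZ' Z'0;exact:(measurable_fun_fubini_tonelli_F (m2:=mu) _ mZ' Z'0).
rewrite /circ_int /Rintegral.
rewrite (_ : (fun t=> _) = (fun t=> fine (\int[mu]_s ((EFin \o Z)^\+ (t,s)) - \int[mu]_s ((EFin \o Z)^\- (t,s)))%E)).
 apply:(measurableT_comp (f:=fine))=>//;apply:emeasurable_funB;apply:hp=>//.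
 - by apply:measurable_funepos;exact/measurable_EFinP.
 - by apply:measurable_funeneg;exact/measurable_EFinP.
apply/funext=> t;congr fine.
have e:=integralE mu setT (fun s : T=>(Z (t,s))%:E).
apply:(etrans (etrans _ e));first by apply:eq_integral.
by congr (_ - _)%E;apply:eq_integral=> s _;rewrite ?funeposE ?funenegE.
Qed.

Let polar_ge0 W a b M : 0 < a -> mfun setT W -> (forall x, 0 <= W x <= M) ->
  (forall x, ~~ (a <= enorm x <= b) -> W x = 0) ->
  (\int[m]_z (W z)%:E = (\int[mu]_(t in `[a, b]) (t * circ_int W t))%:E)%E.
Proof.
move=> a0 mW WM Ws.
have WM' x : `|W x| <= M by have /andP[w0 wM]:=WM x;rewrite ger0_norm.
rewrite polar_pos;last 2 first.
- exact/measurable_EFinP.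
- by move=> z;rewrite lee_fin;case/andP: (WM z).
have I t:=circ_integrable t mW WM'.
transitivity (\int[mu]_(t in `]0%R,+oo[) (t * circ_int W t)%:E)%E.
 apply:eq_integral=> t;rewrite inE/= in_itv/= andbT=> t0.
 rewrite EFinM /circ_int fineK;last exact:integrable_fin_num (I t).
 rewrite -(integralZl measurableT (I t));apply:eq_integral=> s _/=.
 by rewrite -EFinD -!EFinM mulrA.
have z t : 0 < t -> t \notin `[a,b]%R -> circ_int W t = 0.
 move=> t0;rewrite in_itv/= => tab;rewrite /circ_int.
 transitivity (\int[mu]_s (cst 0 (s : T) : R));last by rewrite Rintegral_cst// mul0r.
 by apply:eq_Rintegral=> s _;rewrite !Ws ?addr0 ?mulr0// enorm_ray ?normrN gtr0_norm.
have cI: mu.-integrable `[a,b] (EFin \o (fun t=> t * circ_int W t)).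
 have [ab|ba]:=leP a b;last by rewrite set_itv_ge -?leNgt ?bnd_simp//= -?ltNge//;exact:integrable_set0.
 apply:(@bounded_int _ _ _ (b * (2 * pi * M)))=>//;first exact:mu_itv_fin.
  apply:measurable_funTS;apply:measurable_funM=>//;exact:measurable_circ_int.
 move=> t/=;rewrite in_itv/= =>/andP[at_ tb];rewrite normrM ger0_norm ?(le_trans (ltW a0))//.
 apply:ler_pM=>//;first by rewrite (le_trans (ltW a0)).
 exact:circ_int_bound.
rewrite /Rintegral fineK;last exact:integrable_fin_num cI.
rewrite [LHS]integral_mkcond [RHS]integral_mkcond;congr integral;apply/funext=> t.
rewrite !patchE;case:ifPn=> h1;case:ifPn=> h2//.
- rewrite z ?mulr0//;first by move: h1;rewrite inE/= in_itv/= andbT.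
 by apply:contra h2=> h;rewrite inE.
- case/negP: h1;move: h2;rewrite !inE/= !in_itv/= andbT=>/andP[at_ _].
 exact:lt_le_trans at_.
Qed.

Lemma circ_radial_integrable W a b M : 0 < a -> mfun setT W -> (forall x, `|W x| <= M) ->
  mu.-integrable `[a, b] (EFin \o (fun t => t * circ_int W t)).
Proof.
move=> a0 mW WM;have [ab|ba]:=leP a b;last by rewrite set_itv_ge -?leNgt ?bnd_simp//= -?ltNge//;exact:integrable_set0.
apply:(@bounded_int _ _ _ (b * (2 * pi * M)))=>//;first exact:mu_itv_fin.
 by apply:measurable_funTS;apply:measurable_funM=>//;exact:measurable_circ_int.
move=> t/=;rewrite in_itv/= =>/andP[at_ tb];rewrite normrM ger0_norm ?(le_trans (ltW a0))//.
by apply:ler_pM=>//;[rewrite (le_trans (ltW a0))|exact:circ_int_bound].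
Qed.

Lemma polar_signed W a b M : 0 < a -> mfun setT W -> (forall x, `|W x| <= M) ->
  (forall x, ~~ (a <= enorm x <= b) -> W x = 0) ->
  \int[m]_z W z = \int[mu]_(t in `[a, b]) (t * circ_int W t).
Proof.
move=> a0 mW WM Ws.
have M0: 0 <= M by exact:le_trans (WM (0,0)).
pose Wp x:=Num.max (W x) 0;pose Wn x:=Num.max (- W x) 0.
have mp: mfun setT Wp by apply:measurable_maxr=>//;exact:measurable_cst.
have mn: mfun setT Wn.
 by apply:measurable_maxr;[exact:measurableT_comp|exact:measurable_cst].
have bp x : 0 <= Wp x <= M.
 by rewrite /Wp le_max lexx orbT ge_max M0 andbT (le_trans (ler_norm _)).
have bn x : 0 <= Wn x <= M.
 by rewrite /Wn le_max lexx orbT ge_max M0 andbT (le_trans (ler_norm _))// normrN.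
have sp x : ~~ (a <= enorm x <= b) -> Wp x = 0 by move=>/Ws;rewrite /Wp=> ->;rewrite maxxx.
have sn x : ~~ (a <= enorm x <= b) -> Wn x = 0 by move=>/Ws;rewrite /Wn=> ->;rewrite oppr0 maxxx.
have WE x : W x = Wp x - Wn x.
 by rewrite /Wp /Wn;case:(leP (W x) 0)=> h;case:(leP (- W x) 0)=> h';lra.
have nb (V : P -> R) : (forall x,0 <= V x <= M) -> forall x,`|V x| <= M.
 by move=> bV x;have /andP[v0 vM]:=bV x;rewrite ger0_norm.
have I (V : P -> R) : mfun setT V -> (forall x,0 <= V x <= M) ->
  (forall x,~~ (a <= enorm x <= b) -> V x = 0) -> m.-integrable setT (EFin \o V).
 move=> mV bV sV;apply/integrableP;split;first exact/measurable_EFinP.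
 rewrite (_ : (fun x=> _) = (fun x=>(V x)%:E)).
  by rewrite (polar_ge0 a0 mV bV sV) ltry.
 by apply/funext=> x/=;rewrite ger0_norm//;case/andP: (bV x).
have RI (V : P -> R) : mfun setT V -> (forall x,0 <= V x <= M) ->
  (forall x,~~ (a <= enorm x <= b) -> V x = 0) ->
  \int[m]_z V z = \int[mu]_(t in `[a,b]) (t * circ_int V t).
 by move=> mV bV sV;rewrite [LHS]/Rintegral (polar_ge0 a0 mV bV sV).
transitivity (\int[m]_z (Wp z - Wn z));first by apply:eq_Rintegral=> z _;exact:WE.
rewrite RintegralB//;[|exact:I..].
rewrite (RI _ mp bp sp) (RI _ mn bn sn) -RintegralB//;last 2 first.
- exact:(circ_radial_integrable _ a0 mp (nb _ bp)).
- exact:(circ_radial_integrable _ a0 mn (nb _ bn)).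
apply:eq_Rintegral=> t _;rewrite -mulrBr;congr (_ * _).
have ->: circ_int W t = circ_int (fun x=> Wp x + -1 * Wn x) t.
 by apply:eq_Rintegral=> s _;rewrite !WE;ring.
rewrite (@circ_intD _ _ _ M) ?(@circ_intZ _ _ _ M) ?mulN1r//;try exact:nb.
- by apply:measurable_funM=>//;exact:measurable_cst.
- by move=> x;rewrite mulN1r normrN;exact:nb.
Qed.

End circle_integral.

(** * Test fields with radial and tangential parts *)

Section fields.
Context {R : realType}.
Notation T := (measurableTypeR R).
Notation P := (plane R).
Notation mu := (@lebesgue_measure R).
Notation m := (@leb2_borel R).
Implicit Types (a b c s t M : R) (x : R * R) (L : seq ((R -> R) * @angular R)).

Definition ang_one : @angular R := Angular (fun=> 1) (fun=> 1) 1 1.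

Lemma ang_one_smooth : ang_smooth ang_one.
Proof. by split;[move=> k;exact:S1_cst|move=> k;exact:S1_cst|exists 1;split]. Qed.

Lemma ang_fun_one x : ang_fun ang_one x = 1.
Proof. by rewrite /ang_fun/=;do ![case:ifP=>//]. Qed.

Lemma ang_der_one x : ang_fun (ang_der ang_one) x = 0.
Proof.
rewrite /ang_fun /= derive1_cst !mulr0;do ![case:ifP=>//].
Qed.

Fixpoint ang_sum_smooth L : Prop :=
  if L is cA :: L' then [/\ smooth1 cA.1, exists B, forall t, `|cA.1 t| <= B, ang_smooth cA.2 & ang_sum_smooth L']
  else True.

(* A function smooth away from the origin, as a combination of angular functions
   with radial coefficients; [ang_sum_der] is its derivative in the angle. *)
Fixpoint ang_sum L x : R :=
  if L is cA :: L' then cA.1 (enorm x) * ang_fun cA.2 x + ang_sum L' x else 0.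

Fixpoint ang_sum_der L x : R :=
  if L is cA :: L' then cA.1 (enorm x) * ang_fun (ang_der cA.2) x + ang_sum_der L' x else 0.

(** The radial part [G] of the gradient is left unspecified: when the function multiplies the field
    (- x2, x1), the two contributions of [G] to the divergence cancel and only the angular
    derivative remains. *)
Lemma lateral_field L (Q : R -> R) a : 0 < a -> radial a Q -> ang_sum_smooth L ->
  (forall k, Ck k (fun x => Q (enorm x) * ang_sum L x)) /\
  exists G : R * R -> R, forall x,
   pd1 (fun x => Q (enorm x) * ang_sum L x) x (x.1 * G x - x.2 * (Q (enorm x) / enorm x / enorm x * ang_sum_der L x)) /\
   pd2 (fun x => Q (enorm x) * ang_sum L x) x (x.2 * G x + x.1 * (Q (enorm x) / enorm x / enorm x * ang_sum_der L x)).
Proof.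
move=> a0 rQ;elim:L=>[_|[c A] L IH [/= sc _ sA sL]].
 have ->: (fun x=> Q (enorm x) * ang_sum [::] x) = (fun=> 0) by apply/funext=> x/=;rewrite mulr0.
 split;first by move=> k;exact:Ck_cst.
 by exists (fun=> 0)=> x;rewrite /= !mulr0 subrr addr0;split;exact:derC.
have [k2 [G2 d2]]:=IH sL.
have rQc: radial a (fun t=> Q t * c t) by exact:radialM.
have e: (fun x=> Q (enorm x) * ang_sum ((c,A) :: L) x) =
  (fun x=> rad_ang (fun t=> Q t * c t) A x + Q (enorm x) * ang_sum L x).
 by apply/funext=> x;rewrite /rad_ang/=;ring.
rewrite e;split;first by move=> k;apply:CkD;[exact:(rad_ang_Ck k a0 rQc sA)|exact:k2].
exists (fun x=> rad_ang (fun t=> derive1 (fun t=> Q t * c t) t / t) A x + G2 x)=> x.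
have [_ h1 h2]:=rad_ang_local a0 rQc sA x;have [g1 g2]:=d2 x.
split.
 apply:der_eq;first exact:derD h1 g1.
 by rewrite /rad_ang/=;ring.
apply:der_eq;first exact:derD h2 g2.
by rewrite /rad_ang/=;ring.
Qed.

(** Writing the inverse as [t * (t^2)^-1] reduces it to a power of a nonnegative base. *)
Lemma measurable_inv : mfun setT (fun t : R => t^-1).
Proof.
have ->: (fun t : R=> t^-1) = (fun t=> t * (t ^+ 2) `^ (-1)).
 apply/funext=> t;rewrite powR_inv1 ?sqr_ge0//.
 by have [->|t0]:=eqVneq t 0;[rewrite invr0 mul0r|field].
apply:measurable_funM=>//.
apply:(measurableT_comp (f:=fun t : R=> t `^ (-1)));first exact:measurable_powR.
by apply:measurable_funX.
Qed.

Lemma measurable_ang_fun (A : @angular R) : ang_smooth A -> mfun setT (fun x : P => ang_fun A x).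
Proof.
move=>[s1 s2 _];rewrite /ang_fun.
have mr: mfun setT (fun x : P=> x.2 / x.1).
 apply:measurable_funM=>//;apply:(measurableT_comp (f:=fun t : R=> t^-1))=>//.
 exact:measurable_inv.
have mg g : smooth1 g -> mfun setT (fun x : P=> g (x.2 / x.1)).
 move=> sg;apply:(measurableT_comp (f:=g))=>//.
 by apply:cts_mfun;exact:smooth1_cts.
apply:measurable_fun_ifT;[exact:measurable_fun_ltr|exact:mg|].
apply:measurable_fun_ifT;[exact:measurable_fun_ltr|exact:mg|].
apply:measurable_fun_ifT;[exact:measurable_fun_ltr|exact:measurable_cst|exact:measurable_cst].
Qed.

Lemma ang_fun_bounded (A : @angular R) : ang_smooth A -> exists B, forall x, `|ang_fun A x| <= B.
Proof.
move=>[s1 s2 [M [M0 h1 h2 h3 h4]]].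
have hb g c1 c2 : smooth1 g -> (forall s,M <= s -> g s = c1) -> (forall s,s <= - M -> g s = c2) ->
  exists B,forall s,`|g s| <= B.
 move=> sg g1 g2.
 have : compact (g @` `[- M,M]).
  by apply:continuous_compact;[exact:wc_cts (smooth1_cts sg)|exact:segment_compact].
 move=>/compact_bounded[B [_ hB]];exists (`|B| + 1 + (`|c1| + `|c2|))=> s.
 have B1: B < `|B| + 1 by rewrite (le_lt_trans (ler_norm _))// ltrDl.
 have [n1 n2] : 0 <= `|c1| /\ 0 <= `|c2| by [].
 have nB: 0 <= `|B| by [].
 have [sM|sM]:=leP M s;first by rewrite g1//;lra.
 have [sM'|sM']:=leP s (- M);first by rewrite g2//;lra.
 have : `|g s| <= `|B| + 1 by apply:(hB _ B1);exists s=>//=;rewrite in_itv/= !ltW.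
 by lra.
have [B1 b1]:=hb _ _ _ s1 h1 h2;have [B2 b2]:=hb _ _ _ s2 h3 h4.
exists (B1 + B2 + (`|angp A| + `|angm A|))=> x.
have p1: 0 <= B1 by exact:le_trans (b1 0).
have p2: 0 <= B2 by exact:le_trans (b2 0).
have [n1 n2] : 0 <= `|angp A| /\ 0 <= `|angm A| by [].
rewrite /ang_fun;do ![case:ifP=> _];last 2 first;try lra.
- by have:=b1 (x.2 / x.1);lra.
- by have:=b2 (x.2 / x.1);lra.
Qed.

Lemma ang_fun_ray (A : @angular R) t s : 0 < t -> ang_fun A (ray t s) = ang1 A s /\ ang_fun A (ray (- t) s) = ang2 A s.
Proof.
move=> t0;have d0:=sqrt_dang_gt0 s;rewrite /ang_fun /ray/=.
have e u : u != 0 -> u * (s * Num.sqrt (dang s)) / (u * Num.sqrt (dang s)) = s.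
 by move=> u0;field;rewrite u0 gt_eqF.
rewrite !e ?oppr_eq0 ?gt_eqF//;split;first by rewrite mulr_gt0.
by rewrite mulNr oppr_gt0 oppr_lt0 ltNge ltW ?mulr_gt0.
Qed.

Section bound.
Variables (A : set P) (rho : R -> R) (p : R).
Hypothesis mA : measurable A.
Hypothesis div_le : forall X1 X2 : R * R -> R, test_function X1 -> test_function X2 ->
  (forall x, enorm (X1 x, X2 x) <= rho (enorm x)) ->
  - (\int[m]_(x in A) partial1 X1 x + \int[m]_(x in A) partial2 X2 x) <= p.

Definition slice_mass t : R := circ_int \1_A t.
Definition slice_der L t : R := circ_int (fun x => \1_A x * ang_sum_der L x) t.

Lemma measurable_ang_sum_der L : ang_sum_smooth L ->
  mfun setT (fun x : P => ang_sum_der L x).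
Proof.
elim:L=>[_|[c B] L IH [/= sc _ sB sL]];first exact:measurable_cst.
apply:measurable_funD;last exact:IH.
apply:measurable_funM;last by apply:measurable_ang_fun;exact:ang_der_smooth.
apply:(measurableT_comp (f:=c));first by apply:cts_mfun;exact:smooth1_cts.
by apply:cts_plane_measurable;exact:cts_enorm.
Qed.

Lemma ang_sum_der_bounded L : ang_sum_smooth L -> exists B, forall x, `|ang_sum_der L x| <= B.
Proof.
elim:L=>[_|[c C] L IH [/= _ [B1 b1] sC sL]];first by exists 0=> x;rewrite normr0.
have [B2 b2]:=ang_fun_bounded (ang_der_smooth sC);have [B3 b3]:=IH sL.
exists (B1 * B2 + B3)=> x;rewrite (le_trans (ler_normD _ _))// lerD// normrM.
by apply:ler_pM.
Qed.

Lemma integrable_box_supp (W : P -> R) M B : mfun setT W -> (forall x, `|W x| <= B) ->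
  (forall x, ~ plane_box M x -> W x = 0) -> m.-integrable setT (EFin \o W).
Proof.
move=> mW WB W0.
have h: m.-integrable (plane_box M) (EFin \o W).
 apply:(@integrable_bounded _ _ _ _ B)=>//;[exact:measurable_box|exact:box_finite|].
 exact:measurable_funTS.
have ->: EFin \o W = (EFin \o W) \_ (plane_box M).
 apply/funext=> x;rewrite patchE/=;case:ifPn=>//;rewrite notin_setE=>/W0 ->//.
by apply/(integrable_mkcond _ _).1=>//;exact:measurable_box.
Qed.

(** The field has radial component [- l / t] and tangential component [- q * ang_sum L], the signs
    matching those of [div_le]. Its divergence is [- (l' + q * ang_sum_der L) / t], and the factor 1
    / t cancels in polar coordinates. *)
Lemma field_bound L (l q : R -> R) a b : 0 < a -> a < b -> smooth1 l -> smooth1 q ->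
  (forall t, t <= a -> l t = 0) -> (forall t, b <= t -> l t = 0) ->
  (forall t, t <= a -> q t = 0) -> (forall t, b <= t -> q t = 0) ->
  ang_sum_smooth L -> (forall x, `|ang_sum L x| <= 1) ->
  (forall t, 0 <= t -> 0 <= rho t) ->
  (forall t, a <= t <= b -> enorm (l t / t, q t) <= rho t) ->
  \int[mu]_(t in `[a, b]) (derive1 l t * slice_mass t + q t * slice_der L t) <= p.
Proof.
move=> a0 ab sl sq la lb qa qb sL L1 rho0 lq.
have rl: radial a (fun t=> - l t / t / t).
 apply:radial_div=>//;apply:radial_div=>//;split;first by move=> k;exact:S1N.
 by move=> t /la ->;rewrite oppr0.
have rq: radial a (fun t=> - q t / t).
 apply:radial_div=>//;split;first by move=> k;exact:S1N.
 by move=> t /qa ->;rewrite oppr0.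
pose F:=rad_ang (fun t=> - l t / t / t) ang_one.
have kF k:=rad_ang_Ck k a0 rl ang_one_smooth.
have [kU [G dU]]:=lateral_field a0 rq sL.
pose U x:=(- q (enorm x) / enorm x) * ang_sum L x.
pose X1 x:=F x * x.1 - U x * x.2;pose X2 x:=F x * x.2 + U x * x.1.
have FE x : F x = - l (enorm x) / enorm x / enorm x by rewrite /F /rad_ang ang_fun_one mulr1.
have F0 x : ~~ (a <= enorm x <= b) -> F x = 0.
 rewrite negb_and -!ltNge FE=>/orP[h|h];first by rewrite la ?ltW// oppr0 !mul0r.
 by rewrite lb ?ltW// oppr0 !mul0r.
have U0 x : ~~ (a <= enorm x <= b) -> U x = 0.
 rewrite negb_and -!ltNge /U=>/orP[h|h];first by rewrite qa ?ltW// oppr0 !mul0r.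
 by rewrite qb ?ltW// oppr0 !mul0r.
have tf (X : R * R -> R) : (forall k,Ck k X) -> (forall x,~~ (a <= enorm x <= b) -> X x = 0) -> test_function X.
 move=> kX X0;split=>//;apply:(@subclosed_compact _ _ (plane_box b : set (R * R))).
 - exact:closed_closure.
 - exact:compact_box.
 have cB: closed (plane_box b : set (R * R)) by apply:compact_closed;[exact:norm_hausdorff|exact:compact_box].
 rewrite [X in _ `<=` X]((closure_id _).1 cB);apply:closure_subset.
 move=> x /= Xx;have : a <= enorm x <= b by apply/negPn/negP=>/X0 e;rewrite e eqxx in Xx.
 move=>/andP[_ xb];apply/plane_boxP;split;apply:le_trans xb;rewrite -sqrtr_sqr ler_wsqrtr//.
  by rewrite lerDl sqr_ge0.
 by rewrite lerDr sqr_ge0.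
have kX1 k : Ck k X1 by apply:CkB;apply:CkM;solve [exact:kF|exact:kU|exact:Ck_fst|exact:Ck_snd].
have kX2 k : Ck k X2 by apply:CkD;apply:CkM;solve [exact:kF|exact:kU|exact:Ck_fst|exact:Ck_snd].
have t1: test_function X1 by apply:tf=>// x h;rewrite /X1 F0// U0// !mul0r subrr.
have t2: test_function X2 by apply:tf=>// x h;rewrite /X2 F0// U0// !mul0r addr0.
have Xr x : enorm (X1 x,X2 x) <= rho (enorm x).
 have [h|h]:=boolP (a <= enorm x <= b);last first.
  by rewrite /X1 /X2 F0// U0// !mul0r subrr addr0 /enorm /= expr0n addr0 sqrtr0 rho0// enorm_ge0.
 apply:le_trans (lq _ h);rewrite /enorm ler_wsqrtr//=.
 have t0: 0 < enorm x by case/andP: h=>/(lt_le_trans a0).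
 rewrite /X1 /X2;set t:=enorm x in t0 h *.
 have ->: (F x * x.1 - U x * x.2) ^+ 2 + (F x * x.2 + U x * x.1) ^+ 2 = (F x ^+ 2 + U x ^+ 2) * (t * t).
  by rewrite -expr2 /t enorm_sqr;ring.
 rewrite FE /U -/t.
 have ->: ((- l t / t / t) ^+ 2 + (- q t / t * ang_sum L x) ^+ 2) * (t * t) =
  (l t / t) ^+ 2 + q t ^+ 2 * ang_sum L x ^+ 2 by field;rewrite gt_eqF.
 rewrite lerD2l ler_piMr ?sqr_ge0//.
 by rewrite -real_normK ?num_real// expr_le1.
have:=div_le t1 t2 Xr;apply:le_trans.
pose D x:=derive1 l (enorm x) / enorm x + q (enorm x) / enorm x * ang_sum_der L x.
have divE x : partial1 X1 x + partial2 X2 x = - D x.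
 have [d1 d2]:=dU x.
 have [_ f1 f2]:=rad_ang_local a0 rl ang_one_smooth x.
 have u1: isd (fun s=> U (s,x.2)) x.1 (x.1 * G x - x.2 * (- q (enorm x) / enorm x / enorm x / enorm x * ang_sum_der L x)).
  exact:d1.
 have u2: isd (fun s=> U (x.1,s)) x.2 (x.2 * G x + x.1 * (- q (enorm x) / enorm x / enorm x / enorm x * ang_sum_der L x)).
  exact:d2.
 have ev (V : R * R -> R) : V x = V (x.1,x.2) by case:(x).
 have c1: pd1 X1 x ((x.1 * rad_ang (fun t=> derive1 (fun t=> - l t / t / t) t / t) ang_one x - x.2 *
   rad_ang (fun t=> - l t / t / t / t / t) (ang_der ang_one) x) * x.1 + F x * 1
   - ((x.1 * G x - x.2 * (- q (enorm x) / enorm x / enorm x / enorm x * ang_sum_der L x)) * x.2 + U x * 0)).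
  by rewrite (ev F) (ev U);apply:derB;[apply:(derM f1);exact:derI|apply:(derM u1);exact:derC].
 have c2: pd2 X2 x ((x.2 * rad_ang (fun t=> derive1 (fun t=> - l t / t / t) t / t) ang_one x + x.1 *
   rad_ang (fun t=> - l t / t / t / t / t) (ang_der ang_one) x) * x.2 + F x * 1
   + ((x.2 * G x + x.1 * (- q (enorm x) / enorm x / enorm x / enorm x * ang_sum_der L x)) * x.1 + U x * 0)).
  by rewrite (ev F) (ev U);apply:derD;[apply:(derM f2);exact:derI|apply:(derM u2);exact:derC].
 have [_ ->]:=(pd1P _ _ _).1 c1;have [_ ->]:=(pd2P _ _ _).1 c2.
 rewrite /rad_ang ang_fun_one ang_der_one !mulr0 /D FE.
 have [xa|ax]:=ltP (enorm x) a.
  rewrite la ?ltW// qa ?ltW// !oppr0 !mul0r.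
  have ->: derive1 l (enorm x) = 0 by apply:(radial_der (conj sl la)).2;exact:ltW.
  have ->: derive1 (fun t=> - l t / t / t) (enorm x) = 0 by apply:(radial_der rl).2;exact:ltW.
  by ring.
 have t0: 0 < enorm x by exact:lt_le_trans ax.
 have dl: isd (fun t=> - l t / t / t) (enorm x)
   (- derive1 l (enorm x) / enorm x / enorm x + 2 * l (enorm x) / enorm x / enorm x / enorm x).
  have dV: isd (fun t : R=> t^-1) (enorm x) (- 1 / (enorm x) ^+ 2).
   by apply:(@derV _ (fun y=> y));[rewrite gt_eqF|exact:derI].
  apply:der_eq;first by apply:derM;[apply:derM;[apply:derN;exact:smooth1_isd|exact:dV]|exact:dV].
  by rewrite/=;field;rewrite gt_eqF.
 have ed: derive1 (fun t=> - l t / t / t) (enorm x) =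
   - derive1 l (enorm x) / enorm x / enorm x + 2 * l (enorm x) / enorm x / enorm x / enorm x.
  by rewrite derive1E;case:dl.
 rewrite ed.
 have e2:=enorm_sqr x;set t:=enorm x in t0 e2 *.
 transitivity ((x.1 ^+ 2 + x.2 ^+ 2) * ((- derive1 l t / t / t + 2 * l t / t / t / t) / t)
  + 2 * (- l t / t / t) + (x.1 ^+ 2 + x.2 ^+ 2) * (- q t / t / t / t * ang_sum_der L x));first by ring.
 by rewrite -e2;field;rewrite gt_eqF.
have c1: continuous (partial1 X1) by apply:(@Ck_cts _ 0);case:(kX1 1%N)=> _ [].
have c2: continuous (partial2 X2) by apply:(@Ck_cts _ 0);case:(kX2 1%N)=> _ [].
have p0 (X : R * R -> R) x v : (forall x,~~ (a <= enorm x <= b) -> X x = 0) ->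
  b < enorm x -> 'D_v X x = 0.
 move=> X0 bx;have nz: \forall y \near x,cst 0 y = X y.
  have:=@near_gt _ (@enorm R) x b (@cts_enorm R x) bx.
  by apply:filterS=> y yb;rewrite X0// negb_and -!ltNge yb orbT.
 by have []:=near_eq_is_derive nz (is_derive_cst 0 x v).
have bxb x : ~ plane_box (b + 1) x -> b < enorm x.
 move=> xb;rewrite ltNge;apply/negP=> xb';apply:xb;apply/plane_boxP;split.
  apply:(@le_trans _ _ (enorm x));last by rewrite (le_trans xb')// lerDl.
  by rewrite -sqrtr_sqr ler_wsqrtr// lerDl sqr_ge0.
 apply:(@le_trans _ _ (enorm x));last by rewrite (le_trans xb')// lerDl.
 by rewrite -sqrtr_sqr ler_wsqrtr// lerDr sqr_ge0.
have o1 x : b < enorm x -> partial1 X1 x = 0.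
 by apply:p0=> y h;rewrite /X1 F0// U0// !mul0r subrr.
have o2 x : b < enorm x -> partial2 X2 x = 0.
 by apply:p0=> y h;rewrite /X2 F0// U0// !mul0r addr0.
have [B1 b1]:=cts_bounded c1 (fun x h=> o1 x (bxb x h)).
have [B2 b2]:=cts_bounded c2 (fun x h=> o2 x (bxb x h)).
have I1:=integrable_box_supp (cts_plane_measurable c1) b1 (fun x h=> o1 x (bxb x h)).
have I2:=integrable_box_supp (cts_plane_measurable c2) b2 (fun x h=> o2 x (bxb x h)).
rewrite -RintegralD//;[|exact:integrableS I1|exact:integrableS I2].
pose g (x : P):=\1_A x * (partial1 X1 x + partial2 X2 x).
have mg: mfun setT g.
 apply:measurable_funM;first exact:measurable_indic.
 by apply:measurable_funD;exact:cts_plane_measurable.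
have ind1 x : `|\1_A x : R| <= 1 by rewrite indicE;case:(x \in A);rewrite ?normr1 ?normr0.
have gB x : `|g x| <= B1 + B2.
 rewrite /g normrM -[leRHS]mul1r;apply:ler_pM=>//.
 by rewrite (le_trans (ler_normD _ _))// lerD.
have g0 x : ~~ (a <= enorm x <= b) -> g x = 0.
 rewrite negb_and -!ltNge /g=>/orP[h|h];last by rewrite o1// o2// addr0 mulr0.
 rewrite divE /D qa ?(ltW h)// (radial_der (conj sl la)).2 ?(ltW h)//.
 by rewrite !mul0r addr0 oppr0 mulr0.
have ->: \int[m]_(x in A) (partial1 X1 x + partial2 X2 x) = \int[m]_x g x.
 rewrite /Rintegral [in LHS]integral_mkcond;congr fine;apply:eq_integral=> x _.
 by rewrite patchE /g indicE;case:ifP=> _;rewrite ?mul1r ?mul0r.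
rewrite (polar_signed a0 mg gB g0) -[X in - X]mul1r -mulNr -RintegralZl//;last first.
 exact:(circ_radial_integrable b a0 mg gB).
rewrite le_eqVlt;apply/orP;left;apply/eqP;apply:eq_Rintegral=> t;rewrite inE/= in_itv/= =>/andP[at_ tb].
have t0: 0 < t by exact:lt_le_trans at_.
have mS:=measurable_ang_sum_der sL;have [B3 b3]:=ang_sum_der_bounded sL.
have m1: mfun setT (\1_A : P -> R) by exact:measurable_indic.
have mS': mfun setT (fun x : P=> \1_A x * ang_sum_der L x) by exact:measurable_funM.
have bS x : `|\1_A x * ang_sum_der L x| <= B3.
 by rewrite normrM -[leRHS]mul1r;apply:ler_pM.
have ->: circ_int g t = circ_int (fun x=> - derive1 l t / t * \1_A x + - q t / t * (\1_A x * ang_sum_der L x)) t.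
 apply:eq_Rintegral=> s _;congr (_ * _);rewrite /g !divE /D !enorm_ray normrN gtr0_norm//.
 by congr (_ + _);ring.
pose B4:=Num.max (`|- derive1 l t / t| * 1) (`|- q t / t| * B3).
rewrite (@circ_intD _ _ _ _ B4);last 4 first.
- by apply:measurable_funM=>//;exact:measurable_cst.
- by move=> x;rewrite le_max normrM ler_wpM2l.
- by apply:measurable_funM=>//;exact:measurable_cst.
- by move=> x;rewrite le_max [`|_ * (_ * _)|]normrM [X in _ || X]ler_wpM2l ?orbT.
rewrite (@circ_intZ _ _ _ _ 1)// (@circ_intZ _ _ _ _ B3)// -/(slice_mass t) -/(slice_der L t).
by field;rewrite gt_eqF.
Qed.

End bound.
End fields.

(** * Density points and smooth transitions on the line *)

Section slice_variation.
Context {R : realType}.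
Notation T := (measurableTypeR R).
Notation P := (plane R).
Notation mu := (@lebesgue_measure R).
Implicit Types (a b c e s t r : R) (S : set T).

Lemma density_point S : measurable S -> mu S != 0%E -> exists2 x, S x &
  forall e, 0 < e -> exists2 d, 0 < d & forall r, 0 < r -> r < d ->
    (mu (~` S `&` ball x r) <= (e * r)%:E)%E.
Proof.
move=> mS S0;have [N [mN N0 hN]]:=lebesgue_density mS.
have [x [Sx Nx]] : exists x,S x /\ ~ N x.
 apply:contrapT=> h;move: S0;rewrite (_ : mu S = 0%E) ?eqxx//.
 apply/eqP;rewrite eq_le measure_ge0 andbT -N0;apply:le_measure;rewrite ?inE//.
 by move=> x Sx;apply:contrapT=> Nx;apply:h;exists x.
exists x=>// e e0.
have cv: (mu (S `&` ball x r) * (mu (ball x r))^-1)%E @[r --> 0^'+] --> (1%:E : \bar R).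
 have ->: 1%:E = (\1_S x : R)%:E by rewrite indicE mem_set.
 by apply:contrapT=> h;apply:Nx;exact:hN.
have e20: 0 < e / 2 by rewrite divr_gt0.
have /fine_cvgP[_ /cvgrPdist_lt/(_ _ e20)[d /= d0 hd]]:=cv.
exists d=>// r r0 rd.
have rB: ball_ [eta Num.Def.normr] 0 d r by rewrite /= sub0r normrN gtr0_norm.
have:=hd r rB r0.
have mB: measurable (ball x r : set T) by exact:measurable_ball.
have bE: mu (ball x r) = (2 * r)%:E by rewrite mulr_natl;apply:lebesgue_measure_ball;exact:ltW.
have fS: mu (S `&` ball x r) \is a fin_num.
 rewrite ge0_fin_numE//;apply:(@le_lt_trans _ _ (mu (ball x r)));last by rewrite bE ltry.
 by apply:le_measure;[rewrite inE;exact:measurableI|rewrite inE|exact:subIsetr].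
have fC: mu (~` S `&` ball x r) \is a fin_num.
 rewrite ge0_fin_numE//;apply:(@le_lt_trans _ _ (mu (ball x r)));last by rewrite bE ltry.
 by apply:le_measure;[rewrite inE;apply:measurableI=>//;exact:measurableC|rewrite inE|exact:subIsetr].
have sp: mu (ball x r) = (mu (S `&` ball x r) + mu (~` S `&` ball x r))%E.
 rewrite -measureU//;[|exact:measurableI|by apply:measurableI=>//;exact:measurableC|].
  by rewrite -setIUl setUv setTI.
 by rewrite setIACA setICr set0I.
move: sp;rewrite bE -(fineK fS) -(fineK fC) -EFinD=> -[e2].
have rI: ((2 * r)%:E^-1 = ((2 * r)^-1)%:E)%E by rewrite inver mulf_eq0 (gt_eqF r0) orbF pnatr_eq0.
rewrite rI -EFinM /= ltr_norml=>/andP[_ h];rewrite lee_fin.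
have : (1 - e / 2) * (2 * r) < fine (mu (S `&` ball x r)).
 by rewrite -ltr_pdivlMr ?mulr_gt0//;move: h;lra.
by move: e2;nra.
Qed.

(** A transition from 0 to 1 on [p - r, p + r]. Its derivative has integral 1 and size at most C /
    (2 r); integrated over a set with a density point near [p], it gives almost 1. *)
Definition bump_step (p r s : R) : R := step ((2 * r)^-1 * s + - (2 * r)^-1 * (p - r)).

Lemma bump_step_smooth p r : smooth1 (bump_step p r).
Proof. by move=> k;apply:S1_affine;exact:step_smooth. Qed.

Lemma bump_step0 p r s : 0 < r -> s <= p - r -> bump_step p r s = 0.
Proof.
move=> r0 sp;rewrite /bump_step step0// mulNr -mulrBr.
by rewrite pmulr_rle0 ?invr_gt0 ?mulr_gt0// subr_le0.
Qed.

Lemma bump_step1 p r s : 0 < r -> p + r <= s -> bump_step p r s = 1.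
Proof.
move=> r0 sp;rewrite /bump_step step1// mulNr -mulrBr mulrC ler_pdivlMr ?mulr_gt0//.
by move: sp;lra.
Qed.

Lemma bump_step01 p r s : 0 <= bump_step p r s <= 1.
Proof. by rewrite step_ge0 step_le1. Qed.

Lemma step_der_bounded : exists C : R, 0 < C /\ forall s, `|derive1 (@step R) s| <= C.
Proof.
have c: continuous (derive1 (@step R)) by apply:smooth1_cts;apply:smooth1_der;exact:step_smooth.
have : compact (derive1 (@step R) @` `[0,1]).
 by apply:continuous_compact;[exact:wc_cts|exact:segment_compact].
move=>/compact_bounded[B [_ hB]];exists (`|B| + 1);split;first by rewrite ltr_wpDl.
have B1: B < `|B| + 1 by rewrite (le_lt_trans (ler_norm _))// ltrDl.
move=> s;have [s0|s0]:=ltP s 0.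
 rewrite (@isd_cst_near _ _ s 0) ?normr0 ?addr_ge0//;first exact:smooth1_isd step_smooth.
 by near=> t;rewrite step0// ltW//;near: t;exact:lt_nbhsl.
have [s1|s1]:=ltP 1 s.
 rewrite (@isd_cst_near _ _ s 1) ?normr0 ?addr_ge0//;first exact:smooth1_isd step_smooth.
 by near=> t;rewrite step1// ltW//;near: t;exact:lt_nbhsr.
by apply:(hB _ B1);exists s=>//=;rewrite in_itv/= s0.
Unshelve. all: by end_near. Qed.

Lemma bump_step_der p r s : isd (bump_step p r) s (derive1 (@step R) ((2 * r)^-1 * s + - (2 * r)^-1 * (p - r)) * (2 * r)^-1).
Proof.
apply:(@der_comp _ (@step R) (fun s=>(2 * r)^-1 * s + - (2 * r)^-1 * (p - r))).
 apply:der_eq;first by apply:derD (derC _ _);apply:derM;[exact:derC|exact:derI].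
 by rewrite/=;ring.
exact:smooth1_isd step_smooth.
Qed.

Lemma bump_step_der0 p r s : 0 < r -> ~~ (p - r <= s <= p + r) -> derive1 (bump_step p r) s = 0.
Proof.
move=> r0;rewrite negb_and -!ltNge=>/orP[sp|sp].
 apply:(@isd_cst_near _ _ s 0);first exact:smooth1_isd (bump_step_smooth _ _).
 by near=> t;rewrite bump_step0// ltW//;near: t;exact:lt_nbhsl.
apply:(@isd_cst_near _ _ s 1);first exact:smooth1_isd (bump_step_smooth _ _).
by near=> t;rewrite bump_step1// ltW//;near: t;exact:lt_nbhsr.
Unshelve. all: by end_near. Qed.

Section bump_integral.
Variables (C : R).
Hypotheses (C0 : 0 < C) (hC : forall s, `|derive1 (@step R) s| <= C).

Let der_bound p r s : 0 < r -> `|derive1 (bump_step p r) s| <= C / (2 * r).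
Proof.
move=> r0;rewrite (isd_derive1 (bump_step_der p r)) normrM ler_pM//.
by rewrite gtr0_norm// invr_gt0 mulr_gt0.
Qed.

Lemma bump_integrable p r (f : R -> R) : 0 < r -> mfun setT f -> (forall s, `|f s| <= 1) ->
  mu.-integrable setT (EFin \o (fun s => f s * derive1 (bump_step p r) s)).
Proof.
move=> r0 mf f1;have mb: mfun setT (derive1 (bump_step p r)).
 by apply:cts_mfun;apply:smooth1_cts;apply:smooth1_der;exact:bump_step_smooth.
have h: mu.-integrable `[p - r,p + r] (EFin \o (fun s=> f s * derive1 (bump_step p r) s)).
 apply:(@bounded_int _ _ _ (1 * (C / (2 * r))))=>//;first exact:mu_itv_fin.
  by apply:measurable_funTS;exact:measurable_funM.
 by move=> s _;rewrite normrM ler_pM// der_bound.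
have ->: EFin \o (fun s=> f s * derive1 (bump_step p r) s) =
  (EFin \o (fun s=> f s * derive1 (bump_step p r) s)) \_ `[p - r,p + r].
 apply/funext=> s;rewrite patchE;case:ifPn=>// sn/=.
 by rewrite bump_step_der0 ?mulr0//;apply:contra sn=> h';rewrite inE/= in_itv.
by apply/(integrable_mkcond _ _).1.
Qed.

(* The mass that [step'] puts outside of [S] is small when [S] almost fills the interval. *)
Lemma bump_small S p r e : measurable S -> 0 < r ->
  (mu (S `&` `[(p - r)%R, (p + r)%R]%classic) <= (e * r)%:E)%E ->
  `|\int[mu]_s (\1_S s * derive1 (bump_step p r) s)| <= C * e / 2.
Proof.
move=> mS r0 Se.
have aux (c : R) (y : \bar R) : y \is a fin_num -> (c%:E * y < +oo)%E.
 by case:y=>// z _;rewrite -EFinM ltry.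
have aux2 (c : R) (y : \bar R) (z : R) : 0 <= c -> y \is a fin_num -> (y <= z%:E)%E -> fine (c%:E * y)%E <= c * z.
 by case:y=>// y c0 _;rewrite lee_fin=> yz;rewrite -EFinM /= ler_wpM2l.
have m1: mfun setT (\1_S : R -> R) by exact:measurable_indic.
have i1 s : `|\1_S s : R| <= 1 by rewrite indicE;case:(s \in S);rewrite ?normr1 ?normr0.
have I:=bump_integrable p r0 m1 i1.
apply:le_trans (le_normr_Rintegral _ I) _=>//.
have mSI: measurable (S `&` `[(p - r)%R,(p + r)%R]%classic) by exact:measurableI.
have fS: mu (S `&` `[(p - r)%R,(p + r)%R]%classic) \is a fin_num.
 by rewrite ge0_fin_numE// (le_lt_trans Se)// ltry.
apply:(@le_trans _ _ (\int[mu]_s (C / (2 * r) * \1_(S `&` `[(p - r)%R,(p + r)%R]%classic) s))).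
 apply:le_Rintegral=>//;first exact:integrable_norm I.
  apply/integrableP;split.
   by apply/measurable_EFinP;apply:measurable_funM=>//;exact:measurable_indic.
  rewrite (_ : (fun x=> _) = (fun x=>(C / (2 * r))%:E * (\1_(S `&` `[(p - r)%R,(p + r)%R]%classic) x)%:E)%E);last first.
   by apply/funext=> s/=;rewrite ger0_norm ?EFinM// mulr_ge0 ?divr_ge0 ?mulr_ge0 ?(ltW C0) ?(ltW r0).
  rewrite ge0_integralZl//;last 2 first.
   by apply/measurable_EFinP;exact:measurable_indic.
   by rewrite lee_fin divr_ge0 ?mulr_ge0 ?(ltW C0) ?(ltW r0).
  by rewrite integral_indic// ?setIT ?setTI;exact:aux fS.
 move=> s _;rewrite normrM [X in _ <= _ * X]indicE in_setI.
 rewrite indicE;case:(s \in S);last by rewrite normr0 mul0r mulr_ge0// divr_ge0 ?mulr_ge0 ?(ltW C0) ?(ltW r0).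
 rewrite normr1 mul1r/=;case:(boolP (s \in `[p - r,p + r]%classic))=> sI;first by rewrite mulr1 der_bound.
 by rewrite bump_step_der0 ?normr0 ?mulr0//;apply:contra sI=> h';rewrite inE/= in_itv.
rewrite /Rintegral (_ : (fun x=> _) = (fun x=>(C / (2 * r))%:E * (\1_(S `&` `[(p - r)%R,(p + r)%R]%classic) x)%:E)%E)//.
rewrite ge0_integralZl//;last 2 first.
 by apply/measurable_EFinP;exact:measurable_indic.
 by rewrite lee_fin divr_ge0 ?mulr_ge0 ?(ltW C0) ?(ltW r0).
rewrite integral_indic// ?setIT ?setTI.
apply:(@le_trans _ _ (C / (2 * r) * (e * r))).
 by apply:aux2 fS Se;rewrite divr_ge0 ?mulr_ge0 ?(ltW C0) ?(ltW r0).
by rewrite le_eqVlt;apply/orP;left;apply/eqP;field;rewrite gt_eqF.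
Qed.

Lemma bump_total p r : 0 < r -> \int[mu]_s (\1_(setT : set T) s * derive1 (bump_step p r) s) = 1.
Proof.
move=> r0;transitivity (\int[mu]_(s in `[p - r,p + r]) derive1 (bump_step p r) s).
 rewrite /Rintegral [in RHS]integral_mkcond;congr fine;apply:eq_integral=> s _.
 rewrite patchE indicT mul1r;case:ifPn=>// sn.
 by rewrite bump_step_der0//;apply:contra sn=> h';rewrite inE/= in_itv.
rewrite (@ftcR _ (bump_step p r)).
- by rewrite bump_step1// bump_step0// subr0.
- by move: r0;lra.
- by move=> s _;exact:smooth1_isd (bump_step_smooth _ _).
- by apply:wc_cts;apply:smooth1_cts;apply:smooth1_der;exact:bump_step_smooth.
Qed.

Lemma bump_full S p r e : measurable S -> 0 < r ->
  (mu (~` S `&` `[(p - r)%R, (p + r)%R]%classic) <= (e * r)%:E)%E ->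
  `|\int[mu]_s (\1_S s * derive1 (bump_step p r) s) - 1| <= C * e / 2.
Proof.
move=> mS r0 Se;have mC:=measurableC mS.
have:=bump_small mC r0 Se;rewrite -normrN;congr (`|_| <= _).
have i1 (B : set T) s : `|\1_B s : R| <= 1 by rewrite indicE;case:(s \in B);rewrite ?normr1 ?normr0.
have I1:=bump_integrable p r0 (measurable_indic measurableT) (i1 setT).
have I2:=bump_integrable p r0 (measurable_indic mS) (i1 S).
rewrite -[X in _ - X](bump_total p r0) -opprB;congr (- _);rewrite -RintegralB//.
apply:eq_Rintegral=> s _;rewrite -mulrBl indicT indicC;congr (_ * _).
by rewrite indicE;case:(s \in S);rewrite /= ?subrr ?subr0.
Qed.

End bump_integral.
End slice_variation.

(** * Variation of the angular slices *)

Section slices.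
Context {R : realType}.
Notation T := (measurableTypeR R).
Notation P := (plane R).
Notation mu := (@lebesgue_measure R).
Implicit Types (a b c e s t r p q : R) (S : set T) (L : seq ((R -> R) * @angular R)).

Definition dang_mass S : R := \int[mu]_s (dang s * \1_S s).

Let ind1 S s : `|\1_S s : R| <= 1.
Proof. by rewrite indicE;case:(s \in S);rewrite ?normr1 ?normr0. Qed.

Lemma dang_mass_integrable S : measurable S -> mu.-integrable setT (EFin \o (fun s => dang s * \1_S s)).
Proof.
move=> mS;apply:(le_integrable measurableT _ _ (dang_integrable 1)).
 apply/measurable_EFinP;apply:measurable_funM;last exact:measurable_indic.
 exact:cts_mfun (@cts_dang R).
move=> s _/=;rewrite lee_fin normrM mul1r ler_piMr//.
Qed.

Lemma dang_mass0 S : measurable S -> mu S = 0%E -> dang_mass S = 0.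
Proof.
move=> mS S0;rewrite /dang_mass /Rintegral (_ : (\int[mu]_x _)%E = (\int[mu]_x cst 0%E x)%E).
 by rewrite integral_cst// mul0e.
apply:ae_eq_integral=>//.
 by case/integrableP: (dang_mass_integrable mS).
exists S;split=>// s /= /not_implyP[_];apply:contra_notP=> nS.
by rewrite indicE memNset// mulr0.
Qed.

Lemma dang_mass1 S : measurable S -> mu (~` S) = 0%E -> dang_mass S = pi.
Proof.
move=> mS S0;have I:=dang_mass_integrable mS;have I':=dang_mass_integrable (measurableC mS).
have : dang_mass S + dang_mass (~` S) = pi.
 rewrite /dang_mass -RintegralD// -[RHS]/(fine pi%:E) -integral_dang /Rintegral;congr fine.
 apply:eq_integral=> s _;rewrite -mulrDr indicC indicE.
 by case:(s \in S);rewrite /= ?addr0 ?add0r mulr1.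
by rewrite (dang_mass0 (measurableC mS) S0) addr0.
Qed.

Lemma arcs_apart x y p q r : 4 * r < `|x - y| -> `|p - x| < r -> `|q - y| < r -> x < y -> p + r <= q - r.
Proof. by move=> + + + xy;rewrite ltr0_norm ?subr_lt0// !ltr_norml=> h /andP[h1 h2] /andP[h3 h4];lra. Qed.

Lemma arcs_value (a b e e' : R) : e' = e / 4 -> `|a - 1| <= e' -> `|b| <= e' -> 2 - e <= 2 * a - 2 * b.
Proof. by move=> ->;rewrite !ler_norml=>/andP[h1 h2] /andP[h3 h4];lra. Qed.

Lemma mu_sub0 (B D : set T) : measurable B -> measurable D -> D `<=` B -> mu B = 0%E -> (mu D <= 0%:E)%E.
Proof. by move=> mB mD DB B0;apply:(@le_trans _ _ (mu B));[apply:le_measure;rewrite ?inE|rewrite B0]. Qed.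

Lemma two_int (f g : T -> R) : mu.-integrable setT (EFin \o f) -> mu.-integrable setT (EFin \o g) ->
  \int[mu]_s (2 * f s - 2 * g s) = 2 * (\int[mu]_s f s) - 2 * \int[mu]_s g s.
Proof.
move=> If Ig.
have If': mu.-integrable setT (EFin \o (fun s=> 2 * f s)) by exact:(integrableZl measurableT 2 If).
have Ig': mu.-integrable setT (EFin \o (fun s=> 2 * g s)) by exact:(integrableZl measurableT 2 Ig).
by rewrite (RintegralB measurableT If' Ig');congr (_ - _);rewrite RintegralZl.
Qed.
Lemma mu_itv_ball (B : set T) (u v r : R) (c : \bar R) : measurable B -> `|u - v| < r ->
  (mu (B `&` ball v (2 * r)) <= c)%E -> (mu (B `&` `[(u - r)%R, (u + r)%R]%classic) <= c)%E.
Proof.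
move=> mB uv;apply:le_trans;apply:le_measure.
- rewrite inE;apply:measurableI=>//;exact:measurable_itv.
- rewrite inE;apply:measurableI=>//;exact:(measurable_ball v (2 * r)).
- apply:setIS=> z/=;rewrite in_itv/= =>/andP[z1 z2];rewrite /ball/=.
 by move: uv;rewrite !ltr_norml=>/andP[u1 u2];apply/andP;split;lra.
Qed.

Section slices_of.
Variables (A : set P).
Hypothesis mA : measurable A.

Definition rslice t : set T := [set s | A (ray t s)].

Lemma measurable_rslice t : measurable (rslice t).
Proof.
have:=measurable_fun_pair2 t (@measurable_ray R) measurableT mA.
by rewrite setTI.
Qed.

Let mind : mfun setT (\1_A : P -> R). Proof. exact:measurable_indic. Qed.

Lemma slice_massE t : slice_mass A t = dang_mass (rslice t) + dang_mass (rslice (- t)).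
Proof.
rewrite /slice_mass /circ_int /dang_mass -RintegralD//;last 2 first.
- exact:dang_mass_integrable (measurable_rslice _).
- exact:dang_mass_integrable (measurable_rslice _).
by apply:eq_Rintegral=> s _;rewrite -mulrDr.
Qed.

Definition sder (K : @angular R) t : R := circ_int (fun x => \1_A x * ang_fun (ang_der K) x) t.

Lemma sderE K t : 0 < t -> sder K t =
  \int[mu]_s (\1_(rslice t) s * derive1 (ang1 K) s + \1_(rslice (- t)) s * derive1 (ang2 K) s).
Proof.
move=> t0;apply:eq_Rintegral=> s _.
have [-> ->]:=ang_fun_ray (ang_der K) s t0;rewrite /= /dang.
have e u : \1_A (ray u s) = \1_(rslice u) s :> R by [].
by rewrite !e;have:=dang_den s=> h;field;rewrite gt_eqF.
Qed.

(** From -1 up to 1 around [p], back to -1 around [q]. If [p] is close to a density point of the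
    slice and [q] to one of its complement, the slice sees the rise by 2 and almost nothing of the
    fall. *)
Definition updown p q r s : R := -1 + 2 * bump_step p r s - 2 * bump_step q r s.

Lemma isd_updown p q r s : isd (updown p q r) s (2 * derive1 (bump_step p r) s - 2 * derive1 (bump_step q r) s).
Proof.
have d u:=smooth1_isd s (bump_step_smooth u r).
apply:der_eq;first apply:derB.
- by apply:derD;[exact:derC|apply:derM;[exact:derC|exact:d]].
- by apply:derM;[exact:derC|exact:d].
by rewrite/=;ring.
Qed.

Lemma smooth_updown p q r : smooth1 (updown p q r).
Proof.
have h u k : S1 k (fun s=> 2 * bump_step u r s) by apply:S1M;[exact:S1_cst|exact:bump_step_smooth].
by move=> k;apply:S1B;[apply:S1D;[exact:S1_cst|exact:h]|exact:h].
Qed.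

Lemma updown_out p q r s : 0 < r -> `|p| + `|q| + r <= `|s| -> updown p q r s = -1.
Proof.
move=> r0;rewrite /updown;have:=ler_norm p;have:=ler_norm q;have:=ler_norm (- p);have:=ler_norm (- q).
rewrite !normrN=> h1 h2 h3 h4;have [s0|s0]:=ltP s 0.
 by rewrite [`|s|]ltr0_norm// => h;rewrite !bump_step0 ?mulr0 ?addr0 ?subr0//;lra.
by rewrite [`|s|]ger0_norm// => h;rewrite !bump_step1//;[ring|lra|lra].
Qed.

Lemma updown_bound p q r s : 0 < r -> p + r <= q - r -> `|updown p q r s| <= 1.
Proof.
move=> r0 pq;rewrite /updown ler_norml.
have /andP[p0 p1]:=bump_step01 p r s;have /andP[q0 q1]:=bump_step01 q r s.
have [sq|sq]:=leP s (q - r).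
 by rewrite [bump_step q r s]bump_step0//;apply/andP;split;lra.
by rewrite [bump_step p r s]bump_step1 ?(le_trans pq) ?(ltW sq)//;apply/andP;split;lra.
Qed.

(** The boolean selects the half circle, right or left, on which both transitions take place. *)
Definition two_arcs (cp : bool) p q r : @angular R :=
  if cp then Angular (updown p q r) (fun=> -1) (-1) (-1) else Angular (fun=> -1) (updown p q r) (-1) (-1).

(** For a slice equal to one of the two half circles up to a null set: one transition in the middle
    of each half, rising with the slope on the right and falling on the left. *)
Definition half_turn : @angular R :=
  Angular (fun s => -1 + 2 * bump_step 0 1 s) (fun s => 1 - 2 * bump_step 0 1 s) 1 (-1).

Definition ang_opp (K : @angular R) : @angular R :=
  Angular (fun s => - ang1 K s) (fun s => - ang2 K s) (- angp K) (- angm K).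

Lemma ang_opp_smooth K : ang_smooth K -> ang_smooth (ang_opp K).
Proof.
move=>[s1 s2 [M [M0 h1 h2 h3 h4]]];split=>/=;[by move=> k;exact:S1N|by move=> k;exact:S1N|].
by exists M;split=>// s sM;congr (- _);[exact:h1|exact:h2|exact:h3|exact:h4].
Qed.

Lemma ang_oppE K x : ang_fun (ang_opp K) x = - ang_fun K x.
Proof. by rewrite /ang_fun/=;do ![case:ifP=>//]. Qed.

Lemma sder_opp K t : ang_smooth K -> 0 < t -> sder (ang_opp K) t = - sder K t.
Proof.
move=> sK t0;have [s1 s2 _]:=sK.
have d g : smooth1 g -> derive1 (fun s=> - g s) = (fun s=> - derive1 g s) :> (R -> R).
 by move=> sg;apply:isd_derive1=> s;apply:derN;exact:smooth1_isd.
have e x : ang_fun (ang_der (ang_opp K)) x = - ang_fun (ang_der K) x.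
 by rewrite /ang_fun /= !d//;do ![case:ifP=> _];rewrite ?mulrN ?oppr0.
have [B hB]:=ang_fun_bounded (ang_der_smooth sK).
have mK:=measurable_ang_fun (ang_der_smooth sK).
have m1: mfun setT (\1_A : P -> R) by exact:measurable_indic.
have ->: sder (ang_opp K) t = circ_int (fun x=> -1 * (\1_A x * ang_fun (ang_der K) x)) t.
 by apply:eq_Rintegral=> s _;rewrite !e;ring.
rewrite (@circ_intZ _ _ _ _ B) ?mulN1r//;first exact:measurable_funM.
move=> x;rewrite normrM -[leRHS]mul1r ler_pM//.
by rewrite indicE;case:(x \in A);rewrite ?normr1 ?normr0.
Qed.

Lemma two_arcs_ok cp p q r : 0 < r -> p + r <= q - r ->
  ang_smooth (two_arcs cp p q r) /\ forall x, `|ang_fun (two_arcs cp p q r) x| <= 1.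
Proof.
move=> r0 pq;have su:=smooth_updown p q r;have sc k : S1 k (fun _ : R=> -1 : R) by exact:S1_cst.
have n1: `|-1 : R| <= 1 by rewrite normrN1.
have M0: 0 < `|p| + `|q| + r by rewrite ltr_wpDl ?addr_ge0.
have o s : `|p| + `|q| + r <= s -> updown p q r s = -1.
 by move=> h;apply:updown_out=>//;rewrite (le_trans h)// ler_norm.
have o' s : s <= - (`|p| + `|q| + r) -> updown p q r s = -1.
 by move=> h;apply:updown_out=>//;have:=ler_norm (- s);rewrite normrN;lra.
split;first by rewrite /two_arcs;case:cp;split=>//;exists (`|p| + `|q| + r);split.
move=> x;rewrite /ang_fun /two_arcs;case:cp=>/=;do ![case:ifP=> _ //];exact:updown_bound.
Qed.

Lemma half_turn_ok : ang_smooth half_turn /\ forall x, `|ang_fun half_turn x| <= 1.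
Proof.
have h k : S1 k (fun s : R=> 2 * bump_step 0 1 s) by apply:S1M;[exact:S1_cst|exact:bump_step_smooth].
have b s : 0 <= bump_step 0 1 s <= 1 :> Prop by exact:bump_step01.
split.
 split=>/=;[by move=> k;apply:S1D=>//;exact:S1_cst|by move=> k;apply:S1B=>//;exact:S1_cst|].
 exists 1;split=>// s s1.
 - by rewrite bump_step1 ?add0r//;ring.
 - by rewrite bump_step0 ?sub0r// mulr0 addr0.
 - by rewrite bump_step1 ?add0r//;ring.
 - by rewrite bump_step0 ?sub0r// mulr0 subr0.
move=> x;rewrite /ang_fun/=;do ![case:ifP=> _];rewrite ?normr1 ?normrN1//.
 by rewrite ler_norml;have /andP[b0 b1]:=b (x.2 / x.1);apply/andP;split;lra.
by rewrite ler_norml;have /andP[b0 b1]:=b (x.2 / x.1);apply/andP;split;lra.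
Qed.

(** A countable family suffices: rational centres, widths [n.+1%:R^-1], and a final boolean for the
    sign. Countability reduces the choice of a best member at each radius to finite maxima,
    measurable in the radius. *)
Definition fam_index := (option (bool * (rat * rat) * nat) * bool)%type.

(** Parameters whose two transitions would overlap receive the constant function, with zero angular
    derivative. *)
Definition fam0 (i : option (bool * (rat * rat) * nat)) : @angular R :=
  if i is Some (cp, (p, q), n) then
    if (ratr p + n.+1%:R^-1 <= ratr q - n.+1%:R^-1 :> R) then two_arcs cp (ratr p) (ratr q) n.+1%:R^-1 else ang_one
  else half_turn.

Definition fam (i : fam_index) : @angular R := if i.2 then fam0 i.1 else ang_opp (fam0 i.1).

Lemma fam_ok i : ang_smooth (fam i) /\ forall x, `|ang_fun (fam i) x| <= 1.
Proof.
have h0 j : ang_smooth (fam0 j) /\ forall x,`|ang_fun (fam0 j) x| <= 1.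
 case:j=>[[[cp [p q]] n]|];last exact:half_turn_ok.
 rewrite /fam0;case:ifP=> h;first by apply:two_arcs_ok.
 by split;[exact:ang_one_smooth|move=> x;rewrite ang_fun_one normr1].
have [s b]:=h0 i.1;rewrite /fam;case:ifP=>// _;split;first exact:ang_opp_smooth.
by move=> x;rewrite ang_oppE normrN.
Qed.

Lemma fam_arcs cp (p q : rat) n (b : bool) : ratr p + n.+1%:R^-1 <= ratr q - n.+1%:R^-1 :> R ->
  fam (Some (cp, (p, q), n), b) = if b then two_arcs cp (ratr p) (ratr q) n.+1%:R^-1
    else ang_opp (two_arcs cp (ratr p) (ratr q) n.+1%:R^-1).
Proof.
move=> h;have e: fam0 (Some (cp,(p,q),n)) = two_arcs cp (ratr p) (ratr q) n.+1%:R^-1 by rewrite [LHS]/= ifT.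
by rewrite /fam [_.2]/= [_.1]/= e.
Qed.

Lemma fam_half (b : bool) : fam (None, b) = if b then half_turn else ang_opp half_turn.
Proof. by []. Qed.

(** On the circle, a set neither null nor full has variation at least 2. Either the slice cuts one
    half circle, and density points of the slice and of its complement in that half give two arcs;
    or both halves are trivial, and then exactly one of them is full. *)
Lemma fam_sup t e : 0 < t -> 0 < e -> 0 < slice_mass A t -> slice_mass A t < 2 * pi ->
  exists i, 2 - e <= sder (fam i) t.
Proof.
move=> t0 e0 m0 m2;have [C [C0 hC]]:=@step_der_bounded R.
pose S (cp : bool):=rslice (if cp then t else - t).
have mS cp : measurable (S cp) by exact:measurable_rslice.
have BI u r (B : set T) : 0 < r -> measurable B -> mu.-integrable setT (EFin \o (fun s=> \1_B s * derive1 (bump_step u r) s)).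
 by move=> r0 mB;exact:(bump_integrable hC _ r0 (measurable_indic mB) (ind1 B)).
have arcsE cp p q r : 0 < r -> sder (two_arcs cp p q r) t =
  2 * (\int[mu]_s (\1_(S cp) s * derive1 (bump_step p r) s)) - 2 * \int[mu]_s (\1_(S cp) s * derive1 (bump_step q r) s).
 move=> r0;have I1:=BI p r _ r0 (mS cp);have I2:=BI q r _ r0 (mS cp).
 rewrite (sderE _ t0) -(two_int I1 I2).
 have du: derive1 (updown p q r) = (fun s=> 2 * derive1 (bump_step p r) s - 2 * derive1 (bump_step q r) s) by exact:isd_derive1 (isd_updown p q r).
 have dc: derive1 (fun=> -1 : R) = (fun=> 0 : R) by apply:isd_derive1=> s;exact:derC.
 have key x y z : x * (2 * y - 2 * z) = 2 * (x * y) - 2 * (x * z) :> R by ring.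
 apply:eq_Rintegral=> s _;rewrite -key /S;case:(cp).
  by rewrite [ang1 _]/= [ang2 _]/= du dc mulr0 addr0.
 by rewrite [ang1 _]/= [ang2 _]/= du dc mulr0 add0r.
have [h|h]:=pselect (exists cp,mu (S cp) != 0%E /\ mu (~` S cp) != 0%E).
 have [cp [n0 n1]]:=h.
 have [x Sx hx]:=density_point (mS cp) n0;have [y Sy hy]:=density_point (measurableC (mS cp)) n1.
 have ep0: 0 < e / (4 * C) by rewrite divr_gt0 ?mulr_gt0.
 have [dx dx0 hdx]:=hx _ ep0;have [dy dy0 hdy]:=hy _ ep0.
 have xy: x != y by apply/eqP=> xy;apply:Sy;rewrite -xy.
 have xy0: 0 < `|x - y| by rewrite normr_gt0 subr_eq0.
 pose d:=Num.min (Num.min dx dy) `|x - y|.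
 have d0: 0 < d by rewrite !lt_min dx0 dy0.
 have [n nd] : exists n : nat,4 * n.+1%:R^-1 < d.
  exists (Num.truncn (4 / d));rewrite -[d]invrK ltr_pdivrMr// mulrC -ltr_pdivrMr ?invr_gt0// invrK.
  exact:truncnS_gt.
 set r:=n.+1%:R^-1 in nd;have r0: 0 < r by rewrite invr_gt0.
 move: nd;rewrite !lt_min=>/andP[/andP[rx ry] rxy].
 have rat_near u : exists p : rat,`|ratr p - u| < r.
  have [p] : exists q : rat,ratr q \in `](u - r),(u + r)[ by apply:rat_in_itvoo;lra.
  by rewrite in_itv/= =>/andP[h1 h2];exists p;rewrite ltr_norml;apply/andP;split;lra.
 have [p px]:=rat_near x;have [q qy]:=rat_near y.
 have f1: (mu (~` S cp `&` `[(ratr p - r)%R,(ratr p + r)%R]%classic) <= (2 * (e / (4 * C)) * r)%:E)%E.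
  apply:(mu_itv_ball (v:=x))=>//;first exact:measurableC.
  rewrite (_ : 2 * (e / (4 * C)) * r = e / (4 * C) * (2 * r));last by ring.
  by apply:hdx;lra.
 have f2: (mu (S cp `&` `[(ratr q - r)%R,(ratr q + r)%R]%classic) <= (2 * (e / (4 * C)) * r)%:E)%E.
  apply:(mu_itv_ball (v:=y))=>//.
  rewrite (_ : 2 * (e / (4 * C)) * r = e / (4 * C) * (2 * r));last by ring.
  by rewrite -[S cp]setCK;apply:hdy;lra.
 have g1:=bump_full C0 hC (mS cp) r0 f1;have g2:=bump_small C0 hC (mS cp) r0 f2.
 have Ce: C * (2 * (e / (4 * C))) / 2 = e / 4 by field;rewrite gt_eqF.
 (* Transitions are ordered along the chart. When the point of the complement comes first, the
    centres are exchanged and the sign is reversed. *)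
 have [lt|gt|e']:=ltgtP x y;last by rewrite e' eqxx in xy.
  have pq:=arcs_apart rxy px qy lt.
  exists (Some (cp,(p,q),n),true);rewrite (fam_arcs _ _ pq) (arcsE cp (ratr p) (ratr q) r r0).
  exact:arcs_value Ce g1 g2.
 have qp: ratr q + r <= ratr p - r by apply:arcs_apart qy px gt;rewrite distrC.
 have sm:=(two_arcs_ok cp r0 qp).1.
 exists (Some (cp,(q,p),n),false);rewrite (fam_arcs _ _ qp) (sder_opp sm t0) (arcsE cp (ratr q) (ratr p) r r0) opprB.
 exact:arcs_value Ce g1 g2.
have tr cp : mu (S cp) = 0%E \/ mu (~` S cp) = 0%E.
 by apply:contrapT=>/not_orP[/eqP h1 /eqP h2];apply:h;exists cp.
have mE: slice_mass A t = dang_mass (S true) + dang_mass (S false) by exact:slice_massE.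
have htE: sder half_turn t = 2 * (\int[mu]_s (\1_(S true) s * derive1 (bump_step 0 1) s)) - 2 * \int[mu]_s (\1_(S false) s * derive1 (bump_step 0 1) s).
 have I1:=BI 0 1 _ ltr01 (mS true);have I2:=BI 0 1 _ ltr01 (mS false).
 rewrite (sderE _ t0) -(two_int I1 I2).
 have db u : isd (bump_step 0 1) u (derive1 (bump_step 0 1) u) by exact:smooth1_isd (bump_step_smooth _ _).
 have d1: derive1 (ang1 half_turn) = (fun s=> 2 * derive1 (bump_step 0 1) s).
  apply:isd_derive1=> s;apply:der_eq;first by apply:derD;[exact:derC|apply:derM;[exact:derC|exact:db]].
  by rewrite/=;ring.
 have d2: derive1 (ang2 half_turn) = (fun s=> - (2 * derive1 (bump_step 0 1) s)).
  apply:isd_derive1=> s;apply:der_eq;first by apply:derB;[exact:derC|apply:derM;[exact:derC|exact:db]].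
  by rewrite/=;ring.
 by apply:eq_Rintegral=> s _;rewrite d1 d2 /S;ring.
have z0 (B : set T) : measurable B -> mu B = 0%E -> \int[mu]_s (\1_B s * derive1 (bump_step 0 1) s) = 0.
 move=> mB B0;have:=@bump_small _ _ C0 hC B 0 1 0 mB ltr01.
 rewrite mul0r mulr0 mul0r normr_le0=> h1;apply/eqP;apply:h1.
 by apply:(mu_sub0 mB) B0;[exact:measurableI|exact:subIsetl].
have z1 (B : set T) : measurable B -> mu (~` B) = 0%E -> \int[mu]_s (\1_B s * derive1 (bump_step 0 1) s) = 1.
 move=> mB B0;have:=@bump_full _ _ C0 hC B 0 1 0 mB ltr01.
 rewrite mul0r mulr0 mul0r normr_le0 subr_eq0=> h1;apply/eqP;apply:h1.
 by apply:(mu_sub0 (measurableC mB)) B0;[apply:measurableI=>//;exact:measurableC|exact:subIsetl].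
case:(tr true) (tr false)=>[h1|h1] [h2|h2].
- by move: m0;rewrite mE !dang_mass0// addr0 ltxx.
- exists (None,false);rewrite fam_half (sder_opp half_turn_ok.1 t0).
 by rewrite htE (z0 _ _ h1)// (z1 _ _ h2)//;lra.
- exists (None,true);rewrite fam_half.
 by rewrite htE (z1 _ _ h1)// (z0 _ _ h2)//;lra.
- by move: m2;rewrite mE !dang_mass1// mulr_natl mulr2n ltxx.
Qed.

End slices_of.
End slices.

Lemma lateral_sup_arith {R : realType} (e x1 x2 x3 x4 x5 : R) : 2 * x1 - e / 2 <= x2 -> x2 <= x3 + x4 ->
  x4 <= x5 -> x5 <= e / 2 -> 2 * x1 - e <= x3.
Proof. lra. Qed.

(** * One tangential field that is nearly optimal at all radii *)

Section lateral_sup.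
Context {R : realType}.
Notation T := (measurableTypeR R).
Notation P := (plane R).
Notation mu := (@lebesgue_measure R).
Implicit Types (a b e s t : R) (x : P) (L : seq ((R -> R) * @angular R)).
Variable A : set P.
Hypothesis mA : measurable A.

Let mind : mfun setT (\1_A : P -> R). Proof. exact:measurable_indic. Qed.
Let ind1 x : `|\1_A x : R| <= 1. Proof. by rewrite indicE;case:(x \in A);rewrite ?normr1 ?normr0. Qed.

Lemma ind_mul_bounded (F : P -> R) B : (forall x, `|F x| <= B) -> forall x, `|\1_A x * F x| <= B.
Proof. by move=> FB x;rewrite normrM -[leRHS]mul1r ler_pM. Qed.

Lemma measurable_sder K : ang_smooth K -> mfun setT (sder A K).
Proof.
by move=> sK;apply:measurable_circ_int;apply:measurable_funM=>//;apply:measurable_ang_fun;exact:ang_der_smooth.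
Qed.

Lemma sder_bounded K : ang_smooth K -> exists B, forall t, `|sder A K t| <= B.
Proof.
move=> sK;have [B hB]:=ang_fun_bounded (ang_der_smooth sK);exists (2 * pi * B)=> t.
apply:circ_int_bound;last exact:ind_mul_bounded.
by apply:measurable_funM=>//;apply:measurable_ang_fun;exact:ang_der_smooth.
Qed.

Lemma measurable_slice_der L : ang_sum_smooth L -> mfun setT (slice_der A L).
Proof.
by move=> sL;apply:measurable_circ_int;apply:measurable_funM=>//;exact:measurable_ang_sum_der.
Qed.

Lemma slice_der_bounded L : ang_sum_smooth L -> exists B, forall t, `|slice_der A L t| <= B.
Proof.
move=> sL;have [B hB]:=ang_sum_der_bounded sL;exists (2 * pi * B)=> t.
apply:circ_int_bound;last exact:ind_mul_bounded.
by apply:measurable_funM=>//;exact:measurable_ang_sum_der.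
Qed.

Lemma slice_der_cons (c' : R -> R) K L t : ang_sum_smooth ((c', K) :: L) -> 0 < t ->
  slice_der A ((c', K) :: L) t = c' t * sder A K t + slice_der A L t.
Proof.
move=>/= [_ _ sK sL] t0.
have [B1 h1]:=ang_fun_bounded (ang_der_smooth sK);have [B2 h2]:=ang_sum_der_bounded sL.
have m1: mfun setT (fun x : P=> \1_A x * ang_fun (ang_der K) x).
 by apply:measurable_funM=>//;apply:measurable_ang_fun;exact:ang_der_smooth.
have m2: mfun setT (fun x : P=> \1_A x * ang_sum_der L x).
 by apply:measurable_funM=>//;exact:measurable_ang_sum_der.
pose B:=Num.max (`|c' t| * B1) B2.
have b1 x : `|c' t * (\1_A x * ang_fun (ang_der K) x)| <= B.
 by rewrite normrM (le_trans (ler_wpM2l _ (ind_mul_bounded h1 x)))// le_max lexx.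
have b2 x : `|\1_A x * ang_sum_der L x| <= B by rewrite (le_trans (ind_mul_bounded h2 x))// le_max lexx orbT.
rewrite -(circ_intZ (c' t) t m1 (ind_mul_bounded h1)) -(circ_intD t (measurable_funM (measurable_cst _) m1) b1 m2 b2).
by apply:eq_Rintegral=> s _;rewrite /= !enorm_ray normrN (gtr0_norm t0);ring.
Qed.

Lemma slice_der_nil t : slice_der A [::] t = 0.
Proof.
transitivity (\int[mu]_(s in setT) (0 : R));last exact:(congr1 fine (integral0 mu setT)).
by apply:eq_Rintegral=> s _/=;rewrite !mulr0 addr0 mulr0.
Qed.

Definition ang_good L := ang_sum_smooth L /\ forall x, `|ang_sum L x| <= 1.

(** The factor [1 - c'] makes room for one more function with coefficient [c']: a convex
    combination, still bounded by 1. *)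
Definition scale_sum (c' : R -> R) L : seq ((R -> R) * @angular R) := [seq ((fun t => (1 - c' t) * p.1 t), p.2) | p <- L].

Lemma scale_sum_smooth (c' : R -> R) L : smooth1 c' -> (forall t, 0 <= c' t <= 1) ->
  ang_sum_smooth L -> ang_sum_smooth (scale_sum c' L).
Proof.
move=> sc c01;elim:L=>//= -[d K] L IH /= [sd [B hB] sK sL];split=>//;last exact:IH.
 by move=> k;apply:S1M=>//;apply:S1B=>//;exact:S1_cst.
exists B=> t;rewrite normrM -[leRHS]mul1r ler_pM//.
by have /andP[h0 h1]:=c01 t;rewrite ger0_norm;lra.
Qed.

Lemma ang_sum_scale (c' : R -> R) L x : ang_sum (scale_sum c' L) x = (1 - c' (enorm x)) * ang_sum L x.
Proof. by elim:L=>[|p L IH]/=;rewrite ?mulr0// IH;ring. Qed.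

Lemma slice_der_scale (c' : R -> R) L t : smooth1 c' -> (forall t, 0 <= c' t <= 1) ->
  ang_sum_smooth L -> 0 < t -> slice_der A (scale_sum c' L) t = (1 - c' t) * slice_der A L t.
Proof.
move=> sc c01 + t0;elim:L=>[_|[d K] L IH sL].
 by rewrite /= !slice_der_nil mulr0.
have sL':=scale_sum_smooth sc c01 sL.
rewrite (slice_der_cons sL t0) [LHS](slice_der_cons sL' t0) IH;last by case:sL.
by rewrite/=;ring.
Qed.

Definition nth_fam J : @angular R := if unpickle J is Some i then fam i else ang_one.

Lemma nth_fam_ok J : ang_smooth (nth_fam J) /\ forall x, `|ang_fun (nth_fam J) x| <= 1.
Proof.
rewrite /nth_fam;case:unpickle=>[i|];first exact:fam_ok.
by split;[exact:ang_one_smooth|move=> x;rewrite ang_fun_one normr1].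
Qed.

Fixpoint sup_sder J t : R := if J is J'.+1 then Num.max (sup_sder J' t) (sder A (nth_fam J') t) else 0.

Lemma measurable_sup_sder J : mfun setT (sup_sder J).
Proof.
elim:J=>[|J IH]/=;first exact:measurable_cst.
by apply:measurable_maxr=>//;apply:measurable_sder;exact:(nth_fam_ok J).1.
Qed.

Lemma sup_sder_bounded J : exists B, forall t, `|sup_sder J t| <= B.
Proof.
elim:J=>[|J [B hB]]/=;first by exists 0=> t;rewrite normr0.
have [C hC]:=sder_bounded (nth_fam_ok J).1;exists (Num.max B C)=> t.
by rewrite maxEle;case:ifP=> _;rewrite le_max ?hB ?hC ?orbT.
Qed.

Lemma sup_sder_mono J J' t : (J <= J')%N -> sup_sder J t <= sup_sder J' t.
Proof. by elim:J'=>[|J' IH];[rewrite leqn0=>/eqP->|rewrite leq_eqVlt=>/predU1P[->//|/IH h]/=;rewrite le_max h]. Qed.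

Lemma sup_sder_ge0 J t : 0 <= sup_sder J t.
Proof. exact:(@sup_sder_mono 0 J t). Qed.

Let mS (f : T -> R) a b : mfun setT f -> mfun `[a, b] f.
Proof. by move=> mf;exact:measurable_funS mf. Qed.

Let bint (f : T -> R) a b B : mfun setT f -> (forall t, `|f t| <= B) -> mu.-integrable `[a, b] (EFin \o f).
Proof.
move=> mf fB;apply:(@bounded_int R `[a,b]%classic f B)=>//;first exact:mu_itv_fin.
exact:measurable_funS mf.
Qed.

(** Passing from [J] to [J.+1] means switching to the new function at the radii where it does
    better. The switch is an indicator in the radius; a smooth substitute with values in [0, 1],
    close in L1, loses little because the angular derivatives integrated over slices are bounded. *)
Lemma sup_sder_approx a b J e : 0 < a -> a < b -> 0 < e -> exists L, ang_good L /\
  \int[mu]_(t in `[a, b]) `|slice_der A L t - sup_sder J t| <= e.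
Proof.
move=> a0 ab;elim:J e=>[|J IH] e e0.
 exists [::];split;first by split=>// x;rewrite normr0.
 rewrite (_ : (fun t=> _) = fun=> 0);last by apply/funext=> t;rewrite slice_der_nil subrr normr0.
 by rewrite [leLHS](congr1 fine (integral0 mu _)) ltW.
have [L [[sL L1] Le]]:=IH (e / 2) (divr_gt0 e0 (ltr0n _ 2)).
have [sK K1]:=nth_fam_ok J;set K:=nth_fam J in sK K1 *.
have [B1 h1]:=slice_der_bounded sL;have [B2 h2]:=sder_bounded sK;have [B3 h3]:=sup_sder_bounded J.
have mM:=measurable_sup_sder J;have mK:=measurable_sder sK;have mL:=measurable_slice_der sL.
pose f t : R:=if sup_sder J t < sder A K t then 1 else 0.
have mf: mfun setT f by apply:measurable_fun_ifT=>//;exact:measurable_fun_ltr.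
have f01 t : 0 <= f t <= 1 by rewrite /f;case:ifP=> _;rewrite lexx ler01.
have C0: 0 < B1 + B2 + 1 by have:=le_trans (normr_ge0 _) (h1 0);have:=le_trans (normr_ge0 _) (h2 0);lra.
have e'0: 0 < e / (2 * (B1 + B2 + 1)) by rewrite divr_gt0 ?mulr_gt0.
have [g [sg g01 ge]]:=smooth_L1 ab e'0 (mS mf) (fun t _=> f01 t).
have mg: mfun setT g by apply:cts_mfun;exact:smooth1_cts.
have sL':=scale_sum_smooth sg g01 sL.
have sgL: ang_sum_smooth ((g,K) :: scale_sum g L).
 by split=>//;exists 1=> t/=;have /andP[g0 g1]:=g01 t;rewrite ger0_norm.
exists ((g,K) :: scale_sum g L);split.
 split=>// x;rewrite /= ang_sum_scale;have /andP[g0 g1]:=g01 (enorm x).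
 rewrite (le_trans (ler_normD _ _))// !normrM (ger0_norm g0) [`|1 - _|]ger0_norm ?subr_ge0//.
 have : g (enorm x) * `|ang_fun K x| <= g (enorm x) * 1 by rewrite ler_wpM2l.
 have : (1 - g (enorm x)) * `|ang_sum L x| <= (1 - g (enorm x)) * 1 by rewrite ler_wpM2l ?subr_ge0.
 by lra.
pose D t:=(B1 + B2 + 1) * `|f t - g t| + `|slice_der A L t - sup_sder J t|.
have mfg: mfun setT (fun t=> `|f t - g t|) by apply:measurableT_comp=>//;exact:measurable_funB.
have mLM: mfun setT (fun t=> `|slice_der A L t - sup_sder J t|) by apply:measurableT_comp=>//;exact:measurable_funB.
have bfg t : `|f t - g t| <= 2 by have /andP[? ?]:=f01 t;have /andP[? ?]:=g01 t;rewrite ler_norml;apply/andP;split;lra.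
have bLM t : `|slice_der A L t - sup_sder J t| <= B1 + B3 by rewrite (le_trans (ler_normB _ _))// lerD.
have I1:=@bint _ a b _ mfg (fun t=> le_trans (eq_ind_r (fun z=> z <= _) (lexx _) (normr_id _)) (bfg t)).
have I2:=@bint _ a b _ mLM (fun t=> le_trans (eq_ind_r (fun z=> z <= _) (lexx _) (normr_id _)) (bLM t)).
have mab: measurable (`[a,b]%classic : set T) by exact:measurable_itv.
have I1': mu.-integrable `[a,b] (EFin \o (fun t=>(B1 + B2 + 1) * `|f t - g t|)) by exact:(integrableZl mab _ I1).
apply:(@le_trans _ _ (\int[mu]_(t in `[a,b]) D t)).
 apply:le_Rintegral=>//.
 - have [B4 h4]:=slice_der_bounded sgL;have [B5 h5]:=sup_sder_bounded J.+1.
  apply:(@bint _ a b (B4 + B5)).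
   apply:measurableT_comp=>//;apply:measurable_funB;[exact:measurable_slice_der|exact:measurable_sup_sder].
  by move=> t;rewrite normr_id (le_trans (ler_normB _ _))// lerD.
 - exact:(integrableD mab I1' I2).
 move=> t/=;rewrite in_itv/= =>/andP[at_ _];have t0: 0 < t by exact:lt_le_trans at_.
 rewrite (slice_der_cons sgL t0) (slice_der_scale sg g01 sL t0) -/K.
 have mE: Num.max (sup_sder J t) (sder A K t) = f t * sder A K t + (1 - f t) * sup_sder J t.
  by rewrite /f;case:ltP=> _;ring.
 rewrite mE (_ : _ - _ = (g t - f t) * (sder A K t - slice_der A L t) + (1 - f t) * (slice_der A L t - sup_sder J t));last by ring.
 rewrite (le_trans (ler_normD _ _))// lerD// normrM.
  rewrite mulrC (distrC (g t)) ler_wpM2r// (le_trans (ler_normB _ _))//.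
  by have:=h1 t;have:=h2 t;lra.
 have /andP[f0 f1]:=f01 t.
 by rewrite -[leRHS]mul1r ler_wpM2r// ger0_norm;lra.
rewrite (RintegralD mab I1' I2) RintegralZl//.
have : (B1 + B2 + 1) * (\int[mu]_(t in `[a,b]) `|f t - g t|) <= (B1 + B2 + 1) * (e / (2 * (B1 + B2 + 1))) by rewrite ler_wpM2l// ltW.
have ->: (B1 + B2 + 1) * (e / (2 * (B1 + B2 + 1))) = e / 2 by field;rewrite gt_eqF.
by move: Le;lra.
Qed.

Definition cut_ind t : R := if (0 < slice_mass A t) && (slice_mass A t < 2 * pi) then 1 else 0.

Lemma measurable_slice_mass : mfun setT (slice_mass A).
Proof. exact:measurable_circ_int. Qed.

Lemma measurable_cut_ind : mfun setT cut_ind.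
Proof.
apply:measurable_fun_ifT=>//;apply:measurable_and;apply:measurable_fun_ltr=>//;exact:measurable_slice_mass.
Qed.

(** By [fam_sup] the finite maxima, capped at 2 so as to be dominated, converge to 2 on every cut
    slice; elsewhere they are multiplied by 0. A finite stage [J] is then approximated by a single
    combination. *)
Lemma lateral_sup (v : T -> R) a b C e : 0 < a -> a < b -> mfun setT v -> (forall t, 0 <= v t <= C) -> 0 < e ->
  exists L, ang_good L /\
    2 * (\int[mu]_(t in `[a, b]) (v t * cut_ind t)) - e <= \int[mu]_(t in `[a, b]) (v t * slice_der A L t).
Proof.
move=> a0 ab mv vC e0;have mab: measurable (`[a,b]%classic : set T) by exact:measurable_itv.
have C0: 0 <= C by have /andP[h1 h2]:=vC 0;exact:le_trans h2.
have mN:=measurable_cut_ind.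
have N01 t : 0 <= cut_ind t <= 1 by rewrite /cut_ind;case:ifP=> _;rewrite lexx ler01.
pose F J t:=v t * (Num.min (sup_sder J t) 2 * cut_ind t).
have mF J : mfun setT (F J).
 apply:measurable_funM=>//;apply:measurable_funM=>//;apply:measurable_minr=>//;exact:measurable_sup_sder.
have m02 J t : 0 <= Num.min (sup_sder J t) 2 <= 2 by rewrite le_min sup_sder_ge0 ler0n ge_min lexx orbT.
have bF J t : `|F J t| <= 2 * C.
 have /andP[h1 h2]:=vC t;have /andP[h3 h4]:=N01 t;have /andP[h5 h6]:=m02 J t.
 rewrite ger0_norm ?mulr_ge0// mulrC;apply:ler_pM=>//;rewrite ?mulr_ge0//.
 by rewrite -[leRHS]mulr1 ler_pM.
have cF: (fun J=> \int[mu]_(t in `[a,b]) F J t) @ \oo --> \int[mu]_(t in `[a,b]) (v t * (2 * cut_ind t)).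
 have fin: (\int[mu]_(t in `[a,b]) (v t * (2 * cut_ind t))%:E)%E \is a fin_num.
  apply:integrable_fin_num=>//;apply:(@bint _ a b (C * 2));first by apply:measurable_funM=>//;exact:measurable_funM.
  move=> t;have /andP[h1 h2]:=vC t;have /andP[h3 h4]:=N01 t.
  by rewrite ger0_norm ?mulr_ge0// ler_pM ?mulr_ge0//;lra.
 apply/fine_cvg;rewrite fineK//.
 apply:(@dominated_cvg _ T R mu _ mab (fun J t=>(F J t)%:E) (fun t=>(v t * (2 * cut_ind t))%:E) (cst (2 * C)%:E))=>//.
 - by move=> J;apply/measurable_EFinP;exact:(mS (mF J)).
 - move=> t/=;rewrite in_itv/= =>/andP[at_ _];have t0: 0 < t by exact:lt_le_trans at_.
  apply:cvg_EFin;first exact:nearW.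
  apply:cvgM;first exact:cvg_cst.
  rewrite /cut_ind;case:ifPn=>[/andP[p1 p2]|_];last first.
   by rewrite mulr0;under eq_fun do rewrite mulr0;exact:cvg_cst.
  apply:cvgM;last exact:cvg_cst.
  apply/cvgrPdist_le=> d d0;have [i hi]:=fam_sup mA t0 d0 p1 p2.
  exists (pickle i).+1=>//= J iJ.
  have : 2 - d <= sup_sder J t.
   apply:le_trans (sup_sder_mono t iJ);rewrite /= le_max.
   by rewrite /nth_fam pickleK hi orbT.
  have /andP[h5 h6]:=m02 J t.
  by rewrite ger0_norm ?subr_ge0// => h7;rewrite lerBlDr -lerBlDl le_min;apply/andP;split;lra.
 - apply:(@bint (cst (2 * C)) a b (2 * C))=>// t;rewrite ger0_norm// mulr_ge0//.
 - by move=> J t _;rewrite /= lee_fin.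
have e4: 0 < e / 2 by rewrite divr_gt0.
have [J hJ] : exists J,\int[mu]_(t in `[a,b]) (v t * (2 * cut_ind t)) - e / 2 <= \int[mu]_(t in `[a,b]) F J t.
 have /cvgrPdist_le/(_ _ e4)[J _ hJ]:=cF;exists J.
 by have:=hJ J (leqnn _);rewrite /= ler_norml=>/andP[_];lra.
have eC: 0 < e / (2 * (C + 1)) by rewrite divr_gt0 ?mulr_gt0//;lra.
have [L [gL Le]]:=@sup_sder_approx a b J _ a0 ab eC;exists L;split=>//.
have [B hB]:=slice_der_bounded gL.1;have mL:=measurable_slice_der gL.1;have [B' hB']:=sup_sder_bounded J.
have B0: 0 <= B by exact:le_trans (hB 0).
have B'0: 0 <= B' by exact:le_trans (hB' 0).
have bv t : `|v t| <= C by have /andP[h1 h2]:=vC t;rewrite ger0_norm.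
have mdiff: mfun setT (fun t=> `|slice_der A L t - sup_sder J t|).
 by apply:measurableT_comp=>//;apply:measurable_funB=>//;exact:measurable_sup_sder.
have I1: mu.-integrable `[a,b] (EFin \o F J) by exact:(@bint _ a b _ (mF J) (bF J)).
have I2: mu.-integrable `[a,b] (EFin \o (fun t=> v t * slice_der A L t)).
 by apply:(@bint _ a b (C * B));[exact:measurable_funM|move=> t;rewrite normrM ler_pM].
have I3: mu.-integrable `[a,b] (EFin \o (fun t=> `|slice_der A L t - sup_sder J t|)).
 by apply:(@bint _ a b (B + B'))=>// t;rewrite normr_id (le_trans (ler_normB _ _))// lerD.
have I3': mu.-integrable `[a,b] (EFin \o (fun t=> C * `|slice_der A L t - sup_sder J t|)) by exact:(integrableZl mab _ I3).
have step: \int[mu]_(t in `[a,b]) F J t <= \int[mu]_(t in `[a,b]) (v t * slice_der A L t + C * `|slice_der A L t - sup_sder J t|).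
 apply:le_Rintegral=>//;first exact:(integrableD mab I2 I3').
 move=> t _;have /andP[h1 h2]:=vC t;have /andP[h3 h4]:=N01 t;have /andP[h5 h6]:=m02 J t.
 have h7: Num.min (sup_sder J t) 2 * cut_ind t <= sup_sder J t.
  apply:(@le_trans _ _ (Num.min (sup_sder J t) 2 * 1));first by rewrite ler_wpM2l.
  by rewrite mulr1 ge_min lexx.
 have h8: F J t <= v t * sup_sder J t by rewrite ler_wpM2l.
 have h9:=ler_norm (sup_sder J t - slice_der A L t);rewrite distrC in h9.
 have h10: v t * (sup_sder J t - slice_der A L t) <= v t * `|slice_der A L t - sup_sder J t| by rewrite ler_wpM2l.
 have h11: v t * `|slice_der A L t - sup_sder J t| <= C * `|slice_der A L t - sup_sder J t| by rewrite ler_wpM2r.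
 by lra.
rewrite (RintegralD mab I2 I3') RintegralZl// in step.
have h12: C * (\int[mu]_(t in `[a,b]) `|slice_der A L t - sup_sder J t|) <= C * (e / (2 * (C + 1))) by rewrite ler_wpM2l.
have h13: C * (e / (2 * (C + 1))) <= e / 2.
 have ->: e / 2 = (C + 1) * (e / (2 * (C + 1))) by field;rewrite gt_eqF// ltr_wpDl.
 by rewrite ler_wpM2r ?(ltW eC)// lerDl.
have h14: \int[mu]_(t in `[a,b]) (v t * (2 * cut_ind t)) = 2 * (\int[mu]_(t in `[a,b]) (v t * cut_ind t)).
 rewrite -RintegralZl//;first by apply:eq_Rintegral=> t _;ring.
 apply:(@bint _ a b (C));first exact:measurable_funM.
 by move=> t;rewrite normrM -[leRHS]mulr1 ler_pM//;have /andP[h1 h2]:=N01 t;rewrite ger0_norm.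
by rewrite h14 in hJ;exact:lateral_sup_arith hJ step h12 h13.
Qed.

End lateral_sup.

(** * A layer cake formula *)

Section layer.
Context {R : realType}.
Notation T := (measurableTypeR R).
Notation mu := (@lebesgue_measure R).
Implicit Types (a b c e s t x y : R).

Lemma layer_cake (E f : T -> R) (B : set T) : measurable B -> mfun setT E -> mfun setT f ->
  (forall t, B t -> 0 <= E t) -> (forall t, B t -> 0 <= f t <= 1) ->
  mfun (`]0%R, 1%R[%classic : set T) (fun y => \int[mu]_(t in B `&` [set t | (y < f t)%R]) (E t)%:E)%E /\
  (\int[mu]_(t in B) (E t * f t)%:E = \int[mu]_(y in `]0%R, 1%R[) \int[mu]_(t in B `&` [set t | (y < f t)%R]) (E t)%:E)%E.
Proof.
move=> mB mE mf E0 f01.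
have mfin: measurable [set z : T * T|z.2 < f z.1].
 have mb: mfun setT (fun z : T * T=> z.2 < f z.1).
  apply:measurable_fun_ltr;[exact:measurable_snd|exact:(measurableT_comp mf measurable_fst)].
 have:=mb measurableT [set true] I;rewrite setTI;congr measurable.
pose Z (z : T * T) : \bar R:=((E z.1)%:E * (\1_B z.1 * \1_(`]0%R,1%R[%classic : set T) z.2 * \1_[set z : T * T|(z.2 < f z.1)%R] z)%:E)%E.
have mZ: mfun setT Z.
 apply:emeasurable_funM;first by apply/measurable_EFinP;exact:(measurableT_comp mE measurable_fst).
 apply/measurable_EFinP;apply:measurable_funM;last exact:measurable_indic.
 apply:measurable_funM.
  by apply:(measurableT_comp (f:=\1_B : T -> R))=>//;exact:measurable_indic.
 by apply:(measurableT_comp (f:=\1_(`]0%R,1%R[%classic : set T) : T -> R))=>//;exact:measurable_indic.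
have Z0 z : (0 <= Z z)%E.
 rewrite /Z !indicE;case:(boolP (z.1 \in B))=> zB;last by rewrite !mul0r mule0.
 by rewrite mule_ge0// lee_fin;[apply:E0;rewrite inE in zB].
have GE y : y \in (`]0%R,1%R[%classic : set T) -> (\int[mu]_x Z (x,y) = \int[mu]_(t in B `&` [set t|(y < f t)%R]) (E t)%:E)%E.
 move=> yI;rewrite [RHS]integral_mkcond;apply:eq_integral=> t _;rewrite patchE /Z /= [\1_(_ : set T) y]indicE yI mulr1.
 rewrite !indicE -natrM mulnb in_setI [(t,y) \in _](_ : _ = (t \in [set t|y < f t]));last by apply/idP/idP;rewrite !inE.
 by case:ifP;rewrite ?mule1 ?mule0.
have mI: measurable (`]0%R,1%R[%classic : set T) by exact:measurable_itv.
split.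
 apply:(eq_measurable_fun (fun y=> \int[mu]_x Z (x,y))%E);first by move=> y /GE.
 apply:(measurable_funS measurableT)=>//.
 have:=@measurable_fun_fubini_tonelli_G _ _ _ _ _ mu Z mZ Z0;apply.
have:=fubini_tonelli (m1:=mu) (m2:=mu) Z mZ Z0.
have ->: (\int[mu]_x \int[mu]_y Z (x,y) = \int[mu]_(t in B) (E t * f t)%:E)%E.
 rewrite [RHS]integral_mkcond;apply:eq_integral=> t _;rewrite patchE.
 case:ifPn=> tB;last first.
  rewrite (_ : (fun y=> _) = cst 0%E) ?integral0//.
  by apply/funext=> y;rewrite /Z /= [\1_B t]indicE (negbTE tB) !mul0r mule0.
 have tB': B t by rewrite inE in tB.
 have /andP[f0 f1]:=f01 _ tB'.
 have ->: (\int[mu]_y Z (t,y) = (E t)%:E * \int[mu]_y (\1_(`]0%R,f t[%classic : set T) y)%:E)%E.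
  rewrite -ge0_integralZl//;last 2 first.
  - by apply/measurable_EFinP;exact:measurable_indic.
  - by rewrite lee_fin E0.
  apply:eq_integral=> y _;rewrite /Z /= [\1_B t]indicE tB mul1r;congr (_ * _%:E)%E.
  rewrite !indicE -natrM mulnb;congr (nat_of_bool _)%:R.
  apply/idP/idP;rewrite !inE/= !in_itv/=.
   by move=>/andP[];rewrite !inE/= !in_itv/= =>/andP[-> _] ->.
  by move=>/andP[y0 yf];apply/andP;split;apply/mem_set;rewrite /= ?in_itv/= ?y0 ?yf ?(lt_le_trans yf f1).
 rewrite integral_indic// setIT EFinM;congr (_ * _)%E.
 apply:(etrans (lebesgue_measure_itv `]0%R,f t[));rewrite /= lte_fin;case:(ltP 0 (f t))=>[_|f0'];first by rewrite sube0.
 by congr EFin;apply/eqP;rewrite eq_le f0.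
move=> ->;rewrite [RHS]integral_mkcond;apply:eq_integral=> y _;rewrite patchE.
case:ifPn=> yI;first exact:GE.
rewrite (_ : (fun x=> _) = cst 0%E) ?integral0//.
by apply/funext=> t;rewrite /Z /= [\1_(_ : set T) y]indicE (negbTE yI) mulr0 mul0r mule0.
Qed.

End layer.

(** * Weighted length and area of radial intervals *)

Section float.
Context {R : realType}.
Notation T := (measurableTypeR R).
Notation mu := (@lebesgue_measure R).
Implicit Types (s t x y c d e a b u : R).
Variables (h h' w : R -> R).
Notation k := (circ h).
Hypothesis Hr : radial_profile h h' w.
Let dh : forall t, isd h t (h' t). Proof. by case:Hr. Qed.
Let h'm : {homo h' : s t / s <= t}. Proof. by case:Hr. Qed.
Let h'0 : forall t, 0 <= h' t. Proof. by case:Hr. Qed.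
Let dw : forall t, 0 <= t -> isd w t (k t). Proof. by case:Hr. Qed.
Let dk : forall t, isd k t (expR (h t) * (1 + t * h' t)). Proof. by move=> t;exact:(der_circ Hr). Qed.

(** This is the sign of the derivative of the ratio in [shift_ratio]. It comes from
    [(t * k)' = k * (2 + t * h')] with [t * h'] nondecreasing, and from the monotonicity of
    [k t / t = exp (h t)]. *)
Lemma circ_chord c e : 0 <= c -> c <= e ->
  (e - c) * (k e + k c) <= (w e - w c) * (2 + e * h' e + c * h' c).
Proof.
move=> c0 ce;have e0: 0 <= e by exact:le_trans ce.
have h1: e * k e - c * k c <= (w e - w c) * (2 + e * h' e).
 pose F t:=w t * (2 + e * h' e) - t * k t.
 suff : F c <= F e by rewrite /F;lra.
 have dF t : 0 <= t -> isd F t (k t * (e * h' e - t * h' t)).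
  move=> t0;apply:der_eq;first apply:derB.
  - by apply:derM;[exact:dw|exact:derC].
  - by apply:derM;[exact:derI|exact:dk].
  by rewrite /circ/=;ring.
 apply:(der_le (f':=fun t=> k t * (e * h' e - t * h' t))) ce _ _ _.
 - by apply:within_der=> t /andP[ct _];apply:dF;exact:le_trans ct.
 - by move=> t /andP[ct _];apply:dF;rewrite (le_trans c0)// ltW.
 - move=> t /andP[ct te];have t0: 0 <= t by rewrite (le_trans c0)// ltW.
  rewrite mulr_ge0 ?circ_ge0// subr_ge0;apply:ler_pM=>//;[exact:ltW|exact:h'm (ltW te)].
have h2: e * k c - c * k e <= 0.
 rewrite /circ (_ : _ - _ = e * c * (expR (h c) - expR (h e)));last by ring.
 by rewrite mulr_ge0_le0 ?mulr_ge0// subr_le0 ler_expR (h_le Hr).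
have h3: 0 <= (w e - w c) * (c * h' c) by rewrite mulr_ge0 ?mulr_ge0// subr_ge0 (w_le Hr).
by move: h1 h2 h3;lra.
Qed.

(* [Z] is the length along a ray; the ratio below decreases when the interval
   [c, e] moves outwards with a fixed length. *)
Lemma shift_ratio (Z : R -> R) c e c' e' : (forall t, 0 <= t -> isd Z t (expR (h t))) ->
  0 <= c -> c <= c' -> c < e -> Z e - Z c = Z e' - Z c' -> c' < e' -> e <= e' ->
  (w e' - w c') * (k e + k c) <= (w e - w c) * (k e' + k c').
Proof.
move=> dZ c0 cc' ce eZ ce' ee'.
have Zlt x y : 0 <= x -> x < y -> Z x < Z y.
 move=> x0 xy;apply:(der_lt (f':=fun t=> expR (h t))) xy _ _ _.
 - by apply:within_der=> t /andP[xt _];apply:dZ;exact:le_trans xt.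
 - by move=> t /andP[xt _];apply:dZ;rewrite (le_trans x0)// ltW.
 - by move=> t _;exact:expR_gt0.
have Zinj x y : 0 <= x -> 0 <= y -> Z x = Z y -> x = y.
 by move=> x0 y0 xy;have [/(Zlt _ _ x0)|/(Zlt _ _ y0)|//]:=ltgtP x y;rewrite xy ltxx.
have cZ a b : 0 <= a -> {within `[a,b],continuous Z}.
 by move=> a0;apply:(within_der (f':=fun t=> expR (h t)))=> t /andP[at_ _];apply:dZ;exact:le_trans at_.
pose l:=Z e - Z c.
pose g v:=xget 0 [set t|0 <= t /\ Z t = v].
have gK t : 0 <= t -> g (Z t) = t.
 move=> t0;rewrite /g;case:xgetP=>[y _ [y0 yt]|/(_ t)];last by case.
 exact:Zinj.
have [lt0 c'0] : 0 <= e' /\ 0 <= c' by split;lra.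
(* [E t] is the right end of the interval that starts at [t] and has length [l] in the metric
   [exp h]; as [t] goes from [c] to [c'], the interval moves from [c, e] to [c', e']. *)
pose E t:=g (Z t + l).
have EP t : c <= t <= c' -> [/\ t < E t,E t <= e' & Z (E t) = Z t + l].
 move=>/andP[ct tc'].
 have t0: 0 <= t by exact:le_trans ct.
 have lp : 0 < l by rewrite subr_gt0 Zlt.
 have Zmono x y : 0 <= x -> x <= y -> Z x <= Z y.
  by move=> x0;rewrite le_eqVlt=>/predU1P[->//|/(Zlt _ _ x0)/ltW].
 have te': t <= e' by rewrite (le_trans tc')// ltW.
 have [y /andP[ty ye] Zy] : exists2 y,t <= y <= e' & Z y = Z t + l.
  apply:ivt=>//;first exact:cZ.
  rewrite lerDl (ltW lp)/=;have:=Zmono _ _ t0 tc';rewrite /l eZ;lra.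
 have y0: 0 <= y by exact:le_trans ty.
 have ->: E t = y by rewrite /E -Zy gK.
 split=>//;rewrite lt_neqAle ty andbT;apply/eqP=> yt.
 by move: Zy;rewrite -yt=>/eqP;rewrite eq_sym -subr_eq0 addrC addKr gt_eqF.
have [e1 e2] : E c = e /\ E c' = e'.
 by split;[rewrite /E /l addrC subrK gK// (le_trans c0)// ltW|rewrite /E /l eZ addrC subrK gK].
pose W t:=w (E t) - w t;pose K t:=k (E t) + k t.
have dE t : c <= t <= c' -> isd E t (expR (h t) / expR (h (E t))).
 move=> tI;have [ct tc']:=andP tI;have [tE Ee' ZE]:=EP t tI.
 have t0: 0 <= t by exact:le_trans ct.
 have E0: 0 < E t by exact:le_lt_trans tE.
 have dg: isd g (Z (E t)) (expR (h (E t)))^-1.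
  apply:(@is_derive_inverse _ Z).
  - by near=> y;apply:gK;apply:ltW;near: y;exact:(@lt_nbhsr R).
  - near=> y;have y0: 0 <= y by apply:ltW;near: y;exact:(@lt_nbhsr R).
   exact:der_cts (dZ _ y0).
  - exact:dZ (ltW E0).
  - by rewrite gt_eqF// expR_gt0.
 rewrite ZE in dg;apply:der_eq.
  apply:(@der_comp _ g (fun t=> Z t + l));last exact:dg.
  by apply:derD (derC _ _);exact:dZ t0.
 by rewrite/=;field;rewrite gt_eqF// expR_gt0.
pose F t:=W t * (k e' + k c') - (w e' - w c') * K t.
suff : F c' <= F c by rewrite /F /W /K e1 e2;lra.
(* On [c, c'] the ratio W/K has a nonpositive derivative. *)
pose Q t:=W t / K t.
have K0 t : c <= t <= c' -> 0 < K t.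
 move=>/[dup] /EP[tE _ _] /andP[ct _];rewrite ltr_wpDr ?circ_ge0 ?(le_trans c0)// circ_gt0//.
 by rewrite (le_lt_trans _ tE)// (le_trans c0).
have dW t : c <= t <= c' -> isd W t (expR (h t) * (E t - t)).
 move=> tI;have [ct tc']:=andP tI;have [tE _ _]:=EP t tI.
 have t0: 0 <= t by exact:le_trans ct.
 apply:der_eq;first apply:derB.
 - by apply:der_comp;[exact:dE|apply:dw;rewrite ltW// (le_lt_trans t0)].
 - exact:dw.
 by rewrite /circ;field;rewrite gt_eqF// expR_gt0.
have dK t : c <= t <= c' -> isd K t (expR (h t) * (2 + E t * h' (E t) + t * h' t)).
 move=> tI;apply:der_eq;first apply:derD.
 - by apply:der_comp;[exact:dE|exact:dk].
 - exact:dk.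
 by rewrite/=;field;rewrite gt_eqF// expR_gt0.
have dQ t : c <= t <= c' -> isd Q t (expR (h t) * ((E t - t) * K t - W t * (2 + E t * h' (E t) + t * h' t)) / K t ^+ 2).
 move=> tI;have Kt: 0 < K t by exact:K0.
 apply:der_eq;first by apply:derM;[exact:dW|apply:derV;[rewrite gt_eqF|exact:dK]].
 by rewrite/=;field;rewrite gt_eqF.
have cQ:=within_der dQ.
have : Q c' <= Q c.
 apply:(der_ge (f':=fun t=> expR (h t) * ((E t - t) * K t - W t * (2 + E t * h' (E t) + t * h' t)) / K t ^+ 2)) cc' cQ _ _.
  by move=> t /andP[ct tc'];apply:dQ;rewrite !ltW.
 move=> t tI;have [ct tc']:=andP tI;have [tE _ _]:=EP t (introT andP (conj (ltW ct) (ltW tc'))).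
 rewrite mulr_le0_ge0 ?invr_ge0 ?sqr_ge0// mulr_ge0_le0 ?expR_ge0// subr_le0.
 by apply:circ_chord;[rewrite (le_trans c0)// ltW|exact:ltW].
rewrite /Q ler_pdivrMr ?K0 ?lexx ?cc'// mulrAC ler_pdivlMr ?K0 ?lexx ?cc'//.
by rewrite /F /W /K e1 e2;lra.
Unshelve. all: by end_near. Qed.

End float.

(** * Gain along a chord that starts at minus k *)

Section float.
Context {R : realType}.
Notation T := (measurableTypeR R).
Notation mu := (@lebesgue_measure R).
Implicit Types (s t x y c d e a b u : R).
Variables (h h' w : R -> R).
Notation k := (circ h).
Hypothesis Hr : radial_profile h h' w.
Let dh : forall t, isd h t (h' t). Proof. by case:Hr. Qed.
Let h'm : {homo h' : s t / s <= t}. Proof. by case:Hr. Qed.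
Let h'0 : forall t, 0 <= h' t. Proof. by case:Hr. Qed.
Let dw : forall t, 0 <= t -> isd w t (k t). Proof. by case:Hr. Qed.
Let dk : forall t, isd k t (expR (h t) * (1 + t * h' t)). Proof. by move=> t;exact:(der_circ Hr). Qed.

(** Layer cake in the height y of [sqrt (1 - (l / k)^2)], which exceeds y exactly where
    [|l| < s * k] with [s = sqrt (1 - y^2)]. So tangential integrals compare as soon as the [exp h]
    lengths of these sets do, level by level. *)
Lemma lateral_cmp (a1 b1 a2 b2 : R) (l1 l2 : R -> R) : 0 <= a1 -> 0 <= a2 ->
  (forall x, 0 < x -> {for x, continuous l1}) -> (forall x, 0 < x -> {for x, continuous l2}) ->
  (forall s, 0 < s < 1 ->
    (\int[mu]_(t in `]a1, b1] `&` [set t | (`|l1 t| < s * k t)%R]) (expR (h t))%:E <=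
     \int[mu]_(t in `]a2, b2] `&` [set t | (`|l2 t| < s * k t)%R]) (expR (h t))%:E)%E) ->
  \int[mu]_(t in `[a1, b1]) lateral h (l1 t) t <= \int[mu]_(t in `[a2, b2]) lateral h (l2 t) t.
Proof.
move=> a10 a20 c1 c2 lev.
have sq (y r : R) : 0 < y -> y < 1 -> (y < Num.sqrt (1 - r ^+ 2)) = (`|r| < Num.sqrt (1 - y ^+ 2)).
 move=> y0 y1;have y2: 0 < 1 - y ^+ 2 by rewrite subr_gt0 expr_lt1 ?(ltW y0).
 apply/idP/idP=> H.
  have S0: 0 < Num.sqrt (1 - r ^+ 2) by exact:lt_trans H.
  have r2: 0 < 1 - r ^+ 2 by rewrite -sqrtr_gt0.
  by rewrite -sqrtr_sqr ltr_sqrt//;have:=sqr_sqrtr (ltW r2);set S:=Num.sqrt _ in H *;nra.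
 have h2: r ^+ 2 < 1 - y ^+ 2.
  by rewrite -(sqr_sqrtr (ltW y2)) -[r ^+ 2]real_normK ?num_real// ltr_pXn2r ?nnegrE ?sqrtr_ge0.
 have y20: 0 < y ^+ 2 by rewrite exprn_gt0.
 by rewrite -{1}[y]ger0_norm ?(ltW y0)// -sqrtr_sqr ltr_sqrt;lra.
have key a b l : 0 <= a -> (forall x,0 < x -> {for x,continuous l}) ->
 mfun (`]0%R,1%R[%classic : set T) (fun y=> \int[mu]_(t in `]a,b] `&` [set t|(`|l t| < Num.sqrt (1 - y ^+ 2) * k t)%R]) (expR (h t))%:E)%E /\
 (\int[mu]_(t in `[a,b]) (lateral h (l t) t)%:E =
  \int[mu]_(y in `]0%R,1%R[) \int[mu]_(t in `]a,b] `&` [set t|(`|l t| < Num.sqrt (1 - y ^+ 2) * k t)%R]) (expR (h t))%:E)%E.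
 move=> a0 cl;pose f t : R:=Num.sqrt (1 - (l t / k t) ^+ 2).
 have f01 t : 0 <= (f \_ `]a,b]%classic) t <= 1.
  rewrite patchE;case:ifP=> _;last by rewrite lexx ler01.
  by rewrite sqrtr_ge0 /= -[leRHS]sqrtr1 ler_wsqrtr// gerDl oppr_le0 sqr_ge0.
 have mI: measurable (`]a,b]%classic : set T) by exact:measurable_itv.
 have mf: mfun (`]a,b]%classic : set T) f.
  apply:(measurable_funS (measurable_itv `[a,b])).
   by move=> x/=;rewrite !in_itv/= =>/andP[/ltW-> ->].
  apply:meas_itv_pos=>// x x0;rewrite /f.
  have ck:=der_cts (dk x).
  apply:continuous_comp;last exact:sqrt_continuous.
  apply:cvgB;first exact:cvg_cst.
  apply:(@continuous_comp _ _ _ (fun t=> l t / k t) (fun y=> y ^+ 2));last exact:exprn_continuous.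
  apply:cvgM;first exact:cl.
  by apply:cvgV;[rewrite gt_eqF// circ_gt0|exact:ck].
 have mE: mfun setT (fun t=> expR (h t)).
  by apply:cts_mfun=> x;exact:der_cts (der_expR (dh x)).
 have [mG lc]:=@layer_cake R (fun t=> expR (h t)) (f \_ `]a,b]%classic) _ mI mE ((measurable_restrictT _ mI).1 mf) (fun t _=> expR_ge0 _)
  (fun t _=> f01 t).
 have GE y : y \in (`]0%R,1%R[%classic : set T) -> (\int[mu]_(t in `]a,b] `&` [set t|(y < (f \_ `]a,b]%classic) t)%R]) (expR (h t))%:E =
   \int[mu]_(t in `]a,b] `&` [set t|(`|l t| < Num.sqrt (1 - y ^+ 2) * k t)%R]) (expR (h t))%:E)%E.
  rewrite inE/= in_itv/= =>/andP[y0 y1];congr (integral _ _ _).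
  have e1 t : `]a,b]%classic t -> (y < f t) = (`|l t| < Num.sqrt (1 - y ^+ 2) * k t).
   move=>/=;rewrite in_itv/= =>/andP[at_ _];have k0:=circ_gt0 h (le_lt_trans a0 at_).
   by rewrite /f sq// normrM normfV [`|k t|]gtr0_norm// ltr_pdivrMr.
  by apply/seteqP;split=> t [tI /=];rewrite patchE mem_set// e1.
 split;first by apply:eq_measurable_fun mG=> y /GE.
 transitivity (\int[mu]_(t in (`]a,b]%classic : set T)) (expR (h t) * (f \_ `]a,b]%classic) t)%:E)%E.
  rewrite -integral_itv_obnd_cbnd;last first.
   apply/measurable_EFinP;apply:(measurable_funS (measurable_itv `[a,b]))=>//.
    by move=> x/=;rewrite !in_itv/= =>/andP[/ltW-> ->].
   by apply:meas_itv_pos=>// x x0;apply:(cts_lateral Hr)=>//;exact:cl.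
  by apply:eq_integral=> t tI;rewrite patchE tI.
 by rewrite lc;apply:eq_integral=> y /GE.
have fi a b l : 0 <= a -> (forall x,0 < x -> {for x,continuous l}) ->
 (\int[mu]_(t in `[a,b]) (lateral h (l t) t)%:E)%E \is a fin_num.
 by move=> a0 cl;apply:integrable_fin_num=>//;exact:(lateral_int Hr).
have [m1 k1]:=key a1 b1 l1 a10 c1;have [m2 k2]:=key a2 b2 l2 a20 c2.
rewrite /Rintegral fine_le ?fi// k1 k2;apply:ge0_le_integral=>//.
- by move=> y _;apply:integral_ge0=> t _;rewrite lee_fin expR_ge0.
move=> y;rewrite /= in_itv/= =>/andP[y0 y1];apply:lev.
by rewrite sqrtr_gt0 subr_gt0 expr_lt1 ?(ltW y0)// y1 /= -[ltRHS]sqrtr1 ltr_sqrt ?ltr01// gtrDl oppr_lt0 exprn_gt0.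
Qed.

Lemma first_hit (m : R -> R) a b : a < b -> (forall x, a <= x <= b -> {for x, continuous m}) ->
  m a < 0 -> 0 <= m b -> exists e, [/\ a < e <= b, m e = 0 & forall t, a <= t < e -> m t < 0].
Proof.
move=> ab cm ma mb;pose S:=[set t|a <= t <= b /\ 0 <= m t].
have Sb: S b by split=>//;rewrite lexx ltW.
have lS: lbound S a by move=> t [/andP[]].
have hS: has_inf S by split;[exists b|exists a].
have cI: a <= inf S by apply:lb_le_inf;[exists b|exact:lS].
have Ib: inf S <= b by apply:ge_inf=>//;exact:hS.2.
have low t : a <= t < inf S -> m t < 0.
 move=>/andP[ct ti];rewrite ltNge;apply/negP=> h1.
 have : inf S <= t by apply:ge_inf;[exact:hS.2|split=>//;rewrite ct (le_trans (ltW ti))].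
 by rewrite leNgt ti.
have dm: {for inf S,continuous m} by apply:cm;rewrite cI.
have mi: m (inf S) = 0.
 apply/eqP;rewrite eq_le;apply/andP;split;rewrite leNgt;apply/negP=> h1.
  have cbi: a < inf S by rewrite lt_neqAle cI andbT;apply/eqP=> e;move: h1;rewrite -e;lra.
  have /nbhs_ballP[d /= d0 bd] : \forall t \near inf S,0 < m t by exact:(dm _ (lt_nbhsr h1)).
  pose t:=inf S - Num.min d (inf S - a) / 2.
  have md: Num.min d (inf S - a) <= d by rewrite ge_min lexx.
  have mc: Num.min d (inf S - a) <= inf S - a by rewrite ge_min lexx orbT.
  have m0: 0 < Num.min d (inf S - a) by rewrite lt_min d0 subr_gt0.
  have mt: 0 < m t by apply:bd;rewrite /ball/= ltr_norml /t;apply/andP;split;lra.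
  have : m t < 0 by apply:low;rewrite /t;apply/andP;split;lra.
  by lra.
 have /nbhs_ballP[d /= d0 bd] : \forall t \near inf S,m t < 0 by exact:(dm _ (lt_nbhsl h1)).
 have [t St td] : exists2 t,S t & t < inf S + d by apply:inf_adherent.
 have it: inf S <= t by apply:ge_inf=>//;exact:hS.2.
 have : m t < 0 by apply:bd;rewrite /ball/= ltr_norml;apply/andP;split;lra.
 by case:St=> _;lra.
exists (inf S);split=>//.
by rewrite Ib andbT lt_neqAle cI andbT;apply/eqP=> e;move: mi;rewrite -e;lra.
Qed.

(** [chord_gain] wants a chord at least [k] at both ends, while this one starts at [- k t1]. A
    parallel chord [L] above it, through a point (v, k v), is admissible. [shift_ratio] then shows
    that [L] has the smaller tangential integral, although its interval may begin further left. *)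
Lemma float_gain (lam l0 t1 t3 u y : R) : 0 < t1 -> t1 < t3 -> 0 < lam ->
  lam * w t1 + l0 = - k t1 -> lam * w t3 + l0 = k t3 ->
  (forall t, t1 <= t <= t3 -> lam * w t + l0 <= k t) -> 0 <= u -> u <= y -> y <= t3 ->
  pi * (k y - k u - lam * (w y - w u)) <= \int[mu]_(t in `[t1, t3]) lateral h (lam * w t + l0) t.
Proof.
move=> t10 t13 lam0 e1 e3 lk u0 uy yt3.
have t30: 0 < t3 by exact:lt_trans t13.
have y0: 0 <= y by exact:le_trans uy.
pose D t:=k t - lam * w t;pose l t:=lam * w t + l0.
have cl x : 0 < x -> {for x,continuous l}.
 by move=> x0;apply:(@der_cts _ l x (lam * k x));apply:der_eq;[by apply:derD;[apply:derM;[exact:derC|exact:dw (ltW x0)]|exact:derC]|rewrite mul0r add0r addr0].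
have dD t : 0 <= t -> isd D t (expR (h t) * (1 + t * h' t) - lam * k t).
 move=> t0;apply:der_eq;first by apply:derB;[exact:dk|apply:derM;[exact:derC|exact:dw]].
 by rewrite /= mul0r add0r.
have cD a b : 0 <= a -> {within `[a,b],continuous D}.
 by move=> a0;apply:(within_der (f':=fun t=> expR (h t) * (1 + t * h' t) - lam * k t))=> t /andP[at_ _];apply:dD;exact:le_trans at_.
have Dl t : 0 <= t -> t <= t3 -> l0 <= D t.
 move=> t0 tt3;have [h1|h1]:=leP t1 t;first by have:=lk t;rewrite h1 tt3=>/(_ isT);rewrite /D;lra.
 have:=circ_ge0 h t0;have:=circ_ge0 h (ltW t10).
 have : lam * w t <= lam * w t1 by rewrite ler_pM2l// (w_le Hr)// ltW.
 by rewrite /D;lra.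
have D3: D t3 = l0 by rewrite /D -e3;ring.
have ge0: 0 <= \int[mu]_(t in `[t1,t3]) lateral h (l t) t by apply:Rintegral_ge0=> t _;exact:lateral_ge0.
(* [D] is the height of [k] over chords of slope [lam]. Replacing [y] by a maximum of [D] and [u] by
   a minimum before it only strengthens the claim, and at an interior maximum [lam] has the value
   that [chord_gain] requires. *)
have [ys]:=EVT_max (le_trans uy yt3) (cD u t3 u0);rewrite in_itv/= =>/andP[uys yst3] ysm.
have Dy: D y <= D ys by apply:ysm;rewrite in_itv/= uy.
have ys0: 0 <= ys by exact:le_trans uys.
have [v]:=EVT_min ys0 (cD 0 ys (lexx 0));rewrite in_itv/= =>/andP[v0 vys] vm.
have Du: D v <= D u by apply:vm;rewrite in_itv/= u0.
have goalE: k y - k u - lam * (w y - w u) = D y - D u by rewrite /D;ring.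
have pi0: 0 < pi :> R by exact:pi_gt0.
rewrite goalE;have [DD|DD]:=leP (D ys) (D v).
 by apply:le_trans ge0;rewrite mulr_ge0_le0 ?(ltW pi0)//;lra.
have vys': v < ys by rewrite lt_neqAle vys andbT;apply/eqP=> e;rewrite e ltxx in DD.
have ys3: ys < t3 by rewrite lt_neqAle yst3 andbT;apply/eqP=> e;have:=Dl v v0 (le_trans vys yst3);move: DD;rewrite e D3;lra.
have [uys'|]:=ltP u ys;last first.
 move=> h1;have e: u = ys by apply/eqP;rewrite eq_le uys h1.
 by apply:le_trans ge0;rewrite mulr_ge0_le0 ?(ltW pi0)//;rewrite e;lra.
have ysp: 0 < ys by exact:le_lt_trans uys'.
have lamE: lam = ys^-1 + h' ys.
 have d0: is_derive ys 1 D 0.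
  apply:(@derive1_at_max _ D u t3);[lra|by move=> x;rewrite in_itv/= =>/andP[ux _];have []:=dD x (ltW (le_lt_trans u0 ux))|by rewrite in_itv/= uys'|].
  by move=> x;rewrite in_itv/= =>/andP[/ltW ux /ltW xt];apply:ysm;rewrite in_itv/= ux.
 have [_ z1]:=d0;have [_ z2]:=dD ys ys0.
 have : expR (h ys) * (1 + ys * h' ys) = lam * (ys * expR (h ys)) by apply/eqP;rewrite -subr_eq0 -[X in X == 0]z2 z1.
 rewrite mulrC mulrA=>/mulIf;rewrite gt_eqF ?expR_gt0// =>/(_ isT) e.
 have ysn: ys != 0 by rewrite gt_eqF.
 by rewrite -[LHS](mulfK ysn) -e;field.
pose L t:=lam * w t + D v.
have cg:=chord_gain Hr v0 vys' ys3 lamE (_ : k v <= L v) (_ : k t3 <= L t3).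
apply:(@le_trans _ _ (\int[mu]_(t in `[v,t3]) lateral h (L t) t)).
 apply:(le_trans _ (cg _ _));rewrite /L /D ?ler_pM2l//.
 - by move: Dy Du;rewrite /D;lra.
 - lra.
 - by have:=Dl v v0 (le_trans vys yst3);rewrite /D;lra.
have [Z dZ]:=@exists_primitive R (fun t=> expR (h t)) (-1) (fun x=> der_cts (der_expR (dh x))).
have dZ0 t : 0 <= t -> isd Z t (expR (h t)) by move=> t0;apply:dZ;lra.
have Zlt a b : 0 <= a -> a < b -> Z a < Z b.
 move=> a0 ab;apply:(der_lt (f':=fun t=> expR (h t))) ab _ _ _.
 - by apply:within_der=> t /andP[at_ _];apply:dZ0;exact:le_trans at_.
 - by move=> t /andP[at_ _];apply:dZ0;rewrite (le_trans a0)// ltW.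
 - by move=> t _;exact:expR_gt0.
have cZ a b : 0 <= a -> {within `[a,b],continuous Z}.
 by move=> a0;apply:(within_der (f':=fun t=> expR (h t)))=> t /andP[at_ _];apply:dZ0;exact:le_trans at_.
have mE (B : set T) : mfun B (fun t=>(expR (h t))%:E).
 by apply/measurable_EFinP;apply:(measurable_funS measurableT)=>//;apply:cts_mfun=> x;exact:der_cts (der_expR (dh x)).
have E0 t : (0 <= (expR (h t))%:E)%E by rewrite lee_fin expR_ge0.
have ZI a b : 0 <= a -> a <= b -> (\int[mu]_(t in `]a,b[) (expR (h t))%:E = (Z b - Z a)%:E)%E.
 move=> a0 ab;rewrite -(@integral_itv_bndoo R a b _ true false);last exact:mE.
 have e: (forall x,a <= x <= b -> isd Z x (expR (h x))) -> (\int[mu]_(x in `[a,b]) (expR (h x))%:E = (Z b - Z a)%:E)%E.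
  by move=> H;exact (@ftc R Z (fun t=> expR (h t)) a b ab H (@wc_exph R h h' w Hr _)).
 apply:e.
 by move=> t /andP[at_ _];apply:dZ0;exact:le_trans at_.
have cL x : 0 < x -> {for x,continuous L}.
 by move=> x0;apply:(@der_cts _ L x (lam * k x));apply:der_eq;[by apply:derD;[apply:derM;[exact:derC|exact:dw (ltW x0)]|exact:derC]|rewrite mul0r add0r addr0].
have mlev a (g : R -> R) s : 0 <= a -> (forall x,0 < x -> {for x,continuous g}) -> measurable (`]a,t3] `&` [set t|(`|g t| < s * k t)%R] : set T).
 move=> a0 cg';have mb: mfun (`]a,t3]%classic : set T) (fun t=> `|g t| < s * k t).
  apply:(measurable_funS (measurable_itv `[a,t3]));first by move=> x/=;rewrite !in_itv/= =>/andP[/ltW-> ->].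
  apply:measurable_fun_ltr;apply:meas_itv_pos=>// x x0.
   by apply:(@continuous_comp _ _ _ g Num.norm);[exact:cg'|exact:norm_continuous].
  by apply:cvgM;[exact:cvg_cst|exact:der_cts (dk x)].
 by have:=mb (measurable_itv `]a,t3]) [set true] Logic.I;congr measurable.
apply:lateral_cmp=>//;[exact:ltW|].
move=> s /andP[s0 s1].
have Ll t : l t <= L t by rewrite lerD2l;apply:Dl=>//;exact:le_trans yst3.
have Lm a b : 0 <= a -> a <= b -> L a <= L b by move=> a0 ab;rewrite lerD2r ler_pM2l// (w_le Hr).
have Lv: L v = k v by rewrite /L /D;ring.
have mm a b : 0 <= a -> a < b -> l a + s * k a < l b + s * k b.
 move=> a0 ab;apply:ltrD;last by rewrite ltr_pM2l// (circ_lt Hr).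
 by rewrite ltrD2r ltr_pM2l// (w_lt Hr).
have cwl a b : 0 <= a -> {within `[a,b],continuous l}.
 by move=> a0;apply:wcD;[apply:wcM;[exact:wcC|exact:(wc_w Hr)]|exact:wcC].
have k1:=circ_gt0 h t10;have k3:=circ_gt0 h t30.
(* At [cb] the lower chord enters level [s], from [l = - s * k]. If [cb <= v], plain inclusion of
   the level sets suffices. *)
have [cb /andP[tcb cbt] cbE] : exists2 cb,t1 <= cb <= t3 & l cb + s * k cb = 0.
 apply:ivt;[exact:ltW|by apply:wcD;[exact:cwl (ltW t10)|apply:wcM;[exact:wcC|exact:(wc_circ Hr)]]|].
 rewrite /l e1 e3;apply/andP;split;nra.
have cb0: 0 < cb by exact:lt_le_trans tcb.
have [cbv|vcb]:=leP cb v.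
 apply:ge0_subset_integral=>//;[exact:mlev|exact:mlev (ltW t10) _|].
 move=> t [/=];rewrite !in_itv/= =>/andP[vt tt3];rewrite ltr_norml=>/andP[_ h2];split.
  by rewrite /= ?in_itv/= tt3 andbT (le_lt_trans tcb)// (le_lt_trans cbv).
 rewrite /= ltr_norml (le_lt_trans (Ll t) h2) andbT.
 have:=mm cb t (ltW cb0) (le_lt_trans cbv vt);rewrite cbE /l;lra.
have [eb [/andP[ceb ebt] ebE ebm]] : exists e,[/\ cb < e <= t3,l e - s * k e = 0 & forall t,cb <= t < e -> l t - s * k t < 0].
 apply:first_hit=>//.
 - rewrite lt_neqAle cbt andbT;apply/eqP=> e;move: cbE;rewrite e /l e3.
  have : 0 < s * k t3 by rewrite mulr_gt0.
  by lra.
 - move=> x /andP[x1 _];have x0: 0 <= x by exact:le_trans (ltW cb0) x1.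
  apply:(@der_cts _ _ x (lam * k x - s * (expR (h x) * (1 + x * h' x))));apply:der_eq.
   by apply:derB;[apply:derD;[apply:derM;[exact:derC|exact:dw]|exact:derC]|apply:derM;[exact:derC|exact:dk]].
  by rewrite/=;ring.
 - have : 0 < s * k cb by rewrite mulr_gt0// circ_gt0.
  by move: cbE;lra.
 - by rewrite /l e3;nra.
have kcb:=circ_gt0 h cb0;have eb0: 0 < eb by exact:lt_trans ceb.
have keb:=circ_gt0 h eb0.
pose x:=Z eb - Z cb;have x0: 0 < x by rewrite subr_gt0 Zlt// ltW.
(* (v, e') has the same [exp h] length as (cb, eb), on which [|l| < s * k] throughout. It remains to
   see that [L] is above the level between [e'] and [eb]. *)
have [e' /andP[ve' e'b] Ze'] : exists2 e',v <= e' <= eb & Z e' = Z v + x.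
 apply:ivt;[by rewrite ltW// (lt_trans vcb)|exact:cZ|].
 by have:=Zlt v cb v0 vcb;rewrite /x;move: x0;rewrite /x=> x0 h1;apply/andP;split;lra.
(* The interval [cb, eb] is moved back, at constant length, until it ends at [t]. The ratio of its
   area to the sum of [k] at its ends can only grow, and on [cb, eb] this ratio is [s / lam]. *)
have outL t : e' <= t -> t <= eb -> s * k t <= L t.
 move=> e't teb;have t0: 0 <= t by rewrite (le_trans _ e't)// (le_trans v0).
 have Zt1: Z e' <= Z t by move: e't;rewrite le_eqVlt=>/predU1P[->//|];move/(Zlt _ _ (le_trans v0 ve'))/ltW.
 have Zt2: Z t <= Z eb by move: teb;rewrite le_eqVlt=>/predU1P[->//|];move/(Zlt _ _ t0)/ltW.
 have [c /andP[vc ccb] Zc] : exists2 c,v <= c <= cb & Z c = Z t - x.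
  apply:ivt;[exact:ltW|exact:cZ|by apply/andP;split;move: Zt1 Zt2;rewrite Ze' /x;lra].
 have c0: 0 <= c by exact:le_trans vc.
 have ct: c < t.
  rewrite ltNge;apply/negP=> tc;have : Z t <= Z c by move: tc;rewrite le_eqVlt=>/predU1P[->//|];move/(Zlt _ _ t0)/ltW.
  by rewrite Zc;lra.
 have e5: Z t - Z c = Z eb - Z cb by rewrite Zc /x;ring.
 have sr:=shift_ratio Hr dZ0 c0 ccb ct e5 ceb teb.
 have h1: lam * (w eb - w cb) = s * (k eb + k cb) by move: ebE cbE;rewrite /l;lra.
 have h2: s * (k t + k c) <= lam * (w t - w c).
  rewrite -(ler_pM2r (addr_gt0 keb kcb)).
  have:=ler_wpM2l (ltW lam0) sr;rewrite !mulrA h1;lra.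
 have Lc: 0 <= L c by rewrite (le_trans _ (Lm _ _ v0 vc))// Lv circ_ge0.
 have skc: 0 <= s * k c by rewrite mulr_ge0 ?(ltW s0)// circ_ge0.
 by move: h2 Lc;rewrite /L;lra.
pose X:=`]eb,t3] `&` [set t|(`|L t| < s * k t)%R].
have mX: measurable (X : set T) by exact:mlev (ltW eb0) _.
have mIo a b : measurable (`]a,b[%classic : set T) by exact:measurable_itv.
apply:(@le_trans _ _ (\int[mu]_(t in `]v,e'[ `|` X) (expR (h t))%:E)%E).
 apply:ge0_subset_integral=>//;[exact:mlev|exact:measurableU|].
 move=> t [/=];rewrite !in_itv/= =>/andP[vt tt3] tL.
 have [ebt'|tneb]:=ltP eb t;first by right;split;rewrite /= ?in_itv/= ?ebt' ?tt3.
 left;rewrite /= ?in_itv/= vt /= ltNge;apply/negP=> e't;have:=outL t e't tneb.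
 by move: tL;rewrite ltr_norml=>/andP[_ tL];rewrite leNgt tL.
apply:(@le_trans _ _ (\int[mu]_(t in `]cb,eb[ `|` X) (expR (h t))%:E)%E).
 rewrite (ge0_integral_setU mu (mIo v e') mX (mE _));[|by move=> t _;exact:E0|];last first.
  by apply/disj_setPS=> t [/=];rewrite in_itv/= =>/andP[_ h1] [/=];rewrite in_itv/= =>/andP[h2 _] _;have:=lt_trans (lt_le_trans h1 e'b) h2;rewrite ltxx.
 rewrite (ge0_integral_setU mu (mIo cb eb) mX (mE _));[|by move=> t _;exact:E0|];last first.
  by apply/disj_setPS=> t [/=];rewrite in_itv/= =>/andP[_ h1] [/=];rewrite in_itv/= =>/andP[h2 _] _;have:=lt_trans h1 h2;rewrite ltxx.
 rewrite leeD2r// !ZI ?(ltW cb0) ?(ltW ceb)// lee_fin Ze' /x;lra.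
apply:ge0_subset_integral=>//;[exact:measurableU|exact:mlev (ltW t10) _|].
move=> t [/=|[/=]];rewrite !in_itv/= =>/andP[h1 h2];last first.
 move=> h3;split;first by rewrite /= ?in_itv/= h2 andbT (le_lt_trans tcb)// (lt_trans ceb).
 rewrite /= ltr_norml;move: h3;rewrite ltr_norml=>/andP[_ h3];rewrite (le_lt_trans (Ll t) h3) andbT.
 by have:=mm cb t (ltW cb0) (lt_trans ceb h1);rewrite cbE /l;lra.
split;first by rewrite /= ?in_itv/= (le_lt_trans tcb h1) (le_trans (ltW h2) ebt).
rewrite /= ltr_norml;apply/andP;split.
 by have:=mm cb t (ltW cb0) h1;rewrite cbE /l;lra.
by rewrite -subr_lt0;apply:ebm;rewrite (ltW h1).
Unshelve. all: by end_near. Qed.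

End float.

(** * Supporting chords of k *)

Section chords.
Context {R : realType}.
Notation mu := (@lebesgue_measure R).
Implicit Types (s t x y c d e a b u : R).
Variables (h h' w : R -> R).
Notation k := (circ h).
Hypothesis Hr : radial_profile h h' w.
Let h'm : {homo h' : s t / s <= t}. Proof. by case:Hr. Qed.
Let h'0 : forall t, 0 <= h' t. Proof. by case:Hr. Qed.
Let dw : forall t, 0 <= t -> isd w t (k t). Proof. by case:Hr. Qed.
Let dk : forall t, isd k t (expR (h t) * (1 + t * h' t)). Proof. by move=> t;exact:(der_circ Hr). Qed.

Lemma cts_chord lam c x : 0 <= x -> {for x, continuous (fun t => lam * w t + c)}.
Proof.
move=> x0;apply:(@der_cts _ (fun t=> lam * w t + c) x (lam * k x));apply:der_eq.
 by apply:derD;[apply:derM;[exact:derC|exact:dw]|exact:derC].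
by rewrite /= mul0r add0r addr0.
Qed.

Lemma wc_chord lam c a b : 0 <= a -> {within `[a, b], continuous (fun t => lam * w t + c)}.
Proof. by move=> a0;apply:wcD;[apply:wcM;[exact:wcC|exact:(wc_w Hr)]|exact:wcC]. Qed.

Let dD lam t : 0 <= t -> isd (fun t => k t - lam * w t) t (expR (h t) * (1 + t * h' t) - lam * k t).
Proof.
move=> t0;apply:der_eq;first by apply:derB;[exact:dk|apply:derM;[exact:derC|exact:dw]].
by rewrite /= mul0r add0r.
Qed.

Let cD lam a b : 0 <= a -> {within `[a, b], continuous (fun t => k t - lam * w t)}.
Proof.
move=> a0;apply:(within_der (f':=fun t=> expR (h t) * (1 + t * h' t) - lam * k t))=> t /andP[at_ _].
by apply:dD;exact:le_trans at_.
Qed.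

Lemma critical_slope (lam p : R) : 0 < p -> isd (fun t : R => k t - lam * w t) p 0 -> lam = p^-1 + h' p.
Proof.
move=> p0 d0;have [_ z1]:=d0;have [_ z2]:=@dD lam _ (ltW p0).
have : expR (h p) * (1 + p * h' p) = lam * (p * expR (h p)) by apply/eqP;rewrite -subr_eq0 -[X in X == 0]z2 z1.
rewrite mulrC mulrA=>/mulIf;rewrite gt_eqF ?expR_gt0// =>/(_ isT) e.
have pn: p != 0 by rewrite gt_eqF.
by rewrite -[LHS](mulfK pn) -e;field.
Qed.

(** The centre for [chord_gain] is a maximum of [k - lam * w] on [a, b]; if that maximum is at most
    [c], the left side is nonpositive. *)
Lemma touch_gain lam c a b y : 0 < a -> a <= y -> y <= b -> lam * w a + c = k a -> lam * w b + c = k b ->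
  pi * (k y - (lam * w y + c)) <= \int[mu]_(t in `[a, b]) lateral h (lam * w t + c) t.
Proof.
move=> a0 ay yb ea eb;have ab:=le_trans ay yb;have pi0: 0 < pi :> R by exact:pi_gt0.
have ge0: 0 <= \int[mu]_(t in `[a,b]) lateral h (lam * w t + c) t by apply:Rintegral_ge0=> t _;exact:lateral_ge0.
pose D t:=k t - lam * w t.
have [p]:=EVT_max ab (@cD lam a b (ltW a0));rewrite in_itv/= =>/andP[ap pb] pm.
have Dy: D y <= D p by apply:pm;rewrite in_itv/= ay.
have ->: k y - (lam * w y + c) = D y - c by rewrite /D;ring.
have [pc|pc]:=leP (D p) c.
 by apply:le_trans ge0;rewrite mulr_ge0_le0 ?(ltW pi0)//;lra.
have ap': a < p by rewrite lt_neqAle ap andbT;apply/eqP=> e;move: pc;rewrite -e /D;lra.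
have pb': p < b by rewrite lt_neqAle pb andbT;apply/eqP=> e;move: pc;rewrite e /D;lra.
have lamE: lam = p^-1 + h' p.
 apply:critical_slope;first exact:lt_trans ap'.
 apply:(@derive1_at_max _ _ a b)=>//;[|by rewrite in_itv/= ap'|].
  by move=> x;rewrite in_itv/= =>/andP[ax _];have []:=@dD lam _ (ltW (lt_trans a0 ax)).
 by move=> x;rewrite in_itv/= =>/andP[/ltW ax /ltW xb];apply:pm;rewrite in_itv/= ax.
apply:(le_trans _ (chord_gain Hr (ltW a0) ap' pb' lamE (eq_ind_r (fun z=> z <= _) (lexx _) (esym ea)) (eq_ind_r (fun z=> z <= _) (lexx _) (esym eb)))).
by rewrite ler_pM2l//;move: Dy;rewrite /D;lra.
Qed.

Lemma lipschitz_cts (f : R -> R) W x : (forall y, `|f y - f x| <= W * `|y - x|) -> {for x, continuous f}.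
Proof.
move=> fW;apply/cvgrPdist_lt=> e e0;have W1: 0 < `|W| + 1 by rewrite ltr_wpDl.
apply/nbhs_ballP;exists (e / (`|W| + 1));first by apply:divr_gt0.
move=> y /= yd;have {}yd : `|x - y| < e / (`|W| + 1) by [].
rewrite distrC (le_lt_trans (fW y))// (@le_lt_trans _ _ ((`|W| + 1) * `|y - x|))//.
 by rewrite ler_wpM2r// (le_trans (ler_norm W))// lerDl.
by rewrite mulrC -ltr_pdivlMr// distrC.
Qed.

(** A supporting line from below over [y], for [k] seen as a function of the weighted area. The
    slope is found by continuity: [m lam] compares the minima of [k - lam * w] on the two sides of
    [y]; it is nonpositive for [lam = 0] and nonnegative for [lam = Lm]. *)
Lemma chord_exists a b y : 0 < a -> a <= y -> y <= b -> exists lam c t4 t5,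
  [/\ 0 <= lam, a <= t4 <= y, y <= t5 <= b, lam * w t4 + c = k t4 /\ lam * w t5 + c = k t5 &
   forall t, a <= t <= b -> lam * w t + c <= k t].
Proof.
move=> a0 ay;rewrite le_eqVlt=>/predU1P[<-|yb].
 (* When [y] is the right end, a slope steep enough to make [k - lam * w] nonincreasing on [a, y]
    gives a line touching at [y]; both contacts are then [y]. *)
 pose lam:=a^-1 + h' y;have lam0: 0 <= lam by rewrite addr_ge0// invr_ge0 ltW.
 exists lam,(k y - lam * w y),y,y;split=>//;[by rewrite ay lexx|by rewrite lexx|by split;ring|].
 move=> t /andP[at_ ty];suff : k y - lam * w y <= k t - lam * w t by lra.
 have t0: 0 < t by exact:lt_le_trans at_.
 apply:(der_ge (f:=fun t=> k t - lam * w t) (f':=fun t=> expR (h t) * (1 + t * h' t) - lam * k t)) ty (@cD lam t y (ltW t0)) _ _.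
  by move=> x /andP[tx _];apply:dD;rewrite ltW// (lt_trans t0).
 move=> x /andP[tx xy];have x0: 0 < x by exact:lt_trans tx.
 have ->: expR (h x) * (1 + x * h' x) - lam * k x = expR (h x) * (1 + x * h' x - lam * x) by rewrite /circ;ring.
 rewrite mulr_ge0_le0 ?expR_ge0// /lam.
 have h1:=h'm (ltW xy);have h2: 1 <= a^-1 * x by rewrite ler_pdivlMl// mulr1;lra.
 have : x * h' x <= x * h' y by rewrite ler_wpM2l// ltW.
 by lra.
pose D lam t:=k t - lam * (w t - w a).
have cDa lam c d : 0 <= c -> {within `[c,d],continuous (D lam)}.
 move=> c0;rewrite (_ : D lam = fun t=>(k t - lam * w t) + lam * w a);last by apply/funext=> t;rewrite /D;ring.
 by apply:wcD;[exact:cD|exact:wcC].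
have y0: 0 < y by exact:lt_le_trans ay.
have E1 lam : exists t,a <= t <= y /\ forall s,a <= s <= y -> D lam t <= D lam s.
 by have [t tI tm]:=EVT_min ay (cDa lam a y (ltW a0));exists t;split;[rewrite in_itv in tI|move=> s sI;apply:tm;rewrite in_itv].
have E2 lam : exists t,y <= t <= b /\ forall s,y <= s <= b -> D lam t <= D lam s.
 by have [t tI tm]:=EVT_min (ltW yb) (cDa lam y b (ltW y0));exists t;split;[rewrite in_itv in tI|move=> s sI;apply:tm;rewrite in_itv].
have [p1 P1]:=choice E1;have [p2 P2]:=choice E2.
pose W:=w b - w a.
have wW t : a <= t <= b -> 0 <= w t - w a <= W.
 by move=>/andP[at_ tb];rewrite subr_ge0 lerD2r !(w_le Hr)// ?ltW// (lt_le_trans a0 at_).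
have lip (q : R -> R) l l' t t' : a <= t <= b -> a <= t' <= b -> D l t <= D l t' -> D l' t' <= D l' t -> `|D l' t' - D l t| <= W * `|l' - l|.
 move=> tI t'I h1 h2;have:=wW _ tI;have:=wW _ t'I;move: h1 h2;rewrite /D=> h1 h2 /andP[a1 a2] /andP[b1 b2].
 have n1:=ler_norm (l' - l);have n2:=ler_norm (- (l' - l));rewrite normrN in n2.
 have n0: 0 <= `|l' - l| by [].
 rewrite ler_norml;apply/andP;split;nra.
pose m lam:=D lam (p1 lam) - D lam (p2 lam).
have cm: continuous m.
 move=> l;apply:(@lipschitz_cts _ (2 * W))=> l';rewrite /m.
 have in1 z : a <= p1 z <= b by have [/andP[-> /=] h1 _]:=P1 z;rewrite (le_trans h1)// ltW.
 have in2 z : a <= p2 z <= b by have [/andP[h1 ->] _]:=P2 z;rewrite (le_trans ay).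
 have h1:=lip id l l' _ _ (in1 l) (in1 l') ((P1 l).2 _ (P1 l').1) ((P1 l').2 _ (P1 l).1).
 have h2:=lip id l l' _ _ (in2 l) (in2 l') ((P2 l).2 _ (P2 l').1) ((P2 l').2 _ (P2 l).1).
 have ->: D l' (p1 l') - D l' (p2 l') - (D l (p1 l) - D l (p2 l)) = (D l' (p1 l') - D l (p1 l)) - (D l' (p2 l') - D l (p2 l)) by ring.
 by apply:le_trans (ler_normB _ _) _;lra.
pose Lm:=k b / (w b - w y).
have wby: 0 < w b - w y by rewrite subr_gt0 (w_lt Hr)// ltW.
have L0: 0 <= Lm by rewrite divr_ge0 ?(ltW wby)// circ_ge0// ltW// (lt_trans y0).
have [lam /andP[lam0 _] lamE] : exists2 lam,0 <= lam <= Lm & m lam = 0.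
 apply:ivt=>//;first exact:wc_cts.
 apply/andP;split.
  rewrite /m subr_le0;have h1:=(P1 0).2 a;rewrite lexx ay in h1.
  apply:le_trans (h1 isT) _;rewrite /D !mul0r !subr0;have /andP[h2 _]:=(P2 0).1.
  by apply:circ_le;[exact:Hr|exact:ltW|exact:le_trans h2].
 rewrite /m subr_ge0;have h2:=(P2 Lm).2 b;rewrite lexx (ltW yb) in h2.
 apply:le_trans (h2 isT) _;have /andP[h3 h4]:=(P1 Lm).1.
 have k0: 0 <= k (p1 Lm) by rewrite circ_ge0// (le_trans (ltW a0)).
 have : w (p1 Lm) <= w y by rewrite (w_le Hr)// (le_trans (ltW a0)).
 have e: Lm * (w b - w y) = k b by rewrite /Lm divfK// gt_eqF.
 rewrite /D=> h5;have : Lm * (w b - w y) <= Lm * (w b - w (p1 Lm)) by rewrite ler_wpM2l// lerD2l lerN2.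
 by move: e;lra.
have [i1 m1]:=P1 lam;have [i2 m2]:=P2 lam.
have {}lamE : D lam (p1 lam) = D lam (p2 lam) by apply/eqP;rewrite -subr_eq0;apply/eqP.
exists lam,(D lam (p1 lam) - lam * w a),(p1 lam),(p2 lam);split=>//.
 by split;[rewrite /D;ring|rewrite lamE /D;ring].
move=> t /andP[at_ tb];have [ty|/ltW yt]:=leP t y.
 by have:=m1 t;rewrite at_ ty=>/(_ isT);rewrite /D;lra.
by have:=m2 t;rewrite yt tb=>/(_ isT);rewrite lamE /D;lra.
Qed.

(* The slowest chord leaving (t1, - k t1) that stays below k. *)
Lemma float_chord t1 t2 : 0 < t1 -> t1 < t2 -> exists lam l0 t3, [/\ 0 < lam, t1 < t3 <= t2,
  lam * w t1 + l0 = - k t1, lam * w t3 + l0 = k t3 & forall t, t1 <= t <= t2 -> lam * w t + l0 <= k t].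
Proof.
move=> t10 t12;have t20: 0 < t2 by exact:lt_trans t12.
pose rho t:=(k t + k t1) / (w t - w t1).
have k1:=circ_gt0 h t10;have k2:=circ_gt0 h t20.
have wp t : t1 < t -> 0 < w t - w t1 by move=> h1;rewrite subr_gt0 (w_lt Hr)// ltW.
have r2: 0 < rho t2 by rewrite divr_gt0 ?wp// addr_gt0.
have wlip t : t1 <= t <= t2 -> w t - w t1 <= k t2 * (t - t1).
 move=>/andP[h1 h2];suff : k t2 * t1 - w t1 <= k t2 * t - w t by lra.
 apply:(der_le (f:=fun x=> k t2 * x - w x) (f':=fun x=> k t2 - k x)) h1 _ _ _.
 - apply:(within_der (f':=fun x=> k t2 - k x))=> x /andP[x1 _];apply:der_eq.
   by apply:derB;[apply:derM;[exact:derC|exact:derI]|apply:dw;lra].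
  by rewrite/=;ring.
 - move=> x /andP[x1 _];apply:der_eq.
   by apply:derB;[apply:derM;[exact:derC|exact:derI]|apply:dw;lra].
  by rewrite/=;ring.
 - by move=> x /andP[x1 x2];rewrite subr_ge0 (circ_le Hr)//;lra.
(* Next to [t1] the quotient [rho] blows up, its numerator being at least [k t1]. On (t1, t1 + d] it
   is at least [rho t2], so its minimum can be sought away from the pole. *)
pose d:=Num.min (t2 - t1) (k t1 / (k t2 * rho t2)).
have d0: 0 < d by rewrite lt_min subr_gt0 t12 divr_gt0// mulr_gt0.
have dt: t1 + d <= t2.
 have : d <= t2 - t1 by rewrite ge_min lexx.
 by lra.
have near_t t : t1 < t -> t <= t1 + d -> rho t2 <= rho t.
 move=> h1 h2;rewrite {2}/rho ler_pdivlMr ?wp//.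
 have kt: 0 < k t by rewrite circ_gt0//;lra.
 have h3: w t - w t1 <= k t2 * (t - t1) by apply:wlip;rewrite (ltW h1) (le_trans h2).
 have h4: d <= k t1 / (k t2 * rho t2) by rewrite ge_min lexx orbT.
 have h5: d * (k t2 * rho t2) <= k t1 by rewrite -ler_pdivlMr// mulr_gt0.
 have h6: rho t2 * (w t - w t1) <= rho t2 * (k t2 * (t - t1)) by rewrite ler_pM2l.
 have h7: (k t2 * rho t2) * (t - t1) <= (k t2 * rho t2) * d by apply:ler_wpM2l;[rewrite mulr_ge0 ?ltW|lra].
 by lra.
have cr: {within `[t1 + d,t2],continuous rho}.
 have h1: 0 <= t1 + d by lra.
 apply:wcM;first by apply:wcD;[exact:(wc_circ Hr)|exact:wcC].
 apply:wcV;first by apply:wcB;[exact:(wc_w Hr)|exact:wcC].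
 by move=> x/=;rewrite in_itv/= =>/andP[h2 _];rewrite gt_eqF// wp//;lra.
have [t3]:=EVT_min dt cr;rewrite in_itv/= =>/andP[h1 h2] tm.
have t13: t1 < t3 by lra.
pose lam:=rho t3.
have lm t : t1 < t -> t <= t2 -> lam <= rho t.
 move=> h3 h4;have [h5|h5]:=leP t (t1 + d);last by apply:tm;rewrite in_itv/= (ltW h5).
 by apply:le_trans (near_t _ h3 h5);apply:tm;rewrite in_itv/= dt lexx.
have lE: lam * (w t3 - w t1) = k t3 + k t1 by rewrite /lam /rho divfK// gt_eqF// wp.
exists lam,(- k t1 - lam * w t1),t3;split.
- by rewrite /lam divr_gt0 ?wp// addr_gt0// circ_gt0//;lra.
- by rewrite t13.
- by ring.
- by move: lE;lra.
move=> t /andP[];rewrite le_eqVlt=>/predU1P[<- _|h3 h4];first by lra.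
have:=lm t h3 h4;rewrite /rho ler_pdivlMr ?wp//;lra.
Qed.

End chords.

(** * Gluing functions at a radius *)

Section glue.
Context {R : realType}.
Notation mu := (@lebesgue_measure R).
Implicit Types (s t x y c d e a b u : R).

Definition glue (c : R) (f g : R -> R) t : R := if t <= c then f t else g t.

Let cup a b c : a <= c -> c <= b -> `[a, b]%classic = `[a, c]%classic `|` `]c, b]%classic :> set R.
Proof.
move=> ac cb;apply/seteqP;split=> t/=;rewrite !in_itv/=.
 by move=>/andP[h1 h2];case:(leP t c)=> h3;[left;rewrite h1|right].
by move=>[/andP[h1 h2]|/andP[h1 h2]];apply/andP;split=>//;[exact:le_trans cb|rewrite (le_trans ac)// ltW].
Qed.

Let oc c b : `]c, b]%classic `<=` (`[c, b]%classic : set R).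
Proof. by move=> t/=;rewrite !in_itv/= =>/andP[/ltW-> ->]. Qed.

Lemma measurable_glue a b c f g : a <= c -> c <= b -> mfun `[a, c] f -> mfun `[c, b] g ->
  mfun `[a, b] (glue c f g).
Proof.
move=> ac cb mf mg;rewrite (cup ac cb);apply/measurable_funU=>//;split.
 by apply:eq_measurable_fun mf=> t;rewrite inE/= in_itv/= /glue=>/andP[_ ->].
apply:(@eq_measurable_fun _ _ _ _ _ g);last exact:measurable_funS mg.
by move=> t;rewrite inE/= in_itv/= /glue=>/andP[ct _];rewrite leNgt ct.
Qed.

Lemma Rint_glue a b c f g : a <= c -> c <= b -> mu.-integrable `[a, c] (EFin \o f) -> mu.-integrable `[c, b] (EFin \o g) ->
  \int[mu]_(t in `[a, b]) glue c f g t = \int[mu]_(t in `[a, c]) f t + \int[mu]_(t in `[c, b]) g t.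
Proof.
move=> ac cb If Ig;have Ig': mu.-integrable `]c,b] (EFin \o g) by apply:integrableS Ig.
have e1 t : t \in `[a,c]%classic -> glue c f g t = f t by rewrite inE/= in_itv/= /glue=>/andP[_ ->].
have e2 t : t \in `]c,b]%classic -> glue c f g t = g t by rewrite inE/= in_itv/= /glue=>/andP[ct _];rewrite leNgt ct.
have I1: mu.-integrable `[a,c] (EFin \o glue c f g) by apply:eq_integrable If=>// t tI;rewrite /= e1.
have I2: mu.-integrable `]c,b] (EFin \o glue c f g) by apply:eq_integrable Ig'=>// t tI;rewrite /= e2.
rewrite (cup ac cb) Rintegral_setU//;last 2 first.
- have [m1 f1]:=integrableP _ _ _ I1;have [m2 f2]:=integrableP _ _ _ I2.
 have m12: mfun (`[a,c] `|` `]c,b]) (EFin \o glue c f g) by apply/measurable_funU.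
 apply/integrableP;split=>//;rewrite ge0_integral_setU//;first exact:lte_add_pinfty.
  by apply:measurableT_comp.
 by apply/disj_setPS=> t [/=];rewrite !in_itv/= =>/andP[_ h1] /andP[h2 _];have:=lt_le_trans h2 h1;rewrite ltxx.
- by apply/disj_setPS=> t [/=];rewrite !in_itv/= =>/andP[_ h1] /andP[h2 _];have:=lt_le_trans h2 h1;rewrite ltxx.
rewrite -(Rintegral_itv_obnd_cbnd Ig');congr (_ + _);exact:eq_Rintegral.
Qed.

End glue.

(** * Calibration values on blocks of cut slices *)

Section blocks.
Context {R : realType}.
Notation mu := (@lebesgue_measure R).
Implicit Types (s t x y c d e a b u : R) (g l : R -> R).
Variables (h h' w : R -> R).
Notation k := (circ h).
Hypothesis Hr : radial_profile h h' w.
Let dw : forall t, 0 <= t -> isd w t (k t). Proof. by case:Hr. Qed.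
Variables (al ph : R -> R).
Hypothesis mal : mfun setT al.
Hypothesis mph : mfun setT ph.
Hypothesis al01 : forall t, 0 <= al t <= 1.
Hypothesis ph01 : forall t, 0 <= ph t <= 1.
Notation lat l a b := (\int[mu]_(t in `[a, b]) (ph t * lateral h (l t) t)).

Definition mass a b : R := \int[mu]_(t in `[a, b]) (k t * al t).
(** The calibration functional divided by 2 pi: [al] stands for the angular measure over 2 pi, and
    [ph] for the indicator of the cut slices. *)
Definition val a b g l : R := \int[mu]_(t in `[a, b]) (g t * al t) + pi^-1 * lat l a b.

(** [l] is Lipschitz with derivative [g], in integral form. The bound [B] will be [k] or a multiple
    of it. *)
Definition piece (B : R -> R) a b g l : Prop := [/\ mfun `[a, b] g, mfun `[a, b] l,
  exists M, forall t, a <= t <= b -> `|g t| <= M,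
  forall t, a <= t <= b -> l t = l a + \int[mu]_(s in `[a, t]) g s &
  forall t, a <= t <= b -> `|l t| <= B t].

Let meas a b : measurable (`[a, b]%classic : set R). Proof. exact:measurable_itv. Qed.

Lemma int_piece a b g M : mfun `[a, b] g -> (forall t, a <= t <= b -> `|g t| <= M) -> mu.-integrable `[a, b] (EFin \o g).
Proof.
move=> mg gM;apply:(@bounded_int R `[a,b]%classic g M)=>//;first exact:mu_itv_fin.
Qed.

Lemma int_al a b g M : mfun `[a, b] g -> (forall t, a <= t <= b -> `|g t| <= M) ->
  mu.-integrable `[a, b] (EFin \o (fun t => g t * al t)).
Proof.
move=> mg gM;apply:(@int_piece _ _ _ M);first by apply:measurable_funM=>//;exact:measurable_funS mal.
move=> t /gM h1;have /andP[a0 a1]:=al01 t;rewrite normrM (ger0_norm a0) (le_trans _ h1)// ler_piMr//.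
Qed.

Lemma measurable_lateral a b l : 0 < a -> mfun `[a, b] l -> mfun `[a, b] (fun t => lateral h (l t) t).
Proof.
move=> a0 ml;have mk: mfun `[a,b] (fun t=>(k t)^-1).
 apply:meas_itv_pos=>[|x x0];first exact:ltW.
 by apply:cvgV;[rewrite gt_eqF// circ_gt0|exact:der_cts (der_circ Hr x)].
have mg: mfun `[a,b] (fun t=> 1 - (l t / k t) ^+ 2).
 by apply:measurable_funB;[exact:measurable_cst|apply:measurable_funX;exact:measurable_funM].
apply:measurable_funM.
 by apply:meas_itv_pos=>[|x x0];[exact:ltW|case:Hr=> dh _ _ _;exact:der_cts (der_expR (dh x))].
exact:(measurableT_comp (cts_mfun (@sqrt_continuous R)) mg).
Qed.

Lemma int_lat a b l : 0 < a -> mfun `[a, b] l -> mu.-integrable `[a, b] (EFin \o (fun t => ph t * lateral h (l t) t)).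
Proof.
move=> a0 ml;apply:(@int_piece _ _ _ (expR (h b))).
 by apply:measurable_funM;[exact:measurable_funS mph|exact:measurable_lateral].
move=> t /andP[at_ tb];have /andP[p0 p1]:=ph01 t.
rewrite ger0_norm ?mulr_ge0 ?lateral_ge0// (le_trans _ (_ : expR (h t) <= _))// ?ler_expR ?(h_le Hr)//.
by rewrite (le_trans _ (lateral_le h (l t) t))// ler_piMl// lateral_ge0.
Qed.

Lemma piece_glue B a c b g1 l1 g2 l2 : 0 < a -> a <= c -> c <= b -> piece B a c g1 l1 -> piece B c b g2 l2 -> l1 c = l2 c ->
  piece B a b (glue c g1 g2) (glue c l1 l2) /\ val a b (glue c g1 g2) (glue c l1 l2) = val a c g1 l1 + val c b g2 l2.
Proof.
move=> a0 ac cb [mg1 ml1 [M1 b1] i1 k1] [mg2 ml2 [M2 b2] i2 k2] e.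
have I1:=int_piece mg1 b1;have I2:=int_piece mg2 b2.
split;last first.
 have eg (f1 f2 : R -> R) (F : R -> R -> R) : (fun t=> F (glue c f1 f2 t) t) = glue c (fun t=> F (f1 t) t) (fun t=> F (f2 t) t).
  by apply/funext=> t;rewrite /glue;case:ifP.
 rewrite /val (eg g1 g2 (fun z t=> z * al t)) (eg l1 l2 (fun z t=> ph t * lateral h z t)).
 rewrite !Rint_glue//;[by ring|exact:int_lat|by apply:int_lat=>//;exact:lt_le_trans ac|exact:int_al b1|exact:int_al b2].
split.
- exact:measurable_glue.
- exact:measurable_glue.
- exists (Num.max M1 M2)=> t /andP[h1 h2];rewrite /glue;case:(leP t c)=> h3.
  by rewrite le_max b1// h1.
 by rewrite le_max b2 ?orbT// (ltW h3).
- move=> t /andP[h1 h2];rewrite {1 2}/glue ac;case:(leP t c)=> h3.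
  rewrite i1 ?h1//;congr (_ + _);apply:eq_Rintegral=> s;rewrite inE/= in_itv/= =>/andP[_ h4].
  by rewrite /glue (le_trans h4 h3).
 have h4: c <= t by exact:ltW.
 have I2': mu.-integrable `[c,t] (EFin \o g2).
  by apply:integrableS I2=>// s/=;rewrite !in_itv/= =>/andP[-> h5];exact:le_trans h2.
 by rewrite (Rint_glue ac h4 I1 I2') addrA -i1 ?ac ?lexx// e -i2// h4.
- move=> t /andP[h1 h2];rewrite /glue;case:(leP t c)=> h3;first by apply:k1;rewrite h1.
 by apply:k2;rewrite (ltW h3).
Qed.

Lemma Rint_circ a b : 0 <= a -> a <= b -> \int[mu]_(t in `[a, b]) k t = w b - w a.
Proof.
move=> a0 ab;apply:ftcR=>//;last exact:(wc_circ Hr).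
by move=> x /andP[ax _];apply:dw;exact:le_trans ax.
Qed.

Lemma mass_int a b : 0 <= a -> mu.-integrable `[a, b] (EFin \o (fun t => k t * al t)).
Proof.
move=> a0;apply:(@int_al _ _ k (k b)).
 by apply:meas_itv_pos=>// x x0;exact:der_cts (der_circ Hr x).
move=> t /andP[h1 h2];have t0:=le_trans a0 h1.
by rewrite ger0_norm ?circ_ge0// (circ_le Hr).
Qed.

Lemma mass_le a b : 0 <= a -> a <= b -> 0 <= mass a b <= w b - w a.
Proof.
move=> a0 ab;apply/andP;split.
 apply:Rintegral_ge0=> t;rewrite /= in_itv/= =>/andP[h1 _];have /andP[h2 _]:=al01 t.
 by rewrite mulr_ge0// circ_ge0// (le_trans a0).
rewrite -Rint_circ//;apply:le_Rintegral=>//;[exact:mass_int|by apply:cts_int;exact:(wc_circ Hr)|].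
move=> t;rewrite /= in_itv/= =>/andP[h1 _];have /andP[_ h2]:=al01 t.
by rewrite ler_piMr// circ_ge0// (le_trans a0).
Qed.

Lemma mass_cat a c b : 0 <= a -> a <= c -> c <= b -> mass a b = mass a c + mass c b.
Proof.
move=> a0 ac cb;rewrite /mass -Rint_glue//;[by apply:eq_Rintegral=> t _;rewrite /glue;case:ifP|exact:mass_int|].
by apply:mass_int;exact:le_trans ac.
Qed.

Lemma line_piece lam c a b : 0 < a -> a <= b -> (forall t, a <= t <= b -> `|lam * w t + c| <= k t) ->
  piece k a b (fun t => lam * k t) (fun t => lam * w t + c) /\
  \int[mu]_(t in `[a, b]) (lam * k t * al t) = lam * mass a b.
Proof.
move=> a0 ab hk;split;last first.
 rewrite /mass -RintegralZl//;[by apply:eq_Rintegral=> t _;rewrite mulrA|exact:mass_int (ltW a0)].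
have cl x : 0 < x -> {for x,continuous (fun t=> lam * k t)}.
 by move=> x0;apply:cvgM;[exact:cvg_cst|exact:der_cts (der_circ Hr x)].
split=>//.
- by apply:meas_itv_pos=>//;exact:ltW.
- by apply:meas_itv_pos=>[|x x0];[exact:ltW|apply:(cts_chord Hr);exact:ltW].
- exists (`|lam| * k b)=> t /andP[h1 h2];have t0:=lt_le_trans a0 h1.
 by rewrite normrM ler_wpM2l// gtr0_norm ?circ_gt0// (circ_le Hr)// ltW.
- move=> t /andP[h1 _];rewrite (ftcR (f:=fun t=> lam * w t) h1);first by ring.
  move=> x /andP[ax _];apply:der_eq;first by apply:derM;[exact:derC|apply:dw;rewrite (le_trans (ltW a0))].
  by rewrite /= mul0r add0r.
 by apply:wcM;[exact:wcC|exact:(wc_circ Hr)].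
Qed.

Definition full a b : Prop := mu (`[a, b] `&` [set t | ph t != 1]) = 0%E.

Lemma lat_full a b c d l : full a b -> a <= c -> d <= b -> 0 < c -> mfun `[c, d] l ->
  lat l c d = \int[mu]_(t in `[c, d]) lateral h (l t) t.
Proof.
move=> f0 ac db c0 ml;rewrite /Rintegral;congr fine.
have mN: measurable (`[a,b] `&` [set t|ph t != 1] : set R).
 apply:measurableI=>//;rewrite (_ : [set t|ph t != 1] = ~` (ph @^-1` [set 1])).
  by apply:measurableC;rewrite -[X in measurable X]setTI;exact:mph.
 by apply/seteqP;split=> t /= /eqP.
apply:ae_eq_integral=>//.
- by apply/measurable_EFinP;apply:measurable_funM;[exact:measurable_funS mph|exact:measurable_lateral].
- by apply/measurable_EFinP;exact:measurable_lateral.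
exists (`[a,b] `&` [set t|ph t != 1]);split=>// t /= /not_implyP[];rewrite in_itv/= =>/andP[h1 h2] h3;split.
 by rewrite /= in_itv/= (le_trans ac h1) (le_trans h2).
by apply:contra_notN h3=>/eqP->;rewrite mul1r.
Qed.

Lemma lat_full_ge a b c d e f l : full a b -> 0 < a -> a <= c -> d <= b -> c <= e -> f <= d -> mfun `[c, d] l ->
  \int[mu]_(t in `[e, f]) lateral h (l t) t <= lat l c d.
Proof.
move=> f0 a0 ac db ce fd ml;have c0: 0 < c by exact:lt_le_trans ac.
rewrite (lat_full f0 ac db c0 ml);apply:Rint_subset=>//.
- by move=> t/=;rewrite !in_itv/= =>/andP[h1 h2];rewrite (le_trans ce h1) (le_trans h2 fd).
- apply:(@int_piece _ _ _ (expR (h d)));first exact:measurable_lateral.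
 move=> t /andP[_ td];rewrite ger0_norm ?lateral_ge0// (le_trans (lateral_le h (l t) t))//.
 by rewrite ler_expR (h_le Hr).
- by move=> t _;exact:lateral_ge0.
Qed.

Let pi0 : 0 < pi :> R. Proof. exact:pi_gt0. Qed.

Let piV (x z : R) : pi * x <= z -> x <= pi^-1 * z.
Proof. by move=> h1;rewrite ler_pdivlMl. Qed.

Lemma pos_line lam c a b : 0 <= lam -> 0 < a -> 0 <= lam * w a + c -> (forall t, a <= t <= b -> lam * w t + c <= k t) ->
  forall t, a <= t <= b -> `|lam * w t + c| <= k t.
Proof.
move=> l0 a0 h1 h2 t tI;rewrite ger0_norm ?h2//;have /andP[h3 _]:=tI.
by rewrite (le_trans h1)// lerD2r ler_wpM2l// (w_le Hr)// ltW.
Qed.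

(** A disc of radius [u] that absorbs the mass of the block becomes the disc of radius [y], and the
    block pays for the growth of [k]. The starting value [- k t1] is what a free drop of [l] leaves
    behind; [float_chord] recovers from it. *)
Lemma float_block t1 t2 u y : 0 < t1 -> t1 < t2 -> full t1 t2 -> 0 <= u -> u <= t1 -> 0 <= y ->
  w y = w u + mass t1 t2 ->
  exists g l, [/\ piece k t1 t2 g l, l t1 = - k t1 & k y - k u <= val t1 t2 g l].
Proof.
move=> t10 t12 fl u0 ut1 y0 wy;set V:=mass t1 t2 in wy.
have t20: 0 < t2 by exact:lt_trans t12.
have [lam [l0 [t3 [lam0 /andP[t13 t32] e1 e3 lk]]]]:=float_chord Hr t10 t12.
have t30: 0 < t3 by exact:lt_trans t13.
have /andP[V0 VW]:=mass_le (ltW t10) (ltW t12);rewrite -/V in V0 VW.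
have wu1: w u <= w t1 by rewrite (w_le Hr).
have uy: u <= y by rewrite -(w_leE Hr u0 y0);lra.
have yt2: y <= t2 by rewrite -(w_leE Hr y0 (ltW t20));lra.
pose l1 t:=lam * w t + l0.
have l1m s t : 0 <= s -> s <= t -> l1 s <= l1 t by move=> s0 st;rewrite lerD2r ler_pM2l// (w_le Hr).
have k1:=circ_gt0 h t10.
have l1k t : t1 <= t <= t2 -> `|l1 t| <= k t.
 move=> tI;have /andP[h1 h2]:=tI;rewrite ler_norml lk// andbT.
 have:=l1m t1 t (ltW t10) h1;have:=circ_le Hr (ltW t10) h1;rewrite /l1 e1;lra.
have ml c a b : 0 < a -> mfun `[a,b] (fun t=> c * w t + l0).
 by move=> a0;apply:meas_itv_pos=>[|x x0];[exact:ltW|apply:(cts_chord Hr);exact:ltW].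
have lk3 t : t1 <= t <= t3 -> lam * w t + l0 <= k t by move=>/andP[h1 h2];apply:lk;rewrite h1 (le_trans h2).
have [yt3|t3y]:=leP y t3.
 have [pl vl]:=line_piece t10 (ltW t12) l1k.
 exists (fun t=> lam * k t),l1;split=>//.
 have fg:=float_gain Hr t10 t13 lam0 e1 e3 lk3 u0 uy yt3.
 have:=le_trans fg (lat_full_ge fl t10 (lexx _) (lexx _) (lexx _) t32 (ml lam t1 t2 t10)).
 move=>/piV;rewrite /val vl -/V wy;lra.
(* The floating chord pays only up to its contact [t3]. Beyond it a supporting chord at [y] takes
   over, at least as steep by comparison at [t3] and [t5], and the two are glued where they
   cross. *)
have [lam2 [c2 [t4 [t5 [l20 /andP[t34 t4y] /andP[yt5 t52] [e4 e5] lk2]]]]]:=chord_exists Hr t30 (ltW t3y) yt2.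
have t40: 0 < t4 by exact:lt_le_trans t34.
have t35: t3 < t5 by exact:lt_le_trans yt5.
have w35: w t3 < w t5 by rewrite (w_lt Hr)// ltW.
have h53: lam * w t5 + l0 <= k t5 by apply:lk;rewrite (ltW (lt_trans t13 t35)).
have h33: lam2 * w t3 + c2 <= k t3 by apply:lk2;rewrite lexx.
have lam12: lam <= lam2.
 have : 0 <= (lam2 - lam) * (w t5 - w t3) by lra.
 by rewrite pmulr_lge0 ?subr_ge0// subr_gt0.
have [kp /andP[kp3 kp4] kpE] : exists2 kp,t3 <= kp <= t4 & (lam2 - lam) * w kp + (c2 - l0) = 0.
 apply:ivt=>//;first exact:(@wc_chord R h h' w Hr _ _ _ _ (ltW t30)).
 have h4: lam * w t4 + l0 <= k t4 by apply:lk;rewrite (ltW (lt_le_trans t13 t34)) (le_trans t4y).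
 by apply/andP;split;lra.
have kp0: 0 < kp by exact:lt_le_trans kp3.
have kp1: t1 <= kp by rewrite ltW// (lt_le_trans t13).
have kp2: kp <= t2 by rewrite (le_trans kp4)// (le_trans t4y).
have k30:=circ_gt0 h t30.
have [p1 v1]:=line_piece t10 kp1 (fun t tI=> l1k t (introT andP (conj (andP tI).1 (le_trans (andP tI).2 kp2)))).
have l2k: 0 <= lam2 * w kp + c2.
 have : l1 t3 <= l1 kp by apply:l1m=>//;exact:ltW.
 by rewrite /l1 e3;lra.
have [p2 v2]:=line_piece kp0 kp2 (pos_line l20 kp0 l2k (fun t tI=> lk2 t (introT andP (conj (le_trans kp3 (andP tI).1) (andP tI).2)))).
have ek: lam * w kp + l0 = lam2 * w kp + c2 by lra.
have [pg vg]:=piece_glue t10 kp1 kp2 p1 p2 ek.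
exists (glue kp (fun t=> lam * k t) (fun t=> lam2 * k t)),(glue kp l1 (fun t=> lam2 * w t + c2));split.
- exact:pg.
- by rewrite /glue kp1.
rewrite vg.
have fg:=float_gain Hr t10 t13 lam0 e1 e3 lk3 u0 (ltW (le_lt_trans ut1 t13)) (lexx _).
have /piV g1:=le_trans fg (lat_full_ge fl t10 (lexx _) kp2 (lexx _) kp3 (ml lam t1 kp t10)).
have tg:=touch_gain Hr t40 t4y yt5 e4 e5.
have ml2: mfun `[kp,t2] (fun t=> lam2 * w t + c2).
 by apply:meas_itv_pos=>[|x x0];[exact:ltW|apply:(cts_chord Hr);exact:ltW].
have /piV g2:=le_trans tg (lat_full_ge fl t10 kp1 (lexx _) kp4 t52 ml2).
have mc:=mass_cat (ltW t10) kp1 kp2;rewrite -/V in mc.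
have /andP[_ mk]:=mass_le (ltW t10) kp1.
(* Using the smaller slope up to [kp] loses nothing, since the mass in [t1, kp] is at most its area;
   the next term uses [u <= t1] in the same way. *)
have h6: 0 <= (lam2 - lam) * (w kp - w t1 - mass t1 kp) by rewrite mulr_ge0;lra.
have h7: 0 <= (lam2 - lam) * (w t1 - w u) by rewrite mulr_ge0;lra.
rewrite /val v1 v2;move: g1 g2 h6 h7;rewrite wy mc;lra.
Qed.

(** Here [l] may start at any height in [0, k a], so the supporting chord at [y] can be followed at
    once; the value [l a] is to be paid by what lies further in. *)
Lemma full_block a b y : 0 < a -> a <= b -> full a b -> a <= y -> w y = w a + mass a b ->
  exists g l, [/\ piece k a b g l, 0 <= l a & k y <= l a + val a b g l].
Proof.
move=> a0 ab fl ay wy;set V:=mass a b in wy.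
have /andP[V0 VW]:=mass_le (ltW a0) ab;rewrite -/V in V0 VW.
have b0: 0 < b by exact:lt_le_trans ab.
have yb: y <= b by rewrite -(w_leE Hr (le_trans (ltW a0) ay) (ltW b0));lra.
have [lam [c [t4 [t5 [lam0 /andP[t4a t4y] /andP[yt5 t5b] [e4 e5] lk]]]]]:=chord_exists Hr a0 ay yb.
have t40: 0 < t4 by exact:lt_le_trans t4a.
have tg:=touch_gain Hr t40 t4y yt5 e4 e5.
have ml s t : 0 < s -> mfun `[s,t] (fun t=> lam * w t + c).
 by move=> s0;apply:meas_itv_pos=>[|x x0];[exact:ltW|apply:(cts_chord Hr);exact:ltW].
have [la|la]:=leP 0 (lam * w a + c).
 have [pl vl]:=line_piece a0 ab (pos_line lam0 a0 la lk).
 exists (fun t=> lam * k t),(fun t=> lam * w t + c);split=>//.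
 have /piV:=le_trans tg (lat_full_ge fl a0 (lexx _) (lexx _) t4a t5b (ml a b a0)).
 by rewrite /val vl -/V wy;lra.
have k4:=circ_gt0 h t40.
(* A chord negative at [a] is replaced by 0 up to its zero. The slope skipped there would multiply a
   mass at most equal to the area, so the balance stays favourable. *)
have [kp /andP[kp1 kp4] kpE] : exists2 kp,a <= kp <= t4 & lam * w kp + c = 0.
 by apply:ivt=>//;[exact:(@wc_chord R h h' w Hr _ _ _ _ (ltW a0))|rewrite e4 (ltW la) ltW].
have kp0: 0 < kp by exact:lt_le_trans kp1.
have kp2: kp <= b by rewrite (le_trans kp4)// (le_trans t4y).
have [p1 v1] : piece k a kp (fun t=> 0 * k t) (fun t=> 0 * w t + 0) /\ \int[mu]_(t in `[a,kp]) (0 * k t * al t) = 0 * mass a kp.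
 apply:line_piece=>// t /andP[h1 _];rewrite mul0r addr0 normr0 circ_ge0// (le_trans (ltW a0))//.
have [p2 v2]:=line_piece kp0 kp2 (pos_line lam0 kp0 (eq_ind_r (fun z=> 0 <= z) (lexx 0) kpE) (fun t tI=> lk t (introT andP (conj (le_trans kp1 (andP tI).1) (andP tI).2)))).
have [pg vg]:=piece_glue a0 kp1 kp2 p1 p2 (etrans (etrans (addr0 _) (mul0r _)) (esym kpE)).
exists (glue kp (fun t=> 0 * k t) (fun t=> lam * k t)),(glue kp (fun t=> 0 * w t + 0) (fun t=> lam * w t + c));split=>//.
 by rewrite /glue kp1 mul0r addr0.
rewrite vg {1}/glue kp1 mul0r addr0 add0r.
have /piV g2:=le_trans tg (lat_full_ge fl a0 kp1 (lexx _) kp4 t5b (ml kp b kp0)).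
have g1: 0 <= pi^-1 * lat (fun t=> 0 * w t + 0) a kp.
 rewrite mulr_ge0 ?invr_ge0 ?(ltW pi0)//;apply:Rintegral_ge0=> t _;rewrite mulr_ge0 ?lateral_ge0//.
 by have /andP[]:=ph01 t.
have mc:=mass_cat (ltW a0) kp1 kp2;rewrite -/V in mc.
have /andP[_ mk]:=mass_le (ltW a0) kp1.
have h6: 0 <= lam * (w kp - w a - mass a kp) by rewrite mulr_ge0;lra.
by rewrite /val v1 v2 mul0r;move: g1 g2 h6;rewrite wy mc;lra.
Qed.

End blocks.

Section arith.
Context {R : realType}.
Implicit Types (s q e c : R).

Lemma cut_arith s q e c : - e <= q - s -> q - s <= e -> 0 <= c -> c <= 1 -> s * c <= (q - e) * c + 2 * e.
Proof.
move=> h1 h2 c0 c1;have h: (s - q + e) * c <= 2 * e * 1 by apply:ler_pM=>//;lra.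
by lra.
Qed.

Lemma mesh_arith (e2 e c : R) : 0 < c -> e2 <= e / (8 * c) -> 8 * (e2 * c) <= e.
Proof. by move=> c0;rewrite ler_pdivlMr ?mulr_gt0//;lra. Qed.

Lemma sum_arith (i1 i2 P y' y z e2 c e : R) : i1 + i2 <= P -> 2 * y' - e / 2 <= i2 -> y <= y' -> z - 2 * e2 * c <= y ->
  8 * (e2 * c) <= e -> i1 + 2 * z <= P + e.
Proof. by move=> h1 h2 h3 h4 h5;lra. Qed.

End arith.

(** * The calibration inequality for smooth radial parts *)

Section calibration.
Context {R : realType}.
Notation T := (measurableTypeR R).
Notation mu := (@lebesgue_measure R).
Implicit Types (a b c e s t : R).

Lemma cutoff_exists a0 a1 b1 b0 : a0 < a1 -> a1 < b1 -> b1 < b0 -> exists X : R -> R, [/\ smooth1 X, forall t, 0 <= X t <= 1,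
  forall t, t <= a0 -> X t = 0, forall t, b0 <= t -> X t = 0 & forall t, a1 <= t <= b1 -> X t = 1].
Proof.
move=> h1 h2 h3;pose r1:=(a1 - a0) / 2;pose p1:=(a0 + a1) / 2;pose r2:=(b0 - b1) / 2;pose p2:=(b1 + b0) / 2.
have r10: 0 < r1 by rewrite divr_gt0// subr_gt0.
have r20: 0 < r2 by rewrite divr_gt0// subr_gt0.
have e1: p1 - r1 = a0 by rewrite /p1 /r1;field.
have e2: p1 + r1 = a1 by rewrite /p1 /r1;field.
have e3: p2 - r2 = b1 by rewrite /p2 /r2;field.
have e4: p2 + r2 = b0 by rewrite /p2 /r2;field.
exists (fun t=> bump_step p1 r1 t * (1 - bump_step p2 r2 t));split.
- by move=> k;apply:S1M;[exact:bump_step_smooth|apply:S1B;[exact:S1_cst|exact:bump_step_smooth]].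
- move=> t;have /andP[x0 x1]:=bump_step01 p1 r1 t;have /andP[y0 y1]:=bump_step01 p2 r2 t.
 have z0: 0 <= 1 - bump_step p2 r2 t by rewrite subr_ge0.
 by rewrite mulr_ge0//= mulr_ile1// gerBl.
- by move=> t ta;rewrite bump_step0 ?mul0r// e1.
- by move=> t bt;rewrite (bump_step1 r20) ?subrr ?mulr0// e4.
- by move=> t /andP[at_ tb];rewrite (bump_step1 r10) ?e2// (bump_step0 r20) ?e3// subr0 mulr1.
Qed.

Lemma Rint_restrict (B C : set T) (f : T -> R) : B `<=` C -> (forall t, C t -> ~ B t -> f t = 0) ->
  \int[mu]_(t in B) f t = \int[mu]_(t in C) f t.
Proof.
move=> BC f0;rewrite /Rintegral integral_mkcond [in RHS]integral_mkcond;congr fine.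
apply:eq_integral=> t _;rewrite !patchE;have [tB|tB]:=boolP (t \in B).
 by rewrite ifT//;apply/mem_set/BC;rewrite inE in tB.
case:ifPn=>// tC;rewrite f0//;first by rewrite inE in tC.
by move=> h;move: tB;rewrite mem_set.
Qed.

Variables (A : set (plane R)) (h : R -> R) (P : R).
Hypothesis mA : measurable A.
Hypothesis hc : continuous h.
Hypothesis hm : {homo h : s t / s <= t}.
Hypothesis div_le : forall X1 X2 : R * R -> R, test_function X1 -> test_function X2 ->
  (forall x, enorm (X1 x, X2 x) <= expR (h (enorm x))) ->
  - (\int[leb2_borel]_(x in A) partial1 X1 x + \int[leb2_borel]_(x in A) partial2 X2 x) <= P.
Notation m := (slice_mass A).
Notation cut := (cut_ind A).
Notation k := (circ h).
Let meas a b : measurable (`[a, b]%classic : set T). Proof. exact:measurable_itv. Qed.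

Let ch : continuous (fun t => expR (h t)).
Proof. by move=> t;apply:continuous_comp;[exact:hc|exact:continuous_expR]. Qed.

Let mm : mfun setT m. Proof. exact:measurable_slice_mass. Qed.
Let mcut : mfun setT cut. Proof. exact:measurable_cut_ind. Qed.
Let cut01 t : 0 <= cut t <= 1. Proof. by rewrite /cut_ind;case:ifP=> _;rewrite lexx ler01. Qed.

Lemma slice_mass_bound t : 0 <= m t <= 2 * pi.
Proof.
have mI: mfun setT (\1_A : plane R -> R) by exact:measurable_indic.
apply/andP;split.
 apply:Rintegral_ge0=> s _;apply:mulr_ge0;first by rewrite ltW// dang_gt0.
 by apply:addr_ge0;rewrite indicE.
apply:le_trans (ler_norm _) _;rewrite -[leRHS]mulr1;apply:circ_int_bound=>// x.
by rewrite indicE;case:(x \in A);rewrite ?normr1 ?normr0.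
Qed.

Lemma smooth_cal (l : R -> R) a b eta : 0 < a -> a < b -> smooth1 l ->
  (forall t, t <= a -> l t = 0) -> (forall t, b <= t -> l t = 0) -> 0 < eta -> eta < 1 ->
  (forall t, a <= t <= b -> `|l t| <= (1 - eta) * k t) ->
  \int[mu]_(t in `[a, b]) (derive1 l t * m t) + 2 * (\int[mu]_(t in `[a, b]) (lateral h (l t) t * cut t)) <= P.
Proof.
move=> a0 ab sl la lb eta0 eta1 lk;pose a':=a / 2;pose b':=b + 1.
have a'0: 0 < a' by rewrite divr_gt0.
have a'a: a' < a by rewrite /a';lra.
have bb': b < b' by rewrite ltrDl.
have a'b': a' < b' by lra.
have [X [sX X01 Xa Xb X1]]:=cutoff_exists a'a ab bb'.
(* [k] made positive and continuous on the whole line, unchanged from [a'] on. *)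
pose kk t:=Num.max t a' * expR (h t).
have kk0 t : 0 < kk t by rewrite mulr_gt0 ?expR_gt0// lt_max a'0 orbT.
have kkE t : a' <= t -> kk t = k t by move=> h1;rewrite /kk;congr (_ * _);apply/max_idPl.
pose S t:=expR (h t) * Num.sqrt (1 - (l t / kk t) ^+ 2).
have lkk t : a' <= t -> `|l t| <= (1 - eta) * kk t.
 move=> h1;have [ta|at_]:=leP t a;first by rewrite la// normr0 mulr_ge0 ?(ltW (kk0 t))// subr_ge0 ltW.
 have [bt|tb]:=leP b t;first by rewrite lb// normr0 mulr_ge0 ?(ltW (kk0 t))// subr_ge0 ltW.
 by rewrite kkE// lk// !ltW.
have cmax: continuous (fun t : R=> Num.max t a').
 rewrite (_ : (fun t : R=> _) = (fun t=>(t + a' + `|t - a'|) / 2));last by apply/funext=> t;rewrite maxr_absE.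
 move=> t;apply:cvgM;last exact:cvg_cst.
 apply:cvgD;first by apply:cvgD;[exact:cvg_id|exact:cvg_cst].
 apply:(@continuous_comp _ _ _ (fun t=> t - a') Num.norm);last exact:norm_continuous.
 by apply:cvgB;[exact:cvg_id|exact:cvg_cst].
have cS: continuous S.
 move=> t;apply:cvgM;first exact:ch.
 apply:continuous_comp;last exact:sqrt_continuous.
 apply:cvgB;first exact:cvg_cst.
 apply:(@continuous_comp _ _ _ (fun t=> l t / kk t) (fun y=> y ^+ 2));last exact:exprn_continuous.
 apply:cvgM;first exact:smooth1_cts.
 apply:cvgV;first by rewrite gt_eqF.
 by apply:cvgM;[exact:cmax|exact:ch].
have wS: {within `[a',b'],continuous S} by exact:wc_cts.
have [tm tmI Sm]:=EVT_min (ltW a'b') wS;have [tM tMI SM]:=EVT_max (ltW a'b') wS.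
rewrite in_itv/= in tmI;have /andP[tm1 tm2]:=tmI.
have c0: 0 < S tm.
 rewrite mulr_gt0 ?expR_gt0// sqrtr_gt0 subr_gt0 -[X in X < _]real_normK ?num_real// expr_lt1// normrM normfV (gtr0_norm (kk0 tm)).
 rewrite ltr_pdivrMr// mul1r (le_lt_trans (lkk _ tm1))// gtr_pMl//;lra.
have SI t : a' <= t <= b' -> S tm <= S t <= S tM by move=> tI;rewrite Sm ?SM// in_itv.
apply/ler_addgt0Pr=> e e0.
(* At most the minimum of [S], and small enough for the total loss on [a, b] to stay within [e]. *)
pose e2:=Num.min (S tm) (e / (8 * (b - a))).
have ba0: 0 < b - a by rewrite subr_gt0.
have e20: 0 < e2 by rewrite lt_min c0 divr_gt0// mulr_gt0.
have [q [sq q01 qS]]:=smooth_uniform (ltW a'b') e20 cS SI.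
pose Q t:=X t * (q t - e2).
have sQ: smooth1 Q by move=> j;apply:S1M;[exact:sX|apply:S1B;[exact:sq|exact:S1_cst]].
have mQ: mfun setT Q by apply:cts_mfun;exact:smooth1_cts.
have e2m: e2 <= S tm by rewrite ge_min lexx.
have Q0C t : 0 <= Q t <= S tM.
 have /andP[x0 x1]:=X01 t;have /andP[q0 q1]:=q01 t.
 have z0: 0 <= q t - e2 by rewrite subr_ge0 (le_trans e2m).
 by rewrite mulr_ge0//= (le_trans (_ : _ <= 1 * (q t - e2)))// ?ler_wpM2r// mul1r;lra.
have e40: 0 < e / 2 by rewrite divr_gt0.
have [L [[sL L1] hL]]:=lateral_sup mA a'0 a'b' mQ Q0C e40.
have rho0 t : 0 <= t -> 0 <= expR (h t) by move=> _;exact:expR_ge0.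
have QS t : a' <= t <= b' -> Q t <= S t.
 move=> tI;have:=qS t tI;rewrite ler_norml=>/andP[_ h1];have /andP[x0 x1]:=X01 t;have /andP[q0 q1]:=q01 t.
 have z0: 0 <= q t - e2 by rewrite subr_ge0 (le_trans e2m).
 by rewrite (le_trans (_ : _ <= 1 * (q t - e2)))// ?ler_wpM2r// mul1r;lra.
have fb:=@field_bound _ A (fun t=> expR (h t)) P mA div_le L l Q a' b' a'0 a'b' sl sQ
 (fun t ht=> la t (le_trans ht (ltW a'a))) (fun t ht=> lb t (le_trans (ltW bb') ht)) _ _ sL L1 rho0 _.
have {}fb : \int[mu]_(t in `[a',b']) (derive1 l t * m t + Q t * slice_der A L t) <= P.
 apply:fb.
 - by move=> t ht;rewrite /Q Xa// mul0r.
 - by move=> t ht;rewrite /Q Xb// mul0r.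
 move=> t tI;have /andP[t1 t2]:=tI;have t0: 0 < t by exact:lt_le_trans t1.
 have E0:=expR_gt0 (h t).
 have ->: expR (h t) = Num.sqrt (expR (h t) ^+ 2) by rewrite sqrtr_sqr ger0_norm// ltW.
 rewrite /enorm /= ler_wsqrtr//.
 have /andP[Q0 _]:=Q0C t;have QS':=QS t tI.
 have : Q t ^+ 2 <= S t ^+ 2 by rewrite ler_pXn2r// nnegrE (le_trans Q0).
 have ->: S t ^+ 2 = expR (h t) ^+ 2 - (l t / t) ^+ 2.
  rewrite /S exprMn sqr_sqrtr;first by rewrite kkE// /circ;field;rewrite !gt_eqF.
  rewrite subr_ge0 -[X in X <= _]real_normK ?num_real// expr_le1// normrM normfV (gtr0_norm (kk0 t)).
  rewrite ler_pdivrMr// mul1r (le_trans (lkk _ t1))// ger_pMl//;lra.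
 lra.
have ml: mfun setT (derive1 l) by apply:cts_mfun;apply:smooth1_cts;exact:smooth1_der.
have [B1 hB1] : exists B,forall t,a' <= t <= b' -> `|derive1 l t| <= B.
 have c1: {within `[a',b'],continuous (fun t=> `|derive1 l t|)}.
  apply:wc_cts=> t;apply:continuous_comp;last exact:norm_continuous.
  by apply:smooth1_cts;exact:smooth1_der.
 by have [z _ hz]:=EVT_max (ltW a'b') c1;exists `|derive1 l z| => t tI;apply:hz;rewrite in_itv.
have I1: mu.-integrable `[a',b'] (EFin \o (fun t=> derive1 l t * m t)).
 apply:(@int_piece _ a' b' _ (B1 * (2 * pi))).
  by apply:(measurable_funS measurableT)=>//;exact:measurable_funM.
 move=> t tI;rewrite normrM;apply:ler_pM=>//;first exact:hB1.
 by have /andP[m0 m1]:=slice_mass_bound t;rewrite ger0_norm.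
have [B2 hB2]:=slice_der_bounded mA sL.
have I2: mu.-integrable `[a',b'] (EFin \o (fun t=> Q t * slice_der A L t)).
 apply:(@int_piece _ a' b' _ (S tM * B2)).
  by apply:(measurable_funS measurableT)=>//;apply:measurable_funM=>//;exact:measurable_slice_der.
 move=> t tI;rewrite normrM;apply:ler_pM=>//.
 by have /andP[m0 m1]:=Q0C t;rewrite ger0_norm.
rewrite (RintegralD (meas a' b') I1 I2) in fb.
have sub: `[a,b]%classic `<=` (`[a',b']%classic : set T).
 by move=> t/=;rewrite !in_itv/= =>/andP[h1 h2];rewrite (le_trans (ltW a'a))// (le_trans h2)// ltW.
have r1: \int[mu]_(t in `[a,b]) (derive1 l t * m t) = \int[mu]_(t in `[a',b']) (derive1 l t * m t).
 apply:Rint_restrict=>// t _ /= /negP;rewrite in_itv/= negb_and -!ltNge=> h1.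
 rewrite (@isd_cst_near _ l t 0) ?mul0r//;first exact:smooth1_isd.
 case/orP: h1=> h1;near=> u.
  by apply:la;apply:ltW;near: u;exact:lt_nbhsl.
 by apply:lb;apply:ltW;near: u;exact:lt_nbhsr.
have Iq: mu.-integrable `[a',b'] (EFin \o (fun t=> Q t * cut t)).
 apply:(@int_piece _ a' b' _ (S tM * 1)).
  by apply:(measurable_funS measurableT)=>//;exact:measurable_funM.
 move=> t tI;rewrite normrM;apply:ler_pM=>//;first by have /andP[m0 m1]:=Q0C t;rewrite ger0_norm.
 by have /andP[m0 m1]:=cut01 t;rewrite ger0_norm.
have r2: \int[mu]_(t in `[a,b]) (Q t * cut t) <= \int[mu]_(t in `[a',b']) (Q t * cut t).
 apply:(@Rint_subset R `[a,b]%classic `[a',b']%classic)=>// t _.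
 by have /andP[m0 _]:=Q0C t;have /andP[m1 _]:=cut01 t;rewrite mulr_ge0.
have Ic: mu.-integrable `[a,b] (EFin \o (fun t=> Q t * cut t)) by apply:integrableS Iq.
have Il: mu.-integrable `[a,b] (EFin \o (fun t=> lateral h (l t) t * cut t)).
 apply:(@int_piece _ a b _ (S tM * 1)).
  apply:measurable_funM;last exact:measurable_funS mcut.
  apply:(@eq_measurable_fun _ _ _ _ _ S);last by apply:(measurable_funS measurableT)=>//;exact:cts_mfun.
  by move=> t;rewrite inE/= in_itv/= =>/andP[h1 _];rewrite /S kkE// (le_trans (ltW a'a)).
 move=> t /andP[h1 h2];have t1: a' <= t by rewrite (le_trans (ltW a'a)).
 rewrite normrM;apply:ler_pM=>//;last by have /andP[m0 m1]:=cut01 t;rewrite ger0_norm.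
 rewrite ger0_norm ?lateral_ge0//;have /andP[_]:=SI t (introT andP (conj t1 (le_trans h2 (ltW bb')))).
 by rewrite /S kkE.
have r3: \int[mu]_(t in `[a,b]) (lateral h (l t) t * cut t) - 2 * e2 * (b - a) <= \int[mu]_(t in `[a,b]) (Q t * cut t).
 have c1: \int[mu]_(t in `[a,b]) (2 * e2) = 2 * e2 * (b - a).
  rewrite [LHS](_ : _ = \int[mu]_(t in `[a,b]) cst (2 * e2) t)// Rintegral_cst//;congr (_ * _).
  have : mu `[a,b]%classic = (b - a)%:E by apply:(etrans (lebesgue_measure_itv _));rewrite /= lte_fin ab -EFinD.
  by move=> h1;exact:(congr1 fine h1).
 have Icst: mu.-integrable `[a,b] (EFin \o (fun=> 2 * e2)).
  by apply:(@int_piece _ a b _ (2 * e2))=>// t _;rewrite ger0_norm// mulr_ge0// ltW.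
 rewrite -c1 lerBlDr -(RintegralD (meas a b) Ic Icst);apply:le_Rintegral=>//;first exact:(integrableD (meas a b) Ic Icst).
 move=> t;rewrite /= in_itv/= =>/andP[h1 h2];have t1: a' <= t by rewrite (le_trans (ltW a'a)).
 have tI: a' <= t <= b' by rewrite t1 (le_trans h2)// ltW.
 have ->: lateral h (l t) t = S t by rewrite /S kkE.
 have:=qS t tI;rewrite ler_norml=>/andP[h3 h4].
 rewrite /Q X1 ?h1// mul1r;have /andP[m0 m1]:=cut01 t;exact:cut_arith.
have r4: 8 * (e2 * (b - a)) <= e by apply:mesh_arith=>//;rewrite ge_min lexx orbT.
rewrite r1;exact:sum_arith fb hL r2 r3 r4.
Unshelve. all: by end_near. Qed.

End calibration.

Lemma tri_arith {R : realType} (g d l e c : R) : g <= d + l -> d <= e -> e <= c -> g <= l + c.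
Proof. lra. Qed.

Lemma val_arith {R : realType} (p I J : R) : p != 0 -> ((2 * p)^-1 * I + p^-1 * J) * (2 * p) = I + 2 * J.
Proof. by move=> p0;field. Qed.

Section arith.
Context {R : realType}.
Implicit Types (x y s u v e : R).

Lemma sqrt_close x y s : 0 <= s -> x <= y + s ^+ 2 -> Num.sqrt x <= Num.sqrt y + s.
Proof.
move=> s0 xy;have z0:=sqrtr_ge0 y.
have zy: y <= Num.sqrt y ^+ 2.
 by have [y0|/ltW y0]:=leP 0 y;[rewrite sqr_sqrtr|rewrite (le_trans y0)// sqr_ge0].
have ->: Num.sqrt y + s = Num.sqrt ((Num.sqrt y + s) ^+ 2) by rewrite sqrtr_sqr ger0_norm// addr_ge0.
apply:ler_wsqrtr;apply:(le_trans xy);have h: 0 <= Num.sqrt y * s by rewrite mulr_ge0.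
by rewrite sqrrD;lra.
Qed.

Lemma ratio_close u v e : 0 < e -> e < 1 -> `|u| <= 1 -> `|v| <= (1 - e) * (`|u| + e / 2) -> 1 - u ^+ 2 <= 1 - v ^+ 2 + e.
Proof.
move=> e0 e1 u1 vu;rewrite -[u ^+ 2]real_normK ?num_real// -[v ^+ 2]real_normK ?num_real//.
have a0: 0 <= `|u| by [];have v0: 0 <= `|v| by [].
set a:=`|u| in u1 vu a0 *;set b:=`|v| in vu v0 *.
have h1: b ^+ 2 <= ((1 - e) * (a + e / 2)) ^+ 2 by rewrite ler_pXn2r// nnegrE (le_trans v0).
have h2: ((1 - e) * (a + e / 2)) ^+ 2 <= (1 - e) * (a + e / 2) ^+ 2.
 rewrite exprMn ler_wpM2r ?sqr_ge0// expr2 ler_piMl//;lra.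
have h3: (1 - e) * (a + e / 2) ^+ 2 <= a ^+ 2 + e.
 have p1: 0 <= e * (1 - a) by rewrite mulr_ge0//;lra.
 have p2: 0 <= e * a ^+ 2 by rewrite mulr_ge0 ?sqr_ge0// ltW.
 have p3: 0 <= e ^+ 2 * a by rewrite mulr_ge0 ?sqr_ge0.
 have p4: 0 <= e ^+ 2 * e by rewrite mulr_ge0 ?sqr_ge0// ltW.
 have p5: 0 <= e ^+ 2 by exact:sqr_ge0.
 have p6: e ^+ 2 <= e by rewrite expr2 ler_piMl ?ltW.
 have ->: (1 - e) * (a + e / 2) ^+ 2 = a ^+ 2 + e * a + e ^+ 2 / 4 - e * a ^+ 2 - e ^+ 2 * a - e ^+ 2 * e / 4 by field.
 have p7: 0 <= e ^+ 2 * (1 - a) by rewrite mulr_ge0//;lra.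
 have p8: 0 <= e * (1 - a) ^+ 2 by rewrite mulr_ge0 ?sqr_ge0// ltW.
 nra.
lra.
Qed.

Lemma bound_arith k e e1 x : 0 <= x -> x <= k + e1 -> e1 <= e / 2 * k -> 0 < e -> e < 1 -> 0 <= e1 -> (1 - e) * x <= (1 - e / 2) * k.
Proof.
move=> x0 xk ek e0 e1' e10;have h: (1 - e) * x <= (1 - e) * (k + e1) by rewrite ler_wpM2l//;lra.
have h2: 0 <= e * e1 by rewrite mulr_ge0// ltW.
by lra.
Qed.

Lemma final_arith (i y P i' y' s e e1 B c d p : R) : i' + 2 * y' <= P -> (1 - e) * i - 2 * p * (B * e1 * c + e1) <= i' ->
  y - d * s <= y' -> e <= s -> e1 <= s -> 0 <= e -> 0 <= B -> 0 <= c -> 0 <= p ->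
  i + 2 * y <= P + (`|i| + 2 * p * (B * c + 1) + 2 * d) * s.
Proof.
move=> h1 h2 h3 es e1s e0 B0 c0 p0.
have n1: e * i <= s * `|i| by rewrite (le_trans (ler_wpM2l e0 (ler_norm i)))// ler_wpM2r.
have Bc: 0 <= 2 * p * (B * c + 1) by rewrite mulr_ge0 ?addr_ge0 ?mulr_ge0.
have n2: 2 * p * (B * c + 1) * e1 <= 2 * p * (B * c + 1) * s by rewrite ler_wpM2l.
by lra.
Qed.

End arith.

(** * The calibration inequality for Lipschitz radial parts *)

Section calibration.
Context {R : realType}.
Notation T := (measurableTypeR R).
Notation mu := (@lebesgue_measure R).
Implicit Types (a b c e s t : R) (g l : R -> R).
Variables (A : set (plane R)) (h : R -> R) (P : R).
Hypothesis mA : measurable A.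
Hypothesis hc : continuous h.
Hypothesis hm : {homo h : s t / s <= t}.
Hypothesis div_le : forall X1 X2 : R * R -> R, test_function X1 -> test_function X2 ->
  (forall x, enorm (X1 x, X2 x) <= expR (h (enorm x))) ->
  - (\int[leb2_borel]_(x in A) partial1 X1 x + \int[leb2_borel]_(x in A) partial2 X2 x) <= P.
Notation m := (slice_mass A).
Notation cut := (cut_ind A).
Notation k := (circ h).
Let meas a b : measurable (`[a, b]%classic : set T). Proof. exact:measurable_itv. Qed.
Let mm : mfun setT m. Proof. exact:measurable_slice_mass. Qed.
Let mcut : mfun setT cut. Proof. exact:measurable_cut_ind. Qed.
Let cut01 t : 0 <= cut t <= 1. Proof. by rewrite /cut_ind;case:ifP=> _;rewrite lexx ler01. Qed.

Lemma measurable_lateral_cts a b l : 0 < a -> mfun `[a, b] l -> mfun `[a, b] (fun t => lateral h (l t) t).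
Proof.
move=> a0 ml;have ck: continuous k.
 by move=> t;apply:cvgM;[exact:cvg_id|apply:continuous_comp;[exact:hc|exact:continuous_expR]].
have mk: mfun `[a,b] (fun t=>(k t)^-1).
 by apply:meas_itv_pos=>[|x x0];[exact:ltW|apply:cvgV;[rewrite gt_eqF// circ_gt0|exact:ck]].
have mg: mfun `[a,b] (fun t=> 1 - (l t / k t) ^+ 2).
 by apply:measurable_funB;[exact:measurable_cst|apply:measurable_funX;exact:measurable_funM].
apply:measurable_funM;last exact:(measurableT_comp (cts_mfun (@sqrt_continuous R)) mg).
by apply:meas_itv_pos=>[|x x0];[exact:ltW|apply:continuous_comp;[exact:hc|exact:continuous_expR]].
Qed.

Let int_latc a b l : 0 < a -> mfun `[a, b] l -> mu.-integrable `[a, b] (EFin \o (fun t => lateral h (l t) t * cut t)).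
Proof.
move=> a0 ml;apply:(@int_piece _ a b _ (expR (h b) * 1)).
 by apply:measurable_funM;[exact:measurable_lateral_cts|exact:measurable_funS mcut].
move=> t /andP[_ tb];have /andP[c0 c1]:=cut01 t.
rewrite normrM (ger0_norm c0) ger0_norm ?lateral_ge0//;apply:ler_pM=>//;first exact:lateral_ge0.
by rewrite (le_trans (lateral_le h (l t) t))// ler_expR hm.
Qed.

Let int_m a b g M : mfun `[a, b] g -> (forall t, a <= t <= b -> `|g t| <= M) ->
  mu.-integrable `[a, b] (EFin \o (fun t => g t * m t)).
Proof.
move=> mg gM;apply:(@int_piece _ a b _ (M * (2 * pi))).
 by apply:measurable_funM=>//;exact:measurable_funS mm.
move=> t tI;rewrite normrM;apply:ler_pM=>//;first exact:gM.
by have /andP[m0 m1]:=slice_mass_bound mA t;rewrite ger0_norm.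
Qed.

Let Rcst a b c : a <= b -> \int[mu]_(t in `[a, b]) c = c * (b - a).
Proof.
move=> ab;rewrite [LHS](_ : _ = \int[mu]_(t in `[a,b]) cst c t)// Rintegral_cst//;congr (_ * _).
have : mu `[a,b]%classic = (b - a)%:E.
 apply:(etrans (lebesgue_measure_itv _));rewrite /= lte_fin -EFinD.
 by move: ab;rewrite le_eqVlt=>/predU1P[->|->//];rewrite ltxx subrr.
by move=> h1;exact:(congr1 fine h1).
Qed.

Let ZI a b c f : mu.-integrable `[a, b] (EFin \o f) -> mu.-integrable `[a, b] (EFin \o (fun t => c * f t)).
Proof. by move=> If;exact:(integrableZl (meas a b) c If). Qed.

Lemma k_le s t : 0 <= s -> s <= t -> k s <= k t.
Proof. by move=> s0 st;rewrite ler_pM ?expR_ge0// ler_expR hm. Qed.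

(** [g] is smoothed in L1, integrated, cut off, and the result multiplied by [1 - e] to restore a
    strict bound. A change of size [e] under a square root moves it by up to the root of [e], which
    is why the parameter is [s] with [e = s^2]. *)
Lemma cal_eps a b g l : 0 < a -> a < b -> piece k a b g l -> l a = 0 -> l b = 0 -> exists C, forall s, 0 < s -> s < 1 ->
  \int[mu]_(t in `[a, b]) (g t * m t) + 2 * (\int[mu]_(t in `[a, b]) (lateral h (l t) t * cut t)) <= P + C * s.
Proof.
move=> a0 ab [mg ml [M gM] il lk] la lb.
pose a1:=a / 2;pose b1:=b + 1.
have a10: 0 < a1 by rewrite divr_gt0.
have a1a: a1 < a by rewrite /a1;lra.
have bb1: b < b1 by rewrite ltrDl.
have a1b1: a1 < b1 by lra.
have [X [sX X01 Xa Xb X1]]:=cutoff_exists a1a ab bb1.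
have cX': continuous (derive1 X) by apply:smooth1_cts;exact:smooth1_der.
have [B [B0 hB]] : exists B,0 <= B /\ forall t,a1 <= t <= b1 -> `|derive1 X t| <= B.
 have c1: {within `[a1,b1],continuous (fun t=> `|derive1 X t|)}.
  by apply:wc_cts=> t;apply:continuous_comp;[exact:cX'|exact:norm_continuous].
 by have [z _ hz]:=EVT_max (ltW a1b1) c1;exists `|derive1 X z|;split=>// t tI;apply:hz;rewrite in_itv.
set I:=Rintegral _ _ _;set Y:=Rintegral mu _ (fun t=> lateral h (l t) t * cut t).
pose d:=expR (h b) * (b - a).
exists (`|I| + 2 * pi * (B * (b1 - a1) + 1) + 2 * d)=> s s0 s1.
pose e:=s ^+ 2;have e0: 0 < e by rewrite exprn_gt0.
have e1': e < 1 by rewrite expr_lt1// ltW.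
have es: e <= s by rewrite /e expr2 ler_piMl// ltW.
have ka1: 0 < k a1 by exact:circ_gt0.
(* The L1 error must also stay below a fraction of [k], uniformly from [a1] on, for the factor
   [1 - e] to absorb it. *)
pose e1:=Num.min e (e / 2 * k a1).
have e10: 0 < e1 by rewrite lt_min e0 mulr_gt0// divr_gt0.
have e1e: e1 <= e by rewrite ge_min lexx.
have e1k t : a1 <= t -> e1 <= e / 2 * k t.
 move=> h1;apply:(@le_trans _ _ (e / 2 * k a1));first by rewrite ge_min lexx orbT.
 by rewrite ler_pM2l ?divr_gt0// k_le// ltW.
pose gt:=g \_ `[a,b]%classic.
have mgt: mfun setT gt by apply/(measurable_restrictT _ (meas a b)).
have gin t : a <= t <= b -> gt t = g t by move=> h1;rewrite /gt patchE mem_set//= in_itv.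
have gout t : ~ (a <= t <= b) -> gt t = 0 by move=> h1;rewrite /gt patchE memNset//= in_itv.
have M0: 0 <= M by have:=gM a;rewrite lexx (ltW ab)=>/(_ isT);exact:le_trans.
have gtM t : `|gt t| <= M.
 by have [h1|/negP h1]:=boolP (a <= t <= b);[rewrite gin// gM|rewrite gout// normr0].
have [g1 [sg1 g1M hg1]] : exists g1,[/\ smooth1 g1,forall x,- M <= g1 x <= M & \int[mu]_(x in `[a1,b1]) `|gt x - g1 x| <= e1].
 apply:smooth_L1=>//;first exact:(measurable_funS measurableT).
 by move=> x _;rewrite -ler_norml.
have cg1:=smooth1_cts sg1.
have [G dG]:=primitive cg1.
have sG: smooth1 G.
 by move=>[|j];[split=>// t;exact:der_cts (dG t)|exact:S1_intro dG (sg1 j)].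
pose G0 t:=G t - G a1.
have Igt u : mu.-integrable `[a1,u] (EFin \o gt).
 by apply:(@int_piece _ a1 u _ M)=>//;exact:(measurable_funS measurableT).
have Ig1 u : mu.-integrable `[a1,u] (EFin \o g1) by apply:cts_int;exact:wc_cts.
have mdf: mfun setT (fun t=> `|gt t - g1 t|).
 by apply:measurableT_comp=>//;apply:measurable_funB=>//;exact:cts_mfun.
have Idf u : mu.-integrable `[a1,u] (EFin \o (fun t=> `|gt t - g1 t|)).
 apply:(@int_piece _ a1 u _ (M + M));first exact:(measurable_funS measurableT).
 by move=> t _;rewrite normr_id (le_trans (ler_normB _ _))// lerD// ler_norml.
have Gclose t : a1 <= t <= b1 -> `|G0 t - \int[mu]_(x in `[a1,t]) gt x| <= e1.
 move=>/andP[h1 h2];rewrite /G0 -(ftcR (f:=G) h1 (fun x _=> dG x));last exact:wc_cts.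
 rewrite distrC -RintegralB//.
 apply:le_trans (le_normr_Rintegral _ _) _=>//;first exact:(integrableB (meas a1 t) (Igt t) (Ig1 t)).
 apply:le_trans hg1;apply:(@Rint_subset R `[a1,t]%classic `[a1,b1]%classic)=>//.
 by move=> x/=;rewrite !in_itv/= =>/andP[-> h3];exact:le_trans h2.
have lx2 t : a <= t <= b -> `|G0 t - l t| <= e1.
 move=>/[dup] tab /andP[h1 h2];have tI: a1 <= t <= b1 by apply/andP;split;lra.
 have:=Gclose t tI;rewrite -(Rint_restrict (B:=`[a,t]%classic)).
 - rewrite il// la add0r (_ : Rintegral mu `[a,t] gt = Rintegral mu `[a,t] g)//.
  by apply:eq_Rintegral=> x;rewrite inE/= in_itv/= =>/andP[h3 h4];apply:gin;rewrite h3 (le_trans h4).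
 - by move=> x/=;rewrite !in_itv/= =>/andP[h3 ->];rewrite andbT;lra.
 - by move=> x/=;rewrite !in_itv/= =>/andP[h3 h4] h5;apply:gout=>/andP[h6 _];apply:h5;rewrite h6 h4.
have lx1 t : a1 <= t -> t <= a -> `|G0 t| <= e1.
 move=> h1;rewrite le_eqVlt=>/predU1P[->|h2].
  by have:=lx2 a;rewrite lexx (ltW ab) la subr0=>/(_ isT).
 have tI: a1 <= t <= b1 by apply/andP;split;lra.
 have:=Gclose t tI;rewrite (_ : \int[mu]_(x in `[a1,t]) gt x = 0) ?subr0//.
 transitivity (\int[mu]_(x in `[a1,t]) (0 : R));last exact:(congr1 fine (integral0 mu _)).
 by apply:eq_Rintegral=> x;rewrite inE/= in_itv/= =>/andP[_ h3];apply:gout=>/andP[h4 _];have:=le_lt_trans (le_trans h4 h3) h2;rewrite ltxx.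
have lx3 t : b <= t -> t <= b1 -> `|G0 t| <= e1.
 move=> h1 h2;have tI: a1 <= t <= b1 by apply/andP;split;lra.
 have:=Gclose t tI;rewrite -(Rint_restrict (B:=`[a,b]%classic)).
 - have gI: \int[mu]_(x in `[a,b]) gt x = 0.
   have:=il b;rewrite lb la add0r (ltW ab) lexx=>/(_ isT) ->.
   by apply:eq_Rintegral=> x;rewrite inE/= in_itv/= => xI;exact:gin.
  by rewrite gI subr0.
 - by move=> x/=;rewrite !in_itv/= =>/andP[h3 h4];apply/andP;split;lra.
 - by move=> x/=;rewrite !in_itv/= =>/andP[h3 h4] h5;apply:gout=> h6;exact:h5.
(* Outside [a, b] the primitive [G0] is within [e1] of 0, because [l] vanishes at both ends; so the
   cutoff costs at most [B * e1] in the derivative. *)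
pose L t:=(1 - e) * (X t * G0 t).
have sL: smooth1 L.
 by move=> j;apply:S1M;[exact:S1_cst|apply:S1M;[exact:sX|apply:S1B;[exact:sG|exact:S1_cst]]].
have dL t : isd L t ((1 - e) * (derive1 X t * G0 t + X t * g1 t)).
 apply:der_eq.
  by apply:derM;[exact:derC|apply:derM;[exact:smooth1_isd|apply:derB;[exact:dG|exact:derC]]].
 by rewrite/=;ring.
have LE:=isd_derive1 dL.
have Labs t : `|L t| <= (1 - e) * `|G0 t|.
 have /andP[x0 x1]:=X01 t;rewrite normrM ger0_norm;last by rewrite subr_ge0 ltW.
 apply:ler_wpM2l;first by rewrite subr_ge0 ltW.
 by rewrite normrM (ger0_norm x0) ler_piMl.
have G0k t : a1 <= t <= b1 -> `|G0 t| <= k t + e1.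
 move=>/andP[h1 h2];have kt: 0 < k t by apply:circ_gt0;exact:lt_le_trans h1.
 have [h3|h3]:=leP t a;first by have:=lx1 t h1 h3;lra.
 have [h4|h4]:=leP b t;first by have:=lx3 t h4 h2;lra.
 have tI: a <= t <= b by rewrite !ltW.
 have:=lx2 t tI;have:=lk t tI;have:=ler_normD (G0 t - l t) (l t);rewrite subrK;lra.
have Lk t : a1 <= t <= b1 -> `|L t| <= (1 - e / 2) * k t.
 move=> tI;have /andP[h1 _]:=tI;apply:(le_trans (Labs t)).
 apply:(@bound_arith _ _ _ e1)=>//;[exact:G0k|exact:e1k|exact:ltW].
have e20: 0 < e / 2 by rewrite divr_gt0.
have e21: e / 2 < 1 by lra.
have La t : t <= a1 -> L t = 0 by move=> h1;rewrite /L Xa// mul0r mulr0.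
have Lb t : b1 <= t -> L t = 0 by move=> h1;rewrite /L Xb// mul0r mulr0.
have sc:=smooth_cal mA hc div_le a10 a1b1 sL La Lb e20 e21 Lk.
have X'G t : a1 <= t <= b1 -> `|derive1 X t * G0 t| <= B * e1.
 move=>/[dup] tI /andP[h1 h2];rewrite normrM.
 have [h3|h3]:=leP t a;first by apply:ler_pM=>//;[exact:hB|exact:lx1].
 have [h4|h4]:=leP b t;first by apply:ler_pM=>//;[exact:hB|exact:lx3].
 rewrite (@isd_cst_near _ X t 1) ?normr0 ?mul0r ?mulr_ge0 ?(ltW e10)//;first exact:smooth1_isd.
 near=> u;apply:X1;apply/andP;split;apply:ltW;near: u;[exact:lt_nbhsr|exact:lt_nbhsl].
have mL': mfun setT (derive1 L) by apply:cts_mfun;apply:smooth1_cts;exact:smooth1_der.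
have dclose t : a1 <= t <= b1 -> `|derive1 L t - (1 - e) * gt t| <= B * e1 + `|gt t - g1 t|.
 move=> tI;rewrite LE;have Xg: X t * gt t = gt t.
  by have [h1|/negP h1]:=boolP (a <= t <= b);[rewrite X1// mul1r|rewrite gout// mulr0].
 rewrite (_ : _ - _ = (1 - e) * (derive1 X t * G0 t + X t * (g1 t - gt t)));last by rewrite -{1}Xg;ring.
 have /andP[x0 x1]:=X01 t.
 rewrite normrM ger0_norm ?subr_ge0 ?(ltW e1')//.
 apply:(@le_trans _ _ (1 * `|derive1 X t * G0 t + X t * (g1 t - gt t)|)).
  by apply:ler_wpM2r=>//;lra.
 rewrite mul1r (le_trans (ler_normD _ _))// lerD ?X'G// normrM (ger0_norm x0) distrC ler_piMl//.
have [B' hB'] : exists B',forall t,a1 <= t <= b1 -> `|derive1 L t| <= B'.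
 exists (B * e1 + (M + M) + M)=> t tI;have:=dclose t tI.
 have n1:=ler_normD (derive1 L t - (1 - e) * gt t) ((1 - e) * gt t);rewrite subrK in n1.
 have n2: `|(1 - e) * gt t| <= M.
  rewrite normrM ger0_norm ?subr_ge0 ?(ltW e1')// (le_trans _ (gtM t))// ler_piMl//;lra.
 have n3: `|gt t - g1 t| <= M + M by rewrite (le_trans (ler_normB _ _))// lerD// ler_norml.
 by lra.
have IL':=int_m (measurable_funS measurableT (@subsetT _ `[a1,b1]%classic) mL') hB'.
have Igm:=int_m (measurable_funS measurableT (@subsetT _ `[a1,b1]%classic) mgt) (fun t _=> gtM t).
have Icst c : mu.-integrable `[a1,b1] (EFin \o (fun=> c)) by apply:(@int_piece _ a1 b1 _ `|c|).
have IK: mu.-integrable `[a1,b1] (EFin \o (fun t=> 2 * pi * (B * e1 + `|gt t - g1 t|))).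
 by apply:ZI;exact:(integrableD (meas a1 b1) (Icst (B * e1)) (Idf b1)).
have st1: (1 - e) * I - 2 * pi * (B * e1 * (b1 - a1) + e1) <= \int[mu]_(t in `[a1,b1]) (derive1 L t * m t).
 have IE: I = \int[mu]_(t in `[a1,b1]) (gt t * m t).
  rewrite -(Rint_restrict (B:=`[a,b]%classic)).
  - by apply:eq_Rintegral=> x;rewrite inE/= in_itv/= => xI;rewrite gin.
  - by move=> x/=;rewrite !in_itv/= =>/andP[h3 h4];apply/andP;split;lra.
  - by move=> x/=;rewrite !in_itv/= => _ h5;rewrite gout ?mul0r// => h6;exact:h5.
 have pp: 0 <= 2 * pi :> R by rewrite mulr_ge0// pi_ge0.
 apply:(@le_trans _ _ ((1 - e) * I - \int[mu]_(t in `[a1,b1]) (2 * pi * (B * e1 + `|gt t - g1 t|)))).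
  rewrite lerD2l lerN2 RintegralZl//;last exact:(integrableD (meas a1 b1) (Icst (B * e1)) (Idf b1)).
  apply:ler_wpM2l=>//.
  by rewrite (RintegralD (meas a1 b1) (Icst (B * e1)) (Idf b1)) Rcst ?(ltW a1b1)// lerD2l.
 rewrite IE -RintegralZl// -(RintegralB (meas a1 b1) (ZI (1 - e) Igm) IK).
 apply:le_Rintegral=>//;first exact:(integrableB (meas a1 b1) (ZI (1 - e) Igm) IK).
 move=> t;rewrite /= in_itv/= => tI;have:=dclose t tI;rewrite ler_norml=>/andP[h1 _].
 have /andP[m0 m1]:=slice_mass_bound mA t.
 have h2: - (B * e1 + `|gt t - g1 t|) * m t <= (derive1 L t - (1 - e) * gt t) * m t by apply:ler_wpM2r.
 have n0: 0 <= B * e1 + `|gt t - g1 t| by rewrite addr_ge0// mulr_ge0// ltW.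
 have h3: (B * e1 + `|gt t - g1 t|) * m t <= (B * e1 + `|gt t - g1 t|) * (2 * pi) by apply:ler_wpM2l.
 by lra.
have sub: `[a,b]%classic `<=` (`[a1,b1]%classic : set T).
 by move=> x/=;rewrite !in_itv/= =>/andP[h3 h4];rewrite (le_trans (ltW a1a) h3) (le_trans h4 (ltW bb1)).
have mLab u v : mfun (`[u,v]%classic : set T) L.
 by apply:(measurable_funS measurableT)=>//;apply:cts_mfun;exact:smooth1_cts.
have ILc:=int_latc a10 (mLab a1 b1);have ILab:=int_latc a0 (mLab a b);have Ilab:=int_latc a0 ml.
have st2: Y - d * s <= \int[mu]_(t in `[a1,b1]) (lateral h (L t) t * cut t).
 apply:(@le_trans _ _ (\int[mu]_(t in `[a,b]) (lateral h (L t) t * cut t)));last first.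
  apply:(@Rint_subset R `[a,b]%classic `[a1,b1]%classic)=>// t _.
  by have /andP[c0 _]:=cut01 t;rewrite mulr_ge0// lateral_ge0.
 have ->: d * s = \int[mu]_(t in `[a,b]) (expR (h b) * s) by rewrite Rcst ?(ltW ab)// /d;ring.
 have Ic: mu.-integrable `[a,b] (EFin \o (fun=> expR (h b) * s)) by apply:(@int_piece _ a b _ `|expR (h b) * s|).
 rewrite lerBlDr -(RintegralD (meas a b) ILab Ic);apply:le_Rintegral=>//;first exact:(integrableD (meas a b) ILab Ic).
 move=> t;rewrite /= in_itv/= =>/[dup] tI /andP[h1 h2];have t0: 0 < t by exact:lt_le_trans h1.
 have kt:=circ_gt0 h t0;have /andP[c0 c1]:=cut01 t.
 have LL: `|L t / k t| <= (1 - e) * (`|l t / k t| + e / 2).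
  rewrite (normrM (L t)) (normrM (l t)) !normfV (gtr0_norm kt) ler_pdivrMr// -mulrA (mulrDl _ (e / 2)) divfK ?gt_eqF//.
  apply:(le_trans (Labs t));apply:ler_wpM2l;first by rewrite subr_ge0 ltW.
  have n1:=ler_normD (G0 t - l t) (l t);rewrite subrK in n1.
  exact:(tri_arith n1 (lx2 t tI) (e1k t (le_trans (ltW a1a) h1))).
 have u1: `|l t / k t| <= 1 by rewrite normrM normfV (gtr0_norm kt) ler_pdivrMr// mul1r lk.
 have q:=sqrt_close (ltW s0) (ratio_close e0 e1' u1 LL).
 have q2: lateral h (l t) t <= lateral h (L t) t + expR (h b) * s.
  apply:(@le_trans _ _ (expR (h t) * (Num.sqrt (1 - (L t / k t) ^+ 2) + s)));first by rewrite ler_wpM2l ?expR_ge0.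
  by rewrite mulrDr lerD2l ler_wpM2r ?(ltW s0)// ler_expR hm.
 have q3: lateral h (l t) t * cut t <= (lateral h (L t) t + expR (h b) * s) * cut t by apply:ler_wpM2r.
 have q4: expR (h b) * s * cut t <= expR (h b) * s * 1 by apply:ler_wpM2l=>//;rewrite mulr_ge0 ?expR_ge0// ltW.
 by rewrite (le_trans q3)// mulrDl lerD2l (le_trans q4)// mulr1.
have e1s: e1 <= s by exact:le_trans es.
have c0: 0 <= b1 - a1 by rewrite subr_ge0 ltW.
exact:(final_arith sc st1 st2 es e1s (ltW e0) B0 c0 (@pi_ge0 R)).
Unshelve. all: by end_near. Qed.

Lemma cal_piece a b g l : 0 < a -> a < b -> piece k a b g l -> l a = 0 -> l b = 0 ->
  val h (fun t => m t / (2 * pi)) cut a b g l <= P / (2 * pi).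
Proof.
move=> a0 ab pl la lb;have [C hC]:=cal_eps a0 ab pl la lb.
have [mg ml [M gM] _ _]:=pl;have pi0: 0 < pi :> R by exact:pi_gt0.
have key: \int[mu]_(t in `[a,b]) (g t * m t) + 2 * (\int[mu]_(t in `[a,b]) (lateral h (l t) t * cut t)) <= P.
 apply/ler_addgt0Pr=> e e0;pose s:=Num.min (2^-1) (e / (`|C| + 1)).
 have C1: 0 < `|C| + 1 by rewrite ltr_wpDl.
 have s0: 0 < s by rewrite lt_min invr_gt0 ltr0n divr_gt0.
 have s1: s < 1 by rewrite gt_min invf_lt1// ltr1n.
 apply:le_trans (hC s s0 s1) _;rewrite lerD2l.
 have h1: s * (`|C| + 1) <= e by rewrite -ler_pdivlMr// ge_min lexx orbT.
 have h2: C * s <= `|C| * s by rewrite ler_wpM2r ?ler_norm// ltW.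
 by lra.
have e1: \int[mu]_(t in `[a,b]) (g t * (m t / (2 * pi))) = (2 * pi)^-1 * \int[mu]_(t in `[a,b]) (g t * m t).
 by rewrite -RintegralZl//;[apply:eq_Rintegral=> t _;ring|exact:int_m gM].
have e2: \int[mu]_(t in `[a,b]) (cut t * lateral h (l t) t) = \int[mu]_(t in `[a,b]) (lateral h (l t) t * cut t).
 by apply:eq_Rintegral=> t _;rewrite mulrC.
rewrite /val e1 e2 ler_pdivlMr ?mulr_gt0// (le_trans _ key)// le_eqVlt;apply/orP;left;apply/eqP.
have pn: pi != 0 :> R by rewrite gt_eqF.
exact:val_arith.
Qed.

End calibration.

(** * Ramps supported on a set of positive measure *)

Section ramp.
Context {R : realType}.
Notation T := (measurableTypeR R).
Notation mu := (@lebesgue_measure R).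
Implicit Types (s t x y c d e a b u : R) (G : set T).

(** A ramp from 0 to 1 that climbs only at points of [G], uniformly with respect to Lebesgue
    measure. *)
Definition frac G a t : R := fine (mu (G `&` `[a, t])) / fine (mu G).
Definition rampd G t : R := \1_G t / fine (mu G).

Lemma fin_sub G a b : measurable G -> G `<=` `[a, b]%classic -> (mu G < +oo)%E.
Proof.
move=> mG Gab;apply:(@le_lt_trans _ _ (mu `[a,b]%classic));last exact:mu_itv_fin.
by apply:le_measure;rewrite ?inE.
Qed.

Lemma ramp_props G a b : measurable G -> G `<=` `[a, b]%classic -> (0 < mu G)%E ->
  [/\ forall t, 0 <= frac G a t <= 1, frac G a a = 0, frac G a b = 1, mfun setT (frac G a) &
      forall t, \int[mu]_(s in `[a, t]) rampd G s = frac G a t].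
Proof.
move=> mG Gab G0;have Gf:=fin_sub mG Gab.
have Gfin: mu G \is a fin_num by rewrite ge0_fin_numE.
have g0: 0 < fine (mu G) by rewrite fine_gt0// G0.
have mGI t : measurable (G `&` `[a,t]%classic : set T) by exact:measurableI.
have finI t : mu (G `&` `[a,t]%classic) \is a fin_num.
 rewrite ge0_fin_numE// (le_lt_trans _ Gf)//;apply:le_measure;rewrite ?inE//;exact:subIsetl.
split.
- move=> t;rewrite divr_ge0 ?fine_ge0//= ler_pdivrMr// mul1r fine_le//.
 by apply:le_measure;rewrite ?inE//;exact:subIsetl.
- rewrite /frac (_ : mu _ = 0%E) ?mul0r//;apply/eqP;rewrite eq_le measure_ge0 andbT.
 apply:(@le_trans _ _ (mu [set a]));last by rewrite lebesgue_measure_set1.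
 by apply:le_measure;rewrite ?inE//;move=> x [_ /=];rewrite in_itv/= =>/le_anti.
- by rewrite /frac (_ : G `&` _ = G) ?divff ?gt_eqF//;apply/setIidPl.
- apply:nondecreasing_measurable=>// s t st;rewrite ler_pM2r ?invr_gt0// fine_le//.
 by apply:le_measure;rewrite ?inE//;apply:setIS=> x/=;rewrite !in_itv/= =>/andP[-> h1];exact:le_trans st.
- move=> t;rewrite /rampd /frac;under eq_Rintegral do rewrite mulrC.
 rewrite RintegralZl//;last first.
  by apply:(@bounded_int R `[a,t]%classic _ 1)=>//;[exact:mu_itv_fin|move=> x _;rewrite indicE;case:(x \in G);rewrite ?normr1 ?normr0].
 by rewrite mulrC;congr (_ * _);rewrite /Rintegral integral_indic.
Qed.

End ramp.

Lemma half_le_le0 {R : realType} (x y : R) : x * y <= y / 2 * x -> x * y <= 0.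
Proof. lra. Qed.

(** The run of true values ending just before [j], with what precedes it: the beginning, or a false
    value. *)
Lemma last_exit (F : nat -> bool) j : exists2 i, (i <= j)%N & (forall m, (i <= m < j)%N -> F m) /\ (i = 0%N \/ exists2 m, i = m.+1 & ~~ F m).
Proof.
elim:j=>[|j [i ij [Fi st]]];first by exists 0%N=>//;split;[move=> m;rewrite ltn0 andbF|left].
have [Fj|Fj]:=boolP (F j);last first.
 by exists j.+1=>//;split;[move=> m /andP[h1 h2];move: (leq_trans h2 h1);rewrite ltnn|right;exists j].
exists i;first exact:leqW.
by split=>// m /andP[h1];rewrite ltnS leq_eqVlt=>/predU1P[->//|h2];apply:Fi;rewrite h1.
Qed.

(** * Assembling blocks on a grid of radii *)

Section grid.
Context {R : realType}.
Notation T := (measurableTypeR R).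
Notation mu := (@lebesgue_measure R).
Implicit Types (s t x y c d e a b u : R) (g l : R -> R) (G : set T).
Variables (h h' w : R -> R).
Notation k := (circ h).
Hypothesis Hr : radial_profile h h' w.
Variables (al ph : R -> R).
Hypothesis mal : mfun setT al.
Hypothesis mph : mfun setT ph.
Hypothesis al01 : forall t, 0 <= al t <= 1.
Hypothesis ph01 : forall t, 0 <= ph t <= 1.
Hypothesis ph1 : forall t, 0 < al t < 1 -> ph t = 1.
Notation lat l a b := (\int[mu]_(t in `[a, b]) (ph t * lateral h (l t) t)).
Notation mass := (mass h al).
Notation val := (val h al ph).
(** A factor slightly above 1 that relaxes the bound on [l], since [k] varies inside a cell;
    [cal_scaled] pays for it. *)
Variable K : R.
Hypothesis K1 : 1 <= K.
Notation Kk := (fun t => K * k t).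
Let K0 : 0 < K. Proof. exact:lt_le_trans K1. Qed.
Let meas a b : measurable (`[a, b]%classic : set T). Proof. exact:measurable_itv. Qed.
Let kKk t : 0 <= t -> k t <= K * k t.
Proof. by move=> t0;rewrite ler_peMl// circ_ge0. Qed.

Lemma null2 (A B : set T) : measurable A -> measurable B -> mu A = 0%E -> mu B = 0%E -> mu (A `|` B) = 0%E.
Proof. by move=> mA mB A0 B0;rewrite measureU0. Qed.

Lemma lat_ge0 l a b : 0 <= pi^-1 * lat l a b.
Proof.
rewrite mulr_ge0 ?invr_ge0 ?pi_ge0//;apply:Rintegral_ge0=> t _;rewrite mulr_ge0 ?lateral_ge0//.
by have /andP[]:=ph01 t.
Qed.

Lemma piece_widen a b g l : 0 <= a -> piece k a b g l -> piece Kk a b g l.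
Proof.
move=> a0 [m1 m2 M i kl];split=>// t tI;apply:le_trans (kl t tI) _.
by apply:kKk;case/andP: tI=> h1 _;exact:le_trans h1.
Qed.

(* A two-sided ramp: up by J1 on G1 and up by J2 on G2. *)
Lemma ramp_piece a b (G1 G2 : set T) J1 J2 c : 0 < a -> a <= b ->
  measurable G1 -> G1 `<=` `[a, b]%classic -> (0 < mu G1)%E ->
  measurable G2 -> G2 `<=` `[a, b]%classic -> (0 < mu G2)%E ->
  (forall x y, 0 <= x <= 1 -> 0 <= y <= 1 -> `|c + J1 * x + J2 * y| <= K * k a) ->
  exists g l, [/\ piece Kk a b g l, l a = c, l b = c + J1 + J2 &
   \int[mu]_(t in `[a, b]) (g t * al t) =
    J1 * (\int[mu]_(t in `[a, b]) (rampd G1 t * al t)) + J2 * (\int[mu]_(t in `[a, b]) (rampd G2 t * al t))].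
Proof.
move=> a0 ab mG1 s1 p1 mG2 s2 p2 bnd.
have [f1 a1 b1 m1 i1]:=ramp_props mG1 s1 p1;have [f2 a2 b2 m2 i2]:=ramp_props mG2 s2 p2.
have mr (G : set T) : measurable G -> mfun setT (rampd G).
 by move=> mG;apply:measurable_funM=>//;exact:measurable_indic.
have br (G : set T) t : `|rampd G t| <= `|(fine (mu G))^-1|.
 by rewrite normrM ler_piMl// indicE;case:(t \in G);rewrite ?normr1 ?normr0.
have Ir (G : set T) t : measurable G -> mu.-integrable `[a,t] (EFin \o rampd G).
 move=> mG;apply:(@bounded_int R `[a,t]%classic _ `|(fine (mu G))^-1|)=>//;first exact:mu_itv_fin.
 exact:measurable_funS (mr _ mG).
have Ira (G : set T) : measurable G -> mu.-integrable `[a,b] (EFin \o (fun t=> rampd G t * al t)).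
 move=> mG;apply:(@bounded_int R `[a,b]%classic _ `|(fine (mu G))^-1|)=>//;first exact:mu_itv_fin.
  by apply:measurable_funM;[exact:measurable_funS (mr _ mG)|exact:measurable_funS mal].
 by move=> t _;have /andP[h1 h2]:=al01 t;rewrite normrM (ger0_norm h1) (le_trans _ (br G t))// ler_piMr.
have Iz (f : R -> R) J d : mu.-integrable `[a,d] (EFin \o f) -> mu.-integrable `[a,d] (EFin \o (fun t=> J * f t)).
 by move=> If;exact:(integrableZl (meas a d) J If).
have E (f1' f2' : R -> R) d : mu.-integrable `[a,d] (EFin \o f1') -> mu.-integrable `[a,d] (EFin \o f2') ->
  \int[mu]_(t in `[a,d]) (J1 * f1' t + J2 * f2' t) = J1 * (\int[mu]_(t in `[a,d]) f1' t) + J2 * \int[mu]_(t in `[a,d]) f2' t.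
 move=> I1 I2;rewrite (RintegralD (meas a d) (Iz _ J1 _ I1) (Iz _ J2 _ I2)).
 by congr (_ + _);rewrite RintegralZl.
pose l t:=c + J1 * frac G1 a t + J2 * frac G2 a t.
have la: l a = c by rewrite /l a1 a2;ring.
exists (fun t=> J1 * rampd G1 t + J2 * rampd G2 t),l;split=>//;last 2 first.
- by rewrite /l b1 b2 !mulr1.
- rewrite -(E _ _ _ (Ira _ mG1) (Ira _ mG2));apply:eq_Rintegral=> t _;ring.
split.
- by apply:(measurable_funS measurableT)=>//;apply:measurable_funD;apply:measurable_funM=>//;exact:mr.
- apply:(measurable_funS measurableT)=>//;apply:measurable_funD;last exact:measurable_funM.
 by apply:measurable_funD=>//;exact:measurable_funM.
- exists (`|J1| * `|(fine (mu G1))^-1| + `|J2| * `|(fine (mu G2))^-1|)=> t _.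
 by rewrite (le_trans (ler_normD _ _))// (normrM J1) (normrM J2);apply:lerD;apply:ler_wpM2l=>//;exact:(br _ t).
- by move=> t _;rewrite la (E _ _ _ (Ir _ t mG1) (Ir _ t mG2)) i1 i2 /l addrA.
- move=> t /andP[at_ _];apply:le_trans (bnd _ _ (f1 t) (f2 t)) _.
 by rewrite ler_pM2l// (circ_le Hr)// ltW.
Qed.

Lemma rampd_zero a b G : measurable G -> (forall t, G t -> al t = 0) -> \int[mu]_(t in `[a, b]) (rampd G t * al t) = 0.
Proof.
move=> mG G0;transitivity (\int[mu]_(t in `[a,b]) (0 : R));last exact:(congr1 fine (integral0 mu _)).
apply:eq_Rintegral=> t _;rewrite /rampd indicE;have [/set_mem/G0->|_]:=boolP (t \in G);first by rewrite mulr0.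
by rewrite !mul0r.
Qed.

Lemma rampd_ge a b G z : a <= b -> measurable G -> G `<=` `[a, b]%classic -> (0 < mu G)%E -> (forall t, G t -> z <= al t) ->
  z <= \int[mu]_(t in `[a, b]) (rampd G t * al t).
Proof.
move=> ab mG s1 p1 Gz;have [_ _ b1 _ i1]:=ramp_props mG s1 p1.
have Gf:=fin_sub mG s1;have g0: 0 < fine (mu G) by rewrite fine_gt0// p1.
have mr: mfun `[a,b] (rampd G) by apply:(measurable_funS measurableT)=>//;apply:measurable_funM=>//;exact:measurable_indic.
have br t : `|rampd G t| <= `|(fine (mu G))^-1|.
 by rewrite normrM ler_piMl// indicE;case:(t \in G);rewrite ?normr1 ?normr0.
have Ir: mu.-integrable `[a,b] (EFin \o rampd G) by apply:(@bounded_int R `[a,b]%classic _ _ (meas a b) (mu_itv_fin _ _ _ _) mr (fun t _=> br t)).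
have ->: z = \int[mu]_(t in `[a,b]) (z * rampd G t) by rewrite RintegralZl// i1 b1 mulr1.
apply:le_Rintegral=>//;first exact:(integrableZl (meas a b) z Ir).
 apply:(@bounded_int R `[a,b]%classic _ `|(fine (mu G))^-1|)=>//;first exact:mu_itv_fin.
  by apply:measurable_funM=>//;exact:measurable_funS mal.
 by move=> t _;have /andP[h1 h2]:=al01 t;rewrite normrM (ger0_norm h1) (le_trans _ (br t))// ler_piMr.
move=> t _;rewrite mulrC /rampd indicE;have [/set_mem Gt|_]:=boolP (t \in G);last by rewrite !mul0r.
by rewrite ler_wpM2l ?Gz// divr_ge0// ltW.
Qed.

Section cells.
Variables (xx : nat -> R) (n : nat) (eta : R).
Hypothesis xx0 : 0 < xx 0%N.
Hypothesis xxS : forall i, xx i.+1 = xx i + eta.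
Hypothesis eta0 : 0 < eta.
Hypothesis kS : forall i, (i < n)%N -> k (xx i.+1) <= K * k (xx i).
Hypothesis lt1 : forall i, (i < n)%N -> mu (`[xx i, xx i.+1] `&` [set t | al t = 1]) = 0%E.

Let zcell i : set T := `[xx i, xx i.+1] `&` [set t | al t = 0].
Let mal1 c : measurable ([set t | al t = c] : set T).
Proof.
have:=mal measurableT (measurable_set1 c);rewrite setTI.
by congr measurable;apply/seteqP;split.
Qed.
Let mz i : measurable (zcell i). Proof. by apply:measurableI. Qed.
(** Cells with almost no empty slice. As [lt1] excludes full slices, almost every slice in them is
    cut and the tangential term acts at full strength. *)
Let F i : bool := mu (zcell i) == 0%E.
Let massF j : R := \sum_(i < j | F i) mass (xx i) (xx i.+1).

Let massFS j : massF j.+1 = massF j + (if F j then mass (xx j) (xx j.+1) else 0).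
Proof. by rewrite /massF big_mkcond big_ord_recr/=;congr (_ + _);rewrite [RHS]big_mkcond. Qed.

Let xm i j : (i <= j)%N -> xx i <= xx j.
Proof. by elim:j=>[|j IH];[rewrite leqn0=>/eqP->|rewrite leq_eqVlt=>/predU1P[->//|/IH h1];rewrite xxS (le_trans h1)// lerDl ltW]. Qed.
Let xp i : 0 < xx i. Proof. by apply:lt_le_trans xx0 _;exact:xm. Qed.

Let run_full i j : (i <= j)%N -> (j <= n)%N -> (forall m, (i <= m < j)%N -> F m) ->
  full ph (xx i) (xx j) /\ massF j = massF i + mass (xx i) (xx j).
Proof.
elim:j=>[|j IH].
 rewrite leqn0=>/eqP-> _ _;split.
  rewrite /full;apply/eqP;rewrite eq_le measure_ge0 andbT.
  apply:(@le_trans _ _ (mu [set xx 0%N]));last by rewrite lebesgue_measure_set1.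
  have mN: measurable ([set t|ph t != 1] : set T).
   rewrite (_ : [set t|ph t != 1] = ~` (ph @^-1` [set 1])).
    by apply:measurableC;rewrite -[X in measurable X]setTI;exact:mph.
   by apply/seteqP;split=> t /= /eqP.
  by apply:le_measure;rewrite ?inE//;[exact:measurableI|move=> x [/=];rewrite in_itv/= =>/le_anti].
 have /andP[h1 h2]:=mass_le Hr mal al01 (ltW (xp 0)) (lexx (xx 0%N)).
 by rewrite subrr in h2;rewrite /massF big_ord0;lra.
have mN: measurable ([set t|ph t != 1] : set T).
 rewrite (_ : [set t|ph t != 1] = ~` (ph @^-1` [set 1])).
  by apply:measurableC;rewrite -[X in measurable X]setTI;exact:mph.
 by apply/seteqP;split=> t /= /eqP.
rewrite leq_eqVlt=>/predU1P[->|ij0] jn HF.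
 split;last first.
  have /andP[h1 h2]:=mass_le Hr mal al01 (ltW (xp j.+1)) (lexx (xx j.+1)).
  by rewrite subrr in h2;lra.
 rewrite /full;apply/eqP;rewrite eq_le measure_ge0 andbT.
 apply:(@le_trans _ _ (mu [set xx j.+1]));last by rewrite lebesgue_measure_set1.
 by apply:le_measure;rewrite ?inE//;[exact:measurableI|move=> x [/=];rewrite in_itv/= =>/le_anti].
have ij: (i <= j)%N by rewrite -ltnS.
have Fj: F j by apply:HF;rewrite ij ltnSn.
have [fl e]:=IH ij (ltnW jn) (fun m mI=> HF m (introT andP (conj (andP mI).1 (leqW (andP mI).2)))).
have xj: xx j <= xx j.+1 by exact:xm.
split;last first.
 by rewrite massFS Fj e (mass_cat Hr mal al01 (ltW (xp i)) (xm ij) xj);ring.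
rewrite /full;apply/eqP;rewrite eq_le measure_ge0 andbT.
apply:(@le_trans _ _ (mu ((`[xx i,xx j] `&` [set t|ph t != 1]) `|` (zcell j `|` (`[xx j,xx j.+1] `&` [set t|al t = 1]))))).
 apply:le_measure;rewrite ?inE;[exact:measurableI|by apply:measurableU;[exact:measurableI|apply:measurableU=>//;exact:measurableI]|].
 move=> t [/=];rewrite in_itv/= =>/andP[h1 h2] pt.
 have [h3|h3]:=leP t (xx j);first by left;split=>//=;rewrite in_itv/= h1.
 right;have /andP[a1 a2]:=al01 t;have cell: `[xx j,xx j.+1]%classic t by rewrite /= in_itv/= h2 (ltW h3).
 have [z0|z0]:=eqVneq (al t) 0;first by left.
 have [z1|z1]:=eqVneq (al t) 1;first by right.
 by move: pt;rewrite ph1 ?eqxx// !lt_neqAle a1 a2 eq_sym z0 z1.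
have m1:=measurableI _ _ (meas (xx j) (xx j.+1)) (mal1 1).
have m2:=measurableI _ _ (meas (xx i) (xx j)) mN.
by rewrite (null2 m2 (measurableU _ _ (mz j) m1) fl (null2 (mz j) m1 (eqP Fj) (lt1 jn))).
Qed.

Let mz0 i : ~~ F i -> (0 < mu (zcell i))%E.
Proof. by rewrite /F lt_def measure_ge0 andbT. Qed.

Let zsub i : zcell i `<=` `[xx i, xx i.+1]%classic. Proof. exact:subIsetl. Qed.

(** Strong induction over the maximal runs of cells in [F]. A run reaching back to the start is one
    [full_block]. Any other is preceded by a cell with empty slices, in which [l] falls to [- k] at
    no cost, and [float_block] recovers. The mass of cells outside [F] is dropped. *)
Lemma run_value j : (j <= n)%N -> exists y g l, [/\ xx 0%N <= y <= xx j, w y = w (xx 0%N) + massF j, piece Kk (xx 0%N) (xx j) g l,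
  0 <= l (xx 0%N) <= k (xx 0%N) & k y <= l (xx 0%N) + val (xx 0%N) (xx j) g l].
Proof.
elim/ltn_ind: j=> j IH jn;have [i ij [Fi st]]:=last_exit F j.
have [fl e]:=run_full ij jn Fi.
have mle a b : 0 < a -> a <= b -> 0 <= mass a b <= w b - w a by move=> a0 ab;exact:(mass_le Hr mal al01 (ltW a0) ab).
have exy a b V : 0 < a -> a <= b -> 0 <= V <= w b - w a -> exists2 y,a <= y <= b & w y = w a + V.
 move=> a0 ab /andP[V0 V1];apply:ivt=>//;first exact:(wc_w Hr (ltW a0)).
 by apply/andP;split;lra.
case:st=>[i0|[m im Fm]].
 subst i;have [y yI wy]:=exy _ _ _ (xp 0) (xm ij) (mle _ _ (xp 0) (xm ij)).
 have [g [l [pl l0 kv]]]:=full_block Hr mal mph al01 ph01 (xp 0) (xm ij) fl (andP yI).1 wy.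
 exists y,g,l;split=>//.
 - by rewrite wy e /massF big_ord0 add0r.
 - exact:piece_widen (ltW (xp 0)) pl.
 - rewrite l0/=;case:pl=> _ _ _ _ /(_ (xx 0%N));rewrite lexx xm// =>/(_ isT);exact:le_trans (ler_norm _).
subst i;have mj: (m < j)%N by [].
have [u [g [l [/andP[u1 u2] wu pl lk kv]]]]:=IH m mj (ltnW (leq_trans mj jn)).
have mF: massF m.+1 = massF m by rewrite massFS (negbTE Fm) addr0.
have mn: (m < n)%N by exact:leq_trans mj jn.
have km: 0 < k (xx m.+1) by exact:circ_gt0.
have lm: `|l (xx m)| <= K * k (xx m) by case:pl=> _ _ _ _;apply;rewrite xm// lexx.
(* [l] goes from its current value to [- k (xx m.+1)] on the empty slices of cell [m], where the
   product [g * al] is 0. The second ramp has height 0. *)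
have bd x y : 0 <= x <= 1 -> 0 <= y <= 1 -> `|l (xx m) + (- k (xx m.+1) - l (xx m)) * x + 0 * y| <= K * k (xx m).
 move=>/andP[x0 x1] _;rewrite mul0r addr0 (_ : _ + _ = l (xx m) * (1 - x) - k (xx m.+1) * x);last by ring.
 rewrite (le_trans (ler_normB _ _))// (normrM (l (xx m))) (normrM (k (xx m.+1))) (ger0_norm x0) (gtr0_norm km) [`|1 - x|]ger0_norm ?subr_ge0//.
 have:=kS mn;have : `|l (xx m)| * (1 - x) <= K * k (xx m) * (1 - x) by rewrite ler_wpM2r ?subr_ge0.
 by move=> h1 h2;have : k (xx m.+1) * x <= K * k (xx m) * x by [rewrite ler_wpM2r];lra.
have [g2 [l2 [p2 l2a l2b v2]]]:=ramp_piece (xp m) (xm (leqnSn m))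
  (mz m) (@zsub m) (mz0 Fm) (mz m) (@zsub m) (mz0 Fm) bd.
have {}v2 : \int[mu]_(t in `[xx m,xx m.+1]) (g2 t * al t) = 0.
 by rewrite v2 mul0r addr0 rampd_zero ?mulr0//;move=> t [].
have [pg vg]:=piece_glue Hr mal mph al01 ph01 (xp 0) (xm (leq0n m)) (xm (leqnSn m)) pl p2 (esym l2a).
set g3:=glue _ g g2 in pg vg;set l3:=glue _ l l2 in pg vg.
have l30: l3 (xx 0%N) = l (xx 0%N) by rewrite /l3 /glue xm.
have l3m: l3 (xx m.+1) = - k (xx m.+1).
 by rewrite /l3 /glue leNgt xxS ltrDl eta0 /= -xxS l2b;ring.
have v3: k u <= l3 (xx 0%N) + val (xx 0%N) (xx m.+1) g3 l3.
 by rewrite vg l30 /val v2;have:=lat_ge0 l2 (xx m) (xx m.+1);move: kv;rewrite /val;lra.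
have um: u <= xx m.+1 by rewrite (le_trans u2)// xm.
move: ij;rewrite leq_eqVlt=>/predU1P[ej|ij].
 exists u,g3,l3;rewrite -ej;split=>//;[by rewrite u1|by rewrite wu mF|by rewrite l30].
have xlt: xx m.+1 < xx j by apply:(@lt_le_trans _ _ (xx m.+2));[rewrite (xxS m.+1) ltrDl|exact:xm].
have u0: 0 < u by exact:lt_le_trans u1.
have /andP[V0 V1]:=mle _ _ (xp m.+1) (ltW xlt).
have wum: w u <= w (xx m.+1) by rewrite (w_le Hr)// ltW.
have [y /andP[y1 y2] wy]:=exy u (xx j) (mass (xx m.+1) (xx j)) u0 (le_trans um (ltW xlt)) ltac:(by apply/andP;split;lra).
have [g4 [l4 [p4 l4a v4]]]:=float_block Hr mal mph al01 ph01 (xp m.+1) xlt fl (ltW u0) um (le_trans (ltW u0) y1) wy.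
have [pg' vg']:=piece_glue Hr mal mph al01 ph01 (xp 0) (xm (leq0n m.+1)) (ltW xlt) pg (piece_widen (ltW (xp m.+1)) p4) (etrans l3m (esym l4a)).
exists y,(glue (xx m.+1) g3 g4),(glue (xx m.+1) l3 l4).
have l50: glue (xx m.+1) l3 l4 (xx 0%N) = l (xx 0%N) by rewrite {1}/glue xm.
split=>//.
- by rewrite (le_trans u1 y1).
- by rewrite wy wu e mF addrA.
- by rewrite l50.
by rewrite vg' l50;move: v3 v4;rewrite l30;lra.
Qed.

(** In a cell outside [F], [l] climbs by [k] where [al] is at least half its average and returns to
    0 on the empty slices for free. The gain is at least the mass of the cell over 2 K eta, so a
    calibration bound makes the mass outside [F] of order [eta]. *)
Lemma mixed_value j : (j <= n)%N -> exists g l, [/\ piece Kk (xx 0%N) (xx j) g l, l (xx 0%N) = 0, l (xx j) = 0 &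
  mass (xx 0%N) (xx j) - massF j <= 2 * K * eta * val (xx 0%N) (xx j) g l].
Proof.
elim:j=>[_|j IH jn].
 exists (fun=> 0),(fun=> 0);split=>//.
 - split=>//;[by exists 0=> t _;rewrite normr0|by move=> t _;rewrite add0r [RHS](congr1 fine (integral0 mu _))|].
  by move=> t /andP[h1 _];rewrite normr0 mulr_ge0 ?(ltW K0)// circ_ge0// (le_trans (ltW (xp 0))).
 - have /andP[h1 h2]:=mass_le Hr mal al01 (ltW (xp 0)) (lexx (xx 0%N));rewrite subrr in h2.
  rewrite /massF big_ord0 subr0 (le_trans h2)// !mulr_ge0 ?(ltW K0) ?(ltW eta0)//.
  rewrite addr_ge0 ?lat_ge0//;apply:Rintegral_ge0=> t _;by rewrite mul0r.
have [g [l [pl l0 lj vl]]]:=IH (ltnW jn).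
have xj: xx j <= xx j.+1 by exact:xm.
have K0e: 0 <= 2 * K * eta by rewrite !mulr_ge0 ?(ltW K0) ?(ltW eta0).
suff [g2 [l2 [p2 l2a l2b v2]]] : exists g2 l2,[/\ piece Kk (xx j) (xx j.+1) g2 l2,l2 (xx j) = 0,l2 (xx j.+1) = 0 &
  mass (xx j) (xx j.+1) - (if F j then mass (xx j) (xx j.+1) else 0) <= 2 * K * eta * val (xx j) (xx j.+1) g2 l2].
 have [pg vg]:=piece_glue Hr mal mph al01 ph01 (xp 0) (xm (leq0n j)) xj pl p2 (etrans lj (esym l2a)).
 exists (glue (xx j) g g2),(glue (xx j) l l2);split=>//.
 - by rewrite /glue xm.
 - by rewrite /glue leNgt xxS ltrDl eta0 /= -xxS.
 rewrite vg (mass_cat Hr mal al01 (ltW (xp 0)) (xm (leq0n j)) xj) massFS.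
 by rewrite [leRHS]mulrDr;move: vl v2;lra.
have [Fj|Fj]:=boolP (F j).
 exists (fun=> 0),(fun=> 0);split=>//.
  split=>//;[by exists 0=> t _;rewrite normr0|by move=> t _;rewrite add0r [RHS](congr1 fine (integral0 mu _))|].
  by move=> t /andP[h1 _];rewrite normr0 mulr_ge0 ?(ltW K0)// circ_ge0// (le_trans (ltW (xp j))).
 rewrite subrr mulr_ge0// addr_ge0 ?lat_ge0//;apply:Rintegral_ge0=> t _;by rewrite mul0r.
set avg:=(\int[mu]_(t in `[xx j,xx j.+1]) al t) / eta.
have Ial: mu.-integrable `[xx j,xx j.+1] (EFin \o al).
 apply:(@bounded_int R `[xx j,xx j.+1]%classic _ 1)=>//;[exact:mu_itv_fin|exact:measurable_funS mal|].
 by move=> t _;have /andP[h1 h2]:=al01 t;rewrite ger0_norm.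
have avg0: 0 <= avg.
 by rewrite divr_ge0 ?(ltW eta0)//;apply:Rintegral_ge0=> t _;have /andP[]:=al01 t.
have kxj: 0 < k (xx j) by exact:circ_gt0.
have kxj1: 0 < k (xx j.+1) by exact:circ_gt0.
have m_le: mass (xx j) (xx j.+1) <= K * k (xx j) * (eta * avg).
 have ->: eta * avg = \int[mu]_(t in `[xx j,xx j.+1]) al t by rewrite /avg mulrC divfK// gt_eqF.
 apply:(@le_trans _ _ (k (xx j.+1) * \int[mu]_(t in `[xx j,xx j.+1]) al t));last first.
  by rewrite ler_wpM2r ?kS//;apply:Rintegral_ge0=> t _;have /andP[]:=al01 t.
 rewrite -RintegralZl//;apply:le_Rintegral=>//;[exact:(mass_int Hr mal al01 _ (ltW (xp j)))|exact:(integrableZl (meas _ _) _ Ial)|].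
 move=> t;rewrite /= in_itv/= =>/andP[h1 h2];have /andP[h3 _]:=al01 t.
 by rewrite ler_wpM2r// (circ_le Hr)// (le_trans (ltW (xp j))).
pose H : set T:=`[xx j,xx j.+1] `&` [set t|avg / 2 <= al t].
have mH: measurable H.
 apply:measurableI=>//;have:=measurable_fun_ler (measurable_cst (avg / 2)) mal measurableT (Y:=[set true]) Logic.I.
 by rewrite setTI;congr measurable;apply/seteqP;split.
have mc: mu `[xx j,xx j.+1]%classic = eta%:E.
 by apply:(etrans (lebesgue_measure_itv _));rewrite /= lte_fin xxS ltrDl eta0 -EFinD;congr EFin;ring.
(* Otherwise [al] would be below half its average almost everywhere; the average would then be 0 and
   [H] the whole cell. *)
have H0: (0 < mu H)%E.
 rewrite lt_def measure_ge0 andbT;apply/eqP=> H0.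
 have h1: \int[mu]_(t in `[xx j,xx j.+1]) al t <= \int[mu]_(t in `[xx j,xx j.+1]) (avg / 2).
  have If: (\int[mu]_(t in `[xx j,xx j.+1]) (al t)%:E)%E \is a fin_num by exact:integrable_fin_num.
  have Ic: mu.-integrable `[xx j,xx j.+1] (EFin \o (fun=> avg / 2)).
   by apply:(@bounded_int R `[xx j,xx j.+1]%classic _ (avg / 2))=>//;[exact:mu_itv_fin|move=> t _;rewrite ger0_norm// divr_ge0].
  rewrite /Rintegral fine_le//;first exact:(integrable_fin_num (meas _ _) Ic).
  apply:ae_ge0_le_integral=>//.
  - by move=> t _;rewrite lee_fin;have /andP[]:=al01 t.
  - by apply/measurable_EFinP;exact:measurable_funS mal.
  - by move=> t _;rewrite lee_fin divr_ge0.
  exists H;split=>// t /= /not_implyP[tI];rewrite lee_fin=>/negP;rewrite -ltNge=>/ltW h2;by split.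
 have e1: \int[mu]_(t in `[xx j,xx j.+1]) al t = eta * avg by rewrite /avg mulrC divfK// gt_eqF.
 have e2: \int[mu]_(t in `[xx j,xx j.+1]) (avg / 2) = avg / 2 * eta.
  rewrite [LHS](_ : _ = \int[mu]_(t in `[xx j,xx j.+1]) cst (avg / 2) t)// Rintegral_cst//;congr (_ * _).
  exact:(congr1 fine mc).
 have a0: avg = 0.
  have : eta * avg <= 0 by rewrite e1 e2 in h1;exact:half_le_le0.
  by rewrite pmulr_rle0// => h2;apply/eqP;rewrite eq_le h2.
 have : mu H = mu `[xx j,xx j.+1]%classic.
  congr (mu _);apply/setIidPl=> t _/=;rewrite a0 mul0r;by have /andP[]:=al01 t.
 by rewrite H0 mc=>/esym/eqP;rewrite eqe gt_eqF.
have bd x y : 0 <= x <= 1 -> 0 <= y <= 1 -> `|0 + k (xx j) * x + (- k (xx j)) * y| <= K * k (xx j).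
 move=>/andP[x0 x1] /andP[y0 y1];rewrite add0r mulNr -mulrBr normrM (gtr0_norm kxj).
 have : `|x - y| <= 1 by rewrite ler_norml;apply/andP;split;lra.
 move=> h1;apply:(@le_trans _ _ (k (xx j)));first by rewrite ler_piMr// ltW.
 exact:kKk (ltW (xp j)).
have [g2 [l2 [p2 l2a l2b v2]]]:=ramp_piece (xp j) xj
  mH (@subIsetl _ _ _) H0 (mz j) (@zsub j) (mz0 Fj) bd.
exists g2,l2;split=>//;first by rewrite l2b;ring.
have r1:=rampd_ge xj mH (@subIsetl _ _ _) H0 (fun t Ht=> Ht.2).
have r2: \int[mu]_(t in `[xx j,xx j.+1]) (rampd (zcell j) t * al t) = 0 by apply:rampd_zero;[exact:mz|move=> t []].
rewrite subr0 (le_trans m_le)// (_ : K * k (xx j) * (eta * avg) = 2 * K * eta * (k (xx j) * (avg / 2)));last by field.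
rewrite ler_wpM2l// /val v2 r2 mulr0 addr0.
have : k (xx j) * (avg / 2) <= k (xx j) * (\int[mu]_(t in `[xx j,xx j.+1]) (rampd H t * al t)) by rewrite ler_pM2l.
by have:=lat_ge0 l2 (xx j) (xx j.+1);lra.
Qed.

End cells.
End grid.

Lemma end_ramp_arith {R : realType} (Km a i K ki L : R) : a * i <= K * ki * i -> K * (ki * i) <= Km -> 0 <= L ->
  - Km <= - a * i + L.
Proof. by move=> h1 h2 h3;lra. Qed.

Lemma total_arith {R : realType} (ky ky' e v1 v2 K p M : R) : ky <= ky' -> ky' - e <= v1 -> v1 + v2 <= K * p ->
  - (K * M) <= v2 -> ky <= K * (p + M) + e.
Proof. by move=> h1 h2 h3 h4;lra. Qed.

Lemma mid_arith {R : realType} (k c e i3 i L3 L : R) : k <= c + (i + L) -> c - e <= i3 -> 0 <= L3 ->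
  k - e <= i3 + L3 + (i + L).
Proof. by move=> h1 h2 h3;lra. Qed.

(** * The perimeter bound at a given level *)

Section level_bound.
Context {R : realType}.
Notation T := (measurableTypeR R).
Notation mu := (@lebesgue_measure R).
Implicit Types (s t x y c d e a b u : R) (g l : R -> R) (G : set T).
Variables (h h' w : R -> R).
Notation k := (circ h).
Hypothesis Hr : radial_profile h h' w.
Variables (al ph : R -> R).
Hypothesis mal : mfun setT al.
Hypothesis mph : mfun setT ph.
Hypothesis al01 : forall t, 0 <= al t <= 1.
Hypothesis ph01 : forall t, 0 <= ph t <= 1.
Hypothesis ph1 : forall t, 0 < al t < 1 -> ph t = 1.
Notation lat l a b := (\int[mu]_(t in `[a, b]) (ph t * lateral h (l t) t)).
Notation mass := (mass h al).
Notation val := (val h al ph).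
Variables p Tm : R.
Hypothesis cal : forall a b g l, 0 < a -> a < b -> b <= Tm -> piece k a b g l -> l a = 0 -> l b = 0 -> val a b g l <= p.
Let meas a b : measurable (`[a, b]%classic : set T). Proof. exact:measurable_itv. Qed.

(** Dividing [l] by [K] makes it admissible; the first term of [val] is divided by [K] and the
    lateral one can only increase. *)
Lemma cal_scaled K a b g l : 1 <= K -> 0 < a -> a < b -> b <= Tm -> piece (fun t => K * k t) a b g l ->
  l a = 0 -> l b = 0 -> val a b g l <= K * p.
Proof.
move=> K1 a0 ab bT [mg ml [M gM] il lk] la lb;have K0: 0 < K by exact:lt_le_trans K1.
have Ig:=int_piece mg gM;have Iga:=int_al mal al01 mg gM.
have ml': mfun `[a,b] (fun t=> K^-1 * l t) by apply:measurable_funM.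
have hl: piece k a b (fun t=> K^-1 * g t) (fun t=> K^-1 * l t).
 split=>//.
 - by apply:measurable_funM.
 - exists (K^-1 * M)=> t tI;rewrite normrM gtr0_norm ?invr_gt0//;apply:ler_wpM2l;[by rewrite invr_ge0 ltW|exact:gM].
 - move=> t tI;have /andP[h1 h2]:=tI;rewrite il// la add0r mulr0 add0r RintegralZl//.
  by apply:integrableS Ig=>// s/=;rewrite !in_itv/= =>/andP[-> h3];exact:le_trans h2.
 - by move=> t tI;rewrite normrM gtr0_norm ?invr_gt0// ler_pdivrMl// lk.
have:=cal a0 ab bT hl;rewrite la lb mulr0=>/(_ erefl erefl) c0.
rewrite -ler_pdivrMl//;apply:le_trans c0;rewrite /val mulrDr lerD//.
 rewrite -RintegralZl// le_eqVlt;apply/orP;left;apply/eqP;apply:eq_Rintegral=> t _;by rewrite mulrA.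
apply:(@le_trans _ _ (pi^-1 * lat l a b)).
 by rewrite ler_piMl ?(lat_ge0 h ph01)// invf_le1.
rewrite ler_wpM2l ?invr_ge0 ?pi_ge0//;apply:le_Rintegral=>//;[exact:(int_lat Hr mph ph01 a0 ml)|exact:(int_lat Hr mph ph01 a0 ml')|].
move=> t;rewrite /= in_itv/= =>/andP[h1 _];have /andP[p0 _]:=ph01 t.
rewrite ler_wpM2l// le_lateral//;first exact:lt_le_trans h1.
by rewrite normrM gtr0_norm ?invr_gt0// ler_piMl// invf_le1.
Qed.

Lemma circ_lip a b x d : 0 <= a -> a <= x -> 0 <= d -> x + d <= b -> k (x + d) - k x <= expR (h b) * (1 + b * h' b) * d.
Proof.
move=> a0 ax d0 xb;set Lp :=expR (h b) * (1 + b * h' b).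
have x0: 0 <= x by exact:le_trans ax.
suff : Lp * x - k x <= Lp * (x + d) - k (x + d) by lra.
have [dh h'm h'0 _]:=Hr.
apply:(der_le (f:=fun t=> Lp * t - k t) (f':=fun t=> Lp - expR (h t) * (1 + t * h' t))).
- by rewrite lerDl.
- apply:(within_der (f':=fun t=> Lp - expR (h t) * (1 + t * h' t)))=> t _;apply:der_eq.
  by apply:derB;[apply:derM;[exact:derC|exact:derI]|exact:(der_circ Hr)].
 by rewrite/=;ring.
- move=> t _;apply:der_eq.
  by apply:derB;[apply:derM;[exact:derC|exact:derI]|exact:(der_circ Hr)].
 by rewrite/=;ring.
move=> t /andP[xt txd];have tb: t <= b by rewrite (le_trans (ltW txd)).
have t0: 0 <= t by rewrite (le_trans x0)// ltW.
rewrite subr_ge0 ler_pM ?expR_ge0 ?ler_expR ?(h_le Hr)// ?addr_ge0 ?mulr_ge0//.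
by rewrite lerD2l ler_pM// h'm.
Qed.

(** The grid starts right after the last cell with full slices. On that cell [l] climbs from 0 at
    the best rate, and inside it the mass is at most the area. Beyond it [run_value] accounts for
    all but a negligible mass. On [T0, T0 + 1] [l] returns to 0, at a cost at most [K] times the
    mass there. *)
Lemma level_bound_eps T0 y e : 0 < T0 -> T0 + 1 <= Tm -> 0 <= y -> w y - w 0 < mass 0 T0 -> 0 <= p -> 0 < e -> e < 1 ->
  k y <= (1 + e) * (p + mass T0 (T0 + 1)) + e.
Proof.
move=> T00 TTm y0 wy p0 e0 e1;pose K:=1 + e;have K1: 1 <= K by rewrite lerDl ltW.
have K0: 0 < K by lra.
pose gam:=mass 0 T0 - (w y - w 0);have g0: 0 < gam by rewrite subr_gt0.
have ET:=expR_gt0 (h T0).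
(* If no cell has full slices, the grid starts at [del], where [k] is at most [e] and the reward of
   the initial climb can be given up. *)
pose del:=Num.min (T0 / 2) (e / expR (h T0)).
have del0: 0 < del by rewrite lt_min !divr_gt0.
have delT: del <= T0 / 2 by rewrite ge_min lexx.
have kdel: k del <= e.
 have h1: del <= e / expR (h T0) by rewrite ge_min lexx orbT.
 rewrite /circ;apply:(@le_trans _ _ (del * expR (h T0))).
  by rewrite ler_pM2l// ler_expR (h_le Hr)//;lra.
 by rewrite -ler_pdivlMr.
pose Lp :=expR (h T0) * (1 + T0 * h' T0).
have h'0: 0 <= h' T0 by case:Hr=> _ _ h0 _;exact:h0.
have Lp0: 0 < Lp by rewrite mulr_gt0// ltr_wpDr// mulr_ge0// ltW.
have kd2: 0 < k (del / 2) by rewrite circ_gt0// divr_gt0.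
(* Three demands on the mesh: the cell before the grid stays away from 0, [k] grows by a factor at
   most [K] over one cell, and the mass lost in the mixed cells is below the excess [gam]. *)
pose eta1:=Num.min (Num.min (del / 2) (e * k (del / 2) / Lp)) (gam / (8 * (p + 1))).
have p1: 0 < p + 1 by lra.
have eA: 0 < e * k (del / 2) / Lp by rewrite divr_gt0// mulr_gt0.
have eB: 0 < gam / (8 * (p + 1)) by rewrite divr_gt0// mulr_gt0.
have eta10: 0 < eta1 by rewrite !lt_min eA eB divr_gt0.
have [N N1] : exists N : nat,(T0 - del) / N.+1%:R <= eta1.
 exists (Num.truncn ((T0 - del) / eta1));rewrite ler_pdivrMr ?ltr0n// mulrC -ler_pdivrMr// ltW//.
 exact:truncnS_gt.
pose eta:=(T0 - del) / N.+1%:R;have eta0: 0 < eta by rewrite divr_gt0// subr_gt0;lra.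
move: N1;rewrite -/eta !le_min=>/andP[/andP[eta_d eta_k] eta_g].
pose z (i : nat):=del + i%:R * eta.
have zN: z N.+1 = T0 by rewrite /z /eta mulrC divfK ?pnatr_eq0//;ring.
have zS i : z i.+1 = z i + eta by rewrite /z -natr1;ring.
have zm i j : (i <= j)%N -> z i <= z j.
 by move=> ij;rewrite lerD2l ler_wpM2r ?(ltW eta0)// ler_nat.
have zd i : del <= z i by rewrite lerDl mulr_ge0// ltW.
have kK x : del / 2 <= x -> x + eta <= T0 -> k (x + eta) <= K * k x.
 move=> dx xT;have d20: 0 <= del / 2 by lra.
 have h1:=circ_lip d20 dx (ltW eta0) xT;rewrite -/Lp in h1.
 have h2: Lp * eta <= e * k (del / 2) by rewrite mulrC -ler_pdivlMr.
 have h3: e * k (del / 2) <= e * k x by rewrite ler_pM2l// (circ_le Hr).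
 by rewrite /K;lra.
pose cell1 i : set T:=`[z i,z i.+1] `&` [set t|al t = 1].
have mcell1 i : measurable (cell1 i).
 apply:measurableI=>//;have:=mal measurableT (measurable_set1 1);rewrite setTI.
 by congr measurable;apply/seteqP;split.
have [s sN [Fs st]]:=last_exit (fun i=> mu (cell1 i) == 0%E) N.+1.
pose xx i:=z (s + i)%N;pose n:=(N.+1 - s)%N.
have xxn: xx n = T0 by rewrite /xx /n subnKC// zN.
have xx00: 0 < xx 0%N by rewrite (lt_le_trans del0)// zd.
have xxS i : xx i.+1 = xx i + eta by rewrite /xx addnS zS.
have xxT i : (i <= n)%N -> xx i <= T0.
 by move=> h1;rewrite -zN zm//;move: h1;rewrite /n leq_subRL// => h1.
have kS i : (i < n)%N -> k (xx i.+1) <= K * k (xx i).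
 move=> h1;rewrite xxS;apply:kK;[|by rewrite -xxS xxT].
 by have:=zd (s + i)%N;rewrite -/(xx i);lra.
have lt1 i : (i < n)%N -> mu (`[xx i,xx i.+1] `&` [set t|al t = 1]) = 0%E.
 by move=> h1;have:=Fs (s + i)%N;rewrite leq_addr -addnS -leq_subRL// h1=>/(_ isT)/eqP;rewrite /cell1 /xx addnS.
have xx0T: xx 0%N <= T0 by exact:xxT.
have [y' [g [l [/andP[y1 y2] wy' pl /andP[l0 lk] kv]]]]:=run_value Hr mal mph al01 ph01 ph1 K1 xx00 xxS eta0 kS lt1 (leqnn n).
have [g2 [l2 [p2 l2a l2b v2]]]:=mixed_value Hr mal mph al01 ph01 K1 xx00 xxS eta0 kS (leqnn n).
rewrite xxn in y2 pl kv p2 l2b v2.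
set MF:=(X in w (xx 0%N) + X) in wy';rewrite -/MF in v2.
have mix: mass (xx 0%N) T0 - MF < gam.
 have [xT|xT]:=ltP (xx 0%N) T0.
  have T0m: T0 <= Tm by lra.
  have h1:=cal_scaled K1 xx00 xT T0m p2 l2a l2b.
  apply:(le_lt_trans v2).
  have KE: 0 <= 2 * K * eta by rewrite mulr_ge0 ?(ltW eta0)// mulr_ge0// ltW.
  have h2: 2 * K * eta * val (xx 0%N) T0 g2 l2 <= 2 * K * eta * (K * p) by apply:ler_wpM2l.
  apply:(le_lt_trans h2).
  have h3: eta * (8 * (p + 1)) <= gam by rewrite -ler_pdivlMr ?mulr_gt0.
  have h4: K * K * (eta * p) <= 4 * (eta * p).
   by rewrite ler_wpM2r ?mulr_ge0 ?(ltW eta0)// /K;nra.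
  by rewrite (_ : 2 * K * eta * (K * p) = 2 * (K * K * (eta * p)));[lra|ring].
 have /andP[h1 h2]:=mass_le Hr mal al01 (ltW T00) (lexx T0).
 have xe: xx 0%N = T0 by apply/eqP;rewrite eq_le xx0T.
 have MF0: 0 <= MF.
  apply:sumr_ge0=> i _;have a1: 0 <= xx i by exact:le_trans (ltW del0) (zd _).
  have a2: xx i <= xx i.+1 by rewrite xxS lerDl ltW.
  by have /andP[]:=mass_le Hr mal al01 a1 a2.
 by rewrite xe;lra.
(* Up to [xx 0] the mass is at most the area, and the mass dropped beyond is less than [gam]; so the
   radius reached is at least [y]. *)
have yy: y <= y'.
 rewrite -(w_leE Hr y0 (le_trans (ltW xx00) y1)).
 have h1:=mass_cat Hr mal al01 (lexx 0) (ltW xx00) xx0T.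
 have /andP[_ h2]:=mass_le Hr mal al01 (lexx 0) (ltW xx00).
 by move: mix;rewrite /gam wy';lra.
have x0e: 0 < xx 0%N - eta by have:=zd (s + 0)%N;rewrite -/(xx 0%N);lra.
have kx0: k (xx 0%N) <= K * k (xx 0%N - eta).
 have:=kK (xx 0%N - eta);rewrite subrK;apply=>//.
 by have:=zd (s + 0)%N;rewrite -/(xx 0%N);lra.
have x0x: xx 0%N - eta <= xx 0%N by lra.
set c:=l (xx 0%N) in l0 lk kv.
have bdc x u : 0 <= x <= 1 -> 0 <= u <= 1 -> `|0 + c * x + 0 * u| <= K * k (xx 0%N - eta).
 move=>/andP[a1 a2] _;rewrite mul0r addr0 add0r normrM !ger0_norm//.
 by apply:le_trans kx0;apply:le_trans lk;rewrite ler_piMr.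
have [g3 [l3 [p3 l3a l3b v3]]] : exists g3 l3,[/\ piece (fun t=> K * k t) (xx 0%N - eta) (xx 0%N) g3 l3,l3 (xx 0%N - eta) = 0,l3 (xx 0%N) = c &
  c - e <= \int[mu]_(t in `[(xx 0%N - eta)%R,xx 0%N]) (g3 t * al t)].
 case:st=>[s0|[m sm Sm]].
  pose G : set T:=`[(xx 0%N - eta)%R,xx 0%N]%classic.
  have G0: (0 < mu G)%E.
   by apply:(@lt_le_trans _ _ eta%:E);[rewrite lte_fin|rewrite [leRHS](lebesgue_measure_itv `[(xx 0%N - eta)%R,xx 0%N])/= lte_fin ltrBlDr ltrDl eta0 -EFinD lee_fin;lra].
  have mG: measurable G by exact:meas.
  have GG: G `<=` `[(xx 0%N - eta)%R,xx 0%N]%classic by [].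
  have [g3 [l3 [p3 l3a l3b v3]]]:=ramp_piece Hr mal al01 K1 x0e x0x mG GG G0 mG GG G0 bdc.
  exists g3,l3;split=>//;first by rewrite l3b;ring.
  apply:(@le_trans _ _ 0).
   have : k (xx 0%N) <= e by rewrite /xx s0 /z mul0r addr0.
   lra.
  rewrite v3 mul0r addr0 mulr_ge0//;apply:Rintegral_ge0=> t _;rewrite mulr_ge0//;last by have /andP[]:=al01 t.
  by rewrite divr_ge0// fine_ge0.
 have zx: z m = xx 0%N - eta by rewrite /xx addn0 sm zS addrK.
 have zx': z m.+1 = xx 0%N by rewrite /xx addn0 sm.
 have G0: (0 < mu (cell1 m))%E by rewrite lt_def measure_ge0 andbT.
 have Gs: cell1 m `<=` `[(xx 0%N - eta)%R,xx 0%N]%classic by rewrite -zx -zx';exact:subIsetl.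
 have [g3 [l3 [p3 l3a l3b v3]]]:=ramp_piece Hr mal al01 K1 x0e x0x (mcell1 m) Gs G0 (mcell1 m) Gs G0 bdc.
 exists g3,l3;split=>//;first by rewrite l3b;ring.
 rewrite v3 mul0r addr0.
 have h1:=rampd_ge mal al01 x0x (mcell1 m) Gs G0 (fun t Gt=> eq_ind_r (fun q=> 1 <= q) (lexx 1) (Gt.2 : al t = 1)).
 have : c * 1 <= c * (\int[mu]_(t in `[(xx 0%N - eta)%R,xx 0%N]) (rampd (cell1 m) t * al t)) by rewrite ler_wpM2l.
 lra.
have [p4 v4]:=piece_glue Hr mal mph al01 ph01 x0e x0x xx0T p3 pl l3b.
set g5:=glue _ g3 g in p4 v4;set l5:=glue _ l3 l in p4 v4.
have l5a: l5 (xx 0%N - eta) = 0 by rewrite /l5 /glue x0x.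
have v5: k y' - e <= val (xx 0%N - eta) T0 g5 l5.
 rewrite v4 /val;have q0:=lat_ge0 h ph01 l3 (xx 0%N - eta) (xx 0%N).
 exact:mid_arith kv v3 q0.
have TT: T0 <= T0 + 1 by rewrite lerDl.
pose G : set T:=`[T0,(T0 + 1)%R]%classic.
have G1: mu G = 1%:E by apply:(etrans (lebesgue_measure_itv `[T0,(T0 + 1)%R]));rewrite /= lte_fin ltrDl ltr01 -EFinD;congr EFin;ring.
have G0: (0 < mu G)%E by rewrite G1 lte_fin.
have xeT: xx 0%N - eta <= T0 by lra.
have lT: `|l5 T0| <= K * k T0 by case:p4=> _ _ _ _;apply;rewrite xeT lexx.
have bdT x u : 0 <= x <= 1 -> 0 <= u <= 1 -> `|l5 T0 + (- l5 T0) * x + 0 * u| <= K * k T0.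
 move=>/andP[a1 a2] _;rewrite mul0r addr0 (_ : _ + _ = l5 T0 * (1 - x));last by ring.
 rewrite normrM (le_trans _ lT)// ler_piMr// ger0_norm;lra.
have mG: measurable G by exact:meas.
have GG: G `<=` `[T0,(T0 + 1)%R]%classic by [].
have [g6 [l6 [p6 l6a l6b v6]]]:=ramp_piece Hr mal al01 K1 T00 TT mG GG G0 mG GG G0 bdT.
have [p7 v7]:=piece_glue Hr mal mph al01 ph01 x0e xeT TT p4 p6 (esym l6a).
have xT1: xx 0%N - eta < T0 + 1 by lra.
have h1:=cal_scaled K1 x0e xT1 TTm p7.
have {}h1 : val (xx 0%N - eta) T0 g5 l5 + val T0 (T0 + 1) g6 l6 <= K * p.
 rewrite -v7;apply:h1;first by rewrite {1}/glue xeT.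
 by rewrite {1}/glue leNgt ltrDl ltr01 /= l6b;ring.
have rI: \int[mu]_(t in `[T0,(T0 + 1)%R]) (rampd G t * al t) = \int[mu]_(t in `[T0,(T0 + 1)%R]) al t.
 apply:eq_Rintegral=> t tG;rewrite /rampd indicE (_ : t \in G)// G1 /= divr1 mul1r//.
have I0: 0 <= \int[mu]_(t in `[T0,(T0 + 1)%R]) al t by apply:Rintegral_ge0=> t _;have /andP[]:=al01 t.
have Ial: mu.-integrable `[T0,(T0 + 1)%R] (EFin \o al).
 apply:(@bounded_int R `[T0,(T0 + 1)%R]%classic _ 1)=>//;[exact:mu_itv_fin|exact:measurable_funS mal|].
 by move=> t _;have /andP[q1 q2]:=al01 t;rewrite ger0_norm.
have kI: k T0 * (\int[mu]_(t in `[T0,(T0 + 1)%R]) al t) <= mass T0 (T0 + 1).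
 rewrite -RintegralZl//;apply:le_Rintegral=>//;[exact:(integrableZl (meas _ _) _ Ial)|exact:(mass_int Hr mal al01 _ (ltW T00))|].
 move=> t;rewrite /= in_itv/= =>/andP[q1 q2];have /andP[q3 _]:=al01 t.
 by rewrite ler_wpM2r// (circ_le Hr)// ltW.
have v8: - (K * mass T0 (T0 + 1)) <= val T0 (T0 + 1) g6 l6.
 rewrite /val v6 rI mul0r addr0;have q0:=lat_ge0 h ph01 l6 T0 (T0 + 1).
 have q1: l5 T0 * (\int[mu]_(t in `[T0,(T0 + 1)%R]) al t) <= K * k T0 * (\int[mu]_(t in `[T0,(T0 + 1)%R]) al t).
  by rewrite ler_wpM2r// (le_trans (ler_norm _)).
 have q2: K * (k T0 * (\int[mu]_(t in `[T0,(T0 + 1)%R]) al t)) <= K * mass T0 (T0 + 1) by rewrite ler_pM2l.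
 exact:end_ramp_arith q1 q2 q0.
exact:total_arith (circ_le Hr y0 yy) v5 h1 v8.
Qed.

Lemma level_bound T0 y : 0 < T0 -> T0 + 1 <= Tm -> 0 <= y -> w y - w 0 < mass 0 T0 -> 0 <= p -> k y <= p + mass T0 (T0 + 1).
Proof.
move=> T00 TTm y0 wy p0;set A:=p + _;rewrite leNgt;apply/negP=> kA.
have A0: 0 <= A.
 have TT: T0 <= T0 + 1 by rewrite lerDl.
 by have /andP[h1 _]:=mass_le Hr mal al01 (ltW T00) TT;rewrite /A addr_ge0.
pose e:=Num.min (2^-1) ((k y - A) / (2 * (A + 1))).
have A1: 0 < A + 1 by lra.
have e0: 0 < e by rewrite lt_min invr_gt0 ltr0n divr_gt0 ?subr_gt0// mulr_gt0.
have e1: e < 1 by rewrite gt_min invf_lt1// ltr1n.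
have:=level_bound_eps T00 TTm y0 wy p0 e0 e1;rewrite -/A.
have : e * (2 * (A + 1)) <= k y - A by rewrite -ler_pdivlMr ?mulr_gt0// ge_min lexx orbT.
by lra.
Qed.

End level_bound.

(** In this form the dependence on [h] for a fixed [l] is visibly monotone. *)
Lemma lateral_sqrt {R : realType} (h : R -> R) (l t : R) : 0 < t ->
  lateral h l t = Num.sqrt (expR (h t) ^+ 2 - (l / t) ^+ 2).
Proof.
move=> t0;have E0:=expR_gt0 (h t).
have E: expR (h t) = Num.sqrt (expR (h t) ^+ 2) by rewrite sqrtr_sqr gtr0_norm.
rewrite /lateral {1}E -sqrtrM ?sqr_ge0//;congr Num.sqrt;rewrite /circ;field.
by rewrite !gt_eqF.
Qed.

(** * From convex to differentiable exponents *)

Section regularise.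
Context {R : realType}.
Notation T := (measurableTypeR R).
Notation mu := (@lebesgue_measure R).
Implicit Types (s t x y c d e a b u : R) (g l : R -> R).
Variable h0 : R -> R.
Hypothesis h0m : forall s t, 0 <= s -> s <= t -> h0 s <= h0 t.
Hypothesis h0c : forall a b q, 0 <= a -> 0 <= b -> 0 <= q <= 1 -> h0 (q * a + (1 - q) * b) <= q * h0 a + (1 - q) * h0 b.

(** The constant extension of a nondecreasing convex function is nondecreasing and convex on the
    whole line, where averages over [t, t + e] and two-sided derivatives make sense. *)
Definition ext t : R := h0 (Num.max t 0).
Notation h := ext.

Lemma ext_pos t : 0 <= t -> h t = h0 t.
Proof. by move=> t0;rewrite /ext;congr h0;apply/max_idPl. Qed.

Lemma ext_neg t : t <= 0 -> h t = h0 0.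
Proof. by move=> t0;rewrite /ext;congr h0;apply/max_idPr. Qed.

Lemma ext_le s t : s <= t -> h s <= h t.
Proof.
move=> st;apply:h0m;first by rewrite le_max lexx orbT.
by rewrite ge_max !le_max st lexx orbT.
Qed.

(** Convexity in the form that makes the derivative of the averaged exponent, a difference quotient,
    nondecreasing. *)
Lemma ext_incr s t e : 0 <= e -> s <= t -> h (s + e) - h s <= h (t + e) - h t.
Proof.
move=> e0 st.
have pos a b : 0 <= a -> a <= b -> h (a + e) - h a <= h (b + e) - h b.
 move=> a0 ab;have b0: 0 <= b by exact:le_trans ab.
 move: e0;rewrite le_eqVlt=>/predU1P[<-|e0];first by rewrite !addr0 !subrr.
 rewrite !ext_pos ?addr_ge0 ?(ltW e0)//.
 have D0: 0 < b + e - a by lra.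
 pose q:=e / (b + e - a).
 have qD: q * (b + e - a) = e by rewrite /q divfK// gt_eqF.
 have q0: 0 <= q by rewrite divr_ge0 ?(ltW e0)// ltW.
 have q1: q <= 1 by rewrite ler_pdivrMr// mul1r;lra.
 have be0: 0 <= b + e by lra.
 have c1:=h0c be0 a0 (introT andP (conj q0 q1));have c2:=h0c a0 be0 (introT andP (conj q0 q1)).
 rewrite (_ : q * (b + e) + (1 - q) * a = a + e) in c1;last by rewrite -[in RHS]qD;ring.
 rewrite (_ : q * a + (1 - q) * (b + e) = b) in c2;last by rewrite (_ : q * a + (1 - q) * (b + e) = b + e - q * (b + e - a));[rewrite qD addrK|ring].
 by lra.
have [s0|s0]:=leP 0 s;first exact:pos.
have [se|se]:=leP (s + e) 0.
 by rewrite !(ext_neg (t:=s + e))// (ext_neg (ltW s0)) subrr subr_ge0 ext_le// lerDl.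
rewrite (ext_neg (ltW s0));have [t0|t0]:=leP t 0.
 by rewrite (ext_neg t0) lerD2r ext_le// lerD2r.
apply:le_trans (pos 0 t (lexx _) (ltW t0));rewrite add0r [h 0]ext_neg// lerD2r ext_le//;lra.
Qed.

Lemma ext_lip m x y : x <= y -> y <= x + 1 -> x <= m -> h y - h x <= (h (m + 1) - h m) * (y - x).
Proof.
move=> xy y1 xm;have e0: 0 <= y - x by lra.
have h1:=ext_incr e0 xm;rewrite (_ : x + (y - x) = y) in h1;last by ring.
apply:(le_trans h1).
pose M:=Num.max m 0;have M0: 0 <= M by rewrite le_max lexx orbT.
have mM: m <= M by rewrite le_max lexx.
have [m0|m0]:=leP 0 m;last first.
 have [z0|z0]:=leP (m + (y - x)) 0.
  rewrite (ext_neg z0) (ext_neg (ltW m0)) subrr mulr_ge0// subr_ge0.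
  by rewrite -[h0 0](ext_neg (ltW m0)) ext_le// lerDl.
 have b0: 0 <= m + 1 by lra.
 have q1: 0 <= y - x <= 1 by apply/andP;split;lra.
 have c1:=h0c b0 (lexx 0) q1;rewrite mulr0 addr0 in c1.
 have h2: h (m + (y - x)) <= h0 ((y - x) * (m + 1)).
  rewrite ext_pos ?(ltW z0)//;apply:h0m;[exact:ltW|nra].
 rewrite (ext_neg (ltW m0)) (ext_pos b0);lra.
have b0: 0 <= m + 1 by lra.
have q1: 0 <= y - x <= 1 by apply/andP;split;lra.
have c1:=h0c b0 m0 q1.
rewrite (_ : (y - x) * (m + 1) + (1 - (y - x)) * m = m + (y - x)) in c1;last by ring.
have e1: h (m + (y - x)) = h0 (m + (y - x)) by rewrite ext_pos// addr_ge0.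
by rewrite e1 (ext_pos m0) (ext_pos b0);lra.
Qed.

Lemma ext_cts : continuous h.
Proof.
move=> x;set C:=h (x + 1 + 1) - h (x + 1).
have C0: 0 <= C by rewrite subr_ge0 ext_le// lerDl.
apply/cvgrPdist_lt=> e e0;apply/nbhs_ballP;exists (Num.min 1 (e / (C + 1)));first by rewrite /= lt_min ltr01 divr_gt0//;lra.
move=> y /= xy;have {}xy : `|x - y| < Num.min 1 (e / (C + 1)) by [].
move: xy;rewrite lt_min=>/andP[d1 d2].
have de: C * `|x - y| < e.
 have : `|x - y| * (C + 1) < e by rewrite -ltr_pdivlMr//;lra.
 have:=normr_ge0 (x - y);nra.
have [xy|yx]:=leP x y.
 have e1: `|h x - h y| = h y - h x by rewrite distrC ger0_norm// subr_ge0 ext_le.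
 have e2: `|x - y| = y - x by rewrite distrC ger0_norm// subr_ge0.
 rewrite e1 (le_lt_trans _ de)// e2 /C;apply:(@ext_lip (x + 1) x y)=>//;last by rewrite lerDl.
 by move: d1;rewrite e2;lra.
have e1: `|h x - h y| = h x - h y by rewrite ger0_norm// subr_ge0 ext_le// ltW.
have e2: `|x - y| = x - y by rewrite ger0_norm// subr_ge0 ltW.
rewrite e1 (le_lt_trans _ de)// e2 /C;apply:(@ext_lip (x + 1) y x);[exact:ltW| |lra].
by move: d1;rewrite e2;lra.
Qed.

(** The forward mean over a length [e] lies between [h t] and [h (t + e)], and its derivative is a
    difference quotient of [h], nonnegative and nondecreasing. The length is fixed by a Lipschitz
    constant of [h] on [0, m]. *)
Lemma regular_approx m d : 0 < m -> 0 < d -> exists hr hr' w, radial_profile hr hr' w /\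
  forall t, 0 <= t <= m -> h t <= hr t <= h t + d.
Proof.
move=> m0 d0;set C:=h (m + 1) - h m.
have C0: 0 <= C by rewrite subr_ge0 ext_le// lerDl.
pose e:=Num.min 1 (d / (C + 1)).
have C1: 0 < C + 1 by lra.
have e0: 0 < e by rewrite lt_min ltr01 divr_gt0.
have e1: e <= 1 by rewrite ge_min lexx.
have eC: C * e <= d.
 have : e * (C + 1) <= d by rewrite -ler_pdivlMr// ge_min lexx orbT.
 lra.
have [H dH]:=primitive ext_cts.
pose hr t:=(H (t + e) - H t) / e;pose hr' t:=(h (t + e) - h t) / e.
have dhr t : isd hr t (hr' t).
 apply:der_eq.
  apply:derM;last exact:derC.
  apply:derB;last exact:dH.
  by apply:(@der_comp _ H (fun t=> t + e));[apply:derD;[exact:derI|exact:derC]|exact:dH].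
 by rewrite /hr'/=;ring.
have ckr: continuous (circ hr).
 move=> t;apply:(@der_cts _ (circ hr) t (1 * expR (hr t) + t * (expR (hr t) * hr' t))).
 by apply:derM;[exact:derI|exact:der_expR].
have [w dw]:=exists_primitive (-1) ckr.
have bounds t : h t <= hr t <= h (t + e).
 have te: t <= t + e by rewrite lerDl ltW.
 have cH (f : R -> R) f' : (forall x,isd f x (f' x)) -> {within `[t,t + e],continuous f}.
  by move=> df;apply:(within_der (f':=f'))=> x _.
 apply/andP;split;rewrite /hr.
  rewrite ler_pdivlMr//.
  have d1 x : isd (fun x=> H x - h t * x) x (h x - h t).
   by apply:der_eq;[apply:derB;[exact:dH|apply:derM;[exact:derC|exact:derI]]|rewrite/=;ring].
  have pos1 x : t < x < t + e -> 0 <= h x - h t by move=>/andP[x1 _];rewrite subr_ge0 ext_le// ltW.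
  have:=der_le (f':=fun x=> h x - h t) te (cH _ _ d1) (fun x _=> d1 x) pos1;lra.
 rewrite ler_pdivrMr//.
 have d1 x : isd (fun x=> h (t + e) * x - H x) x (h (t + e) - h x).
  by apply:der_eq;[apply:derB;[apply:derM;[exact:derC|exact:derI]|exact:dH]|rewrite/=;ring].
 have pos1 x : t < x < t + e -> 0 <= h (t + e) - h x by move=>/andP[_ x1];rewrite subr_ge0 ext_le// ltW.
 have:=der_le (f':=fun x=> h (t + e) - h x) te (cH _ _ d1) (fun x _=> d1 x) pos1;lra.
exists hr,hr',w;split.
 split=>//.
 - by move=> s t st;rewrite ler_pM2r ?invr_gt0// ext_incr// ltW.
 - by move=> t;rewrite divr_ge0 ?(ltW e0)// subr_ge0 ext_le// lerDl ltW.
 - by move=> t t0;apply:dw;lra.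
move=> t /andP[t0 tm];have /andP[-> /= h1]:=bounds t;apply:(le_trans h1).
have te: t <= t + e by rewrite lerDl ltW.
have te1: t + e <= t + 1 by rewrite lerD2l.
have:=ext_lip te te1 tm;rewrite -/C (_ : t + e - t = e);last by ring.
by move=> h2;lra.
Qed.

Section transfer.
Variables (al ph : R -> R).
Hypothesis mal : mfun setT al.
Hypothesis mph : mfun setT ph.
Hypothesis al01 : forall t, 0 <= al t <= 1.
Hypothesis ph01 : forall t, 0 <= ph t <= 1.
Hypothesis ph1 : forall t, 0 < al t < 1 -> ph t = 1.
Notation k := (circ h).
Variable p : R.
Hypothesis p0 : 0 <= p.
Hypothesis cal : forall a b g l, 0 < a -> a < b -> piece k a b g l -> l a = 0 -> l b = 0 -> val h al ph a b g l <= p.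

Lemma k_cts : continuous k.
Proof.
by move=> t;apply:cvgM;[exact:cvg_id|apply:continuous_comp;[exact:ext_cts|exact:continuous_expR]].
Qed.

Let mlat a b l : 0 < a -> mfun `[a, b] l -> mfun `[a, b] (fun t => lateral h (l t) t).
Proof.
move=> a0 ml;have mk: mfun `[a,b] (fun t=>(k t)^-1).
 by apply:meas_itv_pos=>[|x x0];[exact:ltW|apply:cvgV;[rewrite gt_eqF// circ_gt0|exact:k_cts]].
have mg: mfun `[a,b] (fun t=> 1 - (l t / k t) ^+ 2).
 by apply:measurable_funB;[exact:measurable_cst|apply:measurable_funX;exact:measurable_funM].
apply:measurable_funM;last exact:(measurableT_comp (cts_mfun (@sqrt_continuous R)) mg).
by apply:meas_itv_pos=>[|x x0];[exact:ltW|apply:continuous_comp;[exact:ext_cts|exact:continuous_expR]].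
Qed.

(** Replacing [h] by [hr] multiplies [k] by a factor between 1 and [expR d] on [0, m]. The
    calibration bound is multiplied by [expR d] as well: a piece for [hr] divided by [expR d] is a
    piece for [h]. *)
Lemma level_eps m T0 y d : 0 < T0 -> T0 + 1 <= m -> 0 <= y -> y <= m -> 0 < d ->
  expR d * (\int[mu]_(t in `[0%R, y]) k t) < mass h al 0 T0 -> k y <= expR d * (p + mass h al T0 (T0 + 1)).
Proof.
move=> T00 Tm y0 ym d0 lt;have m0: 0 < m by lra.
have [hr [hr' [w [Hr hb]]]]:=regular_approx m0 d0.
have [dhr _ _ dw]:=Hr.
have Ed:=expR_gt0 d.
have kb t : 0 <= t <= m -> k t <= circ hr t <= expR d * k t.
 move=>/[dup] tI /andP[t0 tm];have /andP[h1 h2]:=hb t tI;rewrite ler_wpM2l ?ler_expR//=.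
 by rewrite /circ mulrCA ler_wpM2l// -expRD ler_expR addrC.
have ckr:=fun A=> @wc_circ R hr hr' w Hr A.
have mab a b : measurable (`[a,b]%classic : set T) by exact:measurable_itv.
have bnd (f : R -> R) a b : {within `[a,b],continuous f} -> mu.-integrable `[a,b] (EFin \o (fun t=> f t * al t)).
 move=> cf;have If:=cts_int cf;apply:(le_integrable (mab a b) _ _ If).
  by apply/measurable_EFinP;apply:measurable_funM;[case/integrableP: If=>/measurable_EFinP|exact:measurable_funS mal].
 by move=> t _/=;rewrite lee_fin;have /andP[a1 a2]:=al01 t;rewrite normrM (ger0_norm a1) ler_piMr.
have ck A : {within A,continuous k} by apply:wc_cts;exact:k_cts.
have Imass a b:=bnd k a b (ck _);have Imassr a b:=bnd (circ hr) a b (ckr _).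
have calr a b g l : 0 < a -> a < b -> b <= m -> piece (circ hr) a b g l -> l a = 0 -> l b = 0 -> val hr al ph a b g l <= expR d * p.
 move=> a0 ab bm [mg ml [M gM] il lk] la lb;pose q:=(expR d)^-1.
 have q0: 0 < q by rewrite invr_gt0.
 have Ig:=int_piece mg gM.
 have ml': mfun `[a,b] (fun t=> q * l t) by apply:measurable_funM.
 have hl: piece k a b (fun t=> q * g t) (fun t=> q * l t).
  split=>//.
  - by apply:measurable_funM.
  - by exists (q * M)=> t tI;rewrite normrM gtr0_norm//;apply:ler_wpM2l;[exact:ltW|exact:gM].
  - move=> t tI;have /andP[h1 h2]:=tI;rewrite il// la add0r mulr0 add0r RintegralZl//.
   by apply:integrableS Ig=>// s/=;rewrite !in_itv/= =>/andP[-> h3];exact:le_trans h2.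
  - move=> t tI;have /andP[h1 h2]:=tI;rewrite normrM gtr0_norm// ler_pdivrMl// (le_trans (lk t tI))//.
   by have /andP[_]:=kb t (introT andP (conj (le_trans (ltW a0) h1) (le_trans h2 bm))).
 have:=cal a0 ab hl;rewrite la lb mulr0=>/(_ erefl erefl) c0.
 rewrite -ler_pdivrMl//;apply:le_trans c0;rewrite /val mulrDr lerD//.
  rewrite -RintegralZl//;last exact:(int_al mal al01 mg gM).
  by rewrite le_eqVlt;apply/orP;left;apply/eqP;apply:eq_Rintegral=> t _;rewrite mulrA.
 have Ir:=int_lat Hr mph ph01 a0 ml.
 rewrite mulrCA ler_wpM2l ?invr_ge0 ?pi_ge0// -RintegralZl//;apply:le_Rintegral=>//.
 - exact:(integrableZl (mab a b) _ Ir).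
 - apply:(@int_piece _ a b _ (expR (h b))).
   by apply:measurable_funM;[exact:measurable_funS mph|exact:mlat].
  move=> t /andP[_ tb];have /andP[p1 p2]:=ph01 t.
  rewrite ger0_norm ?mulr_ge0 ?lateral_ge0// (le_trans _ (_ : expR (h t) <= _))// ?ler_expR ?ext_le//.
  by rewrite (le_trans _ (lateral_le h (q * l t) t))// ler_piMl// lateral_ge0.
 move=> t;rewrite /= in_itv/= =>/andP[h1 h2];have t0: 0 < t by exact:lt_le_trans h1.
 have /andP[p1 p2]:=ph01 t;rewrite mulrCA ler_wpM2l//.
 have tI: a <= t <= b by rewrite h1.
 have lt':=lk t tI;have tm: 0 <= t <= m by rewrite (ltW t0) (le_trans h2).
 have /andP[_ e2]:=hb t tm.
 have qA: q * expR (hr t) <= expR (h t) by rewrite /q ler_pdivrMl// -expRD ler_expR addrC.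
 have qE: q = Num.sqrt (q ^+ 2) by rewrite sqrtr_sqr gtr0_norm.
 rewrite -/q !lateral_sqrt// {1}qE -sqrtrM ?sqr_ge0// ler_wsqrtr//.
 have ->: (q * l t / t) ^+ 2 = q ^+ 2 * (l t / t) ^+ 2 by rewrite -exprMn mulrA.
 by rewrite mulrBr lerD2r -exprMn ler_pXn2r// nnegrE ?mulr_ge0 ?expR_ge0 ?(ltW q0).
have wy: w y - w 0 < mass hr al 0 T0.
 rewrite -(Rint_circ Hr (lexx 0) y0).
 apply:(@le_lt_trans _ _ (expR d * (\int[mu]_(t in `[0%R,y]) k t))).
  rewrite -RintegralZl//;last exact:cts_int.
  apply:le_Rintegral=>//;[exact:cts_int|exact:(integrableZl (mab _ _) _ (cts_int (ck _)))|].
  by move=> t;rewrite /= in_itv/= =>/andP[t0 ty];have /andP[_]:=kb t (introT andP (conj t0 (le_trans ty ym))).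
 apply:(lt_le_trans lt);apply:le_Rintegral=>// t;rewrite /= in_itv/= =>/andP[t0 tT].
 have /andP[a1 _]:=al01 t;rewrite ler_wpM2r//.
 have tm': t <= m by rewrite (le_trans tT)// (le_trans _ Tm)// lerDl.
 by have /andP[]:=kb t (introT andP (conj t0 tm')).
have pd0: 0 <= expR d * p by rewrite mulr_ge0// ltW.
have lb:=level_bound Hr mal mph al01 ph01 ph1 calr T00 Tm y0 wy pd0.
have /andP[ky _]:=kb y (introT andP (conj y0 ym)).
apply:(le_trans ky);apply:(le_trans lb);rewrite mulrDr lerD2l.
rewrite -RintegralZl//;apply:le_Rintegral=>//;first exact:(integrableZl (mab _ _) _ (Imass _ _)).
move=> t;rewrite /= in_itv/= =>/andP[t0 tT];have /andP[a1 _]:=al01 t;rewrite mulrA ler_wpM2r//.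
by have /andP[_]:=kb t (introT andP (conj (le_trans (ltW T00) t0) (le_trans tT Tm))).
Qed.

Lemma level T0 y : 0 < T0 -> 0 <= y -> \int[mu]_(t in `[0%R, y]) k t < mass h al 0 T0 ->
  k y <= p + mass h al T0 (T0 + 1).
Proof.
move=> T00 y0 lt;pose m:=Num.max (T0 + 1) y.
have Tm: T0 + 1 <= m by rewrite le_max lexx.
have ym: y <= m by rewrite le_max lexx orbT.
set I:=Rintegral _ _ _ in lt;set M:=mass h al 0 T0 in lt *;set A:=p + _.
have I0: 0 <= I by apply:Rintegral_ge0=> t;rewrite /= in_itv/= =>/andP[t0 _];exact:circ_ge0.
have A0: 0 <= A.
 rewrite addr_ge0//;apply:Rintegral_ge0=> t;rewrite /= in_itv/= =>/andP[t0 _].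
 by have /andP[a1 _]:=al01 t;rewrite mulr_ge0// circ_ge0// (le_trans (ltW T00)).
rewrite leNgt;apply/negP=> kA.
have c1: {for 0,continuous (fun d : R=> expR d * I)} by apply:cvgM;[exact:continuous_expR|exact:cvg_cst].
have c2: {for 0,continuous (fun d : R=> expR d * A)} by apply:cvgM;[exact:continuous_expR|exact:cvg_cst].
have n1: \forall d \near (0 : R),expR d * I < M by apply:(c1 _ (lt_nbhsl _));rewrite expR0 mul1r.
have n2: \forall d \near (0 : R),expR d * A < k y by apply:(c2 _ (lt_nbhsl _));rewrite expR0 mul1r.
have /nbhs_ballP[r /= r0 br] : \forall d \near (0 : R),expR d * I < M /\ expR d * A < k y by near do split.
have []:=br (r / 2);first by rewrite /ball/= sub0r normrN ger0_norm ?divr_ge0 ?(ltW r0)//;lra.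
have d0: 0 < r / 2 by rewrite divr_gt0.
move=> q1 q2;have:=level_eps T00 Tm y0 ym d0 q1;rewrite -/A;lra.
Unshelve. all: by end_near. Qed.

End transfer.
End regularise.

(** * Slices of a disc *)

Section ball_slice.
Context {R : realType}.
Notation mu := (@lebesgue_measure R).
Notation m := (@leb2_borel R).
Notation T := (measurableTypeR R).
Notation P := (plane R).
Variable r : R.
Hypothesis r0 : 0 < r.

(** For [|y| >= r] the root is 0 by convention: the chord is empty, but its graph continues along
    the axis. *)
Definition half_chord (y : R) : R := Num.sqrt (r ^+ 2 - y ^+ 2).
Notation hc := half_chord.

Lemma cts_half_chord : continuous hc.
Proof.
move=> y;apply:continuous_comp;last exact:sqrt_continuous.
by apply:cvgB;[exact:cvg_cst|rewrite expr2;under eq_fun do rewrite expr2;apply:cvgM;exact:cvg_id].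
Qed.

Lemma half_chord_ge0 y : 0 <= hc y. Proof. exact:sqrtr_ge0. Qed.

Lemma half_chord_out y : r <= `|y| -> hc y = 0.
Proof.
move=> ry;apply:ler0_sqrtr;rewrite subr_le0 -[y ^+ 2]real_normK ?num_real//.
by rewrite ler_sqr ?nnegrE ?(ltW r0).
Qed.

Lemma half_chord_lt x y : (`|x| < hc y) = (Num.sqrt (x ^+ 2 + y ^+ 2) < r).
Proof.
have e: r = Num.sqrt (r ^+ 2) by rewrite sqrtr_sqr gtr0_norm.
rewrite -[`|x|]sqrtr_sqr [in RHS]e ltr_sqrt ?exprn_gt0// -ltrBrDr /half_chord.
have [h|h]:=ltP 0 (r ^+ 2 - y ^+ 2);first by rewrite ltr_sqrt.
rewrite (ler0_sqrtr h) ltNge sqrtr_ge0/=;apply/esym/negbTE;rewrite -leNgt.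
by rewrite (le_trans h)// sqr_ge0.
Qed.

Lemma slice_ftc (u u' : R -> R) s : 0 <= s -> (forall x, isd u x (u' x)) -> continuous u' ->
  \int[mu]_x ((`|x| < s)%R%:R * u' x) = u s - u (- s).
Proof.
move=> s0 du cu;have ss: - s <= s by rewrite (le_trans _ s0)// oppr_le0.
have wc: {within `[- s,s],continuous u'} by exact:wc_cts.
rewrite -(ftcR ss (fun x _=> du x) wc).
have ic:=cts_int wc.
have io: mu.-integrable `](- s)%R,s[ (EFin \o u').
 by apply:(integrableS _ _ _ ic)=>//;exact:subset_itv_oo_cc.
have ico: mu.-integrable `](- s)%R,s] (EFin \o u').
 by apply:(integrableS _ _ _ ic)=>//;exact:subset_itv_oc_cc.
rewrite -(Rintegral_itv_obnd_cbnd ico) -(Rintegral_itv_bndo_bndc io) [RHS]Rintegral_mkcond.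
apply:eq_Rintegral=> x _;rewrite patchE mem_setE in_itv/= -ltr_norml.
by case:ifP=> h;rewrite ?mul1r ?mul0r.
Qed.

End ball_slice.

(** * Integrals of partial derivatives over a disc *)

Section ball_fubini.
Context {R : realType}.
Notation mu := (@lebesgue_measure R).
Notation m := (@leb2_borel R).
Notation T := (measurableTypeR R).
Notation P := (plane R).
Variable r : R.
Hypothesis r0 : 0 < r.
Notation hc := (half_chord r).

Let ball_in x : centred_ball r x -> plane_box r x.
Proof.
move=> h;apply/plane_boxP;split;apply:le_trans (ltW h);rewrite -sqrtr_sqr ler_wsqrtr//.
 by rewrite lerDl sqr_ge0.
by rewrite lerDr sqr_ge0.
Qed.

Lemma measurable_ball : measurable (centred_ball r : set P).
Proof. by apply:measurable_ltr;apply:cts_plane_measurable;exact:cts_enorm. Qed.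

Lemma ball_Rint_fubini (G : R * R -> R) : continuous G ->
  \int[leb2]_x (\1_(centred_ball r) x * G x) = \int[mu]_y (\int[mu]_x ((`|x| < hc y)%R%:R * G (x, y))) /\
  \int[leb2]_x (\1_(centred_ball r) x * G x) = \int[mu]_x (\int[mu]_y ((`|y| < hc x)%R%:R * G (x, y))).
Proof.
move=> cG;have mG:=cts_plane_measurable cG.
have mB:=measurable_ball;have mB':=borel_leb2_measurable mB.
have sub0 (A : set P) : A `<=` A `|` set0 by move=> x;left.
have e1:=@Rintegral_repr R (centred_ball r) (centred_ball r) set0 mB' mB measurable0 (measure0 m) (@sub0 _) (@sub0 _) G mG.
have [K hK] : exists K,forall x,plane_box r x -> `|G x| <= K.
 have : compact (G @` (plane_box r : set (R * R))).
  by apply:continuous_compact;[exact:wc_cts|exact:compact_box].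
 move=>/compact_bounded[K [rK hK]];exists (`|K| + 1)=> x xb.
 have K1: K < `|K| + 1 by rewrite (le_lt_trans (ler_norm _))// ltrDl.
 by apply:(hK _ K1);exists x.
pose W x:=\1_(centred_ball r) x * G x.
have mW: mfun (setT : set P) W.
 by apply:measurable_funM=>//;apply:measurable_indic;exact:mB.
have WK x : `|W x| <= `|K|.
 rewrite /W indicE;case:(boolP (x \in _))=> h;rewrite ?mul0r ?normr0// mul1r.
 by rewrite (le_trans (hK x _)) ?ler_norm//;apply:ball_in;rewrite inE in h.
have W0 x : ~ plane_box r x -> W x = 0.
 move=> h;rewrite /W indicE;case:(boolP (x \in _))=> h2;rewrite ?mul0r//.
 by exfalso;apply:h;apply:ball_in;rewrite inE in h2.
have iW:=integrable_box_supp mW WK W0.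
have e2: \int[leb2]_x (\1_(centred_ball r) x * G x) = \int[m]_x W x.
 rewrite e1 Rintegral_mkcond;apply:eq_Rintegral=> x _.
 by rewrite patchE /W indicE;case:(boolP (x \in _))=> _;rewrite ?mul1r ?mul0r.
have W2 x y : W (x,y) = (`|x| < hc y)%R%:R * G (x,y).
 have hb: ((x,y) \in centred_ball r) = (`|x| < hc y) by rewrite (half_chord_lt r0);apply/idP/idP;rewrite inE.
 by rewrite /W indicE hb.
have W1 x y : W (x,y) = (`|y| < hc x)%R%:R * G (x,y).
 by rewrite W2 !(half_chord_lt r0) addrC.
have f1:=fubini1 iW;have f2:=fubini2 iW.
have sl (w : T -> R) : mfun setT w -> (forall x,`|w x| <= `|K|) -> (forall x,~~ (`|x| <= r) -> w x = 0) ->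
  mu.-integrable setT (EFin \o w).
 move=> mw wK w0;have h: mu.-integrable `[- r,r] (EFin \o w).
  by apply:(@int_piece _ (- r) r _ `|K|)=>//;exact:measurable_funTS.
 have ->: EFin \o w = (EFin \o w) \_ `[- r,r].
  apply/funext=> x;rewrite patchE /= mem_setE in_itv/= -ler_norml.
  by case:ifPn=>// /w0 ->.
 by apply/(integrable_mkcond _ _).1=>//;exact:measurable_itv.
rewrite e2;split;rewrite /Rintegral;congr fine.
 rewrite -f2;apply:eq_integral=> y _;rewrite /fubini_G/=.
 rewrite -[LHS]fineK;first by congr EFin;apply:eq_Rintegral=> x _;rewrite W2.
 apply:(integrable_fin_num measurableT);apply:sl=>[|x|x h];first exact:(measurable_fun_pair1 y mW).
  exact:WK.
 by apply:W0=>/plane_boxP[/= h1 _];rewrite h1 in h.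
rewrite -f1;apply:eq_integral=> y _;rewrite /fubini_F/=.
rewrite -[LHS]fineK;first by congr EFin;apply:eq_Rintegral=> x _;rewrite W1.
apply:(integrable_fin_num measurableT);apply:sl=>[|x|x h];first exact:(measurable_fun_pair2 y mW).
 exact:WK.
by apply:W0=>/plane_boxP[/= _ h1];rewrite h1 in h.
Qed.

Let cts_pair (a b : R -> R) : continuous a -> continuous b -> continuous (fun y => (a y, b y)).
Proof. by move=> ca cb y;exact:(cvg_pair (ca y) (cb y)). Qed.

Let cid : continuous (fun y : R => y). Proof. by move=> y;exact:cvg_id. Qed.
Let ccst (z : R) : continuous (fun y : R => z). Proof. by move=> y;exact:cvg_cst. Qed.

Let cts1 (G : R * R -> R) (y : R) : continuous G -> continuous (fun x : R => G (x, y)).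
Proof.
have h: continuous (fun x : R=>(x,y)):=@cts_pair (fun x=> x) (fun=> y) cid (@ccst y).
by move=> cG x;apply:(continuous_comp (h x));exact:cG.
Qed.

Let cts2 (G : R * R -> R) (y : R) : continuous G -> continuous (fun x : R => G (y, x)).
Proof.
have h: continuous (fun x : R=>(y,x)):=@cts_pair (fun=> y) (fun x=> x) (@ccst y) cid.
by move=> cG x;apply:(continuous_comp (h x));exact:cG.
Qed.

Lemma ball_partial1 phi : test_function phi ->
  \int[leb2]_x (\1_(centred_ball r) x * partial1 phi x) =
  \int[mu]_y (phi (hc y, y) - phi (- hc y, y)).
Proof.
move=>[k _];have cp: continuous (partial1 phi) by apply:(@Ck_cts _ 0);case:(k 1%N)=> _ [_ _ []].
have [-> _]:=ball_Rint_fubini cp.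
apply:eq_Rintegral=> y _.
apply:(@slice_ftc R (fun x=> phi (x,y)) (fun x=> partial1 phi (x,y)))=>//.
- exact:half_chord_ge0.
- by move=> x;exact:(Ck_pd1 (x,y) (k 1%N)).
- exact:cts1.
Qed.

Lemma ball_partial2 phi : test_function phi ->
  \int[leb2]_x (\1_(centred_ball r) x * partial2 phi x) =
  \int[mu]_x (phi (x, hc x) - phi (x, - hc x)).
Proof.
move=>[k _];have cp: continuous (partial2 phi) by apply:(@Ck_cts _ 0);case:(k 1%N)=> _ [_ _ _ []].
have [_ ->]:=ball_Rint_fubini cp.
apply:eq_Rintegral=> x _.
apply:(@slice_ftc R (fun y=> phi (x,y)) (fun y=> partial2 phi (x,y)))=>//.
- exact:half_chord_ge0.
- by move=> y;exact:(Ck_pd2 (x,y) (k 1%N)).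
- exact:cts2.
Qed.

End ball_fubini.

(** * From chords to integrals over the angle *)

Section chords.
Context {R : realType}.
Notation mu := (@lebesgue_measure R).
Notation m := (@leb2_borel R).
Notation T := (measurableTypeR R).
Notation P := (plane R).
Variable r : R.
Hypothesis r0 : 0 < r.
Notation hc := (half_chord r).

Let sub_chord (phi : R * R -> R) (psi : R -> R) :
  (forall y, r <= `|y| -> psi y = 0) -> \int[mu]_y psi y = \int[mu]_(y in `[- r, r]) psi y.
Proof.
move=> h;rewrite [RHS]Rintegral_mkcond;apply:eq_Rintegral=> y _;rewrite patchE mem_setE in_itv/= -ler_norml.
by case:ifPn=>//;rewrite -ltNge=>/ltW /h.
Qed.

Notation pi := (@pi R).

Let sin_half (x : R) : r * sin x = r * sin x -> hc (r * sin x) = r * `|cos x|.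
Proof.
move=> _;rewrite /half_chord exprMn -{1}[r ^+ 2]mulr1 -mulrBr -(cos2Dsin2 x) addrK -exprMn sqrtr_sqr normrM gtr0_norm//.
Qed.

Let cos_half (x : R) : hc (r * cos x) = r * `|sin x|.
Proof.
by rewrite /half_chord exprMn -{1}[r ^+ 2]mulr1 -mulrBr -(cos2Dsin2 x) addrAC subrr add0r -exprMn sqrtr_sqr normrM gtr0_norm.
Qed.

Let pi0 : 0 < pi. Proof. exact:pi_gt0. Qed.

Let cts_pair (a b : R -> R) : continuous a -> continuous b -> continuous (fun y => (a y, b y)).
Proof. by move=> ca cb y;exact:(cvg_pair (ca y) (cb y)). Qed.

Let subst (F psi a a' : R -> R) lo hi : lo <= hi -> (forall x, isd F x (psi x)) ->
  (forall x, isd a x (a' x)) -> continuous a' -> continuous psi ->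
  \int[mu]_(x in `[lo, hi]) (psi (a x) * a' x) = F (a hi) - F (a lo).
Proof.
move=> lh dF da ca' cpsi;apply:(@ftcR _ (fun x=> F (a x)) (fun x=> psi (a x) * a' x))=>//.
 by move=> x _;apply:(@der_comp _ F a).
apply:wc_cts=> x;apply:cvgM;last exact:ca'.
by apply:continuous_comp;[exact:(der_cts (da x))|exact:cpsi].
Qed.

Let cat3 (f : R -> R) a b c d : a <= b -> b <= c -> c <= d -> continuous f ->
  \int[mu]_(x in `[a, d]) f x = \int[mu]_(x in `[a, b]) f x + \int[mu]_(x in `[b, c]) f x + \int[mu]_(x in `[c, d]) f x.
Proof.
move=> ab bc cd cf;have [F dF]:=primitive cf.
have e x y : x <= y -> \int[mu]_(x in `[x,y]) f x = F y - F x.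
 by move=> xy;apply:ftcR=>//;exact:wc_cts.
by rewrite (e _ _ ab) (e _ _ bc) (e _ _ cd) (e _ _ (le_trans (le_trans ab bc) cd));ring.
Qed.

Definition circle_pt (x : R) : R * R := (r * cos x, r * sin x).

Let dsin x : isd (fun x => r * sin x) x (r * cos x).
Proof.
by apply:der_eq;[apply:derM;[exact:derC|exact:is_derive_sin]|rewrite mul0r add0r].
Qed.

Let dcos x : isd (fun x => r * cos x) x (- (r * sin x)).
Proof.
by apply:der_eq;[apply:derM;[exact:derC|exact:is_derive_cos]|rewrite mul0r add0r mulrN].
Qed.

Let cs : continuous (fun x : R => r * sin x). Proof. by move=> x;exact:(der_cts (dsin x)). Qed.
Let cc : continuous (fun x : R => r * cos x). Proof. by move=> x;exact:(der_cts (dcos x)). Qed.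

Lemma cts_circle_pt : continuous circle_pt.
Proof. by apply:cts_pair;[exact:cc|exact:cs]. Qed.

(** The right and left arcs are graphs over the ordinate [r * sin x]. Which arc is traced depends on
    the sign of the cosine, hence the cuts at pi / 2 and 3 pi / 2. Primitives [F1] and [F2] along
    the arcs turn each substitution into the fundamental theorem. *)
Lemma chord1 (phi : R * R -> R) : continuous phi ->
  \int[mu]_y (phi (hc y, y) - phi (- hc y, y)) = \int[mu]_(x in `[0, 2 * pi]) (phi (circle_pt x) * (r * cos x)).
Proof.
move=> cp;have cid: continuous (fun y : R=> y) by move=> y;exact:cvg_id.
have c1: continuous (fun y=> phi (hc y,y)).
 by move=> y;apply:(@continuous_comp _ _ _ (fun y=>(hc y,y)));[exact:(cts_pair (@cts_half_chord R r) cid)|exact:cp].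
have c2: continuous (fun y=> phi (- hc y,y)).
 move=> y;apply:(@continuous_comp _ _ _ (fun y=>(- hc y,y)));last exact:cp.
 by apply:cts_pair=>// z;apply:cvgN;exact:cts_half_chord.
have [F1 d1]:=primitive c1;have [F2 d2]:=primitive c2.
rewrite (sub_chord phi);last by move=> y /(half_chord_out r0) ->;rewrite oppr0 subrr.
have rr: - r <= r by rewrite (le_trans _ (ltW r0))// oppr_le0 ltW.
rewrite (@ftcR _ (fun y=> F1 y - F2 y))//;last 2 first.
- by move=> y _;apply:derB.
- by apply:wc_cts=> y;apply:cvgB;[exact:c1|exact:c2].
have cf: continuous (fun x=> phi (circle_pt x) * (r * cos x)).
 move=> x;apply:cvgM;last exact:cc.
 by apply:(@continuous_comp _ _ _ circle_pt);[exact:cts_circle_pt|exact:cp].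
rewrite (@cat3 _ 0 (pi / 2) (pi + pi / 2) (2 * pi))//;[|by move: pi0;lra..].
have q1: \int[mu]_(x in `[0,pi / 2]) (phi (circle_pt x) * (r * cos x)) = F1 r - F1 0.
 transitivity (\int[mu]_(x in `[0,pi / 2]) (phi (hc (r * sin x),r * sin x) * (r * cos x))).
  apply:eq_Rintegral=> x;rewrite inE/= in_itv/= =>/andP[x0 x1].
  rewrite sin_half// ger0_norm//;apply:cos_ge0_pihalf;apply/andP;split;last by [].
  by move: pi0;lra.
 have ->: F1 r - F1 0 = F1 (r * sin (pi / 2)) - F1 (r * sin 0) by rewrite sin_pihalf sin0 mulr1 mulr0.
 by apply:(@subst F1 (fun y=> phi (hc y,y)) (fun x=> r * sin x) (fun x=> r * cos x))=>//;move: pi0;lra.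
have q2: \int[mu]_(x in `[pi / 2,pi + pi / 2]) (phi (circle_pt x) * (r * cos x)) = F2 (- r) - F2 r.
 transitivity (\int[mu]_(x in `[pi / 2,pi + pi / 2]) (phi (- hc (r * sin x),r * sin x) * (r * cos x))).
  apply:eq_Rintegral=> x;rewrite inE/= in_itv/= =>/andP[x0 x1].
  rewrite sin_half// ler0_norm ?mulrN ?opprK// -oppr_ge0 -[x](subrK pi) cosDpi opprK.
  by apply:cos_ge0_pihalf;apply/andP;split;lra.
 have ->: F2 (- r) - F2 r = F2 (r * sin (pi + pi / 2)) - F2 (r * sin (pi / 2)).
  by rewrite addrC (addrC pi) sinDpi sin_pihalf mulr1 mulrN1 addrC.
 by apply:(@subst F2 (fun y=> phi (- hc y,y)) (fun x=> r * sin x) (fun x=> r * cos x))=>//;move: pi0;lra.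
have q3: \int[mu]_(x in `[pi + pi / 2,2 * pi]) (phi (circle_pt x) * (r * cos x)) = F1 0 - F1 (- r).
 transitivity (\int[mu]_(x in `[pi + pi / 2,2 * pi]) (phi (hc (r * sin x),r * sin x) * (r * cos x))).
  apply:eq_Rintegral=> x;rewrite inE/= in_itv/= =>/andP[x0 x1].
  rewrite sin_half// ger0_norm// -[x](subrK (pi *+ 2)) cosD2pi.
  by apply:cos_ge0_pihalf;rewrite -(mulr_natl pi 2);apply/andP;split;move: pi0;lra.
 have ->: F1 0 - F1 (- r) = F1 (r * sin (2 * pi)) - F1 (r * sin (pi + pi / 2)).
  by rewrite mulr_natl sin2pi mulr0 (addrC pi) sinDpi sin_pihalf mulrN1.
 by apply:(@subst F1 (fun y=> phi (hc y,y)) (fun x=> r * sin x) (fun x=> r * cos x))=>//;move: pi0;lra.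
by rewrite q1 q2 q3;ring.
Qed.

Lemma chord2 (phi : R * R -> R) : continuous phi ->
  \int[mu]_x (phi (x, hc x) - phi (x, - hc x)) = \int[mu]_(x in `[0, 2 * pi]) (phi (circle_pt x) * (r * sin x)).
Proof.
move=> cp;have cid: continuous (fun y : R=> y) by move=> y;exact:cvg_id.
have c1: continuous (fun y=> phi (y,hc y)).
 by move=> y;apply:(@continuous_comp _ _ _ (fun y=>(y,hc y)));[exact:(cts_pair cid (@cts_half_chord R r))|exact:cp].
have c2: continuous (fun y=> phi (y,- hc y)).
 move=> y;apply:(@continuous_comp _ _ _ (fun y=>(y,- hc y)));last exact:cp.
 by apply:cts_pair=>// z;apply:cvgN;exact:cts_half_chord.
have [F1 d1]:=primitive c1;have [F2 d2]:=primitive c2.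
rewrite (sub_chord phi);last by move=> y /(half_chord_out r0) ->;rewrite oppr0 subrr.
have rr: - r <= r by rewrite (le_trans _ (ltW r0))// oppr_le0 ltW.
rewrite (@ftcR _ (fun y=> F1 y - F2 y))//;last 2 first.
- by move=> y _;apply:derB.
- by apply:wc_cts=> y;apply:cvgB;[exact:c1|exact:c2].
have cf: continuous (fun x=> phi (circle_pt x) * (r * sin x)).
 move=> x;apply:cvgM;last exact:cs.
 by apply:(@continuous_comp _ _ _ circle_pt);[exact:cts_circle_pt|exact:cp].
(* One cut is enough here, since the sine changes sign only at pi; the first of the three intervals
   is degenerate. *)
rewrite (@cat3 _ 0 0 pi (2 * pi))//;[|by move: pi0;lra..].
rewrite set_itv1 Rintegral_set1 add0r.
have neg lo hi (psi : R -> R) : \int[mu]_(x in `[lo,hi]) (psi (r * cos x) * (r * sin x)) = \int[mu]_(x in `[lo,hi]) (- psi (r * cos x) * (- (r * sin x))).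
 by apply:eq_Rintegral=> x _;rewrite mulrNN.
have cms: continuous (fun x : R=> - (r * sin x)) by move=> x;apply:cvgN;exact:cs.
have q1: \int[mu]_(x in `[0,pi]) (phi (circle_pt x) * (r * sin x)) = F1 r - F1 (- r).
 transitivity (\int[mu]_(x in `[0,pi]) (phi (r * cos x,hc (r * cos x)) * (r * sin x))).
  apply:eq_Rintegral=> x;rewrite inE/= in_itv/= => x01.
  by rewrite cos_half// ger0_norm// sin_ge0_pi.
 rewrite (neg 0 pi (fun y=> phi (y,hc y))).
 have ->: F1 r - F1 (- r) = - F1 (r * cos pi) - - F1 (r * cos 0) by rewrite cospi cos0 mulr1 mulrN1;ring.
 apply:(@subst (fun y=> - F1 y) (fun y=> - phi (y,hc y)) (fun x=> r * cos x) (fun x=> - (r * sin x)))=>//.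
 - exact:ltW.
 - by move=> x;exact:derN.
 - by move=> x;apply:cvgN;exact:c1.
have q2: \int[mu]_(x in `[pi,2 * pi]) (phi (circle_pt x) * (r * sin x)) = F2 (- r) - F2 r.
 transitivity (\int[mu]_(x in `[pi,2 * pi]) (phi (r * cos x,- hc (r * cos x)) * (r * sin x))).
  apply:eq_Rintegral=> x;rewrite inE/= in_itv/= =>/andP[x0 x1].
  rewrite cos_half// ler0_norm ?mulrN ?opprK// -oppr_ge0 -[x](subrK pi) sinDpi opprK.
  by apply:sin_ge0_pi;apply/andP;split;lra.
 rewrite (neg pi (2 * pi) (fun y=> phi (y,- hc y))).
 have ->: F2 (- r) - F2 r = - F2 (r * cos (2 * pi)) - - F2 (r * cos pi).
  by rewrite mulr_natl cos2pi cospi mulr1 mulrN1;ring.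
 apply:(@subst (fun y=> - F2 y) (fun y=> - phi (y,- hc y)) (fun x=> r * cos x) (fun x=> - (r * sin x)))=>//.
 - by move: pi0;lra.
 - by move=> x;exact:derN.
 - by move=> x;apply:cvgN;exact:c2.
by rewrite q1 q2;ring.
Qed.

End chords.

(** * Weighted image measures *)

Section weight_measure.
Context {R : realType}.
Notation mu := (@lebesgue_measure R).
Notation T := (measurableTypeR R).
Notation P := (plane R).
Variables (w : T -> R) (D : set T) (g : T -> P).
Hypotheses (mw : mfun setT w) (w0 : forall x, 0 <= w x) (mD : measurable D)
  (mg : mfun setT g).

Let wm (A : set P) : \bar R := (\int[mu]_(x in g @^-1` A `&` D) (w x)%:E)%E.

Let mpre A : measurable A -> measurable (g @^-1` A `&` D).
Proof. by move=> mA;apply:measurableI=>//;rewrite -[X in measurable X]setTI;exact:mg. Qed.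

Let wm0 : wm set0 = 0%E.
Proof. by rewrite /wm preimage_set0 set0I integral_set0. Qed.

Let wm_ge0 A : (0 <= wm A)%E.
Proof. by apply:integral_ge0=> x _;rewrite lee_fin. Qed.

Let wm_sigma : semi_sigma_additive wm.
Proof.
move=> F mF tF mUF;rewrite /wm preimage_bigcup setI_bigcupl ge0_integral_bigcup//.
- by apply:is_cvg_nneseries=> n _ _;exact:wm_ge0.
- by move=> k;exact:mpre.
- by apply/measurable_EFinP;exact:measurable_funTS.
- by move=> x _;rewrite lee_fin.
- apply:trivIset_setIr;apply/trivIsetP=>/= i j _ _ ij;rewrite -preimage_setI.
 by move/trivIsetP : tF=>/(_ _ _ I I ij) ->;rewrite preimage_set0.
Qed.

HB.instance Definition _ := isMeasure.Build _ _ _ wm wm0 wm_ge0 wm_sigma.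

Lemma weight_measure : exists m' : {measure set P -> \bar R}, forall A,
  m' A = (\int[mu]_(x in g @^-1` A `&` D) (w x)%:E)%E.
Proof. by exists (wm : {measure set P -> \bar R}). Qed.

End weight_measure.

(** * Image measures and uniqueness from open boxes *)

Section push_measure.
Context {R : realType}.
Notation mu := (@lebesgue_measure R).
Notation T := (measurableTypeR R).
Notation P := (plane R).

Lemma push_measure (g : T -> P) : mfun setT g -> exists m' : {measure set P -> \bar R},
  (forall A, m' A = mu (g @^-1` A)) /\
  forall phi : P -> R, mfun setT phi -> mu.-integrable setT (EFin \o (phi \o g)) ->
    \int[m']_x phi x = \int[mu]_y phi (g y).
Proof.
move=> mg;unshelve eexists (pushforward mu g);first exact:mg.
split=>// phi mphi iphi;rewrite /Rintegral;congr fine.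
rewrite (@integral_pushforward _ _ _ _ R g mg mu setT (EFin \o phi))//;exact/measurable_EFinP.
Qed.

Lemma slice_measure1 (n : {measure set P -> \bar R}) (V : set T) : measurable V ->
  exists n' : {measure set T -> \bar R}, forall A, n' A = n (A `*` V).
Proof.
move=> mV;have mV': measurable (setT `*` V : set P) by exact:measurableX.
unshelve eexists (pushforward (mrestr n mV') (fst : P -> T));first exact:measurable_fst.
move=> A;rewrite /= /pushforward /mrestr;congr (n _).
by apply/seteqP;split=> -[x y]/=;[move=>[Ax [_ Vy]]|move=>[Ax Vy]].
Qed.

Lemma slice_measure2 (n : {measure set P -> \bar R}) (V : set T) : measurable V ->
  exists n' : {measure set T -> \bar R}, forall A, n' A = n (V `*` A).
Proof.
move=> mV;have mV': measurable (V `*` setT : set P) by exact:measurableX.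
unshelve eexists (pushforward (mrestr n mV') (snd : P -> T));first exact:measurable_snd.
move=> A;rewrite /= /pushforward /mrestr;congr (n _).
by apply/seteqP;split=> -[x y]/=;[move=>[Ax [Vy _]]|move=>[Ax Vy]].
Qed.

Lemma open_itv_unique (n1 n2 : {measure set T -> \bar R}) : (n1 setT < +oo)%E ->
  (forall a b, n1 `]a, b[%classic = n2 `]a, b[%classic) -> forall A, measurable A -> n1 A = n2 A.
Proof.
move=> n1T nn;apply:(@measure_unique _ R T (@RGenOpens.G R) (fun k=> `](- k%:R)%R,k%:R[%classic)).
- exact:RGenOpens.measurableE.
- move=> _ _ [a [b ->]] [c [d ->]];exists (Num.max a c),(Num.min b d).
 apply/seteqP;split=> x/=;rewrite !in_itv/= gt_max lt_min.
  by move=>[/andP[-> ->] /andP[-> ->]].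
 by move=>/andP[/andP[-> ->] /andP[-> ->]].
- by move=> k;exists (- k%:R),k%:R.
- apply/seteqP;split=>// x _;exists (Num.truncn `|x|).+1=>//=.
 by rewrite in_itv/= -ltr_norml truncnS_gt.
- by move=> _ [a [b ->]];exact:nn.
- by move=> k;apply:le_lt_trans n1T;apply:le_measure;rewrite ?inE//;exact:measurable_itv.
Qed.

(** One factor at a time: with one side fixed the slices are measures on the line, determined by
    open intervals; rectangles then determine the measure. *)
Lemma open_box_unique (n1 n2 : {measure set P -> \bar R}) : (n1 setT < +oo)%E ->
  (forall a b c d, n1 (`]a, b[ `*` `]c, d[) = n2 (`]a, b[ `*` `]c, d[)) ->
  forall A, measurable A -> n1 A = n2 A.
Proof.
move=> n1T nn;have fin (A : set P) : measurable A -> (n1 A < +oo)%E.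
 by move=> mA;apply:le_lt_trans n1T;apply:le_measure;rewrite ?inE.
have s1 (A : set T) c d : measurable A -> n1 (A `*` `]c,d[) = n2 (A `*` `]c,d[).
 move=> mA;have mI: measurable (`]c,d[%classic : set T) by exact:measurable_itv.
 have [p1 h1]:=slice_measure1 n1 mI;have [p2 h2]:=slice_measure1 n2 mI.
 rewrite -h1 -h2;apply:open_itv_unique=>//.
  by rewrite h1;apply:fin;exact:measurableX.
 by move=> a b;rewrite h1 h2.
have s2 (A B : set T) : measurable A -> measurable B -> n1 (A `*` B) = n2 (A `*` B).
 move=> mA mB;have [p1 h1]:=slice_measure2 n1 mA;have [p2 h2]:=slice_measure2 n2 mA.
 rewrite -h1 -h2;apply:open_itv_unique=>//.
  by rewrite h1;apply:fin;exact:measurableX.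
 by move=> a b;rewrite h1 h2;exact:s1.
apply:(@measure_unique _ R P [set A `*` B|A in measurable & B in measurable] (fun=> setT)).
- exact:measurable_prod_measurableType.
- move=> _ _ [A mA [B mB <-]] [C mC [E mE <-]];exists (A `&` C);first exact:measurableI.
 by exists (B `&` E);[exact:measurableI|rewrite setXI].
- by move=> _;exists setT=>//;exists setT=>//;exact:setXTT.
- by apply/seteqP;split=>// x _;exists 0%N.
- by move=> _ [A mA [B mB <-]];exact:s2.
- by move=> _.
Qed.

End push_measure.

(** * Dominated convergence for real-valued integrals *)

Section limits.
Context {d : measure_display} {X : measurableType d} {R : realType}.

Lemma Rint_lim (n : {measure set X -> \bar R}) (K : set X) (u : nat -> X -> R) (v : X -> R) C :
  measurable K -> (n K < +oo)%E -> (forall k, mfun K (u k)) -> mfun K v ->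
  (forall k x, K x -> `|u k x| <= C) -> (forall x, K x -> u k x @[k --> \oo] --> v x) ->
  \int[n]_(x in K) u k x @[k --> \oo] --> \int[n]_(x in K) v x.
Proof.
move=> mK nK mu' mv uC uv.
have vC x : K x -> `|v x| <= C.
 move=> Kx;have h: `|u k x| @[k --> \oo] --> `|v x| by apply:cvg_norm;exact:uv.
 rewrite -(cvg_lim _ h)//;apply:limr_le;first by apply/cvg_ex;eexists;exact:h.
 by apply:nearW=> k;exact:uC.
have ib (w : X -> R) : mfun K w -> (forall x,K x -> `|w x| <= C) -> n.-integrable K (EFin \o w).
 move=> mw wC;apply:measurable_bounded_integrable=>//.
 exists C;split;first exact:num_real.
 by move=> z Cz x /= Kx;exact:le_trans (wC x Kx) (ltW Cz).
have ic: n.-integrable K (EFin \o (fun=> C)).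
 apply:(@measurable_bounded_integrable _ X R n (fun=> C))=>//.
 exists `|C|%R;split;first exact:num_real.
 by move=> z Cz x /= Kx;exact:ltW.
have iv:=ib v mv vC.
have h: (\int[n]_(x in K) (u k x)%:E)%E @[k --> \oo] --> (\int[n]_(x in K) (v x)%:E)%E.
 apply:(@dominated_cvg _ X R n K mK (fun k x=>(u k x)%:E) (fun x=>(v x)%:E) (fun=> C%:E))=>//.
 - by move=> k;exact/measurable_EFinP.
 - by move=> x Kx;apply:cvg_EFin;[exact:nearW|exact:uv].
by apply:fine_cvg;rewrite fineK//;exact:(integrable_fin_num mK iv).
Qed.

End limits.

(** * Smooth approximation of open boxes *)

Section box_functions.
Context {R : realType}.
Notation P := (plane R).
Implicit Types (g : R -> R) (a b c d : R).

Lemma Ck_fst_comp g k : smooth1 g -> Ck k (fun x : R * R => g x.1).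
Proof.
elim:k g=>[|k IH] g sg.
 split=>// x;apply:(@continuous_comp _ _ _ fst g);[exact:cts_fst|exact:smooth1_cts].
apply:(@Ck_intro R k _ (fun x=> derive1 g x.1) (fun=> 0)).
- by move=> x;apply:(@continuous_comp _ _ _ fst g);[exact:cts_fst|exact:smooth1_cts].
- by move=> x;exact:smooth1_isd.
- by move=> x;rewrite /pd1 /pd2/=;exact:derC.
- by apply:IH;exact:smooth1_der.
- exact:Ck_cst.
Qed.

Lemma Ck_snd_comp g k : smooth1 g -> Ck k (fun x : R * R => g x.2).
Proof.
elim:k g=>[|k IH] g sg.
 split=>// x;apply:(@continuous_comp _ _ _ snd g);[exact:cts_snd|exact:smooth1_cts].
apply:(@Ck_intro R k _ (fun=> 0) (fun x=> derive1 g x.2)).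
- by move=> x;apply:(@continuous_comp _ _ _ snd g);[exact:cts_snd|exact:smooth1_cts].
- by move=> x;rewrite /pd1 /pd2/=;exact:derC.
- by move=> x;exact:smooth1_isd.
- exact:Ck_cst.
- by apply:IH;exact:smooth1_der.
Qed.

Lemma test_function_box u M : (forall k, Ck k u) -> (forall x, ~ plane_box M x -> u x = 0) ->
  test_function (u : R * R -> R).
Proof.
move=> ku u0;split=>//;apply:(@subclosed_compact _ _ (plane_box M : set (R * R))).
- exact:closed_closure.
- exact:compact_box.
have cB: closed (plane_box M : set (R * R)) by apply:compact_closed;[exact:norm_hausdorff|exact:compact_box].
rewrite [X in _ `<=` X]((closure_id _).1 cB);apply:closure_subset.
by move=> x /= /eqP ux;apply:contrapT=>/u0.
Qed.

(** A product of two steps of width 1 / n, one from each end inwards; an interior point lies on both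
    plateaus as soon as [n] is large. *)
Lemma itv_approx a b : exists chi : nat -> R -> R,
  [/\ forall n, smooth1 (chi n), forall n x, 0 <= chi n x <= 1,
      forall n x, ~~ (a < x < b) -> chi n x = 0 &
      forall x, chi n x @[n --> \oo] --> ((a < x < b)%R%:R : R)].
Proof.
pose chi (n : nat) (x : R):=step (n%:R * x + - (n%:R * a)) * step (- n%:R * x + n%:R * b).
have z n x : ~~ (a < x < b) -> chi n x = 0.
 rewrite negb_and -!leNgt=>/orP[h|h];rewrite /chi.
  by rewrite step0 ?mul0r// -mulrN -mulrDr mulr_ge0_le0// subr_le0.
 by rewrite (@step0 _ (_ + n%:R * b)) ?mulr0// mulNr addrC -mulrBr mulr_ge0_le0// subr_le0.
exists chi;split=>//.
- by move=> n k;apply:S1M;apply:S1_affine;exact:step_smooth.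
- by move=> n x;rewrite mulr_ge0 ?step_ge0//= mulr_ile1 ?step_ge0 ?step_le1.
move=> x;have [/andP[ax xb]|h]:=boolP (a < x < b);last first.
 by under eq_fun do rewrite (z _ x h);exact:cvg_cst.
apply:cvg_near_cst;near=> n.
have big c : 0 < c -> c^-1 <= n%:R -> 1 <= n%:R * c by move=> c0;rewrite -ler_pdivrMr// mul1r.
rewrite /chi !step1 ?mulr1//.
 rewrite mulNr addrC -mulrBr;apply:big;first by rewrite subr_gt0.
 by near: n;exact:nbhs_infty_ger.
rewrite -mulrBr;apply:big;first by rewrite subr_gt0.
by near: n;exact:nbhs_infty_ger.
Unshelve. all: by end_near. Qed.

Lemma box_approx a b c d : exists chi : nat -> R * R -> R, exists M,
  [/\ forall n, test_function (chi n), forall n x, 0 <= chi n x <= 1,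
      forall n x, ~ plane_box M x -> chi n x = 0, (`]a, b[ `*` `]c, d[ : set P) `<=` plane_box M &
      forall x, chi n x @[n --> \oo] --> (\1_(`]a, b[ `*` `]c, d[ : set P) x : R)].
Proof.
have [x1 [s1 b1 z1 l1]]:=itv_approx a b;have [x2 [s2 b2 z2 l2]]:=itv_approx c d.
pose M:=Num.max (Num.max `|a| `|b|) (Num.max `|c| `|d|).
have inM u v t : `|u| <= M -> `|v| <= M -> u < t < v -> `|t| <= M.
 rewrite !ler_norml=>/andP[h1 h2] /andP[h3 h4] /andP[h5 h6].
 by rewrite (le_trans h1 (ltW h5)) (le_trans (ltW h6) h4).
have [aM bM cM dM] : [/\ `|a| <= M,`|b| <= M,`|c| <= M & `|d| <= M].
 by rewrite /M !le_max !lexx !orbT.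
have z n x : ~ plane_box M x -> x1 n x.1 * x2 n x.2 = 0.
 move=> h;have [h1|/z1->]:=boolP (a < x.1 < b);last by rewrite mul0r.
 have [h2|/z2->]:=boolP (c < x.2 < d);last by rewrite mulr0.
 by exfalso;apply:h;apply/plane_boxP;split;[exact:(inM a b)|exact:(inM c d)].
exists (fun n x=> x1 n x.1 * x2 n x.2),M;split=>//.
- move=> n;apply:(@test_function_box _ M);last exact:z.
 by move=> k;apply:CkM;[exact:Ck_fst_comp|exact:Ck_snd_comp].
- move=> n x;have /andP[p1 p2]:=b1 n x.1;have /andP[p3 p4]:=b2 n x.2.
 by rewrite mulr_ge0//= mulr_ile1.
- by move=> x []/=;rewrite !in_itv/= => h1 h2;apply/plane_boxP;split;[exact:(inM a b)|exact:(inM c d)].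
- move=> x;have ->: \1_(`]a,b[ `*` `]c,d[ : set P) x = (a < x.1 < b)%R%:R * (c < x.2 < d)%R%:R :> R.
  rewrite indicE (_ : (x \in _) = (a < x.1 < b) && (c < x.2 < d)) ?mulnb ?natrM -?mulnb ?natrM//.
  apply/idP/idP;rewrite inE /= !in_itv/=;first by move=>[-> ->].
  by move=>/andP[-> ->].
 by apply:cvgM;[exact:l1|exact:l2].
Qed.

End box_functions.

Lemma fin_arith {R : realType} (p n u v : R) : (p - n = - (u - v)) <-> ((p + u)%:E = (n + v)%:E).
Proof. by split=>[h|[h]];[congr (_%:E);lra|lra]. Qed.

(** * The derivative of a disc is carried by its circle *)

Section circle_measure.
Context {R : realType}.
Notation mu := (@lebesgue_measure R).
Notation T := (measurableTypeR R).
Notation P := (plane R).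
Notation pi := (@pi R).
Variable r : R.
Hypothesis r0 : 0 < r.
Notation gam := (circle_pt r).
Let I : set T := `[0, 2 * pi]%classic.

Lemma measurable_circle_pt : mfun setT (gam : T -> P).
Proof.
apply:measurable_fun_pair;apply:cts_mfun=> x.
 by apply:cvgM;[exact:cvg_cst|exact:continuous_cos].
by apply:cvgM;[exact:cvg_cst|exact:continuous_sin].
Qed.

Let mI : measurable I. Proof. exact:measurable_itv. Qed.

Let muI : (mu I < +oo)%E.
Proof.
have ->: mu I = (2 * pi - 0)%:E;last exact:ltry.
by apply:(etrans (lebesgue_measure_itv _));rewrite /= lte_fin mulr_gt0 ?pi_gt0// EFinB.
Qed.

Lemma measurable_pull (F : set P) (w : R -> R) : measurable F -> continuous w ->
  mfun (setT : set T) (fun x => \1_F (gam x) * w x).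
Proof.
move=> mF cw;apply:measurable_funM;last exact:cts_mfun.
have mi: mfun (setT : set P) (\1_F : P -> R) by exact:measurable_indic.
exact:(measurableT_comp mi measurable_circle_pt).
Qed.

Lemma integrable_pull (F : set P) (w : R -> R) : measurable F -> continuous w ->
  mu.-integrable I (EFin \o (fun x => \1_F (gam x) * w x)).
Proof.
move=> mF cw;have : compact (w @` `[0,2 * pi]).
 by apply:continuous_compact;[exact:wc_cts|exact:segment_compact].
move=>/compact_bounded[C [rC hC]].
apply:(@int_piece _ 0 (2 * pi) _ (`|C| + 1));first exact:measurable_funTS (measurable_pull mF cw).
move=> t tI;have C1: C < `|C| + 1 by rewrite (le_lt_trans (ler_norm _))// ltrDl.
have h: `|w t| <= `|C| + 1 by apply:(hC _ C1);exists t=>//=;rewrite in_itv.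
by rewrite indicE;case:(boolP (_ \in _))=> _;rewrite ?mul1r// mul0r normr0 addr_ge0.
Qed.

Let weight_fine (w : R -> R) (n : {measure set P -> \bar R}) : continuous w -> (forall x, 0 <= w x) ->
  (forall A, n A = (\int[mu]_(x in gam @^-1` A `&` I) (w x)%:E)%E) ->
  forall A, measurable A -> n A = (\int[mu]_(x in I) (\1_A (gam x) * w x))%:E.
Proof.
move=> cw w0 hn A mA;rewrite hn integral_mkcondl /Rintegral fineK;last exact:(integrable_fin_num mI (integrable_pull mA cw)).
apply:eq_integral=> x _;rewrite patchE indicE.
rewrite (_ : (gam x \in A) = (x \in gam @^-1` A));last by apply/idP/idP;rewrite !inE.
by case:ifP=> _;rewrite ?mul1r ?mul0r.
Qed.

(** Splitting the weight into positive and negative parts turns the claim into an equality of two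
    positive measures, [radon_pos s + np] and [radon_neg s + nn]. Test functions converging to
    indicators give it on open boxes, uniqueness on bounded Borel sets. *)
Lemma radon_of_circle (s : @signed_radon R) (w : R -> R) : continuous w ->
  (forall phi, test_function phi -> radon_int s phi = - \int[mu]_(x in I) (phi (gam x) * w x)) ->
  forall F : set P, measurable F -> bounded_set (F : set (R * R)) ->
  radon_val s F = - \int[mu]_(x in I) (\1_F (gam x) * w x).
Proof.
move=> cw hs.
pose wp x:=Num.max (w x) 0;pose wn x:=Num.max (- w x) 0.
have cp: continuous wp by move=> x;apply:(@continuous_max _ _ w (fun=> 0));[exact:cw|exact:cvg_cst].
have cn: continuous wn.
 by move=> x;apply:(@continuous_max _ _ (fun x=> - w x) (fun=> 0));[apply:cvgN;exact:cw|exact:cvg_cst].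
have p0 x : 0 <= wp x by rewrite /wp le_max lexx orbT.
have n0 x : 0 <= wn x by rewrite /wn le_max lexx orbT.
have wpn x : w x = wp x - wn x.
 by rewrite /wp /wn /Num.max /Order.max;case:ltP=> h1;case:ltP=> h2;lra.
have [np hp]:=weight_measure (cts_mfun cp) p0 mI measurable_circle_pt.
have [nn hn]:=weight_measure (cts_mfun cn) n0 mI measurable_circle_pt.
have fp:=weight_fine cp p0 hp;have fn:=weight_fine cn n0 hn.
have Jpn A : measurable A -> \int[mu]_(x in I) (\1_A (gam x) * w x) =
  \int[mu]_(x in I) (\1_A (gam x) * wp x) - \int[mu]_(x in I) (\1_A (gam x) * wn x).
 move=> mA;rewrite -(RintegralB mI (integrable_pull mA cp) (integrable_pull mA cn)).
 by apply:eq_Rintegral=> x _;rewrite wpn mulrBr.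
have pK:=@radon_pos_fin _ s;have nK:=@radon_neg_fin _ s.
have box a b c d : radon_val s (`]a,b[ `*` `]c,d[) = - \int[mu]_(x in I) (\1_(`]a,b[ `*` `]c,d[ : set P) (gam x) * w x).
 have [chi [M [t01 b01 z0 sub lim]]]:=box_approx a b c d.
 set U:=(`]a,b[ `*` `]c,d[ : set P) in sub lim *.
 have mU: measurable U by apply:measurableX;exact:measurable_itv.
 have mK: measurable (plane_box M):=measurable_box M.
 have mchi n : mfun (setT : set P) (chi n) by apply:cts_plane_measurable;apply:(@Ck_cts _ 0);exact:(t01 n).1.
 have c1 n x : `|chi n x| <= 1 by have /andP[h1 h2]:=b01 n x;rewrite ger0_norm.
 have l1 (m' : {measure set P -> \bar R}) : (m' (plane_box M) < +oo)%E ->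
   \int[m']_(x in plane_box M) chi n x @[n --> \oo] --> fine (m' U).
  move=> mfin;have ->: fine (m' U) = \int[m']_(x in plane_box M) \1_U x.
   by rewrite /Rintegral (integral_indic m' mK mU) (setIidl sub).
  apply:(@Rint_lim _ P R m' (plane_box M) chi (\1_U) 1)=>//.
  by move=> k;exact:measurable_funTS.
 have L: radon_int s (chi n) @[n --> \oo] --> radon_val s U.
  under eq_fun do rewrite (radon_int_rint s (z0 _)) /rint.
  by apply:cvgB;apply:l1;[apply:pK|apply:nK];exact:compact_box.
 have Rr: radon_int s (chi n) @[n --> \oo] --> - \int[mu]_(x in I) (\1_U (gam x) * w x).
  under eq_fun do rewrite (hs _ (t01 _)).
  apply:cvgN.
  have : compact (w @` `[0,2 * pi]).
   by apply:continuous_compact;[exact:wc_cts|exact:segment_compact].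
  move=>/compact_bounded[C [rC hC]].
  apply:(@Rint_lim _ T R mu I (fun n x=> chi n (gam x) * w x) (fun x=> \1_U (gam x) * w x) (`|C| + 1))=>//.
  - move=> k;apply:measurable_funTS;apply:measurable_funM;last exact:cts_mfun.
   exact:(measurableT_comp (mchi k) measurable_circle_pt).
  - by apply:measurable_funTS;exact:measurable_pull.
  - move=> k x xI;have C1: C < `|C| + 1 by rewrite (le_lt_trans (ler_norm _))// ltrDl.
   have h: `|w x| <= `|C| + 1 by apply:(hC _ C1);exists x.
   by rewrite normrM (le_trans _ h)// ler_piMl.
  - by move=> x _;apply:cvgM;[exact:lim|exact:cvg_cst].
 exact:(cvg_unique _ L Rr).
have bnd M (A : set P) : A `<=` plane_box M -> bounded_set (A : set (R * R)).
 move=> AM;have [B [rB hB]]:=bounded_box M.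
 by exists B;split=>// x xB y /AM;exact:hB.
move=> F mF bF.
have [M FM] : exists M,F `<=` (`](- M),M[ `*` `](- M),M[ : set P).
 have [B [rB hB]]:=bF;exists (`|B| + 2)=> x Fx.
 have B1: B < `|B| + 1 by rewrite (le_lt_trans (ler_norm _))// ltrDl.
 have:=hB _ B1 x Fx;rewrite /= prod_normE ge_max=>/andP[h1 h2].
 by split;rewrite /= in_itv/= -ltr_norml (le_lt_trans _ (_ : `|B| + 1 < _))// ltrD2l ltr1n.
set Om:=(`](- M),M[ `*` `](- M),M[ : set P) in FM.
have mOm: measurable Om by apply:measurableX;exact:measurable_itv.
have OmM: Om `<=` plane_box M.
 by move=> x []/=;rewrite !in_itv/= =>/andP[h1 h2] /andP[h3 h4];split;rewrite /= in_itv/= !ltW.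
have finp A : measurable A -> A `<=` Om -> radon_pos s A \is a fin_num.
 by move=> mA AO;apply:radon_bounded_fin=>//;apply:(@bnd M);exact:subset_trans OmM.
have finn A : measurable A -> A `<=` Om -> radon_neg s A \is a fin_num.
 by move=> mA AO;apply:radon_bounded_fin=>//;apply:(@bnd M);exact:subset_trans OmM.
have eqE A : measurable A -> A `<=` Om -> (radon_val s A = - \int[mu]_(x in I) (\1_A (gam x) * w x)) <->
  (radon_pos s A + np A = radon_neg s A + nn A)%E.
 move=> mA AO;rewrite (fp _ mA) (fn _ mA) (Jpn _ mA) /radon_val.
 rewrite -{2}(fineK (finp _ mA AO)) -{2}(fineK (finn _ mA AO)).
 exact:fin_arith.
(* Restriction to one open box makes the masses finite, and open boxes remain open boxes when
   intersected with it. *)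
have key A : measurable A -> mrestr (measure_add (radon_pos s) np) mOm A = mrestr (measure_add (radon_neg s) nn) mOm A.
 apply:open_box_unique.
  change (measure_add (radon_pos s) np (setT `&` Om) < +oo)%E.
  rewrite measure_addE setTI (fp _ mOm);apply:lte_add_pinfty;last exact:ltry.
  by rewrite ltey_eq (finp _ mOm (fun _ h=> h)).
 move=> a b c d.
 change (measure_add (radon_pos s) np ((`]a,b[ `*` `]c,d[) `&` Om) = measure_add (radon_neg s) nn ((`]a,b[ `*` `]c,d[) `&` Om)).
 rewrite !measure_addE.
 have ->: (`]a,b[ `*` `]c,d[) `&` Om = (`](Num.max a (- M)),(Num.min b M)[ `*` `](Num.max c (- M)),(Num.min d M)[ : set P).
  apply/seteqP;split=> x;rewrite /Om /= !in_itv/= !gt_max !lt_min.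
   by move=>[[/andP[-> ->] /andP[-> ->]] [/andP[-> ->] /andP[-> ->]]].
  by move=>[/andP[/andP[-> ->] /andP[-> ->]] /andP[/andP[-> ->] /andP[-> ->]]].
 apply/eqE;last exact:box.
 - by apply:measurableX;exact:measurable_itv.
 - move=> x []/=;rewrite !in_itv/= !gt_max !lt_min=>/andP[/andP[_ h1] /andP[_ h2]] /andP[/andP[_ h3] /andP[_ h4]].
  by split;rewrite /= in_itv/= ?h1 ?h2 ?h3 ?h4.
apply/eqE=>//;have:=key F mF.
by rewrite /mrestr (setIidl FM) !measure_addE.
Qed.

Section variation.
Variable D : @signed_radon R * @signed_radon R.
Hypothesis D1 : forall phi, test_function phi -> radon_int D.1 phi = - \int[mu]_(x in I) (phi (gam x) * (r * cos x)).
Hypothesis D2 : forall phi, test_function phi -> radon_int D.2 phi = - \int[mu]_(x in I) (phi (gam x) * (r * sin x)).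

Let ccos : continuous (fun x : R => r * cos x).
Proof. by move=> x;apply:cvgM;[exact:cvg_cst|exact:continuous_cos]. Qed.
Let csin : continuous (fun x : R => r * sin x).
Proof. by move=> x;apply:cvgM;[exact:cvg_cst|exact:continuous_sin]. Qed.
Let ccst : continuous (fun x : R => r). Proof. by move=> x;exact:cvg_cst. Qed.

(** Minkowski for vector integrals: [N^2] is the integral of the density paired with the fixed
    vector (a, b), of norm [N], and the normal has norm 1. Dividing by [N] gives the bound. *)
Lemma vradon_norm_circle (F : set P) : measurable F -> bounded_set (F : set (R * R)) ->
  vradon_norm D F <= \int[mu]_(x in I) (\1_F (gam x) * r).
Proof.
move=> mF bF;rewrite /vradon_norm (radon_of_circle ccos D1 mF bF) (radon_of_circle csin D2 mF bF).
set a:=\int[mu]_(x in I) (\1_F (gam x) * (r * cos x));set b:=\int[mu]_(x in I) (\1_F (gam x) * (r * sin x)).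
set N:=enorm _;set S:=\int[mu]_(x in I) _.
have N0: 0 <= N by exact:enorm_ge0.
have S0: 0 <= S by apply:Rintegral_ge0=> x _;rewrite mulr_ge0 ?(ltW r0)// indicE ler0n.
have N2: N * N = a * a + b * b.
 by rewrite -expr2 enorm_sqr /= !sqrrN !expr2.
have ic:=integrable_pull mF ccos;have is_:=integrable_pull mF csin;have ir:=integrable_pull mF ccst.
have h: N * N <= N * S.
 have ->: N * S = \int[mu]_(x in I) (N * (\1_F (gam x) * r)) by rewrite RintegralZl.
 have ea: a * a = \int[mu]_(x in I) (a * (\1_F (gam x) * (r * cos x))) by rewrite RintegralZl.
 have eb: b * b = \int[mu]_(x in I) (b * (\1_F (gam x) * (r * sin x))) by rewrite RintegralZl.
 have i1: mu.-integrable I (EFin \o (fun x=> a * (\1_F (gam x) * (r * cos x)))):=integrableZl mI a ic.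
 have i2: mu.-integrable I (EFin \o (fun x=> b * (\1_F (gam x) * (r * sin x)))):=integrableZl mI b is_.
 rewrite N2 ea eb.
 rewrite -(RintegralD mI i1 i2);apply:le_Rintegral=>//.
 - exact:(integrableD mI i1 i2).
 - exact:(integrableZl mI N ir).
 move=> x _;have p0: 0 <= \1_F (gam x) * r :> R by rewrite mulr_ge0 ?(ltW r0)// indicE ler0n.
 have ->: a * (\1_F (gam x) * (r * cos x)) + b * (\1_F (gam x) * (r * sin x)) =
  (\1_F (gam x) * r) * ((- a) * (- cos x) + (- b) * (- sin x)) by ring.
 rewrite [leRHS]mulrC;apply:ler_wpM2l=>//.
 apply:(le_trans (dot_le _ _ _ _));rewrite ler_piMr// /enorm /= !sqrrN cos2Dsin2 sqrtr1//.
have [->|Nn]:=eqVneq N 0;first exact:S0.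
by rewrite -(ler_pM2l (_ : 0 < N))// lt_neqAle eq_sym Nn.
Qed.

Lemma radon_variation_circle : exists2 sig : {measure set P -> \bar R},
  (forall A : set P, measurable A -> (radon_variation D A <= sig A)%E) &
  (forall A, sig A = (\int[mu]_(x in gam @^-1` A `&` I) r%:E)%E).
Proof.
have [sig hs]:=weight_measure (cts_mfun ccst) (fun=> ltW r0) mI measurable_circle_pt.
have fs:=weight_fine ccst (fun=> ltW r0) hs.
exists sig=>// A mA;apply:ub_ereal_sup=> _ [F [mF bF tF FA] <-].
apply:(@le_trans _ _ (\sum_(0 <= k <oo) sig (F k))%E).
 apply:lee_nneseries=> k _;first by rewrite lee_fin vradon_norm_ge0.
 by rewrite fs// lee_fin vradon_norm_circle.
have mU: measurable (\bigcup_k F k) by exact:bigcup_measurable.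
apply:(@le_trans _ _ (sig (\bigcup_k F k))).
 by rewrite measure_semi_bigcup.
by apply:le_measure;rewrite ?inE.
Qed.

End variation.

End circle_measure.

(** * Perimeter of a centred disc *)

Section ball_perimeter.
Context {R : realType}.
Notation mu := (@lebesgue_measure R).
Notation m := (@leb2_borel R).
Notation T := (measurableTypeR R).
Notation P := (plane R).
Notation pi := (@pi R).
Variable r : R.
Hypothesis r0 : 0 < r.
Notation hc := (half_chord r).
Notation Bl := (centred_ball r).

Lemma compact_plane_measurable (K : set P) : compact (K : set (R * R)) -> measurable K.
Proof.
move=> cK;rewrite -[K]setCK;apply:measurableC;apply:open_plane_measurable.
by rewrite openC;apply:compact_closed=>//;exact:norm_hausdorff.
Qed.

Lemma compact_in_box (K : set P) : compact (K : set (R * R)) -> exists M, K `<=` plane_box M.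
Proof.
move=>/compact_bounded[B [rB hB]];exists (`|B| + 1)=> x Kx.
have B1: B < `|B| + 1 by rewrite (le_lt_trans (ler_norm _))// ltrDl.
by have:=hB _ B1 x Kx;rewrite /= prod_normE ge_max=>/andP[h1 h2];exact/plane_boxP.
Qed.

(** The condition on boxes makes the curve proper, so compact sets get finite mass although the
    image of Lebesgue measure is infinite. *)
Lemma push_radon (a b : R -> R) : continuous a -> continuous b ->
  (forall y M, plane_box M (a y, b y) -> `|y| <= M) ->
  exists m' : {measure set P -> \bar R}, (forall K, compact (K : set (R * R)) -> (m' K < +oo)%E) /\
   forall phi, test_function phi -> mu.-integrable setT (EFin \o (fun y => phi (a y, b y))) /\
     \int[m']_x phi x = \int[mu]_y phi (a y, b y).
Proof.
move=> ca cb ab;pose g (y : T) : P:=(a y,b y).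
have mg: mfun setT g by apply:measurable_fun_pair;exact:cts_mfun.
have [m' [h1 h2]]:=push_measure mg;exists m';split.
 move=> K cK;have mK:=compact_plane_measurable cK;have [M KM]:=compact_in_box cK.
 have mI: measurable (`[- M,M]%classic : set T) by exact:measurable_itv.
 rewrite h1;apply:(@le_lt_trans _ _ (mu `[(- M)%R,M]%classic)).
  apply:le_measure;rewrite ?inE//;first by rewrite -[X in measurable X]setTI;exact:mg.
  by move=> y /= /KM /ab;rewrite in_itv/= ler_norml.
 by rewrite lebesgue_measure_itv/=;case:ifP=> _;rewrite ?ltry.
move=> phi tphi;have [M z]:=test_box tphi.
have cphi: continuous phi by apply:(@Ck_cts _ 0);exact:tphi.1.
have cg: continuous (fun y : R=>(a y,b y)) by move=> y;exact:(cvg_pair (ca y) (cb y)).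
have cpg: continuous (fun y=> phi (a y,b y)) by move=> y;apply:(continuous_comp (cg y));exact:cphi.
have ig: mu.-integrable setT (EFin \o (fun y=> phi (a y,b y))).
 have ->: EFin \o (fun y=> phi (a y,b y)) = (EFin \o (fun y=> phi (a y,b y))) \_ `[- M,M].
  apply/funext=> y;rewrite patchE /= mem_setE in_itv/= -ler_norml.
  by case:ifPn=>// /negP h;rewrite z// =>/ab.
 apply/(integrable_mkcond _ _).1;first exact:measurable_itv.
 by apply:cts_int;exact:wc_cts.
by split=>//;apply:(h2 phi)=>//;exact:cts_plane_measurable.
Qed.

(** Images of Lebesgue measure under the half circles, seen as graphs over a whole axis. Beyond
    [-r, r] the two graphs run together along the axis and cancel in the difference. *)
Lemma ball_distr : exists D, distr_derivative \1_Bl D.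
Proof.
have ch:=@cts_half_chord R r;have ch': continuous (fun y=> - hc y) by move=> y;apply:cvgN;exact:ch.
have cid: continuous (fun y : R=> y) by move=> y;exact:cvg_id.
have snd_ (a : R -> R) y M : plane_box M (a y,y) -> `|y| <= M by move=>/plane_boxP[].
have fst_ (a : R -> R) y M : plane_box M (y,a y) -> `|y| <= M by move=>/plane_boxP[].
have [mL [fL iL]]:=push_radon ch' cid (snd_ _).
have [mR [fR iR]]:=push_radon ch cid (snd_ _).
have [mD [fD iD]]:=push_radon cid ch' (fst_ _).
have [mU [fU iU]]:=push_radon cid ch (fst_ _).
exists (SignedRadon fL fR,SignedRadon fD fU)=> phi tphi.
rewrite (ball_partial1 r0 tphi) (ball_partial2 r0 tphi) /radon_int/=.
have [i1 ->]:=iL _ tphi;have [i2 ->]:=iR _ tphi;have [i3 ->]:=iD _ tphi;have [i4 ->]:=iU _ tphi.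
by rewrite (RintegralB measurableT i2 i1) (RintegralB measurableT i4 i3) !opprB.
Qed.

Lemma ball_finite_perimeter : finite_perimeter Bl.
Proof.
have mB:=@measurable_ball R r;have mB':=borel_leb2_measurable mB.
split=>//;split;last exact:ball_distr.
move=> K cK;have mK:=compact_plane_measurable cK;have mK':=borel_leb2_measurable mK.
have [M KM]:=compact_in_box cK.
apply:(@measurable_bounded_integrable _ (caratheodory_type (m^*)%mu) R leb2 (\1_Bl) K mK').
- rewrite [ltLHS](leb2E mK) (le_lt_trans _ (box_finite M))//.
 by apply:le_measure;rewrite ?inE//;exact:measurable_box.
- by apply:measurable_funTS;exact:(@measurable_indic _ (caratheodory_type (m^*)%mu)).
- exists 1;split;first exact:num_real.
 by move=> z z1 x /= _;rewrite indicE;case:(_ \in _);rewrite ?normr1 ?normr0 ltW// (lt_trans _ z1).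
Qed.

(** The variation is dominated by arc length, hence does not charge the complement of the circle,
    and on the circle the weight is the constant [rho r]. *)
Lemma ball_perimeter_le (rho : R -> R) : continuous rho -> (forall t, 0 <= rho t) ->
  (weighted_perimeter (fun x => rho (enorm x)) Bl <= (2 * pi * r * rho r)%:E)%E.
Proof.
move=> crho rho0;have [D0 hD0]:=ball_distr.
have hD: distr_derivative \1_Bl (Dchi Bl) by rewrite /Dchi;case:xgetP=>[D _ //|/(_ D0)].
set D:=Dchi Bl in hD *.
have D1 phi : test_function phi -> radon_int D.1 phi = - \int[mu]_(x in `[0,2 * pi]) (phi (circle_pt r x) * (r * cos x)).
 move=> tphi;have [h _]:=hD _ tphi;have cphi: continuous phi by apply:(@Ck_cts _ 0);exact:tphi.1.
 by rewrite -(chord1 r0 cphi) -(ball_partial1 r0 tphi) h opprK.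
have D2 phi : test_function phi -> radon_int D.2 phi = - \int[mu]_(x in `[0,2 * pi]) (phi (circle_pt r x) * (r * sin x)).
 move=> tphi;have [_ h]:=hD _ tphi;have cphi: continuous phi by apply:(@Ck_cts _ 0);exact:tphi.1.
 by rewrite -(chord2 r0 cphi) -(ball_partial2 r0 tphi) h opprK.
have [sig hs sigE]:=radon_variation_circle r0 D1 D2.
pose C : set P:=[set x|enorm x = r].
have mC: measurable C.
 have me: mfun (setT : set P) (@enorm R) by apply:cts_plane_measurable;exact:cts_enorm.
 by have:=me measurableT _ (measurable_set1 r);rewrite setTI.
have mf: mfun (setT : set P) (fun x=>(rho (enorm x))%:E).
 apply/measurable_EFinP;apply:cts_plane_measurable=> x.
 by apply:(continuous_comp (@cts_enorm R x));exact:crho.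
have gC x : C (circle_pt r x).
 rewrite /C /circle_pt /enorm /= !exprMn -mulrDr cos2Dsin2 mulr1 sqrtr_sqr gtr0_norm//.
have N0: radon_variation D (~` C) = 0%E.
 apply/eqP;rewrite eq_le measure_ge0 andbT (le_trans (hs _ (measurableC mC)))// sigE.
 rewrite (_ : _ `&` _ = set0) ?integral_set0//.
 by apply/seteqP;split=>// x [/= h _];exact:(h (gC x)).
rewrite /weighted_perimeter -/D.
rewrite (@ge0_negligible_integral _ P R (radon_variation D) setT (~` C))//;last 2 first.
- exact:measurableC.
- by move=> x _;rewrite lee_fin.
rewrite setDE setCK setTI.
have ->: (\int[radon_variation D]_(x in C) (rho (enorm x))%:E = \int[radon_variation D]_(x in C) (cst (rho r)%:E x))%E.
 by apply:eq_integral=> x;rewrite inE /C /= => ->.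
rewrite integral_cst// mulrC EFinM;apply:lee_wpmul2l;first by rewrite lee_fin.
apply:(le_trans (hs _ mC));rewrite sigE.
rewrite (_ : _ `&` _ = `[0,2 * pi]%classic);last first.
 by apply/seteqP;split=> x/=;[case|move=> h;split=>//;exact:gC].
rewrite (integral_cst mu _ r%:E);last exact:measurable_itv.
have p0: 0 < 2 * pi by rewrite mulr_gt0// pi_gt0.
have e: mu `[0%R,(2 * pi)%R]%classic = (2 * pi)%:E.
 by apply:(etrans (lebesgue_measure_itv _));rewrite /= lte_fin p0 -EFinB subr0.
apply:(@le_trans _ _ (r%:E * (2 * pi)%:E)%E);last by rewrite -EFinM lee_fin mulrC.
apply:lee_wpmul2l;first by rewrite lee_fin ltW.
by rewrite le_eqVlt;apply/orP;left;apply/eqP;exact:e.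
Qed.

End ball_perimeter.

(** * Weighted volume in polar coordinates *)

Section radial_volume.
Context {R : realType}.
Notation mu := (@lebesgue_measure R).
Notation m := (@leb2_borel R).
Notation T := (measurableTypeR R).
Notation P := (plane R).
Notation pi := (@pi R).

Lemma volume_polar (A : set P) (rho : R -> R) : measurable A -> continuous rho -> (forall t, 0 <= rho t) ->
  (\int[m]_(x in A) (rho (enorm x))%:E =
   \int[mu]_(t in `]0%R, +oo[) (t * rho t * slice_mass A t)%:E)%E.
Proof.
move=> mA crho rho0.
pose F x : \bar R:=(\1_A x * rho (enorm x))%:E.
have mi: mfun (setT : set P) (\1_A : P -> R) by exact:measurable_indic.
have mF: mfun (setT : set P) F.
 apply/measurable_EFinP;apply:measurable_funM=>//;apply:cts_plane_measurable=> x.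
 by apply:(continuous_comp (@cts_enorm R x));exact:crho.
have i0 x : 0 <= \1_A x :> R by rewrite indicE ler0n.
have F0 x : (0 <= F x)%E by rewrite lee_fin mulr_ge0.
rewrite integral_mkcond.
have ->: (fun x : P=>(rho (enorm x))%:E) \_ A = F.
 by apply/funext=> x;rewrite patchE /F indicE;case:ifP=> _;rewrite ?mul1r ?mul0r.
rewrite (polar_pos mF F0);apply:eq_integral=> t;rewrite inE/= in_itv/= andbT=> t0.
have b1 x : `|\1_A x| <= 1 :> R by rewrite indicE;case:(_ \in _);rewrite ?normr1 ?normr0.
have ic:=@circ_integrable R (\1_A : P -> R) t 1 mi b1.
rewrite EFinM /slice_mass /circ_int /Rintegral fineK;last exact:(integrable_fin_num measurableT ic).
rewrite -(integralZl measurableT ic);apply:eq_integral=> s _.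
rewrite /F !enorm_ray normrN (gtr0_norm t0) -EFinD -!EFinM;congr EFin;ring.
Qed.

Lemma slice_mass_ball r t : 0 < t -> slice_mass (centred_ball r : set P) t = if t < r then 2 * pi else 0.
Proof.
move=> t0;rewrite /slice_mass /circ_int.
have e s : \1_(centred_ball r : set P) (ray t s) = (t < r)%R%:R :> R /\ \1_(centred_ball r : set P) (ray (- t) s) = (t < r)%R%:R :> R.
 have h x : \1_(centred_ball r : set P) x = (enorm x < r)%R%:R :> R.
  by rewrite indicE;congr ((nat_of_bool _)%:R);apply/idP/idP;rewrite inE.
 by rewrite !h !enorm_ray normrN gtr0_norm.
under eq_Rintegral=> s _ do rewrite (e s).1 (e s).2.
case:ifP=> _;last first.
 under eq_Rintegral=> s _ do rewrite addr0 mulr0.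
 exact:(congr1 fine (integral0 mu _)).
under eq_Rintegral=> s _ do rewrite mulrC.
have id: mu.-integrable setT (EFin \o @dang R).
 have:=@dang_integrable R 1;apply:eq_integrable=>// s _;by rewrite /= mul1r.
rewrite RintegralZl// /Rintegral integral_dang/=;ring.
Qed.

Lemma cvg_integral_ray (G : R -> R) (V : R) : mfun (setT : set T) G -> (forall t, 0 < t -> 0 <= G t) ->
  (\int[mu]_(t in `]0%R, +oo[) (G t)%:E = V%:E)%E ->
  mu.-integrable `]0, +oo[ (EFin \o G) /\
  \int[mu]_(t in `[0, n%:R]) G t @[n --> \oo] --> V.
Proof.
move=> mG G0 GV.
have mI: measurable (`]0,+oo[%classic : set T) by exact:measurable_itv.
have iG: mu.-integrable `]0,+oo[ (EFin \o G).
 apply/integrableP;split;first by apply/measurable_EFinP;exact:measurable_funTS.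
 rewrite (_ : integral _ _ _ = V%:E) ?ltry// -GV;apply:eq_integral=> t.
 by rewrite inE/= in_itv/= andbT=> t0;rewrite ger0_norm// G0.
split=>//.
pose u (n : nat) (t : R):=if t <= n%:R then G t else 0.
have mu_ n : mfun (setT : set T) (u n).
 apply:measurable_fun_ifT=>//;apply:measurable_fun_ler=>//;exact:measurable_cst.
have e n : (\int[mu]_(t in `[0,n%:R]) G t) = \int[mu]_(t in `]0,+oo[) u n t.
 rewrite -(@Rintegral_itv_obnd_cbnd R 0 (BRight n%:R));last first.
  by apply:(integrableS _ _ _ iG)=>//;move=> x/=;rewrite !in_itv/= =>/andP[->].
 rewrite [LHS]Rintegral_mkcond [RHS]Rintegral_mkcond;apply:eq_Rintegral=> t _.
 by rewrite !patchE !mem_setE !in_itv/= andbT /u;case:(0 < t)=>//=;case:(t <= n%:R).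
under eq_fun do rewrite e.
have ->: V = \int[mu]_(t in `]0,+oo[) G t by rewrite /Rintegral GV.
have h: (\int[mu]_(t in `]0%R,+oo[) (u n t)%:E)%E @[n --> \oo] --> (\int[mu]_(t in `]0%R,+oo[) (G t)%:E)%E.
 apply:(@dominated_cvg _ T R mu _ mI (fun n t=>(u n t)%:E) (fun t=>(G t)%:E) (fun t=>(G t)%:E))=>//.
 - by move=> n;apply/measurable_EFinP;exact:measurable_funTS.
 - move=> t _;apply:cvg_EFin;first exact:nearW.
  apply:cvg_near_cst;near=> n;rewrite /= /u ifT//;near: n;exact:nbhs_infty_ger.
 - move=> n t;rewrite /= in_itv/= andbT=> t0;rewrite lee_fin /u;case:ifP=> _;last by rewrite normr0 G0.
  by rewrite ger0_norm// G0.
by apply:fine_cvg;rewrite fineK//;exact:(integrable_fin_num mI iG).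
Unshelve. all: by end_near. Qed.

End radial_volume.

Lemma gap_arith {R : realType} (d v z x : R) : d <= v - z -> v - x < d -> z < x.
Proof. lra. Qed.

(** * Lower bound for the perimeter of a competitor *)

Section competitor_bound.
Context {R : realType}.
Notation mu := (@lebesgue_measure R).
Notation m := (@leb2_borel R).
Notation T := (measurableTypeR R).
Notation P := (plane R).
Notation pi := (@pi R).
Variable h0 : R -> R.
Hypothesis h0m : forall s t, 0 <= s -> s <= t -> h0 s <= h0 t.
Hypothesis h0c : forall a b q, 0 <= a -> 0 <= b -> 0 <= q <= 1 -> h0 (q * a + (1 - q) * b) <= q * h0 a + (1 - q) * h0 b.
Notation h := (ext h0).
Notation k := (circ h).
Notation f := (fun x : R * R => expR (h (enorm x))).

Let hc : continuous h. Proof. exact:ext_cts. Qed.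
Let hm : {homo h : s t / s <= t}. Proof. by move=> s t;exact:ext_le. Qed.
Let kc : continuous k. Proof. exact:k_cts. Qed.

Lemma cts_expR_ext : continuous (fun t => expR (h t)).
Proof. by move=> t;apply:continuous_comp;[exact:hc|exact:continuous_expR]. Qed.

Lemma cts_radial_density : continuous f.
Proof. by move=> x;apply:(@continuous_comp _ _ _ (@enorm R) (fun t=> expR (h t)));[exact:cts_enorm|exact:cts_expR_ext]. Qed.

Let k0 t : 0 < t -> 0 < k t. Proof. by move=> t0;rewrite mulr_gt0 ?expR_gt0. Qed.

Lemma circ_int_lt y r : 0 <= y -> y < r -> \int[mu]_(t in `[0, y]) k t < \int[mu]_(t in `[0, r]) k t.
Proof.
move=> y0 yr;have [W dW]:=primitive kc.
have e a b : a <= b -> \int[mu]_(t in `[a,b]) k t = W b - W a.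
 by move=> ab;apply:ftcR=>//;exact:wc_cts.
rewrite !e ?(le_trans y0 (ltW yr))// ltrD2r.
apply:(@der_lt _ W k)=>//;first by apply:(within_der (f':=k))=> x _;exact:dW.
by move=> x /andP[h1 _];apply:k0;exact:le_lt_trans h1.
Qed.

Let meas a b : measurable (`[a, b]%classic : set T). Proof. exact:measurable_itv. Qed.

(** Strictness comes from an intermediate radius [r'], which also keeps its closed disc inside the
    open disc of radius [r]. *)
Lemma ball_volume_gt r v y : 0 < r -> weighted_volume f (centred_ball r) = v%:E -> 0 <= y -> y < r ->
  \int[mu]_(t in `[0, y]) k t < v / (2 * pi).
Proof.
move=> r0 vB y0 yr;pose r':=(y + r) / 2.
have yr': y < r' by rewrite /r';lra.
have rr': r' < r by rewrite /r';lra.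
have r'0: 0 <= r' by exact:le_trans (ltW yr').
have pp: 0 < 2 * pi by rewrite mulr_gt0// pi_gt0.
apply:(lt_le_trans (circ_int_lt y0 yr'));rewrite ler_pdivlMr//.
have mB: measurable (centred_ball r : set P).
 by apply:measurable_ltr;apply:cts_plane_measurable;exact:cts_enorm.
have mB':=borel_leb2_measurable mB.
have sub0 (A : set P) : A `<=` A `|` set0 by move=> x;left.
have vr:=@volume_repr R (centred_ball r) (centred_ball r) set0 mB' mB measurable0 (measure0 m) (@sub0 _) (@sub0 _) f (cts_plane_measurable cts_radial_density).
pose G t:=t * expR (h t) * slice_mass (centred_ball r : set P) t.
have vG: (\int[mu]_(t in `]0%R,+oo[) (G t)%:E)%E = v%:E.
 by rewrite -vB vr (volume_polar mB cts_expR_ext)// => t;exact:expR_ge0.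
have sb:=slice_mass_bound mB.
have G0 t : 0 < t -> 0 <= G t.
 by move=> t0;have /andP[s0 _]:=sb t;rewrite mulr_ge0// ltW// k0.
have mG: mfun (setT : set T) G.
 by apply:measurable_funM;[exact:cts_mfun kc|exact:measurable_slice_mass].
have [iG _]:=cvg_integral_ray mG G0 vG.
have ik a b : mu.-integrable `[a,b] (EFin \o k) by apply:cts_int;exact:wc_cts.
have ->: v = \int[mu]_(t in `]0,+oo[) G t by rewrite /Rintegral vG.
have mI: measurable (`]0,+oo[%classic : set T) by exact:measurable_itv.
have mJ: measurable (`]0,r']%classic : set T) by exact:measurable_itv.
apply:(@le_trans _ _ (\int[mu]_(t in `]0,r']) G t));last first.
 apply:Rint_subset=>//.
  by move=> t/=;rewrite !in_itv/= =>/andP[->].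
 by move=> t;rewrite /= in_itv/= andbT;exact:G0.
have ikJ: mu.-integrable `]0,r'] (EFin \o k).
 by apply:(integrableS _ _ _ (ik 0 r'))=>//;exact:subset_itv_oc_cc.
rewrite -(Rintegral_itv_obnd_cbnd ikJ) mulrC -RintegralZl// le_eqVlt;apply/orP;left;apply/eqP.
apply:eq_Rintegral=> t;rewrite inE/= in_itv/= =>/andP[t0 tr].
by rewrite /G slice_mass_ball// (le_lt_trans tr rr') mulrC.
Qed.

(** [E] is replaced by a Borel representative, whose slices are measurable. For [y < r] the disc of
    radius [y] has volume below [v], hence below that of [E] inside a large disc, and [level]
    applies. Continuity of [k] then reaches [r]. *)
Lemma competitor_lower r v E : 0 < r -> weighted_volume f (centred_ball r) = v%:E -> competitor f v E ->
  ((2 * pi * r * expR (h r))%:E <= weighted_perimeter f E)%E.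
Proof.
move=> r0 vB [[mE bvE] vE].
have pp: 0 < 2 * pi by rewrite mulr_gt0// pi_gt0.
have [->|Pfin]:=eqVneq (weighted_perimeter f E) +oo%E;first by rewrite leey.
have wp0: (0 <= weighted_perimeter f E)%E by apply:integral_ge0=> x _;rewrite lee_fin expR_ge0.
have wpf: weighted_perimeter f E \is a fin_num by rewrite ge0_fin_numE// ltey.
pose Q:=fine (weighted_perimeter f E);have QE: Q%:E = weighted_perimeter f E by rewrite /Q fineK.
have Q0: 0 <= Q by rewrite -lee_fin QE.
rewrite -QE lee_fin.
have [A [N [mA mN N0 AE EA]]]:=leb2_borel_repr mE.
have mf:=cts_plane_measurable cts_radial_density.
have div_le X1 X2 : test_function X1 -> test_function X2 -> (forall x,enorm (X1 x,X2 x) <= expR (h (enorm x))) ->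
  - (\int[m]_(x in A) partial1 X1 x + \int[m]_(x in A) partial2 X2 x) <= Q.
 by move=> t1 t2 X12;rewrite -lee_fin QE;exact:(divergence_le mE mA mN N0 AE EA bvE t1 t2 mf X12).
have cal:=cal_piece mA hc hm div_le.
have sb:=slice_mass_bound mA.
pose al t:=slice_mass A t / (2 * pi);pose ph:=cut_ind A;pose p:=Q / (2 * pi).
have mal: mfun (setT : set T) al.
 by apply:measurable_funM;[exact:measurable_slice_mass|exact:measurable_cst].
have al01 t : 0 <= al t <= 1.
 by have /andP[s0 s1]:=sb t;rewrite /al divr_ge0 ?(ltW pp)//= ler_pdivrMr// mul1r.
have ph01 t : 0 <= ph t <= 1 by rewrite /ph /cut_ind;case:ifP=> _;rewrite ?lexx ?ler01.
have ph1 t : 0 < al t < 1 -> ph t = 1.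
 by rewrite /al /ph /cut_ind ltr_pdivlMr// mul0r ltr_pdivrMr// mul1r=> ->.
have p0: 0 <= p by rewrite divr_ge0// ltW.
pose G t:=t * expR (h t) * slice_mass A t.
have vG: (\int[mu]_(t in `]0%R,+oo[) (G t)%:E)%E = v%:E.
 rewrite -vE (volume_repr mE mA mN N0 AE EA mf) (volume_polar mA cts_expR_ext)// => t;exact:expR_ge0.
have G0 t : 0 < t -> 0 <= G t.
 by move=> t0;have /andP[s0 _]:=sb t;rewrite mulr_ge0// ltW// k0.
have mG: mfun (setT : set T) G.
 by apply:measurable_funM;[exact:cts_mfun kc|exact:measurable_slice_mass].
have [iG cG]:=cvg_integral_ray mG G0 vG.
have iGc a b : 0 <= a -> mu.-integrable `[a,b] (EFin \o G).
 move=> a0;apply:(@int_piece _ a b G (b * expR (h b) * (2 * pi)));first exact:measurable_funTS.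
 move=> t /andP[h1 h2];have t0: 0 <= t by exact:le_trans h1.
 have /andP[s0 s1]:=sb t;have kt: 0 <= t * expR (h t) by rewrite mulr_ge0 ?expR_ge0.
 rewrite ger0_norm ?mulr_ge0// ler_pM// ler_pM ?expR_ge0// ler_expR;exact:hm.
have massE a b : 0 <= a -> mass h al a b = (2 * pi)^-1 * \int[mu]_(t in `[a,b]) G t.
 move=> a0;have <-: \int[mu]_(t in `[a,b]) ((2 * pi)^-1 * G t) = (2 * pi)^-1 * \int[mu]_(t in `[a,b]) G t.
  by rewrite RintegralZl//;exact:iGc.
 by apply:eq_Rintegral=> t _;rewrite /al /G /circ mulrA mulrC.
pose I n:=\int[mu]_(t in `[0,n%:R]) G t.
have step n : \int[mu]_(t in `[n%:R,n%:R + 1]) G t = I n.+1 - I n.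
 rewrite /I -[n.+1%:R]natr1.
 have n1: n%:R <= n%:R + 1 :> R by rewrite lerDl.
 rewrite (@Rintegral_itvB R G (BLeft 0) (BRight (n%:R + 1)) n%:R)//;[|exact:iGc|by rewrite bnd_simp ler0n].
 rewrite Rintegral_itv_obnd_cbnd//.
 by apply:(integrableS _ _ _ (iGc n%:R (n%:R + 1) (ler0n _ _)))=>//;exact:subset_itv_oc_cc.
have key y : 0 <= y -> y < r -> k y <= p.
 move=> y0 yr;apply/ler_addgt0Pr=> e e0.
 have lt:=ball_volume_gt r0 vB y0 yr.
 set c:=\int[mu]_(t in `[0,y]) k t in lt.
 have cv: 2 * pi * c < v by rewrite mulrC -ltr_pdivlMr.
 (* One bound puts enough of the mass of [E] inside radius [n]; the other makes the remainder in
    [level], the mass between [n] and [n + 1], at most [e]. *)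
 pose d:=Num.min (v - 2 * pi * c) (2 * pi * e / 2).
 have d0: 0 < d by rewrite lt_min subr_gt0 cv/= divr_gt0// mulr_gt0.
 have [n [n0 b0 b1]] : exists n : nat,[/\ (0 < n)%N,`|v - I n| < d & `|v - I n.+1| < d].
  have c0: \forall n \near \oo,`|v - I n| < d by move/cvgrPdist_lt : cG;apply.
  have [n0 _ hn0]:=c0.
  exists n0.+1;split=>//;apply:hn0=>/=;rewrite ?leqnSn//.
  by rewrite -addn2 leq_addr.
 have nR: 0 < n%:R :> R by rewrite ltr0n.
 have dl: d <= v - 2 * pi * c by rewrite ge_min lexx.
 have dr: d <= 2 * pi * e / 2 by rewrite ge_min lexx orbT.
 have lv:=@level R h0 h0m h0c al ph mal (measurable_cut_ind mA) al01 ph01 ph1 p p0 cal n%:R y nR y0.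
 move: b0 b1;rewrite !ltr_norml=>/andP[_ b0] /andP[b1 _].
 apply:(le_trans (lv _));rewrite massE ?ler0n//.
  by rewrite ltr_pdivlMl//;exact:(gap_arith dl b0).
 rewrite lerD2l step ler_pdivrMl//;move: b0 b1 dr=> b0 b1 dr;lra.
have kr: k r <= p.
 rewrite leNgt;apply/negP=> pk.
 have nb: nbhs (r : R) [set t|p < k t] by apply:(cvgr_gt (k r) (@kc r) p pk).
 have /nbhs_ballP[e /= e0 he]:=nb.
 pose y:=r - Num.min e r / 2.
 have mn0: 0 < Num.min e r by rewrite lt_min e0.
 have mn1: Num.min e r <= e by rewrite ge_min lexx.
 have mn2: Num.min e r <= r by rewrite ge_min lexx orbT.
 have : p < k y.
  by apply:he;rewrite /ball /= /y opprD opprK addrA subrr add0r gtr0_norm;lra.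
 by rewrite ltNge key//;rewrite /y;lra.
move: kr;rewrite /p ler_pdivlMr// /circ=> kr.
by rewrite (le_trans _ kr)// le_eqVlt;apply/orP;left;apply/eqP;ring.
Qed.

End competitor_bound.

Theorem theorem1p1 (R : realType) (h : R -> R)
    (h_nondecreasing : {in `[0, +oo[ &, {homo h : x y / x <= y}})
    (h_convex : convex_function (`[0, +oo[%classic : set R) h)
    (f : R * R -> R) (f_def : forall x, f x = expR (h (enorm x)))
    (v : R) (v_gt0 : 0 < v)
    (B : set (R * R)) (B_ball : exists2 r : R, 0 < r & B = centred_ball r)
    (B_volume : weighted_volume f B = v%:E) :
  competitor f v B /\ weighted_perimeter f B = isoperimetric_profile f v.
Proof.
have h0m s t : 0 <= s -> s <= t -> h s <= h t.
 by move=> s0 st;apply:h_nondecreasing=>//;rewrite in_itv/= andbT// (le_trans s0).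
have h0c a b q : 0 <= a -> 0 <= b -> 0 <= q <= 1 -> h (q * a + (1 - q) * b) <= q * h a + (1 - q) * h b.
 move=> a0 b0 /andP[q0 q1].
 have ain: a \in (`[0,+oo[%classic : set R) by rewrite inE/= in_itv/= andbT.
 have bin: b \in (`[0,+oo[%classic : set R) by rewrite inE/= in_itv/= andbT.
 exact:(h_convex (Itv01 q0 q1) a b ain bin).
(* [h] is evaluated at norms, where it agrees with its extension. *)
have fE: f = fun x=> expR (ext h (enorm x)).
 by apply/funext=> x;rewrite f_def ext_pos// enorm_ge0.
subst f;have [r r0 Br]:=B_ball;subst B.
have fpB:=ball_finite_perimeter r0.
have cB: competitor (fun x=> expR (ext h (enorm x))) v (centred_ball r) by split.
(* An upper bound for the disc is enough here: the reverse inequality is the lower bound for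
   competitors, of which the disc is one. *)
have up:=ball_perimeter_le r0 (cts_expR_ext h0m h0c) (fun t=> expR_ge0 (ext h t)).
split=>//;apply/eqP;rewrite eq_le;apply/andP;split;last first.
 by apply:ereal_inf_lbound;exists (centred_ball r).
apply:le_ereal_inf_tmp=> _ [E cE <-];apply:(le_trans up).
exact:(competitor_lower h0m h0c r0 B_volume cE).
Qed.
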